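(* There is a polynomial-time algorithm that, given an instance of Undirected Integer 2-Commodity Flow on an undirected graph $G$ with demands $d_1,d_2$, either outputs that there is no flow that meets the demands, or outputs a 2-commodity flow whose value for commodity $i$ is at least $d_i-O(\mathrm{vc}(G)^3)$ for each $i\in[2]$.
   Context: An undirected flow network is $(G,c)$ with $G=(V,E)$ undirected and $c:E\to\mathbb{N}_0$. Given sources $s_1,s_2$ and sinks $t_1,t_2$, a 2-commodity flow assigns to each commodity $i\in[2]$ and each ordered pair $(v,w)$ with $vw\in E$ a value $f^i(vw)\ge0$, with flow conservation for commodity $i$ at each $v\notin\{s_i,t_i\}$ and $\sum_{i\in[2]}(f^i(vw)+f^i(wv))\le c(vw)$ for each edge $vw$; it is integer if all values lie in $\mathbb{N}_0$. The value for commodity $i$ is the net outflow of commodity $i$ at $s_i$. An instance of Undirected Integer 2-Commodity Flow consists of such a network, sources, sinks and demands $d_1,d_2\in\mathbb{N}$; a flow meets the demands if it is an integer 2-commodity flow with value $d_i$ for each $i$. $\mathrm{vc}(G)$ is the vertex cover number of $G$. *)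

(* Defs.v *)
From mathcomp Require Import all_boot all_order all_algebra.
Set Implicit Arguments. Unset Strict Implicit. Unset Printing Implicit Defensive.
Import Order.TTheory GRing.Theory Num.Theory.

(*    Tape cells hold: None (blank), Some (inl b) (a bit b, used for   *)
(*    input and output), Some (inr a) (an extra work symbol a : A).    *)

Inductive move := MoveL | MoveR | Stay.

Definition move_int (m : move) : int :=
  match m with MoveL => (-1)%R | MoveR => 1%R | Stay => 0%R end.

Record TM := MkTM {
  tm_A : finType;
  tm_Q : finType;
  tm_start : tm_Q;
  tm_halt : tm_Q -> bool;
  tm_delta : tm_Q -> option (bool + tm_A) -> tm_Q * option (bool + tm_A) * move
}.

Definition sym (M : TM) := option (bool + tm_A M).

Record config (M : TM) := Config {
  c_state : tm_Q M;
  c_head : int;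
  c_tape : int -> sym M
}.

Definition init (M : TM) (x : seq bool) : config M :=
  Config (@tm_start M) 0%R
    (fun j : int => match j with
                    | Posz k => if k < size x then Some (inl (nth false x k)) else None
                    | Negz _ => None
                    end).

Definition step (M : TM) (c : config M) : config M :=
  if @tm_halt M (c_state c) then c else
  let: (q', s', mv) := @tm_delta M (c_state c) (c_tape c (c_head c)) in
  Config q' (c_head c + move_int mv)%R
         (fun j => if j == c_head c then s' else c_tape c j).

Definition is_bit (M : TM) (s : sym M) : bool :=
  match s with Some (inl _) => true | _ => false end.

Definition reads_output (M : TM) (c : config M) (y : seq bool) : Prop :=
  (forall j, j < size y ->
     c_tape c (c_head c + (j%:Z))%R = Some (inl (nth false y j))) /\
  ~~ is_bit (c_tape c (c_head c + (size y)%:Z)%R).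

Definition halts_with (M : TM) (x : seq bool) (T : nat) (y : seq bool) : Prop :=
  let c := iter T (@step M) (@init M x) in
  @tm_halt M (c_state c) /\ reads_output c y.

Fixpoint nat_bits_aux (fuel n : nat) : seq bool :=
  match fuel with
  | 0 => [::]
  | fuel'.+1 => if n == 0 then [::] else odd n :: nat_bits_aux fuel' n./2
  end.

Definition nat_bits (n : nat) : seq bool := nat_bits_aux n n.

(* self-delimiting binary encoding of a natural number *)
Definition enc_nat (n : nat) : seq bool :=
  flatten [seq [:: true; b] | b <- nat_bits n] ++ [:: false; false].

Definition enc_nats (s : seq nat) : seq bool :=
  enc_nat (size s) ++ flatten (map enc_nat s).

(*    Vertices are 0 .. n-1; an edge is a triple (u, v, c(uv)).        *)

Record inst := Inst {
  i_n : nat;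
  i_s1 : nat; i_t1 : nat; i_s2 : nat; i_t2 : nat;
  i_d1 : nat; i_d2 : nat;
  i_edges : seq (nat * nat * nat)
}.

Definition src (I : inst) (i : 'I_2) : nat := if val i == 0 then i_s1 I else i_s2 I.
Definition snk (I : inst) (i : 'I_2) : nat := if val i == 0 then i_t1 I else i_t2 I.
Definition dem (I : inst) (i : 'I_2) : nat := if val i == 0 then i_d1 I else i_d2 I.

Definition same_pair (e e' : nat * nat * nat) : bool :=
  ((e.1.1 == e'.1.1) && (e.1.2 == e'.1.2)) ||
  ((e.1.1 == e'.1.2) && (e.1.2 == e'.1.1)).

Definition wf_inst (I : inst) : Prop :=
  [/\ all (fun e => [&& e.1.1 < i_n I, e.1.2 < i_n I & e.1.1 != e.1.2]) (i_edges I),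
      pairwise (fun e e' => ~~ same_pair e e') (i_edges I),
      [&& i_s1 I < i_n I, i_t1 I < i_n I, i_s2 I < i_n I & i_t2 I < i_n I]
    & 0 < i_d1 I /\ 0 < i_d2 I].

Definition enc_inst (I : inst) : seq bool :=
  enc_nats ([:: i_n I; i_s1 I; i_t1 I; i_s2 I; i_t2 I; i_d1 I; i_d2 I] ++
            flatten [seq [:: e.1.1; e.1.2; e.2] | e <- i_edges I]).

Definition adjb (I : inst) (v w : nat) : bool :=
  has (fun e => ((e.1.1 == v) && (e.1.2 == w)) || ((e.1.1 == w) && (e.1.2 == v)))
      (i_edges I).

(* an integer-valued assignment f i v w = f^i(vw) on ordered pairs *)
Definition flowfun := 'I_2 -> nat -> nat -> nat.

Definition netout (I : inst) (f : flowfun) (i : 'I_2) (v : nat) : int :=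
  (\sum_(w < i_n I | adjb I v w) ((f i v w)%:Z - (f i w v)%:Z))%R.

Definition int_2flow (I : inst) (f : flowfun) : Prop :=
  (forall e, e \in i_edges I ->
     \sum_(i < 2) (f i e.1.1 e.1.2 + f i e.1.2 e.1.1) <= e.2) /\
  (forall (i : 'I_2) v, v < i_n I -> v != src I i -> v != snk I i ->
     netout I f i v = 0%R).

Definition meets_demands (I : inst) (f : flowfun) : Prop :=
  int_2flow I f /\ forall i : 'I_2, netout I f i (src I i) = Posz (dem I i).

Definition is_cover (I : inst) (S : {set 'I_(i_n I)}) : bool :=
  all (fun e => [exists x in S, (val x == e.1.1) || (val x == e.1.2)]) (i_edges I).

Definition vc (I : inst) : nat :=
  \big[minn/i_n I]_(S : {set 'I_(i_n I)} | @is_cover I S) #|S|.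

(* 4. Outputs.  None = "no flow meets the demands"; Some fl = a flow   *)
(*    given edge by edge: the j-th entry of fl is                      *)
(*    (f^1(u v), f^1(v u), f^2(u v), f^2(v u)) for the j-th edge (u,v,c). *)

Definition flow_out := option (seq (nat * nat * nat * nat)).

Definition enc_out (r : flow_out) : seq bool :=
  match r with
  | None => [:: false]
  | Some fl => true :: enc_nats (flatten [seq [:: x.1.1.1; x.1.1.2; x.1.2; x.2] | x <- fl])
  end.

Definition flow_of (I : inst) (fl : seq (nat * nat * nat * nat)) : flowfun :=
  fun i v w =>
    let E := i_edges I in
    let j := find (fun e => (e.1.1 == v) && (e.1.2 == w)) E in
    let j' := find (fun e => (e.1.1 == w) && (e.1.2 == v)) E in
    let x0 := (0, 0, 0, 0) in
    if j < size E then
      (let x := nth x0 fl j in if val i == 0 then x.1.1.1 else x.1.2)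
    else if j' < size E then
      (let x := nth x0 fl j' in if val i == 0 then x.1.1.2 else x.2)
    else 0.

(* Main.v *)
Require Import Defs.
From mathcomp Require Import all_boot all_order all_algebra.
Import Order.TTheory GRing.Theory Num.Theory.
From mathcomp Require Import zify ring lra.
Set Implicit Arguments. Unset Strict Implicit. Unset Printing Implicit Defensive.

(* The sum g and the difference h of the two commodities are single flows with
   independent conservation constraints, and |f1| + |f2| <= c means that |g| <= c
   and |h| <= c.  Integral g and h give integral commodities as soon as both have
   the parity of c on every edge.  Writing g = 2 x - c turns this into an integral
   flow x in the box [0, c] with excess equal to half of a given integer, and the
   obstruction is the parity of the degree (counted with capacities).

   Let S consist of the terminals and of the ends of a maximal matching, so that
   |S| <= 4 + 2 vc and every edge meets S.  In an integral flow that meets the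
   demands, every vertex of odd degree outside S has an incident edge with an
   unused unit of capacity.  A linear program asks for fractional g and h and
   for fractional unused units lambda, of total amount one at each of these
   vertices; if it is infeasible then there is no flow.  Otherwise the unused
   units are fixed to single edges greedily while the program stays feasible.
   Comparing the number of odd vertices with the number of tight constraints at
   an extreme point shows that at most 2 |S| odd vertices are left over.  Removing
   the fixed units and rounding gives integral commodities that violate
   conservation by at most one unit at no more than 3 |S| vertices, and routing
   inside each commodity restores conservation at a loss of at most 3 |S| units.

   Linear feasibility is decided up to a tolerance by the relaxation method with
   step sizes 2^k, ..., 2, 1 in units of 1/N of a capacity unit, which uses only
   additions: by Hoffman's circulation theorem a point violating the constraints
   by eps is at distance polynomial in eps and |E| from a solution.  Integral
   flows are found with the same test, one binary digit at a time, and the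
   integrality of cuts absorbs the tolerance.

   Polynomial running time is proved for functions on binary trees that are
   assembled from combinators, whose programs run on a machine with five stacks
   and are simulated by a Turing machine. *)

(** * The algorithm *)

(** The count 2 |S| comes from a local exchange. If no lambda at an odd vertex v outside S is close
    to N, two of them are large; one is raised, the other lowered, and g and h follow on tight
    edges. The imbalance at v is absorbed by an edge that is not tight; if there is none, the odd
    degree forces the two changes to cancel. So v has a direction living on its own edges that keeps
    all tight constraints except conservation of g and h at S, which is 2 |S| equations. With more
    such vertices a nonzero combination survives and the point is not extreme. The obstacle is that
    feasibility is known only up to a tolerance M. Every fixed edge adds M to the slack of the next
    program, so that what a test certifies holds exactly at the slack of the next one. Well
    separated sizes absorb the accumulated error: M = 16 (m + 1), a unit can be fixed once its
    lambda is at least N - M^4, and N = M^8. Vertex names are binary numbers, so errors are summed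
    over the vertices that occur and never over the whole range. *)

(* The row (cs, (a, b)) is the inequality (sum of the x_j with cs_j.1) + a
   <= (sum of the x_j with cs_j.2) + b. *)
Definition row := (seq (bool * bool) * (nat * nat))%type.

Definition pos_val (cs : seq (bool * bool)) (x : seq nat) :=
  sumn [seq (if p.1.1 then p.2 else 0) | p <- zip cs x].
Definition neg_val (cs : seq (bool * bool)) (x : seq nat) :=
  sumn [seq (if p.1.2 then p.2 else 0) | p <- zip cs x].
Definition violated (t : nat) (x : seq nat) (r : row) :=
  neg_val r.1 x + r.2.2 + t < pos_val r.1 x + r.2.1.

(** The subtraction is truncated at 0, so the step includes the projection onto the nonnegative
    orthant; this never increases the distance to a nonnegative solution. *)
Definition move_along (s : nat) (x : seq nat) (cs : seq (bool * bool)) :=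
  [seq (if p.1.1 then p.2 - s else if p.1.2 then p.2 + s else p.2) | p <- zip cs x].
Definition row0 : row := ([::], (0, 0)).

Definition relax_step (rows : seq row) (sm : nat * nat) (x : seq nat) :=
  if nilp [seq r <- rows | violated sm.2 x r] then x
  else move_along sm.1 x (head row0 [seq r <- rows | violated sm.2 x r]).1.
Definition relax_phase (rows : seq row) (R : seq unit) (x : seq nat) (sm : nat * nat) :=
  foldl (fun x _ => relax_step rows sm x) x R.
Definition relax (rows : seq row) (sc : seq (nat * nat)) (R : seq unit) (x : seq nat) :=
  foldl (relax_phase rows R) x sc.

(* Parameters: tolerance, unit, number of rounds, scales (2^j, tolerance * 2^j). *)
Definition param := (nat * nat * seq unit * seq (nat * nat))%type.
Definition pM (P : param) := P.1.1.1.
Definition pN (P : param) := P.1.1.2.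
Definition pR (P : param) := P.1.2.
Definition psc (P : param) := P.2.

Definition decide (P : param) (rows : seq row) (x0 : seq nat) :=
  all (fun r => ~~ violated (pM P) (relax rows (psc P) (pR P) x0) r) rows.

(** Doubled entries are pushed in front, so [scales] runs from the coarsest step to the finest. *)
Definition dbl_head (acc : seq (nat * nat)) (_ : unit) :=
  ((head (0, 0) acc).1 + (head (0, 0) acc).1, (head (0, 0) acc).2 + (head (0, 0) acc).2) :: acc.
Definition scales (M : nat) (l : seq unit) := foldl dbl_head [:: (1, M)] l.

Definition onehot (m : seq nat) (j : nat) (b : bool * bool) : seq (bool * bool) :=
  [seq (b.1 && (i == j), b.2 && (i == j)) | i <- m].

Definition arc := (nat * nat * nat)%type.
Definition vcon := (nat * (nat * nat * nat))%type.

Definition div_row (arcs : seq arc) (v : nat) (b : bool) : seq (bool * bool) :=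
  [seq (if b then (a.1.2 == v, a.1.1 == v) else (a.1.1 == v, a.1.2 == v)) | a <- arcs].

Definition indices (T : Type) (s : seq T) := iota 0 (size s).

Definition arc_rows (N : nat) (arcs : seq arc) (lo : seq nat) : seq row :=
  flatten [seq [:: (onehot (indices arcs) p.1 (false, true), (N * p.2.2, 0));
                   (onehot (indices arcs) p.1 (true, false), (0, N * p.2.1.2))]
          | p <- zip (indices arcs) (zip arcs lo)].
(* (v, (X, Y, Z)) bounds the excess of v: out + X <= in + Z and in + Y <= out + Z. *)
Definition vcon_rows (N : nat) (arcs : seq arc) (vcs : seq vcon) : seq row :=
  flatten [seq [:: (div_row arcs w.1 false, (N * w.2.1.1, N * w.2.2));
                   (div_row arcs w.1 true, (N * w.2.1.2, N * w.2.2))] | w <- vcs].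
Definition flow_rows N arcs vcs lo := arc_rows N arcs lo ++ vcon_rows N arcs vcs.

Definition flow_ok (P : param) arcs vcs lo :=
  decide P (flow_rows (pN P) arcs vcs lo) [seq 0 | _ <- arcs].

Definition raise_at (j s : nat) (lo : seq nat) :=
  [seq (if p.1 == j then p.2 + s else p.2) | p <- zip (indices lo) lo].
(** The scales of the relaxation method double as the powers of two of a binary search: [sm.1] runs
    through them in decreasing order. *)
Definition raise_step P arcs vcs (j : nat) (lo : seq nat) (sm : nat * nat) :=
  if flow_ok P arcs vcs (raise_at j sm.1 lo) then raise_at j sm.1 lo else lo.
(* The lexicographically largest integral flow, one binary digit at a time. *)
Definition intflow (P : param) (arcs : seq arc) (vcs : seq vcon) :=
  foldl (fun lo j => foldl (raise_step P arcs vcs j) lo (psc P)) [seq 0 | _ <- arcs] (indices arcs).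

(* (s1, t1, s2, t2, d1, d2) *)
Definition terms := (nat * nat * nat * nat * nat * nat)%type.
Definition supply (q : terms) v := let: (s1, t1, s2, t2, d1, d2) := q in (v == s1) * d1 + (v == s2) * d2.
Definition demand (q : terms) v := let: (s1, t1, s2, t2, d1, d2) := q in (v == t1) * d1 + (v == t2) * d2.
(** Reversing the second commodity turns the difference h into a sum, so every construction for g
    applies to h with these terminals. *)
Definition swap2 (q : terms) : terms := let: (s1, t1, s2, t2, d1, d2) := q in (s1, t1, t2, s2, d1, d2).

Definition out_cap (arcs : seq arc) v := sumn [seq (if a.1.1 == v then a.2 else 0) | a <- arcs].
Definition in_cap (arcs : seq arc) v := sumn [seq (if a.1.2 == v then a.2 else 0) | a <- arcs].
Definition mem_nat (v : nat) (s : seq nat) := has (fun w => w == v) s.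
Definition odd_inner (E : seq arc) (cv : seq nat) v :=
  odd (out_cap E v + in_cap E v) && ~~ mem_nat v cv.

Definition nones (E : seq arc) : seq (bool * bool) := [seq (false, false) | _ <- E].
Definition incident (a : arc) v := (a.1.1 == v) || (a.1.2 == v).

(* Variables: p_g, p_h and lambda for every edge, where g = p_g - N c and
   h = p_h - N c; g and h are the sum and the difference of the commodities. *)
Definition edge_rows (N dl kp : nat) (E : seq arc) (p : nat * (arc * bool)) : seq row :=
  let oh := onehot (indices E) p.1 in
  let c := p.2.1.2 in
  [:: (oh (false, true) ++ nones E ++ oh (true, false), (0, dl));
      (oh (true, false) ++ nones E ++ oh (true, false), (0, N * (c + c) + dl));
      (nones E ++ oh (false, true) ++ oh (true, false), (0, dl));
      (nones E ++ oh (true, false) ++ oh (true, false), (0, N * (c + c) + dl));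
      (nones E ++ nones E ++ oh (true, false), (0, N + dl));
      (nones E ++ nones E ++ oh (false, true), (if p.2.2 then N else 0, kp + dl))].
(** The shift p = g + N c adds N times the capacity out minus the capacity in to the excess, which
    is why capacities appear next to supply and demand. Each of the two equations is split into two
    inequalities, relaxed by [dl]. *)
Definition cons_rows (N dl : nat) (E : seq arc) (q : terms) (v : nat) : seq row :=
  [:: (div_row E v false ++ nones E ++ nones E, (N * (in_cap E v + demand q v), N * (out_cap E v + supply q v) + dl));
      (div_row E v true ++ nones E ++ nones E, (N * (out_cap E v + supply q v), N * (in_cap E v + demand q v) + dl));
      (nones E ++ div_row E v false ++ nones E, (N * (in_cap E v + demand (swap2 q) v), N * (out_cap E v + supply (swap2 q) v) + dl));
      (nones E ++ div_row E v true ++ nones E, (N * (out_cap E v + supply (swap2 q) v), N * (in_cap E v + demand (swap2 q) v) + dl))].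
Definition odd_rows (N dl : nat) (E : seq arc) (cv : seq nat) (v : nat) : seq row :=
  if odd_inner E cv v then
    [:: (nones E ++ nones E ++ [seq (incident a v, false) | a <- E], (0, N + dl));
        (nones E ++ nones E ++ [seq (false, incident a v) | a <- E], (N, dl))]
  else [::].
Definition lp_rows (N dl kp : nat) E (cv vs : seq nat) q (fx : seq bool) : seq row :=
  flatten [seq edge_rows N dl kp E p | p <- zip (indices E) (zip E fx)] ++
  flatten [seq cons_rows N dl E q v ++ odd_rows N dl E cv v | v <- vs].

Definition nfix (fx : seq bool) := sumn [seq nat_of_bool b | b <- fx].
(* (E, cv, vs, terminals, kappa) *)
Definition lpdata := (seq arc * seq nat * seq nat * terms * nat)%type.
(** Acceptance certifies a solution only up to one tolerance [pM P]. The slack grows by this amount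
    with every fixed edge, so the certified point satisfies its constraints exactly at the slack
    used after the next fixing. *)
Definition lp_ok (P : param) (D : lpdata) (fx : seq bool) :=
  let: (E, cv, vs, q, kp) := D in
  decide P (lp_rows (pN P) (pM P * nfix fx) kp E cv vs q fx) [seq 0 | _ <- E ++ (E ++ E)].

Definition set_fix (fx : seq bool) (j : nat) := [seq (p.1 == j) || p.2 | p <- zip (indices fx) fx].
Definition free_at (E : seq arc) (cv : seq nat) (fx : seq bool) v :=
  odd_inner E cv v && ~~ has (fun p => p.2 && incident p.1 v) (zip E fx).
Definition fixable (P : param) (D : lpdata) (fx : seq bool) : seq (nat * arc) :=
  let: (E, cv, vs, q, kp) := D in
  [seq p <- zip (indices E) E | (free_at E cv fx p.2.1.1 || free_at E cv fx p.2.1.2) && lp_ok P D (set_fix fx p.1)].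
Definition fix_step P D fx (_ : arc) :=
  if nilp (fixable P D fx) then fx else set_fix fx (head (0, (0, 0, 0)) (fixable P D fx)).1.
Definition fix_edges P (D : lpdata) := let: (E, cv, vs, q, kp) := D in
  foldl (fix_step P D) [seq false | _ <- E] E.

Definition cover_step (cv : seq nat) (e : arc) :=
  if mem_nat e.1.1 cv || mem_nat e.1.2 cv then cv else e.1.1 :: e.1.2 :: cv.
Definition terminals (q : terms) := let: (s1, t1, s2, t2, d1, d2) := q in [:: s1; t1; s2; t2].
Definition cover (q : terms) (E : seq arc) := foldl cover_step (terminals q) E.
Definition vertices (q : terms) (E : seq arc) := terminals q ++ flatten [seq [:: e.1.1; e.1.2] | e <- E].

Definition even_arcs (E : seq arc) (fx : seq bool) : seq arc := [seq (p.1.1, p.1.2 - nat_of_bool p.2) | p <- zip E fx].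
(** For x = (g + c) / 2 the excess must be half of supply + out - demand - in. The last entry is the
    upper half of the sum of the other two, so the resulting bounds on the excess are the floor and
    the ceiling of that half-integer. *)
Definition half_vcons (q : terms) (arcs : seq arc) (vs : seq nat) : seq vcon :=
  [seq (v, (demand q v + in_cap arcs v, supply q v + out_cap arcs v,
            ((demand q v + in_cap arcs v) + (supply q v + out_cap arcs v) + 1)./2)) | v <- vs].

Definition route_arcs (E : seq arc) (fw bw : seq nat) : seq arc :=
  [seq (p.1.1, p.2) | p <- zip E fw] ++ [seq (p.1.1.2, p.1.1.1, p.2) | p <- zip E bw].
(** The excess is at least [d - L] at the source and 0 away from the terminals. [Z] will be at least
    the total capacity, so that it imposes nothing further at the source or at the sink. *)
Definition route_vcons (vs : seq nat) (s t d L Z : nat) : seq vcon :=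
  [seq (v, (if v == s then (0, d - L + Z, Z) else if v == t then (0, 0, Z) else (0, 0, 0))) | v <- vs].
Definition drop_size (T U : Type) (r : seq T) (E : seq U) := foldl (fun r _ => behead r) r E.
(* The conservative part of an almost conservative flow. *)
Definition route P (E : seq arc) (vs : seq nat) (s t d L : nat) (fw bw : seq nat) : seq (nat * nat) :=
  let r := intflow P (route_arcs E fw bw) (route_vcons vs s t d L (sumn fw + sumn bw + d)) in
  zip [seq p.2 | p <- zip E r] (drop_size r E).

(** Polynomially bounded parameters are kept in unary, as lists of units, so that a fold over such a
    list is a loop of polynomial length. *)
Definition mulu (a b : seq unit) : seq unit := flatten [seq b | _ <- a].
Definition poly_base (E : seq arc) : seq unit := flatten [seq nseq 16 tt | _ <- (0, 0, 0) :: E].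
Definition pw2 (W : seq unit) := mulu W W.
(** With w the length of [W]: tolerance w, unit w^8, w^24 rounds per phase, and step sizes up to
    2^(w^8 + |l|). The summand w^8 in the exponent makes the coarsest scale dominate the unit,
    because w^8 < 2^(w^8). *)
Definition mk_param (W l : seq unit) : param :=
  (size W, size (pw2 (pw2 (pw2 W))), mulu (pw2 (pw2 (pw2 W))) (pw2 (pw2 (pw2 (pw2 W)))),
   scales (size W) (pw2 (pw2 (pw2 W)) ++ l)).

(** From g = 2 [qg] - c and h = 2 [qh] - c the commodities are (g + h) / 2 = [qg] + [qh] - c and (g
    - h) / 2 = [qg] - [qh]. Truncated subtraction yields their positive and negative parts, the
    flows in the two directions of an edge. *)
Definition two_flow P (q : terms) (E : seq arc) (vs : seq nat) (L : nat) (arcs : seq arc) : seq (nat * nat * nat * nat) :=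
  let: (s1, t1, s2, t2, d1, d2) := q in
  let qg := intflow P arcs (half_vcons q arcs vs) in
  let qh := intflow P arcs (half_vcons (swap2 q) arcs vs) in
  let z := zip (zip qg qh) arcs in
  let r1 := route P E vs s1 t1 d1 L [seq p.1.1 + p.1.2 - p.2.2 | p <- z] [seq p.2.2 - (p.1.1 + p.1.2) | p <- z] in
  let r2 := route P E vs s2 t2 d2 L [seq p.1.1 - p.1.2 | p <- z] [seq p.1.2 - p.1.1 | p <- z] in
  [seq (p.1, p.2.1, p.2.2) | p <- zip r1 r2].

Definition solve (l : seq unit) (q : terms) (E : seq arc) : flow_out :=
  let: (s1, t1, s2, t2, d1, d2) := q in
  let W := poly_base E in
  let P := mk_param W l in
  let cv := cover q E in
  let vs := vertices q E in
  let D := (E, cv, vs, q, size (pw2 (pw2 W))) in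
  if (s1 == t1) || (s2 == t2) || ~~ lp_ok P D [seq false | _ <- E] then None
  else Some (two_flow P q E vs (3 * size cv) (even_arcs E (fix_edges P D))).

(** * Circulations and transshipments *)

Local Open Scope ring_scope.

Section Circulation.
Variable R : realDomainType.
Variables V E : finType.
Variables t h : E -> V.

(** The largest net flow that the bounds allow to leave X. Hoffman's condition is that it is
    nonnegative for every X. *)
Definition cutval (l u : E -> R) (X : {set V}) : R :=
  \sum_e (u e *+ ((t e \in X) && (h e \notin X)) - l e *+ ((t e \notin X) && (h e \in X))).

Definition excess (y : E -> R) (v : V) : R := \sum_e (y e *+ (t e == v) - y e *+ (h e == v)).

Lemma excess_set y (X : {set V}) : \sum_(v in X) excess y v = cutval y y X.
Proof.
rewrite /excess exchange_big; apply: eq_bigr => e _ /=.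
rewrite sumrB.
have H (f : E -> V) : \sum_(v in X) y e *+ (f e == v) = y e *+ (f e \in X).
  case: (boolP (f e \in X)) => [i|n]; last first.
    rewrite big1 // => v vX; case: eqP => // ev; by rewrite ev vX in n.
  rewrite (bigD1 (f e)) //= eqxx big1 ?addr0 // => v /andP[_ /negbTE].
  by rewrite eq_sym => ->.
by rewrite !H; case: (t e \in X); case: (h e \in X) => /=; rewrite ?subrr ?subr0 ?sub0r.
Qed.

(** Submodularity of the cut function, edge by edge. The edge [e0] leads from X minus Y to Y minus
    X: it counts u - l on the right but crosses the boundary of neither the intersection nor the
    union, which gives the extra term. *)
Lemma cutval_submod (l u : E -> R) (X Y : {set V}) (e0 : E) :
  (forall e, l e <= u e) ->
  (t e0 \in X) && (h e0 \notin X) -> (t e0 \notin Y) && (h e0 \in Y) ->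
  cutval l u (X :&: Y) + cutval l u (X :|: Y) + (u e0 - l e0) <= cutval l u X + cutval l u Y.
Proof.
move=> lu /andP[tX hX] /andP[tY hY].
rewrite /cutval -!big_split (bigD1 e0) //= [X in _ <= X](bigD1 e0) //=.
rewrite !inE tX (negbTE hX) (negbTE tY) hY /= !mulr1n !mulr0n.
rewrite [X in X <= _](_ : _ = (u e0 - l e0) + \sum_(i | i != e0)
   (u i *+ ((t i \in X :&: Y) && (h i \notin X :&: Y)) -
     l i *+ ((t i \notin X :&: Y) && (h i \in X :&: Y)) +
     (u i *+ ((t i \in X :|: Y) && (h i \notin X :|: Y)) -
      l i *+ ((t i \notin X :|: Y) && (h i \in X :|: Y))))); last first.
  by rewrite !subr0 !add0r addrC.
rewrite !subr0 !sub0r lerD2l; apply: ler_sum => e _; have := lu e.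
rewrite !inE; case: (t e \in X); case: (t e \in Y); case: (h e \in X); case: (h e \in Y);
  rewrite /= ?mulr1n ?mulr0n; lra.
Qed.

Lemma cutval_upd (l u l' u' : E -> R) (e0 : E) (X : {set V}) :
  (forall e, e != e0 -> l' e = l e /\ u' e = u e) ->
  cutval l' u' X = cutval l u X +
    ((u' e0 - u e0) *+ ((t e0 \in X) && (h e0 \notin X)) -
     (l' e0 - l e0) *+ ((t e0 \notin X) && (h e0 \in X))).
Proof.
move=> H; rewrite /cutval (bigD1 e0) //= [in RHS](bigD1 e0) //=.
rewrite (eq_bigr (fun i => u i *+ ((t i \in X) && (h i \notin X)) - l i *+ ((t i \notin X) && (h i \in X)))); last first.
  by move=> e /H[-> ->].
set S := \sum_(i | _) _; rewrite !mulrnBl; ring.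
Qed.
End Circulation.

(* Hoffman: fixing the flow of one edge keeps all cut conditions, for a value
   that exists because the cut function is submodular. *)
Theorem hoffman_circulation (R : realDomainType) (V E : finType) (t h : E -> V) (l u : E -> R) :
  (forall e, l e <= u e) -> (forall X, 0 <= cutval t h l u X) ->
  exists y, (forall e, l e <= y e <= u e) /\ forall v, excess t h y v = 0.
Proof.
have [n] := ubnP #|[set e | l e < u e]|; elim: n l u => // n IH l u lt lu cut.
have [e0 /negPf e0lt|all0] := pickP (fun e => l e != u e); last first.
  have lu' e : l e = u e by have /negbT/negPn/eqP := all0 e.
  exists u; split=> [e|v]; first by rewrite lu' lexx.
  have e1 X : cutval t h u u X = cutval t h l u X by apply: eq_bigr => e _; rewrite lu'.
  have es (X : {set V}) : 0 <= \sum_(v in X) excess t h u v by rewrite excess_set e1.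
  (* The excess is nonnegative on [v] and on its complement; as the total is 0, it vanishes. *)
  have tot : \sum_v excess t h u v = 0.
    have := excess_set t h u [set: V]; rewrite (eq_bigl xpredT) => [->|v']; last by rewrite inE.
    by rewrite /cutval big1 // => e _; rewrite !inE /= subr0.
  apply: le_anti; apply/andP; split; last by have := es [set v]; rewrite big_set1.
  have := es [set~ v]; rewrite (eq_bigl (fun i => i != v)) => [|i]; last by rewrite !inE.
  by move: tot; rewrite (bigD1 v) //=; lra.
have lu0 : l e0 < u e0 by rewrite lt_neqAle e0lt lu.
pose out (X : {set V}) := (t e0 \in X) && (h e0 \notin X).
pose inn (X : {set V}) := (t e0 \notin X) && (h e0 \in X).
(* The least value permitted by the cuts that [e0] leaves; submodularity shows that no cut entered
   by [e0] forbids it. *)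
pose z := \big[Num.max/l e0]_(X : {set V} | out X) (u e0 - cutval t h l u X).
have z_ge : l e0 <= z by exact: bigmax_ge_id.
have z_out X : out X -> u e0 - cutval t h l u X <= z by move=> oX; apply: le_bigmax_cond.
have z_le : z <= u e0 by apply/bigmax_leP; split=> // X _; rewrite lerBlDr lerDl.
have z_inn Y : inn Y -> z <= l e0 + cutval t h l u Y.
  move=> iY; apply/bigmax_leP; split=> [|X oX]; first by rewrite lerDl.
  have := cutval_submod lu oX iY; have := cut (X :&: Y); have := cut (X :|: Y); lra.
pose l' e := if e == e0 then z else l e.
pose u' e := if e == e0 then z else u e.
have upd e : e != e0 -> l' e = l e /\ u' e = u e by rewrite /l' /u' => /negbTE ->.
have [|||y [Hy1 Hy2]] := IH l' u'.
- rewrite ltnS in lt; apply: leq_trans lt; apply: proper_card.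
  apply/properP; split; last by exists e0; rewrite !inE /l' /u' ?eqxx ?ltxx.
  apply/subsetP => e; rewrite !inE /l' /u'; case: eqP => // _; by rewrite ltxx.
- by move=> e; rewrite /l' /u'; case: eqP.
- move=> X; rewrite (cutval_upd t h X upd) /l' /u' eqxx.
  have := cut X; have := z_out X; have := z_inn X; rewrite /out /inn.
  case: (t e0 \in X); case: (h e0 \in X) => /=; rewrite ?mulr1n ?mulr0n ?subr0 ?addr0 ?sub0r //.
    by move=> _ /(_ isT); lra.
  by move=> /(_ isT); lra.
exists y; split=> // e; have := Hy1 e; rewrite /l' /u'.
by case: eqP => // -> /andP[h1 h2]; rewrite (le_trans z_ge h1) (le_trans h2 z_le).
Qed.

Section Transshipment.
Variables (R : realDomainType) (V E : finType) (t h : E -> V).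
Variables (l u : E -> R) (blo bhi : V -> R).

(* The two families of cut conditions, for the two sides of the extra vertex
   through which supplies and demands are routed. *)
Definition cut_lo := forall X : {set V}, \sum_(v in X) blo v <= cutval t h l u X.
Definition cut_hi := forall X : {set V}, cutval t h u l X <= \sum_(v in X) bhi v.

Theorem transshipment : (forall e, l e <= u e) -> (forall v, blo v <= bhi v) ->
  cut_lo -> cut_hi ->
  exists y, (forall e, l e <= y e <= u e) /\ forall v, blo v <= excess t h y v <= bhi v.
Proof.
move=> lu blh clo chi.
(* The extra vertex [None] sends to each v an arc bounded by [blo v] and [bhi v]; conservation at v
   then says that the excess at v is the flow on this arc. *)
pose t' (e : E + V) := match e with inl e => Some (t e) | inr v => None end.
pose h' (e : E + V) := match e with inl e => Some (h e) | inr v => Some v end.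
pose l' (e : E + V) := match e with inl e => l e | inr v => blo v end.
pose u' (e : E + V) := match e with inl e => u e | inr v => bhi v end.
have [||y [Hy1 Hy2]] := @hoffman_circulation R (option V) (E + V)%type t' h' l' u'.
- by case.
- move=> X; pose X0 := [set v | Some v \in X].
  rewrite /cutval big_sumType /=.
  rewrite [X in X + _](_ : _ = cutval t h l u X0); last first.
    by apply: eq_bigr => e _; rewrite !inE.
  case: (boolP (None \in X)) => nX /=.
    have -> : \sum_(i : V) (bhi i *+ (Some i \notin X) - blo i *+ false) = \sum_(v in ~: X0) bhi v.
      rewrite [RHS]big_mkcond; apply: eq_bigr => v _; rewrite !inE subr0.
      by case: (Some v \in X).
    have := chi (~: X0) => H.
    have -> : cutval t h l u X0 = - cutval t h u l (~: X0).
      by rewrite /cutval -sumrN; apply: eq_bigr => e _; rewrite !inE !negbK opprB.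
    by rewrite addrC subr_ge0.
  have -> : \sum_(i : V) (bhi i *+ false - blo i *+ (Some i \in X)) = - \sum_(v in X0) blo v.
    rewrite [in RHS]big_mkcond -sumrN; apply: eq_bigr => v _; rewrite !inE sub0r.
    by case: (Some v \in X).
  by rewrite subr_ge0.
exists (fun e => y (inl e)); split=> [e|v]; first exact: (Hy1 (inl e)).
have := Hy2 (Some v); rewrite /excess big_sumType /=.
rewrite [X in _ + X](bigD1 v) //= eqxx [X in _ + (_ + X)]big1 => [|w /negbTE ne]; last first.
  by rewrite (inj_eq Some_inj) ne subrr.
rewrite addr0 sub0r mulr1n => /eqP; rewrite subr_eq0 => /eqP ->.
exact: (Hy1 (inr v)).
Qed.
End Transshipment.

(** * Error bounds for transshipments *)

Section Near.
Variables (R : realDomainType) (V E : finType) (t h : E -> V).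
Implicit Types (l u y : E -> R) (blo bhi tau : V -> R) (X : {set V}).

Lemma cutval_near l u y (eps : R) X : 0 <= eps ->
  (forall e, l e - eps <= y e <= u e + eps) ->
  cutval t h y y X <= cutval t h l u X + eps *+ #|E|.
Proof.
move=> e0 H; rewrite /cutval -sumr_const -big_split; apply: ler_sum => e _ /=.
have /andP[] := H e; case: (t e \in X); case: (h e \in X) => /=; rewrite ?mulr1n ?mulr0n; lra.
Qed.

Lemma sum_tau_le tau X : (forall v, 0 <= tau v) -> \sum_(v in X) tau v <= \sum_v tau v.
Proof.
move=> t0; rewrite [leRHS](bigID (mem X)) /= lerDl.
by apply: sumr_ge0 => v _; exact: t0.
Qed.

Lemma near_lo l u y blo tau (eps : R) X : 0 <= eps -> (forall v, 0 <= tau v) ->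
  (forall e, l e - eps <= y e <= u e + eps) ->
  (forall v, blo v - tau v <= excess t h y v) ->
  \sum_(v in X) blo v <= cutval t h l u X + (eps *+ #|E| + \sum_v tau v).
Proof.
move=> e0 t0 H B; have := cutval_near X e0 H; rewrite -excess_set.
have : \sum_(v in X) blo v - \sum_(v in X) tau v <= \sum_(v in X) excess t h y v.
  by rewrite -sumrB; apply: ler_sum => v _; exact: B.
have := sum_tau_le X t0; lra.
Qed.

Lemma near_hi l u y bhi tau (eps : R) X : 0 <= eps -> (forall v, 0 <= tau v) ->
  (forall e, l e - eps <= y e <= u e + eps) ->
  (forall v, excess t h y v <= bhi v + tau v) ->
  cutval t h u l X <= \sum_(v in X) bhi v + (eps *+ #|E| + \sum_v tau v).
Proof.
move=> e0 t0 H B.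
have H1 : cutval t h u l X - eps *+ #|E| <= cutval t h y y X.
  rewrite /cutval -sumr_const -sumrB; apply: ler_sum => e _ /=.
  have /andP[] := H e; case: (t e \in X); case: (h e \in X) => /=; rewrite ?mulr1n ?mulr0n; lra.
move: H1; rewrite -excess_set.
have : \sum_(v in X) excess t h y v <= \sum_(v in X) bhi v + \sum_(v in X) tau v.
  by rewrite -big_split; apply: ler_sum => v _; exact: B.
have := sum_tau_le X t0; lra.
Qed.

Lemma feasible_lo l u y blo X : (forall e, l e <= y e <= u e) ->
  (forall v, blo v <= excess t h y v) -> \sum_(v in X) blo v <= cutval t h l u X.
Proof.
move=> H B; have := @near_lo l u y blo (fun=> 0) 0 X (lexx 0).
rewrite mul0rn big1_eq !addr0; apply=> // [e|v]; last by rewrite subr0.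
by rewrite subr0 addr0.
Qed.

Lemma feasible_hi l u y bhi X : (forall e, l e <= y e <= u e) ->
  (forall v, excess t h y v <= bhi v) -> cutval t h u l X <= \sum_(v in X) bhi v.
Proof.
move=> H B; have := @near_hi l u y bhi (fun=> 0) 0 X (lexx 0).
rewrite mul0rn big1_eq !addr0; apply=> // [e|v]; last by rewrite addr0.
by rewrite subr0 addr0.
Qed.

(** Hoffman's error bound. A solution is sought within distance K of [y], which only tightens the
    edge bounds. If some edge of a cut has its bound from this restriction, that bound differs from
    [y] by K, enough to pay for all violations of [y] elsewhere; otherwise the cut condition is one
    of the original problem, which [y0] satisfies. *)
Lemma feasible_near l u y y0 blo bhi tau (eps : R) :
  0 <= eps -> (forall v, 0 <= tau v) ->
  (forall e, l e <= y0 e <= u e) -> (forall v, blo v <= excess t h y0 v <= bhi v) ->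
  (forall e, l e - eps <= y e <= u e + eps) ->
  (forall v, blo v - tau v <= excess t h y v <= bhi v + tau v) ->
  exists z, [/\ forall e, l e <= z e <= u e, forall v, blo v <= excess t h z v <= bhi v &
    forall e, `|z e - y e| <= eps *+ #|E| + \sum_v tau v].
Proof.
move=> e0 t0 F0 B0 F B; set K := eps *+ #|E| + _.
have T0 : 0 <= \sum_v tau v by apply: sumr_ge0.
have Ke : {in E, forall e, eps <= K}.
  move=> e _; have : (0 < #|E|)%N by apply/card_gt0P; exists e.
  rewrite /K; case: #|E| => // n _; rewrite mulrS -addrA lerDl addr_ge0 //.
  by rewrite mulrn_wge0.
have K0 : 0 <= K by rewrite addr_ge0 // mulrn_wge0.
pose l' e := Num.max (l e) (y e - K).
pose u' e := Num.min (u e) (y e + K).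
have lu e : l e <= u e by have /andP[h1 h2] := F0 e; exact: le_trans h1 h2.
have [||||z [z1 z2]] := @transshipment R V E t h l' u' blo bhi.
- move=> e; rewrite /l' /u' ge_max !le_min lu /=.
  have /andP[] := F e; move: K0 (Ke e isT); lra.
- by move=> v; have /andP[h1 h2] := B0 v; exact: le_trans h1 h2.
- move=> X; case: (boolP [exists e, ((t e \in X) && (h e \notin X) && (y e + K < u e))
      || ((t e \notin X) && (h e \in X) && (l e < y e - K))]) => [/existsP[e1 he1]|/existsPn no].
    have : \sum_(v in X) blo v - \sum_(v in X) tau v <= cutval t h y y X.
      rewrite -excess_set -sumrB; apply: ler_sum => v _; by have /andP[] := B v.
    suff : cutval t h y y X + K <= cutval t h l' u' X + eps *+ #|E|.
      have := sum_tau_le X t0; rewrite /K; lra.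
    rewrite /cutval -sumr_const -big_split /= (bigD1 e1) //= [leRHS](bigD1 e1) //=.
    rewrite [leLHS]addrAC; apply: lerD; last first.
      apply: ler_sum => e _; have /andP[f1 f2] := F e.
      have g1 : y e - eps <= u' e by rewrite /u' le_min; move: (Ke e isT); lra.
      have g2 : l' e <= y e + eps by rewrite /l' ge_max; move: (Ke e isT); lra.
      case: (t e \in X); case: (h e \in X) => /=; rewrite ?mulr1n ?mulr0n; lra.
    move: he1; rewrite /l' /u'; case: (t e1 \in X); case: (h e1 \in X) => //=; rewrite ?mulr1n ?mulr0n ?andbF ?orbF //.
      by move=> lt; rewrite (min_idPr (ltW lt)); lra.
    by move=> lt; rewrite (max_idPr (ltW lt)); lra.
  have -> : cutval t h l' u' X = cutval t h l u X.
    apply: eq_bigr => e _; have := no e; rewrite /l' /u'.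
    case: (t e \in X); case: (h e \in X) => //=; rewrite ?mulr1n ?mulr0n ?orbF -leNgt => le.
      by rewrite (min_idPl le).
    by rewrite (max_idPl le).
  by apply: feasible_lo F0 _ => v; have /andP[] := B0 v.
- move=> X; case: (boolP [exists e, ((t e \in X) && (h e \notin X) && (l e < y e - K))
      || ((t e \notin X) && (h e \in X) && (y e + K < u e))]) => [/existsP[e1 he1]|/existsPn no].
    have : cutval t h y y X <= \sum_(v in X) bhi v + \sum_(v in X) tau v.
      rewrite -excess_set -big_split; apply: ler_sum => v _; by have /andP[] := B v.
    suff : cutval t h u' l' X + K <= cutval t h y y X + eps *+ #|E|.
      have := sum_tau_le X t0; rewrite /K; lra.
    rewrite /cutval -sumr_const -big_split /= (bigD1 e1) //= [leRHS](bigD1 e1) //=.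
    rewrite [leLHS]addrAC; apply: lerD; last first.
      apply: ler_sum => e _; have /andP[f1 f2] := F e.
      have g1 : y e - eps <= u' e by rewrite /u' le_min; move: (Ke e isT); lra.
      have g2 : l' e <= y e + eps by rewrite /l' ge_max; move: (Ke e isT); lra.
      case: (t e \in X); case: (h e \in X) => /=; rewrite ?mulr1n ?mulr0n; lra.
    move: he1; rewrite /l' /u'; case: (t e1 \in X); case: (h e1 \in X) => //=; rewrite ?mulr1n ?mulr0n ?andbF ?orbF //.
      by move=> lt; rewrite (max_idPr (ltW lt)); lra.
    by move=> lt; rewrite (min_idPr (ltW lt)); lra.
  have -> : cutval t h u' l' X = cutval t h u l X.
    apply: eq_bigr => e _; have := no e; rewrite /l' /u'.
    case: (t e \in X); case: (h e \in X) => //=; rewrite ?mulr1n ?mulr0n ?orbF -leNgt => le.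
      by rewrite (max_idPl le).
    by rewrite (min_idPl le).
  by apply: feasible_hi F0 _ => v; have /andP[] := B0 v.
exists z; split=> // e; have := z1 e; rewrite /l' /u' ?ge_max ?le_min => /andP[] /andP[? ?] /andP[? ?] //.
  by apply/andP.
by rewrite ler_norml; lra.
Qed.
End Near.

Section IntRound.
Variables (V E : finType) (t h : E -> V).
Variables (l u : E -> int) (blo bhi : V -> int) (y : E -> rat) (tau : V -> rat) (eps : rat).

Lemma cutval_intr (l' u' : E -> int) X :
  (cutval t h l' u' X)%:~R = cutval t h (fun e => (l' e)%:~R : rat) (fun e => (u' e)%:~R) X.
Proof.
rewrite /cutval rmorph_sum; apply: eq_bigr => e _.
by rewrite rmorphB !rmorphMn.
Qed.

Lemma sum_intr (b : V -> int) (X : {set V}) :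
  (\sum_(v in X) b v)%:~R = \sum_(v in X) (b v)%:~R :> rat.
Proof. exact: rmorph_sum. Qed.

(* Cut conditions over the integers that fail by less than 1 hold. *)
Theorem int_round :
  (forall e, l e <= u e) -> (forall v, blo v <= bhi v) ->
  0 <= eps -> (forall v, 0 <= tau v) ->
  (forall e, (l e)%:~R - eps <= y e <= (u e)%:~R + eps) ->
  (forall v, (blo v)%:~R - tau v <= excess t h y v <= (bhi v)%:~R + tau v) ->
  eps *+ #|E| + \sum_v tau v < 1 ->
  exists z : E -> int, (forall e, l e <= z e <= u e) /\ forall v, blo v <= excess t h z v <= bhi v.
Proof.
move=> lu blh e0 t0 F B lt1; apply: transshipment => // X.
  rewrite -ltzD1 -(ltr_int rat) rmorphD /= cutval_intr sum_intr.
  apply: le_lt_trans (near_lo X e0 t0 F (fun v => proj1 (andP (B v)))) _.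
  by rewrite ltrD2l.
rewrite -ltzD1 -(ltr_int rat) rmorphD /= cutval_intr sum_intr.
apply: le_lt_trans (near_hi X e0 t0 F (fun v => proj2 (andP (B v)))) _.
by rewrite ltrD2l.
Qed.
End IntRound.

Local Close Scope ring_scope.

(** * The relaxation method for systems of inequalities *)

Local Open Scope ring_scope.

Definition coef (cs : seq (bool * bool)) (j : nat) : rat :=
  ((nth (false, false) cs j).1)%:R - ((nth (false, false) cs j).2)%:R.
Definition dot n (cs : seq (bool * bool)) (x : nat -> rat) : rat := \sum_(j < n) coef cs j * x j.
Definition sat n (t : rat) (x : nat -> rat) (r : row) := dot n r.1 x + (r.2.1)%:R <= (r.2.2)%:R + t.
Definition ratv (x : seq nat) (j : nat) : rat := (nth 0%N x j)%:R.
Definition wf_row n (r : row) := (size r.1 == n) && all (fun c => ~~ (c.1 && c.2)) r.1.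
Definition dist n (x : seq nat) (y : nat -> rat) : rat := \sum_(j < n) (ratv x j - y j) ^+ 2.

Lemma sumn_nth (s : seq nat) : sumn s = (\sum_(j < size s) nth 0 s j)%N.
Proof. by rewrite sumnE (big_nth 0%N) big_mkord. Qed.

Lemma pos_neg_val n cs x : size cs = n -> size x = n ->
  (pos_val cs x)%:R - (neg_val cs x)%:R = dot n cs (ratv x).
Proof.
move=> sc sx; rewrite /pos_val /neg_val !sumn_nth !size_map size_zip sc sx minnn.
rewrite !natr_sum -sumrB; apply: eq_bigr => j _.
rewrite !(nth_map ((false, false), 0%N)) ?size_zip ?sc ?sx ?minnn //.
rewrite nth_zip ?sc // /coef /ratv /=; case: (nth (false, false) cs j) => [[] []] /=;
by rewrite ?subrr ?subr0 ?sub0r ?mul0r ?mul1r ?mulN1r.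
Qed.

Lemma violatedE n (t : nat) x r : wf_row n r -> size x = n ->
  ~~ violated t x r = sat n t%:R (ratv x) r.
Proof.
move=> /andP[/eqP sc _] sx; rewrite /violated -leqNgt /sat -(pos_neg_val sc sx).
rewrite -(ler_nat rat) !natrD; apply/idP/idP; lra.
Qed.

Lemma size_move s x cs : size cs = size x -> size (move_along s x cs) = size x.
Proof. by move=> e; rewrite size_map size_zip e minnn. Qed.

(** For a row a, the squared distance changes by -2 s <a, x - y> + s^2 |a|^2. The violation bounds
    the inner product below by M s, and |a|^2 <= n <= M, so at least M s^2 is gained. A coordinate
    truncated at 0 only gets closer to a nonnegative [y]. *)
Lemma dist_move n (M s : nat) x y r : wf_row n r -> size x = n -> (n <= M)%N ->
  (forall j, 0 <= y j) -> sat n 0 y r -> violated (M * s)%N x r ->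
  dist n (move_along s x r.1) y + (M * s * s)%:R <= dist n x y.
Proof.
move=> wf sx nM y0 saty; rewrite -[violated _ _ _]negbK (violatedE _ wf sx) /sat -ltNge => viol.
case/andP: wf => /eqP sc /allP cs_ok.
have main : dist n (move_along s x r.1) y <=
   \sum_(j < n) ((ratv x j - y j) ^+ 2 - 2%:R * s%:R * (coef r.1 j * (ratv x j - y j)) + s%:R ^+ 2).
  apply: ler_sum => j _; rewrite /ratv (nth_map ((false, false), 0%N)) ?size_zip ?sc ?sx ?minnn //.
  rewrite nth_zip ?sc // /coef /=.
  have := cs_ok (nth (false, false) r.1 j); rewrite mem_nth ?sc // => /(_ isT).
  have := y0 j; set xj := nth 0%N x j; set yj := y j => yj0.
  case: (nth _ _ _) => [[] []] //= _; rewrite ?subr0 ?sub0r ?subrr ?mul0r ?mulr0 ?mul1r ?mulN1r.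
  - case: (leqP s xj) => le.
      by rewrite natrB //; set a := xj%:R; set b := s%:R; nra.
    rewrite (_ : (xj - s)%N = 0%N); last by apply/eqP; rewrite subn_eq0 ltnW.
    have : xj%:R <= s%:R :> rat by rewrite ler_nat ltnW.
    have : 0 <= xj%:R :> rat by exact: ler0n.
    set a := xj%:R; set b := s%:R => a0 ab; nra.
  - by rewrite natrD; set a := xj%:R; set b := s%:R; nra.
  - by rewrite subr0 lerDl sqr_ge0.
rewrite big_split sumrB /= sumr_const card_ord -mulr_sumr in main.
have e : \sum_(j < n) coef r.1 j * (ratv x j - y j) = dot n r.1 (ratv x) - dot n r.1 y.
  by rewrite -sumrB; apply: eq_bigr => j _; rewrite mulrBr.
rewrite e in main; rewrite /sat addr0 in saty.
have h1 : (M * s)%:R <= dot n r.1 (ratv x) - dot n r.1 y by lra.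
have h2 : s%:R ^+ 2 *+ n <= (M * s * s)%:R :> rat.
  by rewrite -mulr_natl -natrX -natrM ler_nat; nia.
have h3 : 2%:R * s%:R * (M * s)%:R <= 2%:R * s%:R * (dot n r.1 (ratv x) - dot n r.1 y) :> rat.
  by apply: ler_wpM2l => //; rewrite -natrM ler0n.
have h4 : 2%:R * s%:R * (M * s)%:R = 2%:R * (M * s * s)%:R :> rat.
  by rewrite !natrM; ring.
rewrite h4 in h3; rewrite -/(dist n x y) in main.
by move: main h2 h3; set u := dist _ _ _; set v := dist _ _ _; set w := (M * s * s)%:R; lra.
Qed.

Section Relax.
Variables (n M : nat) (rows : seq row).
Hypotheses (wf : all (wf_row n) rows) (nM : (n <= M)%N) (M0 : (0 < M)%N).

Definition within t x := all (fun r => ~~ violated t x r) rows.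

Lemma relax_stepE sm x : size x = n ->
  (within sm.2 x /\ relax_step rows sm x = x) \/
  exists r, [/\ r \in rows, violated sm.2 x r & relax_step rows sm x = move_along sm.1 x r.1].
Proof.
move=> sx; rewrite /relax_step /within.
case e: [seq r <- rows | violated sm.2 x r] => [|r v] /=.
  left; split=> //; apply/allP => r rr; apply/negP => v.
  have : r \in [seq r <- rows | violated sm.2 x r] by rewrite mem_filter v.
  by rewrite e.
have : r \in [seq r <- rows | violated sm.2 x r] by rewrite e mem_head.
by rewrite mem_filter => /andP[vr rr]; right; exists r.
Qed.

Lemma size_relax_step sm x : size x = n -> size (relax_step rows sm x) = n.
Proof.
move=> sx; case: (relax_stepE sm sx) => [[_ ->] //|[r [rr _ ->]]].
by rewrite size_move // sx; have /allP/(_ _ rr)/andP[/eqP] := wf.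
Qed.

Lemma size_relax_phase R x sm : size x = n -> size (relax_phase rows R x sm) = n.
Proof. by elim: R x => //= _ R IH x sx; apply: IH; exact: size_relax_step. Qed.

Lemma size_relax sc R x : size x = n -> size (relax rows sc R x) = n.
Proof. by elim: sc x => //= sm sc IH x sx; apply: IH; exact: size_relax_phase. Qed.

Lemma phase_id R sm x : size x = n -> within sm.2 x -> relax_phase rows R x sm = x.
Proof.
move=> sx w; elim: R => //= _ R IH; rewrite /relax_phase /= (_ : relax_step rows sm x = x) //.
rewrite /relax_step (_ : nilp _) // /nilp size_filter eqn0Ngt -has_count.
by rewrite -all_predC.
Qed.

Lemma phase_within R s x y : size x = n -> (0 < s)%N ->
  (forall j, 0 <= y j) -> all (sat n 0 y) rows -> dist n x y < (size R * (s * s))%:R ->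
  within (M * s) (relax_phase rows R x (s, M * s)%N).
Proof.
move=> + s0 y0 saty; elim: R x => [|u R IH] x sx lt.
  by move: lt; rewrite ltNge sumr_ge0 // => j _; rewrite sqr_ge0.
rewrite /relax_phase /= -/(relax_phase rows R _ _).
case: (relax_stepE (s, M * s)%N sx) => [[w ->]|[r [rr v ->]]].
  by rewrite phase_id.
have wr : wf_row n r by exact: (allP wf).
apply: IH; first by rewrite size_move // sx; case/andP: wr => /eqP.
have := dist_move wr sx nM y0 (allP saty _ rr) v.
have : (s * s)%:R <= (M * s * s)%:R :> rat by rewrite ler_nat -mulnA leq_pmull.
by move: lt; rewrite /= mulSn natrD; lra.
Qed.

Variables (D : nat -> nat) (R : seq unit).
(** An error bound for the system. Combined with [D_small] it says that one phase of step s has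
    enough rounds when it starts from violation at most 2 M s. *)
Hypothesis near_feasible : forall (eps : nat) x, size x = n -> within eps x ->
  exists y, [/\ forall j, 0 <= y j, all (sat n 0 y) rows & dist n x y <= (D eps)%:R].
Hypothesis D_small : forall s, (0 < s)%N -> (D (2 * (M * s)) < size R * (s * s))%N.

Lemma scalesE l : scales M l = [seq (2 ^ j, M * 2 ^ j)%N | j <- rev (iota 0 (size l).+1)].
Proof.
elim/last_ind: l => [|l u IH]; first by rewrite /scales /= muln1.
rewrite /scales foldl_rcons -/(scales M l) IH size_rcons.
have e m : iota 0 m.+1 = rcons (iota 0 m) m by rewrite -addn1 iotaD cats1.
by rewrite [in RHS]e !rev_rcons e rev_rcons /= /dbl_head /= !addnn -!mul2n -expnS mulnCA -expnS.
Qed.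

(** A phase of step 2^j starts from violation 2 M 2^j and ends at M 2^j, which is the starting level
    of the next finer phase; the last phase ends at M. *)
Lemma relax_within l x : size x = n -> within (2 * (M * 2 ^ size l)) x ->
  within M (relax rows (scales M l) R x).
Proof.
rewrite scalesE; elim: {l} (size l) x => [|L IH] x sx w.
  have [y [y0 sy dy]] := near_feasible sx w.
  have := @phase_within R 1 x y sx isT y0 sy; rewrite /relax /= expn0 !muln1; apply.
  by apply: le_lt_trans dy _; rewrite ltr_nat; have := D_small (isT : 0 < 1)%N; rewrite /= expn0 !muln1.
have e m : iota 0 m.+1 = rcons (iota 0 m) m by rewrite -addn1 iotaD cats1.
rewrite e rev_rcons /relax /= -/(relax rows _ R _); apply: IH; first exact: size_relax_phase.
have [y [y0 sy dy]] := near_feasible sx w.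
rewrite mulnCA -expnS; apply: (@phase_within R _ x y) => //; first by rewrite expn_gt0.
by apply: le_lt_trans dy _; rewrite ltr_nat D_small // expn_gt0.
Qed.
End Relax.

Lemma decide_sound n P rows x0 : size x0 = n -> all (wf_row n) rows -> decide P rows x0 ->
  exists x, size x = n /\ all (sat n (pM P)%:R (ratv x)) rows.
Proof.
move=> sx wf /allP d; exists (relax rows (psc P) (pR P) x0); split; first exact: size_relax.
apply/allP => r rr; rewrite -violatedE ?d //; first exact: (allP wf).
exact: size_relax.
Qed.

Local Close Scope ring_scope.

(** * Integral flows found by linear feasibility tests *)

Local Open Scope ring_scope.

Definition arc0 : arc := (0, 0, 0)%N.
Definition atail (A : seq arc) j := (nth arc0 A j).1.1.
Definition ahead (A : seq arc) j := (nth arc0 A j).1.2.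
Definition acap (A : seq arc) j := (nth arc0 A j).2.
Definition exc (A : seq arc) (v : nat) (x : nat -> rat) : rat :=
  \sum_(j < size A) ((atail A j == v)%:R - (ahead A j == v)%:R) * x j.

Lemma dot_onehot (A : seq arc) j b x : (j < size A)%N ->
  dot (size A) (onehot (indices A) j b) x = (b.1%:R - b.2%:R) * x j.
Proof.
move=> lt; rewrite /dot (bigD1 (Ordinal lt)) //= big1 ?addr0 => [|i /negbTE ne].
  by rewrite /coef (nth_map 0%N) ?size_iota // nth_iota //= add0n eqxx !andbT.
rewrite /coef (nth_map 0%N) ?size_iota // nth_iota //= add0n.
have -> : (i == j :> nat) = false by rewrite -[j]/(nat_of_ord (Ordinal lt)) (inj_eq val_inj).
by rewrite !andbF subrr mul0r.
Qed.

Lemma dot_div_row A v b x : dot (size A) (div_row A v b) x = if b then - exc A v x else exc A v x.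
Proof.
rewrite /dot /exc; case: b; rewrite -?sumrN; apply: eq_bigr => j _;
by rewrite /coef (nth_map arc0) //= -?mulNr ?opprB.
Qed.

Lemma all_zip_indices (T U : Type) (A : seq T) (B : seq U) (x0 : T) (y0 : U) (a : pred (nat * (T * U))) :
  size A = size B ->
  all a (zip (indices A) (zip A B)) <-> forall j, (j < size A)%N -> a (j, (nth x0 A j, nth y0 B j)).
Proof.
move=> sz; have szz : size (zip A B) = size A by rewrite size_zip sz minnn.
have N j : (j < size A)%N -> nth (0%N, (x0, y0)) (zip (indices A) (zip A B)) j = (j, (nth x0 A j, nth y0 B j)).
  by move=> lt; rewrite nth_zip ?size_iota ?szz // nth_iota // add0n nth_zip.
split=> [/(all_nthP (0%N, (x0, y0))) H j lt|H].
  by rewrite -N //; apply: H; rewrite size_zip size_iota szz minnn.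
apply/(all_nthP (0%N, (x0, y0))) => j; rewrite size_zip size_iota szz minnn => lt.
by rewrite N //; exact: H.
Qed.

Lemma all_flatten (T : Type) (a : pred T) ss : all a (flatten ss) = all (all a) ss.
Proof. by elim: ss => //= s ss <-; rewrite all_cat. Qed.

Lemma sat_arc_rows N A lo t x : size lo = size A ->
  all (sat (size A) t x) (arc_rows N A lo) <->
  forall j, (j < size A)%N -> (N * nth 0 lo j)%:R <= x j + t /\ x j <= (N * acap A j)%:R + t.
Proof.
move=> sz; rewrite /arc_rows all_flatten all_map (all_zip_indices arc0 0%N) //.
split=> H j lt; have := H j lt; rewrite /= andbT /sat !dot_onehot //= ?mulr0n subr0 sub0r mulN1r mul1r ?addr0 ?add0r.
  by move=> /andP[]; lra.
by move=> [h1 h2]; apply/andP; split; lra.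
Qed.

Lemma sat_vcon_rows N A vcs t x :
  all (sat (size A) t x) (vcon_rows N A vcs) <->
  forall w, w \in vcs -> exc A w.1 x + (N * w.2.1.1)%:R <= (N * w.2.2)%:R + t /\
    - exc A w.1 x + (N * w.2.1.2)%:R <= (N * w.2.2)%:R + t.
Proof.
rewrite /vcon_rows all_flatten all_map; split=> [/allP H w /H|H].
  by rewrite /= andbT /sat !dot_div_row => /andP[].
by apply/allP => w /H[h1 h2]; rewrite /= andbT /sat !dot_div_row; apply/andP.
Qed.

Lemma wf_flow_rows N A vcs lo : (forall a, a \in A -> a.1.1 != a.1.2) ->
  all (wf_row (size A)) (flow_rows N A vcs lo).
Proof.
move=> nl; have W j b : b.1 && b.2 = false -> wf_row (size A) (onehot (indices A) j b, (0, 0)%N).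
  move=> nb; rewrite /wf_row size_map size_iota eqxx /= all_map; apply/allP => i _ /=.
  by case: b nb => [[] []] //=; case: (i == j).
have W' v b : wf_row (size A) (div_row A v b, (0, 0)%N).
  rewrite /wf_row size_map eqxx /= all_map; apply/allP => a aA /=.
  by case: b => /=; apply/negP => /andP[/eqP e1 /eqP e2]; have := nl a aA; rewrite e1 e2 eqxx.
rewrite all_cat !all_flatten !all_map; apply/andP; split; apply/allP => p _ /=.
  have := W p.1 (false, true) erefl; have := W p.1 (true, false) erefl.
  by rewrite /wf_row /= => -> ->.
by have := W' p.1 false; have := W' p.1 true; rewrite /wf_row /= => -> ->.
Qed.

Section IntFlow.
Variables (A : seq arc) (vs : seq nat) (F : nat -> nat * nat * nat) (n : nat).
Hypotheses (loopless : forall a, a \in A -> a.1.1 != a.1.2)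
  (Avs : forall a, a \in A -> (a.1.1 \in vs) && (a.1.2 \in vs))
  (vsn : forall v, v \in vs -> (v <= n)%N)
  (Fok : forall v, ((F v).1.1 + (F v).1.2 <= (F v).2 + (F v).2)%N).
Let vcs := [seq (v, F v) | v <- vs].
Let m := size A.
Let V := 'I_n.+1.
Let tl (j : 'I_m) : V := inord (atail A j).
Let hd (j : 'I_m) : V := inord (ahead A j).

Lemma arc_ends (j : 'I_m) : (atail A j \in vs) /\ (ahead A j \in vs).
Proof. by have /andP[] := Avs (mem_nth arc0 (ltn_ord j)). Qed.

Lemma tlE j v : (tl j == v) = (atail A j == v).
Proof. by rewrite -val_eqE /= inordK // ltnS vsn //; case: (arc_ends j). Qed.
Lemma hdE j v : (hd j == v) = (ahead A j == v).
Proof. by rewrite -val_eqE /= inordK // ltnS vsn //; case: (arc_ends j). Qed.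

Lemma excE (x : nat -> rat) (v : V) : excess tl hd (fun j : 'I_m => x j) v = exc A v x.
Proof.
by apply: eq_bigr => j _; rewrite tlE hdE mulrBl !mulr_natl.
Qed.

Lemma exc_notin x v : v \notin vs -> exc A v x = 0.
Proof.
move=> nv; rewrite /exc big1 // => j _; have [i1 i2] := arc_ends j.
have -> : (atail A j == v) = false by apply: contraNF nv => /eqP <-.
have -> : (ahead A j == v) = false by apply: contraNF nv => /eqP <-.
by rewrite subrr mul0r.
Qed.

Definition flo (v : V) : int := if val v \in vs then (F v).1.2%:Z - (F v).2%:Z else 0.
Definition fhi (v : V) : int := if val v \in vs then (F v).2%:Z - (F v).1.1%:Z else 0.

(** Outside [vs] the excess is exactly 0, so no tolerance is granted there. The range ['I_n.+1] may
    be exponentially larger than the input, and a tolerance at each of its points would have too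
    large a sum. *)
Definition vtol (eps : rat) (v : V) : rat := if val v \in vs then eps else 0.

Lemma sum_vtol eps : 0 <= eps -> \sum_v vtol eps v <= eps *+ size vs.
Proof.
move=> e0; rewrite /vtol -big_mkcond /= sumr_const -[leLHS]mulr_natr -[leRHS]mulr_natr ler_wpM2l // ler_nat.
apply: leq_trans (_ : #|[seq inord v | v <- vs] : seq V| <= _)%N; last first.
  by apply: leq_trans (card_size _) _; rewrite size_map.
apply/subset_leq_card/subsetP => v vvs.
by apply/mapP; exists (val v); rewrite ?inord_val //; exact: vvs.
Qed.

Lemma vtol_ge0 eps v : 0 <= eps -> 0 <= vtol eps v.
Proof. by rewrite /vtol; case: ifP. Qed.

Lemma sat_vcons N t (x : nat -> rat) : 0 <= t ->
  all (sat m t x) (vcon_rows N A vcs) <->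
  forall v : V, N%:R * (flo v)%:~R - vtol t v <= exc A v x <= N%:R * (fhi v)%:~R + vtol t v.
Proof.
move=> t0; rewrite sat_vcon_rows; split=> [H v|H w /mapP[v vvs ->]] /=.
  rewrite /flo /fhi /vtol; case: ifP => vvs.
    have [] := H (val v, F v); first by apply/mapP; exists (val v).
    by rewrite /= !natrM !rmorphB /= -!pmulrn => h1 h2; apply/andP; split; lra.
  by rewrite exc_notin ?vvs // mulr0z mulr0 subrr lexx.
have := H (inord v); rewrite /flo /fhi /vtol /= inordK ?ltnS ?vsn // vvs.
by rewrite !natrM !rmorphB /= -!pmulrn => /andP[h1 h2]; split; lra.
Qed.

Definition int_flow (lo y : seq nat) := size y = m /\
  all (sat m 0 (ratv y)) (flow_rows 1 A vcs lo).

Lemma int_flowP lo y : size lo = m -> size y = m ->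
  int_flow lo y <->
  (forall j : 'I_m, (nth 0 lo j <= nth 0 y j <= acap A j)%N) /\
  forall v : V, (flo v)%:~R <= exc A v (ratv y) <= (fhi v)%:~R.
Proof.
move=> sl sy; rewrite /int_flow all_cat; split.
  move=> [_ /andP[/(sat_arc_rows _ _ _ sl) H1 /(sat_vcons _ _ (lexx 0)) H2]]; split=> [j|v].
    have [] := H1 j (ltn_ord j); rewrite !mul1n !addr0 /ratv !ler_nat => h1 h2.
    by apply/andP.
  by have := H2 v; rewrite !mul1r /vtol if_same subr0 addr0.
move=> [H1 H2]; split=> //; apply/andP; split.
  apply/(sat_arc_rows _ _ _ sl) => j lt; have /andP[h1 h2] := H1 (Ordinal lt).
  by rewrite !mul1n !addr0 /ratv !ler_nat.
by apply/(sat_vcons _ _ (lexx 0)) => v; rewrite !mul1r /vtol if_same subr0 addr0.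
Qed.

Variables (P : param) (l : seq unit).
Let M := pM P.
Let N := pN P.
Hypotheses (mM : (m <= M)%N) (M0 : (0 < M)%N)
  (HN : ((m + size vs) * M + 2 * M < N)%N)
  (Hsc : psc P = scales M l)
  (HR : (m * ((2 * M) * (m + size vs)) ^ 2 < size (pR P))%N)
  (capl : forall j, (N * acap A j <= 2 * (M * 2 ^ size l))%N)
  (vcl : forall w, w \in vcs -> (N * w.2.1.1 <= N * w.2.2 + 2 * (M * 2 ^ size l))%N /\
     (N * w.2.1.2 <= N * w.2.2 + 2 * (M * 2 ^ size l))%N).

(** Divided by N, the accepted point violates each constraint by at most M / N, and [HN] keeps the
    total below 1, as [int_round] demands. *)
Lemma flow_ok_sound lo : size lo = m -> flow_ok P A vcs lo -> exists y, int_flow lo y.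
Proof.
move=> sl; have wf := wf_flow_rows N vcs lo loopless.
have N0 : 0 < N%:R :> rat by rewrite ltr0n; lia.
case/(decide_sound _ wf); first by rewrite size_map.
move=> x [sx]; rewrite all_cat => /andP[/(sat_arc_rows _ _ _ sl) H1 /(sat_vcons _ _ (ler0n _ _)) H2].
pose eps : rat := M%:R / N%:R.
have e0 : 0 <= eps by rewrite divr_ge0 ?ler0n.
have MN : M%:R = N%:R * eps by rewrite mulrC divfK // gt_eqF.
pose y j := ratv x j / N%:R.
have xy j : ratv x j = N%:R * y j by rewrite mulrC divfK // gt_eqF.
have excN v : exc A v (ratv x) = N%:R * exc A v y.
  by rewrite /exc mulr_sumr; apply: eq_bigr => j _; rewrite xy mulrCA.
have B1 (j : 'I_m) : (nth 0%N lo j)%:R - eps <= y j <= (acap A j)%:R + eps.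
  have [] := H1 j (ltn_ord j); rewrite -/M MN !natrM xy -!mulrDr !ler_pM2l // => h1 h2.
  by apply/andP; split; lra.
have B2 (v : V) : (flo v)%:~R - vtol eps v <= exc A v y <= (fhi v)%:~R + vtol eps v.
  have := H2 v; rewrite excN -/M.
  have -> : vtol M%:R v = N%:R * vtol eps v by rewrite /vtol; case: ifP; rewrite ?mulr0 ?MN.
  by rewrite -mulrBr -mulrDr !ler_pM2l.
have [|||||||z [z1 z2]] := @int_round V 'I_m tl hd (fun j => nth 0%N lo j) (fun j => acap A j) flo fhi (fun j => y j) (vtol eps) eps.
- move=> j; rewrite lez_nat leqNgt; have /andP[h1 h2] := B1 j.
  have : (N * nth 0 lo j <= N * acap A j + 2 * M)%N.
    rewrite -(ler_nat rat) natrD !natrM MN; move: (ler_wpM2l (ltW N0) h1) (ler_wpM2l (ltW N0) h2); lra.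
  have : (2 * M < N)%N by lia.
  move=> N2 le; apply/negP => lt.
  have : (N * (acap A j).+1 <= N * nth 0 lo j)%N by rewrite leq_mul2l lt orbT.
  by rewrite mulnS; lia.
- by move=> v; rewrite /flo /fhi; case: ifP => // _; have := Fok v; lia.
- by [].
- by move=> v; exact: vtol_ge0.
- by move=> j; exact: B1.
- by move=> v; rewrite excE; exact: B2.
- rewrite card_ord; apply: (@le_lt_trans _ _ (eps *+ (m + size vs))).
    by rewrite mulrnDr lerD2l sum_vtol.
  rewrite -(ltr_pM2l N0) mulr1 mulrnAr -MN -mulr_natl -natrM ltr_nat; lia.
have zpos j : 0 <= z j by have /andP[h _] := z1 j; apply: le_trans h.
exists [seq `|z j|%N | j <- enum 'I_m].
have zn (j : 'I_m) : nth 0%N [seq `|z j|%N | j <- enum 'I_m] j = `|z j|%N.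
  by rewrite (nth_map j) ?size_enum_ord ?ltn_ord // nth_ord_enum.
apply/int_flowP => //; first by rewrite size_map size_enum_ord.
split=> [j|v].
  by rewrite zn -!lez_nat gez0_abs // z1.
have -> : exc A v (ratv [seq `|z j|%N | j <- enum 'I_m]) = (excess tl hd z v)%:~R.
  rewrite -excE /excess rmorph_sum; apply: eq_bigr => j _.
  by rewrite rmorphB !rmorphMn /= /ratv zn -[in RHS](gez0_abs (zpos j)) pmulrn.
by rewrite !ler_int.
Qed.

(** N times an integral flow solves the scaled system, so [feasible_near] provides a solution within
    eps (m + |vs|) of any near-solution in every coordinate: this is the error bound that the
    relaxation method needs. *)
Lemma flow_ok_complete lo y : size lo = m -> int_flow lo y -> flow_ok P A vcs lo.
Proof.
move=> sl fl; have [sy _] := fl; move/(int_flowP sl sy): fl => [Y1 Y2].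
have wf := wf_flow_rows N vcs lo loopless.
rewrite /flow_ok /decide Hsc -/M; apply: (relax_within wf mM M0 (D := fun eps => m * (eps * (m + size vs)) ^ 2)%N).
- move=> eps x sx w.
  have {}w : all (sat m eps%:R (ratv x)) (flow_rows N A vcs lo).
    by apply/allP => r rr; rewrite -violatedE ?(allP w) //; exact: (allP wf).
  move: w; rewrite all_cat => /andP[/(sat_arc_rows _ _ _ sl) H1 /(sat_vcons _ _ (ler0n _ _)) H2].
  have [|||||z [z1 z2 z3]] := @feasible_near rat V 'I_m tl hd (fun j => (N * nth 0 lo j)%:R) (fun j => (N * acap A j)%:R)
    (fun j => ratv x j) (fun j => N%:R * ratv y j) (fun v => N%:R * (flo v)%:~R) (fun v => N%:R * (fhi v)%:~R)
    (vtol eps%:R) eps%:R (ler0n _ _).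
  + by move=> v; exact: vtol_ge0.
  + move=> j; have /andP[h1 h2] := Y1 j.
    by rewrite /ratv -natrM !ler_nat !leq_mul2l h1 h2 !orbT.
  + move=> v; rewrite (excE (fun j => N%:R * ratv y j)).
    have -> : exc A v (fun j => N%:R * ratv y j) = N%:R * exc A v (ratv y).
      by rewrite /exc mulr_sumr; apply: eq_bigr => j _; rewrite mulrCA.
    by have /andP[h1 h2] := Y2 v; rewrite !ler_wpM2l.
  + by move=> j; have [] := H1 j (ltn_ord j) => h1 h2; apply/andP; split; lra.
  + by move=> v; rewrite (excE (ratv x)); exact: H2.
  pose z' j := if insub j is Some j' then z j' else 0.
  have z'E (j : 'I_m) : z' j = z j by rewrite /z' valK.
  exists z'; split.
  + move=> j; rewrite /z'; case: insubP => // j' _ _; have /andP[h _] := z1 j'.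
    by apply: le_trans h; rewrite ler0n.
  + rewrite all_cat; apply/andP; split.
      apply/(sat_arc_rows _ _ _ sl) => j lt; rewrite (z'E (Ordinal lt)) !addr0.
      by have /andP := z1 (Ordinal lt).
    apply/(sat_vcons _ _ (lexx 0)) => v; rewrite /vtol if_same subr0 addr0.
    have -> : exc A v z' = excess tl hd z v.
      by rewrite -excE; apply: eq_bigr => j _; rewrite z'E.
    exact: z2.
  + have K0 : 0 <= (eps * (m + size vs))%:R :> rat by rewrite ler0n.
    rewrite natrM natrX mulr_natl -[X in _ *+ X]card_ord -sumr_const; apply: ler_sum => j _.
    rewrite z'E -[X in X ^+ 2]opprB sqrrN -real_normK ?num_real // ler_pXn2r ?nnegrE ?normr_ge0 //.
    apply: le_trans (z3 j) _; rewrite card_ord natrM natrD mulrDr lerD //.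
      by rewrite mulr_natr.
    by rewrite mulr_natr sum_vtol.
- move=> s s0; rewrite -/(pR P); have : (2 * (M * s) * (m + size vs) = s * (2 * M * (m + size vs)))%N by lia.
  move=> ->; rewrite expnMn mulnCA mulnC -[(s ^ 2)%N]/(s * s)%N ltn_pmul2r ?muln_gt0 ?s0 //.
- by rewrite size_map.
(* At the zero vector only the constant terms count: lower bounds, which are at most the capacities,
   and the vertex bounds. *)
- apply/allP => r; rewrite /violated -leqNgt mem_cat.
  have pz cs : pos_val cs [seq 0%N | _ <- A] = 0%N.
    by rewrite /pos_val; elim: A cs => [|a A' IH] [|c cs] //=; rewrite IH; case: ifP.
  rewrite pz add0n; case/orP => /flatten_mapP.
    move=> [p pin]; rewrite !inE => /orP[] /eqP -> //=.
    have : all (fun p => p.2.2 <= p.2.1.2)%N (zip (indices A) (zip A lo)).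
      by apply/(all_zip_indices arc0 0%N) => // j lt /=; have /andP[h1 h2] := Y1 (Ordinal lt); apply: leq_trans h1 h2.
    have : all (fun p : nat * (arc * nat) => N * p.2.1.2 <= 2 * (M * 2 ^ size l))%N (zip (indices A) (zip A lo)).
      by apply/(all_zip_indices arc0 0%N) => // j lt /=; exact: capl.
    move=> /allP/(_ p pin) c1 /allP/(_ p pin) c2.
    have : (N * p.2.2 <= N * p.2.1.2)%N by rewrite leq_mul2l c2 orbT.
    by move=> le; apply: leq_trans (leq_trans le c1) _; rewrite leq_addl.
  move=> [w win]; have [c1 c2] := vcl win.
  by rewrite !inE => /orP[] /eqP -> /=; [apply: leq_trans c1 _|apply: leq_trans c2 _]; rewrite -addnA leq_addl.
Qed.

Let feas lo := exists y, int_flow lo y.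

Lemma flow_okP lo : size lo = m -> flow_ok P A vcs lo <-> feas lo.
Proof.
move=> sl; split; first exact: flow_ok_sound.
by case=> y; exact: flow_ok_complete.
Qed.

Definition above (lo y : seq nat) := forall j, (nth 0 lo j <= nth 0 y j)%N.
Let sol := int_flow [seq 0%N | _ <- A].

Lemma size_zeros : size [seq 0%N | _ <- A] = m. Proof. exact: size_map. Qed.
Lemma nth_zeros j : nth 0%N [seq 0%N | _ <- A] j = 0%N.
Proof. by case: (ltnP j m) => lt; [rewrite (nth_map arc0)|rewrite nth_default // size_zeros]. Qed.

Lemma int_flow_sol lo y : size lo = m -> int_flow lo y <-> sol y /\ above lo y.
Proof.
move=> sl; split=> [fl|[fl ab]]; have [sy _] := fl; move: fl.
  rewrite (int_flowP sl sy) /sol (int_flowP size_zeros sy) => -[H1 H2]; split.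
    by split=> // j; rewrite nth_zeros /=; have /andP[] := H1 j.
  move=> j; case: (ltnP j m) => lt; last by rewrite !nth_default ?sl ?sy.
  by have /andP[] := H1 (Ordinal lt).
rewrite (int_flowP sl sy) /sol (int_flowP size_zeros sy) => -[H1 H2]; split=> // j.
by rewrite ab; have /andP[] := H1 j.
Qed.

Lemma size_raise j s lo : size (raise_at j s lo) = size lo.
Proof. by rewrite size_map size_zip size_iota minnn. Qed.

Lemma nth_raise j s lo i : (i < size lo)%N ->
  nth 0%N (raise_at j s lo) i = if i == j then (nth 0 lo i + s)%N else nth 0%N lo i.
Proof.
move=> lt; rewrite /raise_at (nth_map (0%N, 0%N)) ?size_zip ?size_iota ?minnn //.
by rewrite nth_zip ?size_iota //= nth_iota.
Qed.

(** Invariant of the binary search: with k digits left, every solution above the initial bounds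
    stays below the current value at j plus 2^k. *)
Lemma raise_digits j k lo0 lo : (j < m)%N -> size lo = m -> size lo0 = m -> feas lo ->
  above lo0 lo -> (forall i, i != j -> nth 0%N lo i = nth 0%N lo0 i) ->
  (forall y, sol y -> above lo0 y -> nth 0 y j < nth 0 lo j + 2 ^ k)%N ->
  let r := foldl (raise_step P A vcs j) lo [seq (2 ^ i, M * 2 ^ i)%N | i <- rev (iota 0 k)] in
  [/\ size r = m, feas r, above lo0 r, (forall i, i != j -> nth 0%N r i = nth 0%N lo0 i) &
    forall y, sol y -> above lo0 y -> (nth 0 y j <= nth 0 r j)%N].
Proof.
move=> jm; elim: k lo => [|k IH] lo sl s0 fl ab oth bd.
  by split=> // y sy ay; have := bd y sy ay; rewrite addn1 ltnS.
have e q : iota 0 q.+1 = rcons (iota 0 q) q by rewrite -addn1 iotaD cats1.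
rewrite e rev_rcons /= /raise_step /=; apply: IH => //.
- by case: ifP => // _; rewrite size_raise.
- by case: ifP => // /flow_okP; apply; rewrite size_raise.
- move=> i; case: ifP => // _; case: (ltnP i m) => lt; last first.
    by rewrite !nth_default ?size_raise ?sl ?s0.
  rewrite nth_raise ?sl //; apply: leq_trans (ab i) _; case: ifP => // _; exact: leq_addr.
- move=> i ne; case: ifP => _; last exact: oth.
  case: (ltnP i m) => lt; last by rewrite !nth_default ?size_raise ?sl ?s0.
  by rewrite nth_raise ?sl // (negbTE ne) oth.
move=> y sy ay; have := bd y sy ay; rewrite expnS mul2n -addnn addnA.
case: ifP => [_|/negP nok lt]; first by rewrite nth_raise ?sl // eqxx.
rewrite ltnNge; apply/negP => ge; apply: nok; apply/flow_okP; first by rewrite size_raise.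
exists y; apply/int_flow_sol; first by rewrite size_raise.
split=> // i; case: (ltnP i m) => lti; last by rewrite nth_default ?size_raise ?sl.
rewrite nth_raise ?sl //; case: eqP => [->|/eqP ne] //.
by rewrite oth // ay.
Qed.

Hypothesis capl2 : forall j, (acap A j < 2 ^ (size l).+1)%N.

(** The final bounds are still met by some flow, and this flow cannot exceed them on any arc since
    each bound was made maximal in its turn. So the bounds are that flow. *)
Theorem intflow_correct : feas [seq 0%N | _ <- A] ->
  sol (intflow P A vcs).
Proof.
move=> f0.
have main k : (k <= m)%N -> let r := foldl (fun lo j => foldl (raise_step P A vcs j) lo (psc P)) [seq 0%N | _ <- A] (iota 0 k) in
  [/\ size r = m, feas r & forall i y, (i < k)%N -> sol y -> above r y -> (nth 0 y i <= nth 0 r i)%N].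
  elim: k => [|k IH] km; first by split=> //; exact: size_zeros.
  have e q : iota 0 q.+1 = rcons (iota 0 q) q by rewrite -addn1 iotaD cats1.
  rewrite e foldl_rcons; set r := foldl _ _ (iota 0 k).
  have [sr fr Hr] := IH (ltnW km).
  have [|||r1 r2 r3 r4 r5] := @raise_digits k (size l).+1 r r km sr sr fr.
  - by [].
  - by [].
  - move=> y [sy fl] ay; move: (conj sy fl : sol y); rewrite /sol (int_flowP size_zeros sy) => -[H1 _].
    have /andP[_ h] := H1 (Ordinal km); apply: leq_ltn_trans h _.
    by apply: leq_trans (capl2 _) _; exact: leq_addl.
  rewrite Hsc scalesE; split=> // i y; rewrite ltnS leq_eqVlt => /orP[/eqP->|lt] sy ay.
    by apply: r5 => // i'; apply: leq_trans (r3 i') (ay i').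
  rewrite r4; last by rewrite ltn_eqF.
  by apply: Hr => // i'; apply: leq_trans (r3 i') (ay i').
have [sr [y fy] Hr] := main m (leqnn _); rewrite /intflow /indices -/m.
set r := foldl _ _ _ in sr fy Hr *.
have [sy ay] := (int_flow_sol y sr).1 fy.
suff -> : r = y by [].
have [szy _] := fy; apply: (@eq_from_nth _ 0%N) => [|i]; first by rewrite sr szy.
rewrite sr => lt; apply/eqP; rewrite eqn_leq ay /=; exact: Hr.
Qed.
End IntFlow.

Local Close Scope ring_scope.

(** * Extreme points of polyhedra *)

Local Open Scope ring_scope.

Lemma dotD n cs (x y : nat -> rat) : dot n cs (fun j => x j + y j) = dot n cs x + dot n cs y.
Proof. by rewrite /dot -big_split; apply: eq_bigr => j _; rewrite mulrDr. Qed.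

Lemma dotZ n cs (a : rat) x : dot n cs (fun j => a * x j) = a * dot n cs x.
Proof. by rewrite /dot mulr_sumr; apply: eq_bigr => j _; rewrite mulrCA. Qed.

Definition tight n (x : nat -> rat) (r : row) := dot n r.1 x + (r.2.1)%:R == (r.2.2)%:R.

Lemma seq_argmin (T : eqType) (f : T -> rat) s : s != [::] ->
  exists2 x, x \in s & forall y, y \in s -> f x <= f y.
Proof.
elim: s => // x s IH _; case: (altP (s =P [::])) => [->|/IH[y ys ym]].
  by exists x => [|y]; rewrite inE // => /eqP ->.
case: (leP (f x) (f y)) => [le|/ltW le].
  exists x => [|z]; rewrite inE ?eqxx // => /orP[/eqP-> //|/ym]; exact: le_trans.
by exists y => [|z]; rewrite inE ?ys ?orbT // => /orP[/eqP->//|/ym].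
Qed.

(* Moving from a point of a polyhedron along a direction that keeps the tight
   constraints tight, until one more constraint becomes tight. *)
Lemma extreme_point n (rows : seq row) (Q : (nat -> rat) -> Prop) x0 : all (sat n 0 x0) rows ->
  (forall x, all (sat n 0 x) rows -> Q x \/ exists D,
     (forall r, r \in rows -> tight n x r -> dot n r.1 D = 0) /\
     exists2 r, r \in rows & dot n r.1 D != 0) ->
  exists x, all (sat n 0 x) rows /\ Q x.
Proof.
have [k] := ubnP (count (fun r => ~~ tight n x0 r) rows); elim: k x0 => // k IH x ltk fx move_dir.
have [Qx|[D0 [D0t [r0 r0in r0D]]]] := move_dir x fx; first by exists x.
pose slack r := (r.2.2)%:R - (r.2.1)%:R - dot n r.1 x : rat.
have slack_ge0 r : r \in rows -> 0 <= slack r.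
  by move=> /(allP fx); rewrite /sat addr0 /slack; lra.
have tightE r : tight n x r = (slack r == 0) by rewrite /tight /slack; apply/eqP/eqP; lra.
have [D [Dt Dpos]] : exists D, (forall r, r \in rows -> tight n x r -> dot n r.1 D = 0) /\ 0 < dot n r0.1 D.
  case: (ltrgt0P (dot n r0.1 D0)) => [gt|lt|e0]; last by rewrite e0 eqxx in r0D.
    by exists D0.
  exists (fun j => -1 * D0 j); split=> [r rin rt|]; first by rewrite dotZ D0t // mulr0.
  by rewrite dotZ mulN1r oppr_gt0.
pose pos := [seq r <- rows | 0 < dot n r.1 D].
have r0pos : r0 \in pos by rewrite mem_filter Dpos.
(* Ratio test: the smallest quotient is the largest step that keeps all rows satisfied, and it makes
   [r1] tight. *)
have [|r1 r1pos r1min] := @seq_argmin _ (fun r => slack r / dot n r.1 D) pos.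
  by apply: contraTneq r0pos => ->.
move: r1pos; rewrite mem_filter => /andP[r1D r1in].
pose t := slack r1 / dot n r1.1 D.
have t0 : 0 <= t by rewrite divr_ge0 ?slack_ge0 // ltW.
pose x' j := x j + t * D j.
have dx' r : dot n r.1 x' = dot n r.1 x + t * dot n r.1 D by rewrite dotD dotZ.
have fx' : all (sat n 0 x') rows.
  apply/allP => r rin; rewrite /sat addr0 dx'.
  have : t * dot n r.1 D <= slack r.
    case: (ltrP 0 (dot n r.1 D)) => [gt|le].
      by rewrite -ler_pdivlMr //; apply: r1min; rewrite mem_filter gt.
    by apply: le_trans (slack_ge0 _ rin); rewrite mulr_ge0_le0.
  by rewrite /slack; lra.
apply: (IH x') => //; rewrite ltnS in ltk; apply: leq_trans ltk.
have sub : {in rows, forall r, tight n x r -> tight n x' r}.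
  move=> r rin rt; have := Dt r rin rt; move: rt; rewrite /tight dx' => /eqP rt ->.
  by rewrite mulr0 addr0 rt.
have t1 : tight n x' r1.
  have nz : dot n r1.1 D != 0 by rewrite gt_eqF.
  rewrite /tight dx' divfK // /slack; apply/eqP; lra.
have nt1 : ~~ tight n x r1 by apply: contraL r1D => /(Dt _ r1in) ->; rewrite ltxx.
rewrite -!size_filter; apply: (@leq_ltn_trans (size [seq r <- [seq r <- rows | ~~ tight n x r] | ~~ tight n x' r])).
  rewrite -filter_predI; apply/eq_leq/congr1/eq_in_filter => r rin /=.
  by case: (boolP (tight n x r)) => [/(sub _ rin) ->//|_]; rewrite andbT.
rewrite size_filter -[X in (_ < X)%N](count_predC (fun r => ~~ tight n x' r)).
rewrite -[X in (X < _)%N]addn0 ltn_add2l -has_count; apply/hasP; exists r1 => /=.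
  by rewrite mem_filter nt1.
by rewrite t1.
Qed.

Lemma left_kernel (u w : nat) (A : 'M[rat]_(u, w)) : (w < u)%N -> exists t : 'rV_u, t != 0 /\ t *m A = 0.
Proof.
move=> lt; have kn : kermx A != 0.
  rewrite -mxrank_eq0 mxrank_ker subn_eq0 -ltnNge.
  by apply: leq_ltn_trans (rank_leq_col A) lt.
exists (nz_row (kermx A)); rewrite nz_row_eq0; split=> //.
by apply/sub_kermxP; exact: nz_row_sub.
Qed.

Section Split3.
Variables (m : nat) (x : nat -> rat).
(** A vector of the linear program consists of three blocks of length m: p_g, p_h and lambda. *)
Definition part2 (x : nat -> rat) j := x (m + j)%N.
Definition part3 (x : nat -> rat) j := x (m + (m + j))%N.

Lemma dot3 c1 c2 c3 : size c1 = m -> size c2 = m ->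
  dot (m + (m + m)) (c1 ++ c2 ++ c3) x = dot m c1 x + (dot m c2 (part2 x) + dot m c3 (part3 x)).
Proof.
move=> s1 s2; rewrite /dot big_split_ord /=; congr (_ + _).
  by apply: eq_bigr => j _; rewrite /coef nth_cat s1 ltn_ord.
rewrite big_split_ord /=; congr (_ + _); apply: eq_bigr => j _.
  by rewrite /coef nth_cat s1 ltnNge leq_addr /= addKn nth_cat s2 ltn_ord.
by rewrite /coef nth_cat s1 ltnNge leq_addr /= addKn nth_cat s2 ltnNge leq_addr /= addKn.
Qed.
End Split3.

Lemma dot_nones (E : seq arc) x : dot (size E) (nones E) x = 0.
Proof.
rewrite /dot big1 // => j _; rewrite /coef (nth_map arc0) //= subrr mul0r //.
Qed.

Local Close Scope ring_scope.

(** * The linear program *)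

Local Open Scope ring_scope.

Section LPRows.
Variables (E : seq arc) (cv vs : seq nat) (q : terms) (N kp : nat).
Let m := size E.

Lemma all_lp_rows (Pr : pred row) dl fx : size fx = m ->
  all Pr (lp_rows N dl kp E cv vs q fx) <->
  (forall j, (j < m)%N -> all Pr (edge_rows N dl kp E (j, (nth arc0 E j, nth false fx j)))) /\
  (forall v, v \in vs -> all Pr (cons_rows N dl E q v) /\ all Pr (odd_rows N dl E cv v)).
Proof.
move=> sf; rewrite /lp_rows all_cat !all_flatten !all_map.
split=> [/andP[/(all_zip_indices arc0 false)-/(_ (esym sf)) H1 /allP H2]|[H1 H2]].
  split=> [j lt|v vin]; first exact: H1.
  have H : all Pr (cons_rows N dl E q v ++ odd_rows N dl E cv v) := H2 v vin.
  by rewrite all_cat in H; exact/andP.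
apply/andP; split; first by apply/(all_zip_indices arc0 false).
apply/allP => v /H2 /andP H.
by change (is_true (all Pr (cons_rows N dl E q v ++ odd_rows N dl E cv v))); rewrite all_cat.
Qed.

Definition lamsum (lm : nat -> rat) v : rat := \sum_(j < m) (incident (nth arc0 E j) v)%:R * lm j.
(** The excess required of p / N = g / N + c: that of the flow plus that of the capacities. *)
Definition wdiv (q : terms) v : rat :=
  (out_cap E v)%:R + (supply q v)%:R - (in_cap E v)%:R - (demand q v)%:R.

Lemma dot_incident v b x : dot m [seq if b then (incident a v, false) else (false, incident a v) | a <- E] x =
  if b then lamsum x v else - lamsum x v.
Proof.
rewrite /dot /lamsum; case: b; rewrite -?sumrN; apply: eq_bigr => j _;
by rewrite /coef (nth_map arc0) //= ?subr0 ?sub0r ?mulNr.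
Qed.

Lemma dot_incT v x : dot m [seq (incident a v, false) | a <- E] x = lamsum x v.
Proof. exact: (dot_incident v true). Qed.
Lemma dot_incF v x : dot m [seq (false, incident a v) | a <- E] x = - lamsum x v.
Proof. exact: (dot_incident v false). Qed.

Lemma size_onehot j b : size (onehot (indices E) j b) = m.
Proof. by rewrite size_map size_iota. Qed.
Lemma size_nones : size (nones E) = m. Proof. exact: size_map. Qed.
Lemma size_div_row v b : size (div_row E v b) = m. Proof. exact: size_map. Qed.

Definition lpsat (tau : rat) (fx : seq bool) (pg ph lm : nat -> rat) :=
  [/\ forall j, (j < m)%N -> [/\ lm j <= pg j + tau, pg j + lm j <= (N * (acap E j + acap E j))%:R + tau,
        lm j <= ph j + tau, ph j + lm j <= (N * (acap E j + acap E j))%:R + tau & lm j <= N%:R + tau],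
      forall j, (j < m)%N -> (if nth false fx j then N else 0)%:R <= lm j + kp%:R + tau,
      forall v, v \in vs -> `|exc E v pg - N%:R * wdiv q v| <= tau /\
                            `|exc E v ph - N%:R * wdiv (swap2 q) v| <= tau &
      forall v, v \in vs -> odd_inner E cv v -> `|lamsum lm v - N%:R| <= tau].

Let n3 := (m + (m + m))%N.

Lemma lp_rowsP dl fx t x : size fx = m ->
  all (sat n3 t x) (lp_rows N dl kp E cv vs q fx) <->
  lpsat (dl%:R + t) fx x (part2 m x) (part3 m x).
Proof.
move=> sf; rewrite all_lp_rows //; set tau := dl%:R + t.
have Ht : tau = dl%:R + t by [].
split=> [[H1 H2]|[H1 H2 H3 H4]].
  split=> [j lt|j lt|v vin|v vin ov].
  - have := H1 j lt; rewrite /= /sat !dot3 ?size_onehot ?size_nones // !dot_nones !dot_onehot //=.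
    rewrite -/(acap E j) !natrD => /and5P[h1 h2 h3 h4 /and3P[h5 h6 _]].
    by split; move: h1 h2 h3 h4 h5 h6; rewrite ?natrD ?mulr0n; lra.
  - have := H1 j lt; rewrite /= /sat !dot3 ?size_onehot ?size_nones // !dot_nones !dot_onehot //=.
    by rewrite -/(acap E j) !natrD => /and5P[h1 h2 h3 h4 /and3P[h5 h6 _]]; lra.
  - have [+ _] := H2 v vin; rewrite /= /sat !dot3 ?size_div_row ?size_nones // !dot_nones !dot_div_row /=.
    rewrite !natrD !natrM !natrD => /and5P[h1 h2 h3 h4 _].
    by rewrite !ler_norml /wdiv; split; apply/andP; split; lra.
  have [_] := H2 v vin; rewrite /odd_rows ov /= /sat !dot3 ?size_nones // !dot_nones dot_incT dot_incF.
  by rewrite !natrD ler_norml => /and3P[h1 h2 _]; apply/andP; split; move: h1 h2; rewrite ?mulr0n; lra.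
split=> [j lt|v vin].
  have [h1 h2 h3 h4 h5] := H1 j lt; have h6 := H2 j lt.
  rewrite /= /sat !dot3 ?size_onehot ?size_nones // !dot_nones !dot_onehot //= -/(acap E j).
  move: h2 h4 h6; rewrite ?natrD ?mulr0n andbT => h2 h4 h6.
  by apply/and5P; split; [lra|lra|lra|lra|apply/andP; split; lra].
have [h1 h2] := H3 v vin; split.
  rewrite /= /sat !dot3 ?size_div_row ?size_nones // !dot_nones !dot_div_row /=.
  move: h1 h2; rewrite !ler_norml /wdiv !natrD !natrM !natrD => /andP[h1 h2] /andP[h3 h4].
  by rewrite andbT; apply/and4P; split; lra.
rewrite /odd_rows; case: ifP => // ov; have := H4 v vin ov.
rewrite /= /sat !dot3 ?size_nones // !dot_nones dot_incT dot_incF !natrD ler_norml => /andP[h h'].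
by rewrite andbT ?mulr0n; apply/andP; split; lra.
Qed.

Lemma wf_lp_rows dl fx : size fx = m -> (forall a, a \in E -> a.1.1 != a.1.2) ->
  all (wf_row n3) (lp_rows N dl kp E cv vs q fx).
Proof.
move=> sf nl; apply/all_lp_rows => //.
have W1 j b : b.1 && b.2 = false -> all (fun c => ~~ (c.1 && c.2)) (onehot (indices E) j b).
  by move=> nb; rewrite all_map; apply/allP => i _ /=; case: b nb => [[] []] //=; case: (i == j).
have W2 v b : all (fun c => ~~ (c.1 && c.2)) (div_row E v b).
  rewrite all_map; apply/allP => a aA /=.
  by case: b => /=; apply/negP => /andP[/eqP e1 /eqP e2]; have := nl a aA; rewrite e1 e2 eqxx.
have W3 : all (fun c => ~~ (c.1 && c.2)) (nones E) by rewrite all_map; apply/allP.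
have S3 c1 c2 c3 : size c1 = m -> size c2 = m -> size c3 = m -> size (c1 ++ c2 ++ c3) = n3.
  by rewrite !size_cat => -> -> ->.
split=> [j lt|v vin].
  by rewrite /= /wf_row /= !S3 ?size_onehot ?size_nones // !all_cat !W1 ?W3 // eqxx.
split; first by rewrite /= /wf_row /= !S3 ?size_div_row ?size_nones // !all_cat !W2 ?W3 // eqxx.
rewrite /odd_rows; case: ifP => // _.
rewrite /= /wf_row /= !S3 ?size_map // !all_cat ?W3 eqxx /= andbT.
by apply/andP; split; rewrite all_map; apply/allP => a _ /=; rewrite ?andbF.
Qed.
End LPRows.

Lemma out_capE (E : seq arc) v : out_cap E v = (\sum_(j < size E) (atail E j == v) * acap E j)%N.
Proof.
rewrite /out_cap sumn_nth size_map; apply: eq_bigr => j _.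
by rewrite (nth_map arc0) // -/(atail E j) -/(acap E j); case: eqP; rewrite ?mul1n ?mul0n.
Qed.

Lemma in_capE (E : seq arc) v : in_cap E v = (\sum_(j < size E) (ahead E j == v) * acap E j)%N.
Proof.
rewrite /in_cap sumn_nth size_map; apply: eq_bigr => j _.
by rewrite (nth_map arc0) // -/(ahead E j) -/(acap E j); case: eqP; rewrite ?mul1n ?mul0n.
Qed.

Lemma exc_cap E v : exc E v (fun j => (acap E j)%:R) = (out_cap E v)%:R - (in_cap E v)%:R.
Proof.
rewrite out_capE in_capE !natr_sum -sumrB; apply: eq_bigr => j _.
by rewrite !natrM mulrBl.
Qed.

Lemma excD E v x y : exc E v (fun j => x j + y j) = exc E v x + exc E v y.
Proof. by rewrite /exc -big_split; apply: eq_bigr => j _; rewrite mulrDr. Qed.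
Lemma excZ E v (a : rat) x : exc E v (fun j => a * x j) = a * exc E v x.
Proof. by rewrite /exc mulr_sumr; apply: eq_bigr => j _; rewrite mulrCA. Qed.
Lemma exc_sum E v (I : finType) (x : I -> nat -> rat) :
  exc E v (fun j => \sum_i x i j) = \sum_i exc E v (x i).
Proof. by rewrite /exc exchange_big; apply: eq_bigr => j _; rewrite mulr_sumr. Qed.

Lemma sum_ord2 m (a b : nat) (f : nat -> rat) : (a < m)%N -> (b < m)%N -> a != b ->
  (forall j, j != a -> j != b -> f j = 0) -> \sum_(j < m) f j = f a + f b.
Proof.
move=> am bm ab f0; rewrite (bigD1 (Ordinal am)) //= (bigD1 (Ordinal bm)) //=; last first.
  by rewrite -val_eqE eq_sym.
by rewrite big1 ?addr0 // => j /andP[ja jb]; rewrite f0.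
Qed.

Section LocalDirection.
Variables (E : seq arc) (v N : nat) (tau eta : rat) (p lm : nat -> rat).
Let m := size E.
Let c j : rat := (acap E j)%:R.
Let inc j := incident (nth arc0 E j) v.
Let sgn j : rat := (atail E j == v)%:R - (ahead E j == v)%:R.
Hypotheses (loopless : forall a, a \in E -> a.1.1 != a.1.2)
  (tau0 : 0 <= tau) (eta_tau : (m.+2)%:R * tau <= 2 * eta) (eta_ge : tau <= eta)
  (Hdiv : `|exc E v p - N%:R * ((out_cap E v)%:R - (in_cap E v)%:R)| <= tau)
  (Hp : forall j, (j < m)%N -> [/\ 0 <= lm j, 0 <= p j, lm j <= p j + tau &
      p j + lm j <= N%:R * (2 * c j) + tau])
  (Hsum : lamsum E lm v <= N%:R + tau)
  (Hodd : odd (out_cap E v + in_cap E v)).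
Variables (a b : nat).
Hypotheses (am : (a < m)%N) (bm : (b < m)%N) (ab : a != b) (inca : inc a) (incb : inc b)
  (la : eta < lm a) (lb : eta < lm b) (laN : lm a < N%:R) (lbN : lm b < N%:R).

Let dl j : rat := (j == a)%:R - (j == b)%:R.
Let up j := p j + lm j == N%:R * (2 * c j) + tau.
Let dn j := lm j == p j + tau.

Lemma sgn2 j : (j < m)%N -> sgn j * sgn j = (inc j)%:R.
Proof.
move=> lt; have := loopless (mem_nth arc0 lt); rewrite -/(atail E j) -/(ahead E j) /sgn /inc /incident.
rewrite -/(atail E j) -/(ahead E j); case: (eqVneq (atail E j) v) => [->|ne].
  by rewrite eq_sym => /negbTE ->; rewrite subr0 mulr1.
by move=> _; case: eqP => _ /=; rewrite ?sub0r ?subrr ?mulrNN ?mulr1 ?mul0r ?oppr0 ?mulr0.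
Qed.

Lemma sgn_cases j : (j < m)%N -> inc j -> sgn j = 1 \/ sgn j = -1.
Proof.
move=> lt ij; have e : sgn j * sgn j = 1 by rewrite sgn2 // ij.
move: (sgn j) e => s e.
have es : (s - 1) * (s + 1) = s * s - 1 by ring.
have : (s - 1) * (s + 1) == 0 by rewrite es e subrr.
by rewrite mulf_eq0 subr_eq0 addr_eq0 => /orP[] /eqP; auto.
Qed.

Lemma sgn0 j : (j < m)%N -> ~~ inc j -> sgn j = 0.
Proof.
by move=> lt /negbTE ij; have := sgn2 lt; rewrite ij => /eqP; rewrite mulf_eq0 orbb => /eqP.
Qed.

(** The change of p that the tight bounds at [a] and [b] force when lambda grows by 1 at [a] and
    drops by 1 at [b]. *)
Definition base_dir j : rat :=
  if j == a then (if up a then -1 else if dn a then 1 else 0)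
  else if j == b then (if up b then 1 else if dn b then -1 else 0) else 0.

(** With both bounds tight lambda would equal N c + tau, which is too small for c = 0 and too large
    for c > 0. *)
Lemma not_both j : (j < m)%N -> eta < lm j -> lm j < N%:R -> up j -> dn j -> False.
Proof.
move=> lt l1 l2 /eqP h1 /eqP h2; move: l2; rewrite ltNge => /negP; apply.
have e : lm j = N%:R * c j + tau by lra.
case c0 : (acap E j) => [|k].
  by move: l1; rewrite e /c c0 mulr0n mulr0 add0r ltNge eta_ge.
rewrite e; apply: (@le_trans _ _ (N%:R * c j)); last by rewrite lerDl.
by rewrite ler_peMr ?ler0n // /c c0 ler1n.
Qed.

Lemma base_dirP j : (j < m)%N ->
  (up j -> base_dir j = - dl j) /\ (dn j -> base_dir j = dl j) /\ (p j = 0 -> base_dir j = 0).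
Proof.
move=> jm; rewrite /base_dir /dl.
have pos i : (i < m)%N -> eta < lm i -> p i = 0 -> False.
  move=> im li pi; have [_ _ h _] := Hp im; rewrite pi add0r in h.
  by move: (lt_le_trans li h); rewrite ltNge eta_ge.
case: (eqVneq j a) => [->|na].
  rewrite (negbTE ab) subr0; split=> [->//|]; split=> [da|pa]; last by case: (pos a).
  by case: ifP => ua; [case: (not_both am la laN ua da)|rewrite da].
case: (eqVneq j b) => [->|nb]; last by rewrite subrr oppr0.
rewrite sub0r opprK; split=> [->//|]; split=> [db|pb]; last by case: (pos b).
by case: ifP => ub; [case: (not_both bm lb lbN ub db)|rewrite db].
Qed.

Lemma exc_base : exc E v base_dir = sgn a * base_dir a + sgn b * base_dir b.
Proof.
apply: (@sum_ord2 m a b (fun j => sgn j * base_dir j)) => // j /negbTE ja /negbTE jb.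
by rewrite /base_dir ja jb mulr0.
Qed.

Section NoFree.
Hypothesis no_free : forall j, (j < m)%N -> inc j -> [|| up j, dn j | p j == 0].
Let sig j : rat := if up j then 1 else -1.
Let rho j := sgn j * sig j.
(** The amount by which the bound selected by [sig] is exceeded: p + lambda - 2 N c at the upper
    end, lambda - p at the lower end. *)
Let th j := sig j * (p j - N%:R * c j) - N%:R * c j + lm j.

Lemma th_bound j : (j < m)%N -> inc j -> 0 <= th j <= tau.
Proof.
move=> jm ij; have [h1 h2 h3 h4] := Hp jm; have := no_free jm ij; rewrite /th /sig.
have t0 := tau0.
case: ifP => [/eqP u _|_ /=]; first by apply/andP; split; lra.
by case/orP => /eqP e; apply/andP; split; lra.
Qed.

(** As every edge at v sits at an end of its range, the excess of p - N c at v is N times a signed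
    sum of capacities minus the same signed sum of lambda, up to a multiple of tau. The first sum is
    odd, hence at least 1 in absolute value, and lambda has total about N. Opposite signs at [a] and
    [b] would make the second sum smaller by 2 eta, too small to balance N by [eta_tau]. *)
Lemma rho_eq : rho a = rho b.
Proof.
have Hs1 := Hsum; have Ht1 := tau0; have He1 := eta_tau.
have sig2 j : sig j = 1 \/ sig j = -1 by rewrite /sig; case: ifP; auto.
have rho_cases j : (j < m)%N -> inc j -> rho j = 1 \/ rho j = -1.
  move=> jm ij; rewrite /rho; case: (sgn_cases jm ij) => ->; case: (sig2 j) => ->;
  rewrite ?mulr1 ?mulN1r ?opprK; auto.
have rho0 j : (j < m)%N -> ~~ inc j -> rho j = 0 by move=> jm nj; rewrite /rho sgn0 ?mul0r.
have total : exc E v p - N%:R * ((out_cap E v)%:R - (in_cap E v)%:R) =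
   N%:R * (\sum_(j < m) rho j * c j) - \sum_(j < m) rho j * lm j + \sum_(j < m) rho j * th j.
  rewrite -exc_cap /exc !mulr_sumr -!sumrB -big_split; apply: eq_bigr => j _ /=.
  rewrite -/(sgn j) -/(c j) /th /rho.
  have s2 : sig j * sig j = 1 by case: (sig2 j) => ->; rewrite ?mulr1 ?mulrNN ?mulr1.
  have -> : sgn j * p j = sgn j * (sig j * sig j) * p j by rewrite s2 mulr1.
  have -> : N%:R * (sgn j * c j) = sgn j * (sig j * sig j) * (N%:R * c j) by rewrite s2 mulr1 mulrCA.
  by ring.
have e01 : (0 == 1 :> rat) = false by [].
have e0m : (0 == -1 :> rat) = false by [].
have e1m : (1 == -1 :> rat) = false by [].
have em1 : (-1 == 1 :> rat) = false by [].
have odd_sum : 1 <= `|\sum_(j < m) rho j * c j|.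
  pose P := (\sum_(j < m) if rho j == 1%R then acap E j else 0)%N.
  pose Q := (\sum_(j < m) if rho j == (-1)%R then acap E j else 0)%N.
  have -> : \sum_(j < m) rho j * c j = P%:R - Q%:R.
    rewrite /P /Q !natr_sum -sumrB; apply: eq_bigr => j _; rewrite /c.
    case: (boolP (inc j)) => ij; last by rewrite rho0 // mul0r e01 e0m subrr.
    case: (rho_cases j (ltn_ord j) ij) => ->; rewrite eqxx ?e1m ?em1 ?subr0 ?sub0r.
      by rewrite mul1r.
    by rewrite mulN1r.
  have PQ : (P + Q = out_cap E v + in_cap E v)%N.
    rewrite out_capE in_capE -!big_split; apply: eq_bigr => j _ /=.
    rewrite -mulnDl; case: (boolP (inc j)) => ij; last first.
      rewrite rho0 // e01 e0m.
      by move: ij; rewrite /inc /incident negb_or => /andP[/negbTE h1 /negbTE h2]; rewrite /atail /ahead h1 h2.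
    have -> : ((atail E j == v) + (ahead E j == v) = 1)%N.
      have := loopless (mem_nth arc0 (ltn_ord j)); move: ij; rewrite /inc /incident /atail /ahead.
      case: eqP => [->|_] /=; last by move=> ->.
      by rewrite eq_sym => _ /negbTE ->.
    by rewrite mul1n; case: (rho_cases j (ltn_ord j) ij) => ->; rewrite eqxx ?e1m ?em1 ?addn0.
  have : P != Q by apply: contraTneq Hodd => e; rewrite -PQ e addnn odd_double.
  rewrite neq_ltn => /orP[] lt.
    rewrite distrC ger0_norm ?subr_ge0 ?ler_nat ?(ltnW lt) //.
    by rewrite lerBrDr -[1]/(1%:R) -natrD ler_nat add1n.
  rewrite ger0_norm ?subr_ge0 ?ler_nat ?(ltnW lt) //.
  by rewrite lerBrDr -[1]/(1%:R) -natrD ler_nat add1n.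
have th_sum : `|\sum_(j < m) rho j * th j| <= m%:R * tau.
  apply: le_trans (ler_norm_sum _ _ _) _.
  rewrite mulr_natl -[X in _ *+ X]card_ord -sumr_const; apply: ler_sum => j _.
  case: (boolP (inc j)) => ij; last by rewrite rho0 // mul0r normr0.
  have /andP[t0 t1] := th_bound (ltn_ord j) ij.
  rewrite normrM (ger0_norm t0); case: (rho_cases j (ltn_ord j) ij) => ->; rewrite ?normrN normr1 mul1r //.
case: (eqVneq (rho a) (rho b)) => // ne; exfalso.
have lam_sum : `|\sum_(j < m) rho j * lm j| < N%:R + tau - 2 * eta.
  have lamE : lamsum E lm v = \sum_(j < m) (inc j)%:R * lm j by [].
  have bound s : s = 1 \/ s = -1 -> s * \sum_(j < m) rho j * lm j < N%:R + tau - 2 * eta.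
    move=> hs.
    have [i [im ii li ri]] : exists i, [/\ (i < m)%N, inc i, eta < lm i & s * rho i = -1].
      have := rho_cases a am inca; have := rho_cases b bm incb.
      case: hs => -> [] rb [] ra; rewrite ra rb ?eqxx // in ne *.
      - by exists a; rewrite ra mul1r.
      - by exists b; rewrite rb mul1r.
      - by exists b; rewrite rb mulN1r.
      - by exists a; rewrite ra mulN1r.
    apply: (@le_lt_trans _ _ (lamsum E lm v - 2 * lm i)); last first.
      by move: Hs1 li; lra.
    rewrite lamE mulr_sumr (bigD1 (Ordinal im)) //= [in leRHS](bigD1 (Ordinal im)) //=.
    rewrite mulrA ri ii; have -> : 1%:R * lm i = lm i by rewrite mul1r.
    rewrite (_ : lm i + _ - _ = -1 * lm i + \sum_(i0 < m | i0 != Ordinal im) (inc i0)%:R * lm i0); last by ring.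
    rewrite lerD2l; apply: ler_sum => j _; have [l0 _ _ _] := Hp (ltn_ord j).
    case: (boolP (inc j)) => ij; last by rewrite rho0 // !mul0r mulr0.
    by case: hs => ->; case: (rho_cases j (ltn_ord j) ij) => ->; rewrite ?mul1r ?mulN1r ?opprK; lra.
  rewrite ltr_norml; have := bound 1 (or_introl erefl); have := bound (-1) (or_intror erefl).
  by rewrite mul1r mulN1r => *; apply/andP; split; lra.
have : N%:R <= N%:R * `|\sum_(j < m) rho j * c j| by rewrite ler_peMr ?ler0n.
rewrite -[X in X * `|_|]ger0_norm ?ler0n // -normrM.
have := Hdiv; rewrite total.
set x := N%:R * _; set y := \sum_(j < m) rho j * lm j in lam_sum *.
set z := \sum_(j < m) rho j * th j in th_sum * => h1 h2.
have h3 : `|x| <= `|x - y + z| + `|y| + `|z|.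
  have -> : x = (x - y + z) + y - z by ring.
  apply: le_trans (ler_normB _ _) _; rewrite lerD2r.
  by apply: le_trans (ler_normD _ _) _; rewrite (_ : x - y + z + y - z - y + z = x - y + z) //; ring.
have : (m.+2)%:R * tau = m%:R * tau + 2 * tau by rewrite -addn2 natrD mulrDl.
by lra.
Qed.
End NoFree.

(** An edge at v with neither bound tight and p nonzero can absorb the imbalance caused by
    [base_dir]. If there is none, [rho_eq] makes the contributions of [a] and [b] cancel. *)
Lemma local_direction : exists dp : nat -> rat,
  [/\ forall j, (j < m)%N -> ~~ inc j -> dp j = 0, exc E v dp = 0 &
   forall j, (j < m)%N -> (up j -> dp j = - dl j) /\ (dn j -> dp j = dl j) /\ (p j = 0 -> dp j = 0)].
Proof.
have base0 j : ~~ inc j -> base_dir j = 0.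
  move=> nj; rewrite /base_dir; case: eqP => [ja|_]; first by rewrite ja inca in nj.
  by case: eqP => [jb|//]; rewrite jb incb in nj.
case: (boolP [exists j : 'I_m, inc j && ~~ [|| up j, dn j | p j == 0]]) => [/existsP[i /andP[ii fi]]|/existsPn nf].
  move: fi; rewrite !negb_or => /and3P[nu nd np].
  pose s := exc E v base_dir.
  exists (fun j => base_dir j + (- s * sgn i) * (j == i :> nat)%:R); split.
  - move=> j jm nj; rewrite base0 // add0r; case: eqP => [ji|_]; last by rewrite mulr0.
    by rewrite ji ii in nj.
  - rewrite excD excZ -/s.
    have -> : exc E v (fun j => (j == i :> nat)%:R) = sgn i.
      rewrite /exc (bigD1 i) //= eqxx mulr1 big1 ?addr0 // => j /negbTE ne.
      by rewrite (inj_eq val_inj) ne mulr0.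
    by rewrite -mulrA sgn2 ?ltn_ord // ii mulr1 subrr.
  - move=> j jm; have [b1 [b2 b3]] := base_dirP jm.
    case: (eqVneq j i) => [ji|nji]; last by rewrite mulr0 addr0.
    rewrite ji (negbTE nu) (negbTE nd); split=> //; split=> // pe.
    by rewrite pe eqxx in np.
have no_free j : (j < m)%N -> inc j -> [|| up j, dn j | p j == 0].
  by move=> jm ij; have := nf (Ordinal jm); rewrite /= ij /= negbK.
exists base_dir; split=> [j _|//|j]; [exact: base0| |exact: base_dirP].
have := rho_eq no_free; rewrite exc_base /base_dir eqxx eq_sym (negbTE ab) eqxx.
have nz i : (i < m)%N -> eta < lm i -> (p i == 0) = false.
  move=> im li; apply/eqP => pi; have [_ _ h _] := Hp im; rewrite pi add0r in h.
  by move: (lt_le_trans li h); rewrite ltNge eta_ge.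
have sigE i : (i < m)%N -> inc i -> eta < lm i -> up i || dn i.
  by move=> im ii li; have := no_free i im ii; rewrite nz // orbF.
have ea : (if up a then -1 else if dn a then 1 else 0) = - (if up a then 1 else -1) :> rat.
  by have := sigE a am inca la; case: (up a) => //= ->; rewrite opprK.
have eb : (if up b then 1 else if dn b then -1 else 0) = (if up b then 1 else -1) :> rat.
  by have := sigE b bm incb lb; case: (up b) => //= ->.
by rewrite ea eb mulrN => ->; rewrite addNr.
Qed.
End LocalDirection.

Local Close Scope ring_scope.

(** * Fixing odd edges *)

Local Open Scope ring_scope.

Definition glue m (f g h : nat -> rat) (k : nat) : rat :=
  if (k < m)%N then f k else if (k < m + m)%N then g (k - m)%N else h (k - (m + m))%N.

Lemma glueE m f g h j : (j < m)%N ->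
  [/\ glue m f g h j = f j, part2 m (glue m f g h) j = g j & part3 m (glue m f g h) j = h j].
Proof.
move=> lt; rewrite /part2 /part3 /glue lt; split=> //.
  by rewrite ltnNge leq_addr /= ltn_add2l lt addKn.
rewrite ltnNge leq_addr /= ltn_add2l ltnNge leq_addr /=; congr h; lia.
Qed.

Lemma mem_natE v s : mem_nat v s = (v \in s).
Proof. by rewrite -has_pred1. Qed.

Section LPFeasible.
Variables (E : seq arc) (cv vs : seq nat) (q : terms) (N kp : nat).
Let m := size E.
Let n3 := (m + (m + m))%N.

Lemma exc_ext v x y : (forall j, (j < m)%N -> x j = y j) -> exc E v x = exc E v y.
Proof. by move=> e; apply: eq_bigr => j _; rewrite e. Qed.
Lemma lamsum_ext v x y : (forall j, (j < m)%N -> x j = y j) -> lamsum E x v = lamsum E y v.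
Proof. by move=> e; apply: eq_bigr => j _; rewrite e. Qed.

Lemma lpsat_ext t fx pg ph lm pg' ph' lm' :
  (forall j, (j < m)%N -> [/\ pg j = pg' j, ph j = ph' j & lm j = lm' j]) ->
  lpsat E cv vs q N kp t fx pg ph lm -> lpsat E cv vs q N kp t fx pg' ph' lm'.
Proof.
move=> e [H1 H2 H3 H4]; split=> [j lt|j lt|v vin|v vin ov].
- by have [<- <- <-] := e j lt; exact: H1.
- by have [_ _ <-] := e j lt; exact: H2.
- rewrite -!(@exc_ext _ pg pg') -?(@exc_ext _ ph ph') //; try exact: H3.
  + by move=> j lt; have [] := e j lt.
  + by move=> j lt; have [] := e j lt.
- rewrite -(@lamsum_ext _ lm lm'); first exact: H4.
  by move=> j lt; have [] := e j lt.
Qed.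

Definition lpfeas t fx := exists x, (forall k, 0 <= x k) /\
  lpsat E cv vs q N kp t fx x (part2 m x) (part3 m x).

Lemma lpsat_glue t fx pg ph lm :
  (forall j, (j < m)%N -> [/\ 0 <= pg j, 0 <= ph j & 0 <= lm j]) ->
  lpsat E cv vs q N kp t fx pg ph lm ->
  exists x, [/\ forall k, 0 <= x k, lpsat E cv vs q N kp t fx x (part2 m x) (part3 m x) &
    forall j, (j < m)%N -> [/\ x j = pg j, part2 m x j = ph j & part3 m x j = lm j]].
Proof.
move=> pos H; pose x k := if (k < n3)%N then glue m pg ph lm k else 0.
have xE j : (j < m)%N -> [/\ x j = pg j, part2 m x j = ph j & part3 m x j = lm j].
  move=> lt; have [e1 e2 e3] := glueE pg ph lm lt.
  move: e2 e3; rewrite /x /part2 /part3 => <- <-; rewrite -e1 /n3.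
  have -> : (j < m + (m + m))%N by lia.
  have -> : (m + j < m + (m + m))%N by lia.
  by have -> : (m + (m + j) < m + (m + m))%N by lia.
exists x; split=> //.
  move=> k; rewrite /x; case: ifP => // lt; rewrite /glue.
  case: ifP => l1; first by have [] := pos k l1.
  case: ifP => l2; first by have [] := pos (k - m)%N ltac:(lia).
  by have [] := pos (k - (m + m))%N ltac:(rewrite /n3 in lt; lia).
by apply: lpsat_ext H => j lt; have [-> -> ->] := xE j lt.
Qed.

End LPFeasible.

(** * Existence of an edge that can be fixed *)

Section FixExists.
Variables (E : seq arc) (cv vs : seq nat) (q : terms) (N kp tau : nat).
Let m := size E.
Let n3 := (m + (m + m))%N.
Let eta := (m.+2 * tau)%N.
Hypotheses (loopless : forall a, a \in E -> a.1.1 != a.1.2)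
  (covered : forall a, a \in E -> (a.1.1 \in cv) || (a.1.2 \in cv))
  (cv_terms : forall v, v \notin cv -> [/\ supply q v = 0%N, demand q v = 0%N,
     supply (swap2 q) v = 0%N & demand (swap2 q) v = 0%N])
  (kp_ge : (tau + m * eta <= kp)%N) (N_ge : (kp + tau < N)%N) (kp0 : (0 < kp)%N).

Variables (fx : seq bool).
Hypothesis (sfx : size fx = m).
Let inc j v := incident (nth arc0 E j) v.

Lemma free_not_cv v : free_at E cv fx v -> v \notin cv.
Proof. by rewrite /free_at /odd_inner mem_natE => /andP[/andP[]]. Qed.

Lemma free_not_fixed v j : (j < m)%N -> free_at E cv fx v -> inc j v -> nth false fx j = false.
Proof.
move=> lt /andP[_ /hasPn nf] ij; apply/negbTE; have := nf (nth arc0 E j, nth false fx j).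
rewrite -nth_zip ?sfx // mem_nth ?size_zip ?sfx ?minnn // => /(_ isT).
by rewrite nth_zip ?sfx //= -/(inc j v) ij andbT.
Qed.

(** Every edge meets the cover, so it has at most one end outside; different inner vertices
    therefore have disjoint sets of edges. *)
Lemma not_shared v w j : (j < m)%N -> v \notin cv -> w \notin cv -> v != w -> inc j v -> ~~ inc j w.
Proof.
move=> lt nv nw vw ij; have := covered (mem_nth arc0 lt); move: ij; rewrite /inc /incident negb_or.
have ne a b : a \in cv -> b \notin cv -> a != b by move=> ac; apply: contraNneq => <-.
case/orP => /eqP e /orP[] c.
- by rewrite e (negbTE nv) in c.
- by rewrite e vw /= (ne _ _ c nw).
- by rewrite e vw andbT (ne _ _ c nw).
- by rewrite e (negbTE nv) in c.
Qed.

Section Direction.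
Variables (x : nat -> rat).
Let pg := x.
Let ph := part2 m x.
Let lm := part3 m x.
Hypotheses (xpos : forall k, (k < n3)%N -> 0 <= x k)
  (xsat : lpsat E cv vs q N kp tau%:R fx pg ph lm).

Let pos j : (j < m)%N -> [/\ 0 <= pg j, 0 <= ph j & 0 <= lm j].
Proof. by move=> lt; split; apply: xpos; rewrite /n3; lia. Qed.

(** Every bound that is tight at edge j stays tight along d. The conditions are homogeneous and
    linear in d, hence pass to linear combinations. *)
Definition dir_ok (d : nat -> rat) (j : nat) :=
  let dg := d j in let dh := part2 m d j in let dl := part3 m d j in
  let U := (N * (acap E j + acap E j))%:R + tau%:R : rat in
  [/\ [/\ lm j = pg j + tau%:R -> dg = dl, pg j + lm j = U -> dg = - dl & pg j = 0 -> dg = 0],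
      [/\ lm j = ph j + tau%:R -> dh = dl, ph j + lm j = U -> dh = - dl & ph j = 0 -> dh = 0] &
      [/\ lm j = N%:R + tau%:R -> dl = 0, lm j = 0 -> dl = 0 &
         (if nth false fx j then N else 0%N)%:R = lm j + kp%:R + tau%:R -> dl = 0]].

(** The lambda at v sum to about N, none reaches N - kp, and those up to eta contribute at most m
    eta; by [kp_ge] at least two exceed eta. [local_direction] is applied to these two once for g
    and once for h, with the same change of lambda. *)
Lemma vertex_direction v : v \in vs -> free_at E cv fx v ->
  (forall j, (j < m)%N -> inc j v -> lm j < N%:R - kp%:R) ->
  exists d : nat -> rat,
    [/\ forall j, (j < m)%N -> ~~ inc j v -> [/\ d j = 0, part2 m d j = 0 & part3 m d j = 0],
        [/\ exc E v d = 0, exc E v (part2 m d) = 0 & lamsum E (part3 m d) v = 0],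
        forall j, (j < m)%N -> dir_ok d j &
        exists j, [/\ (j < m)%N, inc j v & part3 m d j != 0]].
Proof.
move=> vin fv small; have [H1 H2 H3 H4] := xsat.
have ov : odd_inner E cv v by case/andP: fv.
have ncv := free_not_cv fv; have [sq dq sq' dq'] := cv_terms ncv.
have Hlam := H4 v vin ov; have [Hg Hh] := H3 v vin.
have oddv : odd (out_cap E v + in_cap E v) by case/andP: ov.
have lamlo : N%:R - tau%:R <= lamsum E lm v by move: Hlam; rewrite ler_norml => /andP[]; lra.
have lamhi : lamsum E lm v <= N%:R + tau%:R by move: Hlam; rewrite ler_norml => /andP[]; lra.
have mE : (m * eta)%:R = m%:R * eta%:R :> rat by rewrite natrM.
have kpE : tau%:R + (m * eta)%:R <= kp%:R :> rat by rewrite -natrD ler_nat.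
have NE : kp%:R + tau%:R < N%:R :> rat by rewrite -natrD ltr_nat.
have eta0 : 0 <= eta%:R :> rat by exact: ler0n.
have tau0 : 0 <= tau%:R :> rat by exact: ler0n.
pose big (j : 'I_m) := inc j v && (eta%:R < lm j).
have lamle (j : 'I_m) : ~~ big j -> (inc j v)%:R * lm j <= eta%:R.
  rewrite /big negb_and; case: (inc j v) => /=; last by rewrite mul0r.
  by rewrite -leNgt mul1r.
have [a biga] : exists a, big a.
  apply/existsP; apply: contraT => /existsPn nb; exfalso.
  have : lamsum E lm v <= (m * eta)%:R.
    rewrite natrM mulr_natl -[X in _ *+ X]card_ord -sumr_const; apply: ler_sum => j _.
    exact: lamle (nb j).
  lra.
have [b /andP[bigb ba]] : exists b, big b && (b != a).
  apply/existsP; apply: contraT => /existsPn nb; exfalso.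
  have : lamsum E lm v <= lm a + (m * eta)%:R.
    rewrite /lamsum (bigD1 a) //=; have -> : incident (nth arc0 E a) v = true by case/andP: biga.
    rewrite mul1r lerD2l.
    apply: (@le_trans _ _ (\sum_(j < m | j != a) eta%:R)).
      apply: ler_sum => j ja; apply: lamle; have := nb j; by rewrite ja andbT.
    rewrite sumr_const natrM mulr_natl -[leLHS]mulr_natr -[leRHS]mulr_natr ler_wpM2l // ler_nat.
    by rewrite -[X in (_ <= X)%N](card_ord m) max_card.
  have /andP[ia0 _] := biga; have := small a (ltn_ord a) ia0; lra.
have /andP[ia la] := biga; have /andP[ib lb] := bigb.
have lN j : (j < m)%N -> inc j v -> lm j < N%:R.
  move=> lt ij; apply: lt_le_trans (small j lt ij) _; rewrite gerBl; exact: ler0n.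
have ab : nat_of_ord a != nat_of_ord b by rewrite (inj_eq val_inj) eq_sym.
have eta_tau : (m.+2)%:R * tau%:R <= 2 * eta%:R :> rat.
  by rewrite -!natrM ler_nat /eta leq_pmull.
have eta_ge : tau%:R <= eta%:R :> rat by rewrite ler_nat /eta leq_pmull.
have div p (q0 : terms) : supply q0 v = 0%N -> demand q0 v = 0%N ->
   `|exc E v p - N%:R * wdiv E q0 v| <= tau%:R ->
   `|exc E v p - N%:R * ((out_cap E v)%:R - (in_cap E v)%:R)| <= tau%:R.
  by move=> s0 d0; rewrite /wdiv s0 d0 addr0 subr0.
have capU j : (N * (acap E j + acap E j))%:R + tau%:R = N%:R * (2 * (acap E j)%:R) + tau%:R :> rat.
  by rewrite natrM natrD; ring.
have Hpg j : (j < m)%N -> [/\ 0 <= lm j, 0 <= pg j, lm j <= pg j + tau%:R &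
      pg j + lm j <= N%:R * (2 * (acap E j)%:R) + tau%:R].
  by move=> lt; have [h1 h2 _ _ _] := H1 j lt; have [? ? ?] := pos lt; rewrite -capU.
have Hph j : (j < m)%N -> [/\ 0 <= lm j, 0 <= ph j, lm j <= ph j + tau%:R &
      ph j + lm j <= N%:R * (2 * (acap E j)%:R) + tau%:R].
  by move=> lt; have [_ _ h1 h2 _] := H1 j lt; have [? ? ?] := pos lt; rewrite -capU.
have [dg [dg1 dg2 dg3]] := local_direction loopless tau0 eta_tau eta_ge (div _ _ sq dq Hg) Hpg lamhi oddv
  (ltn_ord a) (ltn_ord b) ab ia ib la lb (lN _ (ltn_ord a) ia) (lN _ (ltn_ord b) ib).
have [dh [dh1 dh2 dh3]] := local_direction loopless tau0 eta_tau eta_ge (div _ _ sq' dq' Hh) Hph lamhi oddv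
  (ltn_ord a) (ltn_ord b) ab ia ib la lb (lN _ (ltn_ord a) ia) (lN _ (ltn_ord b) ib).
pose dl (j : nat) : rat := (j == a)%:R - (j == b)%:R.
exists (glue m dg dh dl).
have gE j : (j < m)%N -> _ := fun lt => glueE dg dh dl lt.
split.
- move=> j lt nj; have [-> -> ->] := gE j lt; rewrite dg1 // dh1 // /dl.
  have -> : (j == a) = false by apply: contraNF nj => /eqP ->.
  have -> : (j == b) = false by apply: contraNF nj => /eqP ->.
  by rewrite subrr.
- split.
  + by rewrite -[RHS]dg2; apply: exc_ext => j lt; have [] := gE j lt.
  + by rewrite -[RHS]dh2; apply: exc_ext => j lt; have [] := gE j lt.
  + rewrite (@lamsum_ext E _ _ dl) => [|j lt]; last by have [] := gE j lt.
    rewrite /lamsum (@sum_ord2 m a b (fun j => (incident (nth arc0 E j) v)%:R * dl j)) //; last first.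
      by move=> j /negbTE ja /negbTE jb; rewrite /dl ja jb subrr mulr0.
    have -> : incident (nth arc0 E a) v = true := ia.
    have -> : incident (nth arc0 E b) v = true := ib.
    by rewrite /dl !eqxx (negbTE ab) eq_sym (negbTE ab) subr0 sub0r !mul1r subrr.
- move=> j lt; have [e1 e2 e3] := gE j lt; rewrite /dir_ok e1 e2 e3.
  have [g1 [g2 g3]] := dg3 j lt; have [h1 [h2 h3]] := dh3 j lt.
  have dl0 : ~~ ((eta%:R < lm j) && (lm j < N%:R - kp%:R) && inc j v) -> dl j = 0.
    rewrite /dl; case: (eqVneq j a) => [->|_]; first by rewrite la small ?ltn_ord // ia.
    case: (eqVneq j b) => [->|_]; first by rewrite lb small ?ltn_ord // ib.
    by rewrite subrr.
  split; split.
  + by move=> e; apply: g2; apply/eqP.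
  + by move=> e; apply: g1; rewrite -capU; apply/eqP.
  + exact: g3.
  + by move=> e; apply: h2; apply/eqP.
  + by move=> e; apply: h1; rewrite -capU; apply/eqP.
  + exact: h3.
  + move=> e; apply: dl0; rewrite e !negb_and -!leNgt; apply/orP; left; apply/orP; right.
    have : 0 <= kp%:R :> rat by exact: ler0n. lra.
  + by move=> e; apply: dl0; rewrite e !negb_and -!leNgt eta0.
  + move=> e; apply: dl0; apply/negP => /andP[_ ij].
    move: e; rewrite (free_not_fixed lt fv ij); have [_ _ l0] := pos lt.
    have : 0 < kp%:R :> rat by rewrite ltr0n.
    by rewrite mulr0n; lra.
- exists a; split=> //; have [_ _ ->] := gE a (ltn_ord a).
  by rewrite /dl eqxx (negbTE ab) subr0 oner_eq0.
Qed.
End Direction.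

Variables (U : seq nat).
Hypotheses (Uuniq : uniq U) (Uvs : {subset U <= vs}) (Ufree : forall v, v \in U -> free_at E cv fx v)
  (Ubig : (size cv + size cv < size U)%N).

(** Nonnegativity is implicit in vectors of natural numbers but has to be a row here, since the
    extreme point argument works with rational vectors and sees only rows. *)
Let pos_row k : row := (onehot (indices (E ++ (E ++ E))) k (false, true), (0, 0))%N.

Lemma dot_pos_row k x : (k < n3)%N -> dot n3 (pos_row k).1 x = - x k.
Proof.
move=> lt; have e : n3 = size (E ++ (E ++ E)) by rewrite !size_cat.
by rewrite e dot_onehot -?e //= sub0r mulN1r.
Qed.

Lemma exc_part2 v (I : finType) (t : I -> rat) (d : I -> nat -> rat) :
  exc E v (part2 m (fun k => \sum_i t i * d i k)) = \sum_i t i * exc E v (part2 m (d i)).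
Proof. by rewrite /part2 exc_sum; apply: eq_bigr => i _; rewrite excZ. Qed.

(** The directions of the single vertices fail only conservation of g and h at cover vertices, which
    is 2 |cv| linear conditions for more than 2 |cv| directions. A kernel vector gives the
    combination; it is nonzero because the supports are disjoint. *)
Lemma combine_directions x : (forall k, (k < n3)%N -> 0 <= x k) ->
  lpsat E cv vs q N kp tau%:R fx x (part2 m x) (part3 m x) ->
  (forall v j, v \in U -> (j < m)%N -> inc j v -> part3 m x j < N%:R - kp%:R) ->
  exists D : nat -> rat,
    [/\ forall j, (j < m)%N -> dir_ok x D j,
        forall v, exc E v D = 0 /\ exc E v (part2 m D) = 0,
        forall v, odd_inner E cv v -> lamsum E (part3 m D) v = 0 &
        exists2 j, (j < m)%N & part3 m D j != 0].
Proof.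
move=> xpos xsat small; pose u := size U; pose w := size cv.
pose vt (i : 'I_u) := nth 0%N U i.
have vtU i : vt i \in U by exact: mem_nth.
have /fin_all_exists[d Hd] : forall i : 'I_u, exists d : nat -> rat,
    [/\ forall j, (j < m)%N -> ~~ inc j (vt i) -> [/\ d j = 0, part2 m d j = 0 & part3 m d j = 0],
        [/\ exc E (vt i) d = 0, exc E (vt i) (part2 m d) = 0 & lamsum E (part3 m d) (vt i) = 0],
        forall j, (j < m)%N -> dir_ok x d j &
        exists j, [/\ (j < m)%N, inc j (vt i) & part3 m d j != 0]].
  by move=> i; apply: vertex_direction => // [||j lt ij]; [exact: Uvs|exact: Ufree|exact: small ij].
pose A : 'M[rat]_(u, w + w) := \matrix_(i, k) match split k with
  | inl a => exc E (nth 0%N cv a) (d i) | inr a => exc E (nth 0%N cv a) (part2 m (d i)) end.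
have [t [t0 tA]] := left_kernel A Ubig.
have tA1 (a : 'I_w) : \sum_i t 0 i * exc E (nth 0%N cv a) (d i) = 0.
  have e0 : (t *m A) 0 (lshift w a) = 0 by rewrite tA mxE.
  rewrite -[RHS]e0 mxE; apply: eq_bigr => i _.
  by rewrite mxE (unsplitK (inl a)).
have tA2 (a : 'I_w) : \sum_i t 0 i * exc E (nth 0%N cv a) (part2 m (d i)) = 0.
  have e0 : (t *m A) 0 (rshift w a) = 0 by rewrite tA mxE.
  rewrite -[RHS]e0 mxE; apply: eq_bigr => i _.
  by rewrite mxE (unsplitK (inr a)).
pose D k := \sum_i t 0 i * d i k.
have D2 j : part2 m D j = \sum_i t 0 i * part2 m (d i) j by [].
have D3 j : part3 m D j = \sum_i t 0 i * part3 m (d i) j by [].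
have ncv i : vt i \notin cv by apply: free_not_cv; apply: Ufree.
have other i v : v \notin cv -> v != vt i -> forall j, (j < m)%N -> inc j v ->
    [/\ d i j = 0, part2 m (d i) j = 0 & part3 m (d i) j = 0].
  move=> nv ne j lt ij; have [h _ _ _] := Hd i; apply: h => //.
  exact: (not_shared lt nv (ncv i) ne ij).
have exc0 i v : v \notin cv -> exc E v (d i) = 0 /\ exc E v (part2 m (d i)) = 0.
  move=> nv; case: (eqVneq v (vt i)) => [->|ne]; first by have [_ [? ? _] _ _] := Hd i.
  have H j : (j < m)%N -> ((atail E j == v)%:R - (ahead E j == v)%:R : rat) != 0 -> inc j v.
    move=> lt; rewrite /inc /incident -/(atail E j) -/(ahead E j).
    by case: (atail E j == v) => //=; case: (ahead E j == v) => //=; rewrite subrr eqxx.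
  by split; rewrite /exc big1 // => j _; set s := (X in X * _); (case: (eqVneq s 0) => [->|/H ij]; first by rewrite mul0r);
     have [e1 e2 _] := other i v nv ne j (ltn_ord j) (ij (ltn_ord j)); rewrite ?e1 ?e2 mulr0.
exists D; split.
- move=> j lt; rewrite /dir_ok D2 D3 /D.
  have K i := let: And4 _ _ h _ := Hd i in h j lt.
  split; split=> e.
  + by apply: eq_bigr => i _; have [[-> //] _ _] := K i.
  + by rewrite -sumrN; apply: eq_bigr => i _; have [[_ -> //] _ _] := K i; rewrite mulrN.
  + by apply: big1 => i _; have [[_ _ -> //] _ _] := K i; rewrite mulr0.
  + by apply: eq_bigr => i _; have [_ [-> //] _] := K i.
  + by rewrite -sumrN; apply: eq_bigr => i _; have [_ [_ -> //] _] := K i; rewrite mulrN.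
  + by apply: big1 => i _; have [_ [_ _ -> //] _] := K i; rewrite mulr0.
  + by apply: big1 => i _; have [_ _ [-> //]] := K i; rewrite mulr0.
  + by apply: big1 => i _; have [_ _ [_ -> //]] := K i; rewrite mulr0.
  + by apply: big1 => i _; have [_ _ [_ _ -> //]] := K i; rewrite mulr0.
- move=> v; rewrite exc_part2 /D exc_sum.
  have -> : \sum_i exc E v (fun j => t 0 i * d i j) = \sum_i t 0 i * exc E v (d i).
    by apply: eq_bigr => i _; rewrite excZ.
  case: (boolP (v \in cv)) => [vc|nv].
    have lt : (index v cv < w)%N by rewrite index_mem.
    by split; [have := tA1 (Ordinal lt) | have := tA2 (Ordinal lt)]; rewrite /= nth_index.
  by split; apply: big1 => i _; have [e1 e2] := exc0 i v nv; rewrite ?e1 ?e2 mulr0.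
- move=> v /andP[_]; rewrite mem_natE => nv.
  rewrite /lamsum (eq_bigr (fun j : 'I_m => \sum_i t 0 i * ((incident (nth arc0 E j) v)%:R * part3 m (d i) j))); last first.
    by move=> j _; rewrite D3 mulr_sumr; apply: eq_bigr => i _; rewrite mulrCA.
  rewrite exchange_big big1 // => i _; rewrite -mulr_sumr.
  case: (eqVneq v (vt i)) => [->|ne]; first by have [_ [_ _ h] _ _] := Hd i; rewrite -/(lamsum E _ _) h mulr0.
  rewrite big1 ?mulr0 // => j _; case: (boolP (incident (nth arc0 E j) v)) => ij; last by rewrite mul0r.
  by have [_ _ ->] := other i v nv ne j (ltn_ord j) ij; rewrite mulr0.
have [i ti] : exists i, t 0 i != 0 by apply/rV0Pn.
have [_ _ _ [j [lt ij nz]]] := Hd i; exists j => //.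
rewrite D3 (bigD1 i) //= big1 ?addr0 ?mulf_neq0 // => i' ne.
have vne : vt i != vt i'.
  by rewrite nth_uniq // eq_sym (inj_eq val_inj).
by have [_ _ ->] := other i' (vt i) (ncv i) vne j lt ij; rewrite mulr0.
Qed.

Lemma tight_edge_rows x D j : (j < m)%N -> dir_ok x D j ->
  forall r, r \in edge_rows N tau kp E (j, (nth arc0 E j, nth false fx j)) -> tight n3 x r -> dot n3 r.1 D = 0.
Proof.
move=> lt [[g1 g2 g3] [h1 h2 h3] [l1 l2 l3]] r; rewrite !inE /tight.
do 6?[case/orP]; move=> /eqP ->; rewrite !dot3 ?size_onehot ?size_nones // !dot_nones !dot_onehot //= -?/(acap E j);
  rewrite ?natrD ?mulr0n ?add0r ?addr0 ?subr0 ?sub0r ?mulN1r ?mul1r => /eqP e.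
- by rewrite g1 ?addNr //; lra.
- by rewrite g2 ?addNr // natrD; lra.
- by rewrite h1 ?addNr //; lra.
- by rewrite h2 ?addNr // natrD; lra.
- exact: l1.
- by rewrite l3 ?oppr0 //; lra.
Qed.

(** As long as no edge at U has lambda at least N - kp, the combined direction keeps tight rows
    tight and changes some lambda, hence the nonnegativity row of that variable. So the extreme
    point search ends at an edge whose new lower bound N - kp already holds. *)
Theorem fix_exists : lpfeas E cv vs q N kp tau%:R fx ->
  exists j v, [/\ (j < m)%N, v \in U, inc j v & lpfeas E cv vs q N kp tau%:R (set_fix fx j)].
Proof.
case=> x0 [x0pos x0sat].
pose rows := lp_rows N tau kp E cv vs q fx ++ [seq pos_row k | k <- iota 0 n3].
pose Q (x : nat -> rat) := exists j v, [/\ (j < m)%N, v \in U, inc j v & N%:R - kp%:R <= part3 m x j].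
have rowsP x : all (sat n3 0 x) rows <-> (forall k, (k < n3)%N -> 0 <= x k) /\
   lpsat E cv vs q N kp tau%:R fx x (part2 m x) (part3 m x).
  rewrite all_cat all_map; split.
    move=> /andP[/(lp_rowsP _ _ _ _ _ _ _ _ sfx)]; rewrite addr0 => h1 /allP h2; split=> // k lt.
    have := h2 k; rewrite mem_iota lt /= => /(_ isT); rewrite /sat dot_pos_row //= ?mulr0n !addr0; lra.
  move=> [h1 h2]; apply/andP; split.
    by apply/(lp_rowsP _ _ _ _ _ _ _ _ sfx); rewrite addr0.
  apply/allP => k; rewrite mem_iota => /andP[_ lt] /=.
  by rewrite /sat dot_pos_row //= ?mulr0n !addr0; have := h1 k lt; lra.
have [|x fs|x [/rowsP[xpos xsat] [j [v [jm vU ij big]]]]] := @extreme_point n3 rows Q x0.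
- by apply/rowsP.
- have [xpos xsat] := (rowsP x).1 fs.
  case: (boolP [exists j : 'I_m, has (inc j) U && (N%:R - kp%:R <= part3 m x j)]).
    by move=> /existsP[j /andP[/hasP[v vU ij] le]]; left; exists j, v.
  move=> /existsPn none; right.
  have small v j : v \in U -> (j < m)%N -> inc j v -> part3 m x j < N%:R - kp%:R.
    move=> vU lt ij; rewrite ltNge; apply/negP => le; have := none (Ordinal lt).
    by rewrite /= le andbT => /hasPn/(_ v vU); rewrite ij.
  have [D [D1 D2 D3 [j jm Dj]]] := combine_directions xpos xsat small.
  exists D; split; last first.
    exists (pos_row (m + (m + j))%N).
      rewrite mem_cat map_f ?orbT // mem_iota /n3; lia.
    by rewrite dot_pos_row ?oppr_eq0 // /n3; lia.
  move=> r; rewrite mem_cat => /orP[|/mapP[k]].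
    have : all (fun r => tight n3 x r ==> (dot n3 r.1 D == 0)) (lp_rows N tau kp E cv vs q fx).
      apply/all_lp_rows => //; split=> [i im|v vin].
        by apply/allP => r' rin; apply/implyP => rt; apply/eqP; exact: (tight_edge_rows im (D1 i im) rin rt).
      have [e1 e2] := D2 v; split.
        rewrite /= !dot3 ?size_div_row ?size_nones // !dot_nones !dot_div_row /= e1 e2.
        by rewrite !oppr0 !addr0 !eqxx !implybT.
      rewrite /odd_rows; case: ifP => // ov.
      by rewrite /= !dot3 ?size_nones // !dot_nones dot_incT dot_incF D3 // !oppr0 !addr0 !eqxx !implybT.
    by move=> /allP h rin rt; apply/eqP; exact: (implyP (h r rin)).
  rewrite mem_iota => /andP[_ lt] -> ; rewrite /tight dot_pos_row //= ?mulr0n addr0 oppr_eq0 => /eqP xk.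
  rewrite dot_pos_row //; apply/eqP; rewrite oppr_eq0; apply/eqP.
  case: (ltnP k m) => l1.
    by have [[_ _ h] _ _] := D1 k l1; exact: h.
  case: (ltnP k (m + m)) => l2.
    have l3 : (k - m < m)%N by lia.
    have ek : (m + (k - m) = k)%N by lia.
    by have [_ [_ _ h] _] := D1 _ l3; move: h; rewrite /part2 ek; apply.
  have l3 : (k - (m + m) < m)%N by rewrite /n3 in lt; lia.
  have ek : (m + (m + (k - (m + m))) = k)%N by lia.
  by have [_ _ [_ h _]] := D1 _ l3; move: h; rewrite /part3 ek; apply.
exists j, v; split=> //; exists (fun k => if (k < n3)%N then x k else 0); split.
  by move=> k; case: ifP => // lt; exact: xpos.
apply: (lpsat_ext (pg := x) (ph := part2 m x) (lm := part3 m x)).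
  move=> i im; rewrite /part2 /part3 /n3.
  have -> : (i < m + (m + m))%N by lia.
  have -> : (m + i < m + (m + m))%N by lia.
  by have -> : (m + (m + i) < m + (m + m))%N by lia.
have [h1 h2 h3 h4] := xsat; split=> // i im.
rewrite /set_fix (nth_map (0%N, false)) ?size_zip ?size_iota ?minnn ?sfx //.
rewrite nth_zip ?size_iota // nth_iota ?sfx //= add0n.
case: (eqVneq i j) => [->|_] /=; last exact: h2.
have : 0 <= tau%:R :> rat by exact: ler0n.
by lra.
Qed.
End FixExists.

Local Close Scope ring_scope.

(** * Soundness and completeness of the linear feasibility test *)

Local Open Scope ring_scope.

(** * Distance to the solutions of the linear program *)

Section NearPotential.
Variables (E : seq arc) (vs : seq nat) (n : nat).
Let m := size E.
Hypotheses (Evs : forall a, a \in E -> (a.1.1 \in vs) && (a.1.2 \in vs))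
  (vsn : forall v, v \in vs -> (v <= n)%N).
Variables (N : nat) (dl eps : rat) (U W p p0 lm lm0 : nat -> rat).
Hypotheses (dl0 : 0 <= dl) (eps0 : 0 <= eps)
  (Hp : forall j, (j < m)%N -> [/\ 0 <= p j, 0 <= lm j, lm j <= p j + (dl + eps) & p j + lm j <= U j + (dl + eps)])
  (Hp0 : forall j, (j < m)%N -> [/\ 0 <= p0 j, 0 <= lm0 j, lm0 j <= N%:R + dl, lm0 j <= p0 j + dl & p0 j + lm0 j <= U j + dl])
  (Hdiv : forall v, v \in vs -> `|exc E v p - W v| <= dl + eps)
  (Hdiv0 : forall v, v \in vs -> `|exc E v p0 - W v| <= dl).

(** The lambda couple g and h, so the program is not a transshipment problem. Putting the lambda of
    a known solution in place of the given one decouples it. Since that lambda lies between 0 and N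
    + dl, the bounds on p are then violated by at most eps + N + dl, and [feasible_near] applies to
    p alone. *)
Lemma near_potential : exists z : nat -> rat,
  [/\ forall j, (j < m)%N -> [/\ 0 <= z j, lm0 j <= z j + dl & z j + lm0 j <= U j + dl],
      forall v, v \in vs -> `|exc E v z - W v| <= dl &
      forall j, (j < m)%N -> `|z j - p j| <= (eps + N%:R + dl) * (m + size vs)%:R].
Proof.
pose e1 := eps + N%:R + dl.
have N0 : 0 <= N%:R :> rat by exact: ler0n.
have e10 : 0 <= e1 by rewrite /e1; move: dl0 eps0 N0; lra.
pose blo (v : 'I_n.+1) : rat := if val v \in vs then W v - dl else 0.
pose bhi (v : 'I_n.+1) : rat := if val v \in vs then W v + dl else 0.
have exE := excE Evs vsn.
have [|||||z [z1 z2 z3]] := @feasible_near rat 'I_n.+1 'I_m (fun j => inord (atail E j)) (fun j => inord (ahead E j))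
   (fun j => Num.max 0 (lm0 j - dl)) (fun j => U j - lm0 j + dl) (fun j => p j) (fun j => p0 j) blo bhi (vtol vs eps) e1 e10.
- by move=> v; exact: vtol_ge0.
- move=> j; have [h1 h2 h3 h4 h5] := Hp0 (ltn_ord j); rewrite ge_max; apply/andP; split; last by lra.
  by apply/andP; split=> //; lra.
- move=> v; rewrite exE /blo /bhi; case: ifP => [vin|/negbT nv]; last by rewrite (exc_notin Evs) ?lexx.
  by have := Hdiv0 vin; rewrite ler_norml => /andP[]; lra.
- move=> j; have [h1 h2 h3 h4] := Hp (ltn_ord j); have [g1 g2 g3 g4 g5] := Hp0 (ltn_ord j).
  apply/andP; split; last by rewrite /e1; move: dl0 eps0 N0; lra.
  rewrite lerBlDr ge_max; apply/andP; split; first by apply: addr_ge0.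
  by rewrite /e1; move: dl0 eps0; lra.
- move=> v; rewrite exE /blo /bhi /vtol; case: ifP => [vin|/negbT nv]; last by rewrite (exc_notin Evs) // subr0 addr0 lexx.
  by have := Hdiv vin; rewrite ler_norml => /andP[]; lra.
pose z' j := if insub j is Some j' then z j' else 0.
have z'E (j : 'I_m) : z' j = z j by rewrite /z' valK.
exists z'; split.
- move=> j lt; rewrite (z'E (Ordinal lt)); have /andP[] := z1 (Ordinal lt).
  by rewrite ge_max /= => /andP[h1 h2] h3; split; lra.
- move=> v vin; have lt : (v < n.+1)%N by rewrite ltnS vsn.
  have -> : exc E v z' = excess (fun j : 'I_m => inord (atail E j)) (fun j : 'I_m => inord (ahead E j)) z (Ordinal lt).
    by rewrite -[v]/(nat_of_ord (Ordinal lt)) -exE; apply: eq_bigr => j _; rewrite z'E.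
  have := z2 (Ordinal lt); rewrite /blo /bhi /= vin => /andP[h1 h2].
  by rewrite ler_norml; apply/andP; split; lra.
- move=> j lt; rewrite (z'E (Ordinal lt)); apply: le_trans (z3 (Ordinal lt)) _.
  rewrite card_ord natrD mulrDr mulr_natr lerD2l.
  apply: le_trans (sum_vtol vs n eps0) _; rewrite -[leLHS]mulr_natr ler_wpM2r ?ler0n //.
  by rewrite -addrA lerDl addr_ge0.
Qed.
End NearPotential.

Section LPTest.
Variables (E : seq arc) (cv vs : seq nat) (q : terms) (kp n : nat) (P : param) (l : seq unit).
Let m := size E.
Let n3 := (m + (m + m))%N.
Let M := pM P.
Let N := pN P.
Hypotheses (loopless : forall a, a \in E -> a.1.1 != a.1.2)
  (Evs : forall a, a \in E -> (a.1.1 \in vs) && (a.1.2 \in vs))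
  (vsn : forall v, v \in vs -> (v <= n)%N)
  (mM : (n3 <= M)%N) (M0 : (0 < M)%N) (Hsc : psc P = scales M l)
  (HR : (n3 * ((2 * M + N + M * m) * (m + size vs + 1)) ^ 2 < size (pR P))%N)
  (Hbig : forall v, (N * (in_cap E v + out_cap E v + supply q v + demand q v + supply (swap2 q) v + demand (swap2 q) v + 1)
     <= 2 * (M * 2 ^ size l))%N).
Let D : lpdata := (E, cv, vs, q, kp).

Lemma nfix_le fx : (nfix fx <= size fx)%N.
Proof. clear; elim: fx => //= b fx IH; rewrite /nfix /=; case: b; rewrite /nfix in IH; lia. Qed.

Lemma size_E3 : size [seq 0%N | _ <- E ++ (E ++ E)] = n3.
Proof. by rewrite size_map !size_cat. Qed.

Lemma lp_ok_sound fx : size fx = m -> lp_ok P D fx ->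
  lpfeas E cv vs q N kp (M * nfix fx + M)%:R fx.
Proof.
move=> sf; rewrite /lp_ok /D => /(decide_sound size_E3)[|x [sx]]; first exact: wf_lp_rows.
move=> /(lp_rowsP _ _ _ _ _ _ _ _ sf); rewrite -natrD => H.
by exists (ratv x); split=> // k; exact: ler0n.
Qed.

Lemma lp_ok_complete fx : size fx = m -> lpfeas E cv vs q N kp (M * nfix fx)%:R fx -> lp_ok P D fx.
Proof.
move=> sf [x0 [x0pos [A1 A2 A3 A4]]]; set dl := (M * nfix fx)%N in A1 A2 A3 A4.
have dl_le : (dl <= M * m)%N by rewrite leq_mul2l -sf nfix_le orbT.
have wf := wf_lp_rows cv vs q N kp dl sf loopless.
rewrite /lp_ok /D /decide Hsc -/M -/N -/dl.
apply: (relax_within wf mM M0 (D := fun eps => n3 * ((eps + N + M * m) * (m + size vs + 1)) ^ 2)%N).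
- move=> eps x sx w.
  have {}w : all (sat n3 eps%:R (ratv x)) (lp_rows N dl kp E cv vs q fx).
    by apply/allP => r rr; rewrite -violatedE ?(allP w) //; exact: (allP wf).
  have [B1 B2 B3 B4] := (lp_rowsP cv vs q N kp dl _ _ sf).1 w.
  have dl0 : 0 <= dl%:R :> rat by exact: ler0n.
  have ep0 : 0 <= eps%:R :> rat by exact: ler0n.
  have lam0 k : 0 <= ratv x k by exact: ler0n.
  have [z [z1 z2 z3]] := @near_potential E vs n Evs vsn N dl%:R eps%:R
    (fun j => (N * (acap E j + acap E j))%:R) (fun v => N%:R * wdiv E q v) (ratv x) x0
    (part3 m (ratv x)) (part3 m x0) dl0 ep0
    (fun j lt => let: And5 h1 h2 h3 h4 h5 := B1 j lt in And4 (lam0 _) (lam0 _) h1 h2)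
    (fun j lt => let: And5 h1 h2 h3 h4 h5 := A1 j lt in And5 (x0pos _) (x0pos _) h5 h1 h2)
    (fun v vin => proj1 (B3 v vin)) (fun v vin => proj1 (A3 v vin)).
  have [y [y1 y2 y3]] := @near_potential E vs n Evs vsn N dl%:R eps%:R
    (fun j => (N * (acap E j + acap E j))%:R) (fun v => N%:R * wdiv E (swap2 q) v) (part2 m (ratv x)) (part2 m x0)
    (part3 m (ratv x)) (part3 m x0) dl0 ep0
    (fun j lt => let: And5 h1 h2 h3 h4 h5 := B1 j lt in And4 (lam0 _) (lam0 _) h3 h4)
    (fun j lt => let: And5 h1 h2 h3 h4 h5 := A1 j lt in And5 (x0pos _) (x0pos _) h5 h3 h4)
    (fun v vin => proj2 (B3 v vin)) (fun v vin => proj2 (A3 v vin)).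
  have sat' : lpsat E cv vs q N kp dl%:R fx z y (part3 m x0).
    split=> // [j lt|v vin]; last by split; [exact: z2|exact: y2].
    by have [? ? ?] := z1 j lt; have [? ? ?] := y1 j lt; have [_ _ _ _ ?] := A1 j lt; split.
  have [|x' [x'pos x'sat x'E]] := lpsat_glue _ sat'.
    by move=> j lt; have [? _ _] := z1 j lt; have [? _ _] := y1 j lt; split=> //; exact: x0pos.
  exists x'; split=> //; first by apply/(lp_rowsP _ _ _ _ _ _ _ _ sf); rewrite addr0.
  set K := ((eps + N + M * m) * (m + size vs + 1))%N.
  have ml : (eps%:R + N%:R + dl%:R) * (m + size vs)%:R <= K%:R :> rat.
    rewrite -!natrD -natrM ler_nat /K leq_mul //; lia.
  have ml1 : eps%:R + N%:R + dl%:R <= K%:R :> rat.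
    rewrite -!natrD ler_nat /K; apply: (@leq_trans (eps + N + M * m)); first by lia.
    by rewrite leq_pmulr // addn1.
  have close k : (k < n3)%N -> `|x' k - ratv x k| <= K%:R.
    move=> lt; case: (ltnP k m) => l1.
      have h := le_trans (z3 k l1) ml.
      by have [e _ _] := x'E k l1; rewrite -e in h.
    case: (ltnP k (m + m)) => l2.
      have l3 : (k - m < m)%N by rewrite ltn_subLR.
      have ek : (m + (k - m) = k)%N by rewrite subnKC.
      have [_ e _] := x'E _ l3; have h := le_trans (y3 _ l3) ml.
      by rewrite -e /part2 ek in h.
    have l3 : (k - (m + m) < m)%N by rewrite ltn_subLR // -addnA.
    have ek : (m + (m + (k - (m + m))) = k)%N by rewrite addnA subnKC.
    have [_ _ e] := x'E _ l3; have [_ _ _ _ b5] := B1 _ l3; have [_ _ _ _ a5] := A1 _ l3.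
    move: e a5 b5; rewrite /part3 ek => -> a5 b5; apply: le_trans ml1.
    by rewrite ler_norml; apply/andP; split; move: (lam0 k) (x0pos k); lra.
  rewrite natrM natrX mulr_natl -[X in _ *+ X]card_ord -sumr_const; apply: ler_sum => k _.
  rewrite -[X in X ^+ 2]opprB sqrrN -real_normK ?num_real // ler_pXn2r ?nnegrE ?normr_ge0 ?ler0n //.
  exact: close.
(* The terms N and M m of the error bound do not scale with the step, but s >= 1 makes them at most
   s N and s M m. *)
- move=> s s0; apply: (@leq_ltn_trans (n3 * ((s * (2 * M + N + M * m)) * (m + size vs + 1)) ^ 2)).
    rewrite leq_mul2l; apply/orP; right; rewrite leq_exp2r // leq_mul2r; apply/orP; right.
    by rewrite !mulnDr; have := leq_pmull N s0; have := leq_pmull (M * m) s0; lia.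
  by rewrite -mulnA expnMn mulnCA mulnC -[(s ^ 2)%N]/(s * s)%N ltn_pmul2r ?muln_gt0 ?s0.
- exact: size_E3.
apply/allP => r rin; rewrite /violated -leqNgt.
have pz cs (s : seq arc) : pos_val cs [seq 0%N | _ <- s] = 0%N.
  by rewrite /pos_val; elim: s cs => [|a A' IH] [|c cs] //=; rewrite IH; case: ifP.
rewrite pz add0n; apply: leq_trans (_ : 2 * (M * 2 ^ size l) <= _)%N; last by rewrite leq_addl.
move: r rin; apply/allP; apply/all_lp_rows => //.
have N_le : (N <= 2 * (M * 2 ^ size l))%N by apply: leq_trans (Hbig 0%N); rewrite leq_pmulr // addn1.
split=> [j lt|v vin].
  by rewrite /=; case: ifP => _; rewrite ?N_le.
have H := Hbig v; split.
  by rewrite /= !(leq_trans _ H) // leq_mul2l; apply/orP; right; clear; lia.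
by rewrite /odd_rows; case: ifP => //= _; rewrite N_le.
Qed.
End LPTest.

Local Close Scope ring_scope.

Lemma size_set_fix fx j : size (set_fix fx j) = size fx.
Proof. by rewrite size_map size_zip size_iota minnn. Qed.

Lemma nth_set_fix fx j i : i < size fx -> nth false (set_fix fx j) i = (i == j) || nth false fx i.
Proof.
move=> lt; rewrite (nth_map (0, false)) ?size_zip ?size_iota ?minnn //.
by rewrite nth_zip ?size_iota //= nth_iota.
Qed.

Lemma nfixE fx : nfix fx = \sum_(i < size fx) nth false fx i.
Proof. by rewrite /nfix sumnE big_map (big_nth false) big_mkord. Qed.

Lemma nfix_set fx j : j < size fx -> nth false fx j = false -> nfix (set_fix fx j) = (nfix fx).+1.
Proof.
move=> lt fj; rewrite !nfixE size_set_fix.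
rewrite (bigD1 (Ordinal lt)) //= [in RHS](bigD1 (Ordinal lt)) //= nth_set_fix // eqxx fj add0n add1n.
congr _.+1; apply: eq_bigr => i; rewrite -val_eqE /= => /negbTE ne.
by rewrite nth_set_fix // ne.
Qed.

(** * The greedy choice of fixed edges *)

Section Greedy.
Variables (E : seq arc) (cv vs : seq nat) (q : terms) (kp n : nat) (P : param) (l : seq unit).
Let m := size E.
Let n3 := (m + (m + m))%N.
Let M := pM P.
Let N := pN P.
Let tau := M * m.+1.
Hypotheses (loopless : forall a, a \in E -> a.1.1 != a.1.2)
  (Evs : forall a, a \in E -> (a.1.1 \in vs) && (a.1.2 \in vs))
  (vsn : forall v, v \in vs -> (v <= n)%N)
  (covered : forall a, a \in E -> (a.1.1 \in cv) || (a.1.2 \in cv))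
  (cv_terms : forall v, v \notin cv -> [/\ supply q v = 0%N, demand q v = 0%N,
     supply (swap2 q) v = 0%N & demand (swap2 q) v = 0%N])
  (kp_ge : (tau + m * (m.+2 * tau) <= kp)%N) (N_ge : (kp + tau < N)%N) (kp0 : (0 < kp)%N)
  (mM : (n3 <= M)%N) (M0 : (0 < M)%N) (Hsc : psc P = scales M l)
  (HR : (n3 * ((2 * M + N + M * m) * (m + size vs + 1)) ^ 2 < size (pR P))%N)
  (Hbig : forall v, (N * (in_cap E v + out_cap E v + supply q v + demand q v + supply (swap2 q) v + demand (swap2 q) v + 1)
     <= 2 * (M * 2 ^ size l))%N).
Let D : lpdata := (E, cv, vs, q, kp).

(** The slack is one tolerance above that of the test, as in [lp_ok_sound]. The last clause, an odd
    end outside the cover for each fixed edge, is what the later parity count relies on. *)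
Definition inv fx := [/\ size fx = m, lpfeas E cv vs q N kp (M * nfix fx + M)%:R fx &
  forall j, nth false fx j -> exists2 v, incident (nth arc0 E j) v & odd_inner E cv v].

Lemma fixable_in fx p : inv fx -> p \in fixable P D fx ->
  [/\ p.1 < m, nth false fx p.1 = false & inv (set_fix fx p.1)].
Proof.
move=> [sf Hf Ho]; rewrite mem_filter => /andP[/andP[fr ok] pin].
case/(nthP (0, arc0)): pin => i; rewrite size_zip size_iota minnn => lt.
rewrite nth_zip ?size_iota // nth_iota // add0n => pE; subst p => /=.
have fi : nth false fx i = false.
  case/orP: fr => /(@free_not_fixed E cv fx _ _ i lt) -> //; rewrite /incident eqxx ?orbT //.
rewrite /= in ok fr; split=> //; split; first by rewrite size_set_fix.
  by apply: (lp_ok_sound loopless) => //; rewrite size_set_fix.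
move=> j; case: (ltnP j (size fx)) => ltj; last by rewrite nth_default // size_set_fix.
rewrite nth_set_fix // => /orP[/eqP ->|]; last exact: Ho.
case/orP: fr => /andP[oi _].
  by exists (nth arc0 E i).1.1; rewrite // /incident eqxx.
by exists (nth arc0 E i).1.2; rewrite // /incident eqxx orbT.
Qed.

(** With more than 2 |cv| free vertices [fix_exists] yields an edge that can be fixed at the current
    slack M nfix + M. This is exactly the slack of the program with one more fixed edge, so the test
    has to accept it. *)
Lemma stuck fx U : inv fx -> nilp (fixable P D fx) -> uniq U -> {subset U <= vs} ->
  (forall v, v \in U -> free_at E cv fx v) -> size U <= size cv + size cv.
Proof.
move=> [sf Hf _] /nilP nl Uu Uvs Uf; rewrite leqNgt; apply/negP => big.
have nf : nfix fx <= m by rewrite -sf nfix_le.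
have tl : M * nfix fx + M <= tau by rewrite /tau mulnS addnC leq_add2l leq_mul2l nf orbT.
have kp' : M * nfix fx + M + m * (m.+2 * (M * nfix fx + M)) <= kp.
  by apply: leq_trans kp_ge; rewrite leq_add ?leq_mul.
have N' : kp + (M * nfix fx + M) < N by apply: leq_ltn_trans N_ge; rewrite leq_add2l.
have [j [v [lt vU ij fj]]] := fix_exists loopless covered cv_terms kp' N' kp0 sf Uu Uvs Uf big Hf.
have fv := Uf v vU; have fxj := free_not_fixed sf lt fv ij.
have ok : lp_ok P D (set_fix fx j).
  apply: (lp_ok_complete (n := n) (l := l)); rewrite ?size_set_fix //.
  by rewrite nfix_set ?sf // mulnS addnC.
suff : (j, nth arc0 E j) \in fixable P D fx by rewrite nl.
rewrite mem_filter ok andbT; apply/andP; split.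
  by case/orP: ij => /eqP ->; rewrite fv ?orbT.
have -> : (j, nth arc0 E j) = nth (0, arc0) (zip (indices E) E) j.
  by rewrite nth_zip ?size_iota // nth_iota.
by rewrite mem_nth // size_zip size_iota minnn.
Qed.

Lemma odd_inner_incident v : odd_inner E cv v -> exists2 a, a \in E & incident a v.
Proof.
case/andP => od _; apply/hasP; apply: contraTT od => /hasPn no.
suff -> : out_cap E v + in_cap E v = 0 by [].
apply/eqP; rewrite addn_eq0 /out_cap /in_cap !sumnE !big_map !big_seq.
by apply/andP; split; apply/eqP/big1 => a /no; rewrite /incident negb_or => /andP[/negbTE h1 /negbTE h2]; rewrite ?h1 ?h2.
Qed.

Lemma nfix_all fx : size fx <= nfix fx -> forall b, b \in fx -> b.
Proof.
elim: fx => //= b fx IH; rewrite /nfix /= -/(nfix fx) => h c; rewrite inE => /orP[/eqP ->|].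
  by case: b h => //; rewrite add0n ltnNge nfix_le.
by apply: IH; case: b h; rewrite ?add1n ?add0n // => /ltnW.
Qed.

(** Every iteration fixes a new edge or is stuck. If all m iterations succeed, all edges are fixed,
    and no vertex is free because an odd vertex has an incident edge. *)
Lemma fix_edges_spec : inv [seq false | _ <- E] -> let fx := fix_edges P D in inv fx /\
  forall U, uniq U -> {subset U <= vs} -> (forall v, v \in U -> free_at E cv fx v) -> size U <= size cv + size cv.
Proof.
move=> inv0; set f0 := [seq false | _ <- E] in inv0.
have H (s : seq arc) k fx : inv fx -> (nilp (fixable P D fx) \/ k <= nfix fx) ->
    let fx' := foldl (fix_step P D) fx s in inv fx' /\ (nilp (fixable P D fx') \/ k + size s <= nfix fx').
  elim: s k fx => [|a s IH] k fx ifx hk /=; first by rewrite addn0.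
  rewrite -addSnnS; apply: IH; rewrite /fix_step; case: ifP => // nn.
    move: nn; case eF: (fixable P D fx) => [//|p F] _.
    by have [] := @fixable_in fx p ifx _; rewrite ?eF ?mem_head.
  - by left.
  right; move: nn hk; case eF: (fixable P D fx) => [//|p F] _ [//|hk].
  have [lt fp _] := @fixable_in fx p ifx ltac:(by rewrite eF mem_head).
  by have [sf _ _] := ifx; rewrite nfix_set ?sf.
have [ii st] := H E 0 f0 inv0 (or_intror (leq0n _)).
split=> // U Uu Uvs Uf; case: st => [st|full]; first exact: stuck ii st Uu Uvs Uf.
case: U Uu Uvs Uf => // v U _ _ /(_ v (mem_head _ _)) /andP[/odd_inner_incident[a aE av] /hasP[]].
have [sf _ _] := ii; have lt : index a E < m by rewrite index_mem.
exists (nth (arc0, false) (zip E (fix_edges P D)) (index a E)).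
  by rewrite mem_nth // size_zip /fix_edges /= sf minnn.
rewrite nth_zip ?sf // nth_index //= av andbT.
by apply: (nfix_all (fx := fix_edges P D)); rewrite ?mem_nth ?sf // /fix_edges /= sf.
Qed.
End Greedy.

(** * Rounding and routing *)

Local Open Scope ring_scope.

Section Bridge.
Variables (A : seq arc) (vs : seq nat) (F : nat -> nat * nat * nat) (n : nat).
Hypotheses (Avs : forall a, a \in A -> (a.1.1 \in vs) && (a.1.2 \in vs))
  (vsn : forall v, v \in vs -> (v <= n)%N).
Let m := size A.
Let V := 'I_n.+1.
Let tl (j : 'I_m) : V := inord (atail A j).
Let hd (j : 'I_m) : V := inord (ahead A j).
Let zeros := [seq 0%N | _ <- A].

Lemma int_flow_of_int (z : 'I_m -> int) :
  (forall j, 0 <= z j <= acap A j) -> (forall v, flo vs F v <= excess tl hd z v <= fhi vs F v) ->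
  exists y, int_flow A vs F zeros y.
Proof.
move=> z1 z2; pose y := [seq (if insub j is Some i then `|z i|%N else 0%N) | j <- iota 0 m].
have sy : size y = m by rewrite size_map size_iota.
have yE (j : 'I_m) : (nth 0%N y j : int) = z j.
  rewrite (nth_map 0%N) ?size_iota // nth_iota // add0n valK.
  by have /andP[] := z1 j; case: (z j).
exists y; apply/(int_flowP F Avs vsn) => //; first exact: size_map.
split=> [j|v].
  have /andP[_] := z1 j; rewrite -yE lez_nat => ->; rewrite andbT.
  by rewrite (nth_map arc0).
have -> : exc A v (ratv y) = (excess tl hd z v)%:~R.
  rewrite -(excE Avs vsn) /excess rmorph_sum; apply: eq_bigr => j _.
  rewrite rmorphB !rmorphMn /= -yE /ratv. by rewrite -!pmulrn.
by rewrite !ler_int; exact: z2.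
Qed.

Lemma int_flow_val y : int_flow A vs F zeros y ->
  [/\ size y = m, forall j, (j < m)%N -> (nth 0 y j <= acap A j)%N &
     forall v, v \in vs -> ((F v).1.2)%:R - ((F v).2)%:R <= exc A v (ratv y) <= ((F v).2)%:R - ((F v).1.1)%:R].
Proof.
move=> fl; have [sy _] := fl; have sz : size zeros = m by exact: size_map.
move: fl => /(int_flowP F Avs vsn sz sy)[H1 H2]; split=> // [j lt|v vin].
  by have /andP[] := H1 (Ordinal lt).
have lt : (v < n.+1)%N by rewrite ltnS vsn.
by have := H2 (Ordinal lt); rewrite /flo /fhi /= vin !rmorphB /= -!pmulrn.
Qed.
End Bridge.

Section Half.
Variables (A : seq arc) (vs : seq nat) (X Y : nat -> nat) (n : nat).
Hypotheses (Avs : forall a, a \in A -> (a.1.1 \in vs) && (a.1.2 \in vs))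
  (vsn : forall v, v \in vs -> (v <= n)%N).
Let m := size A.
Let F v := (X v, Y v, (X v + Y v + 1)./2)%N.
Let zeros := [seq 0%N | _ <- A].

Lemma halfE (k : nat) : ((k + 1)./2)%:R = (k%:R + (odd k)%:R) / 2 :> rat.
Proof.
rewrite addn1 -uphalfE uphalf_half.
have e : k%:R = (odd k)%:R + k./2%:R * 2 :> rat by rewrite -{1}(odd_double_half k) natrD -muln2 natrM.
rewrite natrD; lra.
Qed.

Lemma half_feasible (y : nat -> rat) (eps : rat) : 0 <= eps ->
  (forall j, (j < m)%N -> - eps <= y j <= (acap A j)%:R + eps) ->
  (forall v, v \in vs -> `|exc A v y - ((Y v)%:R - (X v)%:R) / 2| <= eps) ->
  eps * (m + size vs)%:R < 1 ->
  exists z, int_flow A vs F zeros z.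
Proof.
move=> e0 Hy Hv small.
have [|||||||z [z1 z2]] := @int_round 'I_n.+1 'I_m (fun j => inord (atail A j)) (fun j => inord (ahead A j))
   (fun=> 0) (fun j => acap A j) (@flo vs F n) (@fhi vs F n) (fun j => y j) (@vtol vs n eps) eps.
- by [].
- move=> v; rewrite /flo /fhi; case: ifP => //= _.
  rewrite -(ler_int rat) !rmorphB /= -!pmulrn halfE natrD.
  have : 0 <= (odd (X v + Y v))%:R :> rat by exact: ler0n.
  by lra.
- by [].
- by move=> v; exact: vtol_ge0.
- by move=> j; rewrite sub0r -pmulrn; exact: Hy.
- move=> v; rewrite (excE Avs vsn) /flo /fhi /vtol; case: ifP => [vin|/negbT nv]; last first.
    by rewrite (exc_notin Avs) // subr0 addr0 lexx.
  have := Hv _ vin; rewrite !rmorphB /= -!pmulrn halfE natrD ler_norml.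
  have : 0 <= (odd (X v + Y v))%:R :> rat by exact: ler0n.
  by move=> h /andP[h1 h2]; apply/andP; split; lra.
- apply: le_lt_trans small; rewrite natrD mulrDr card_ord mulr_natr lerD2l.
  by rewrite mulr_natr; exact: sum_vtol.
by apply: (int_flow_of_int Avs vsn z1).
Qed.

Lemma half_val z : int_flow A vs F zeros z ->
  [/\ size z = m, forall j, (j < m)%N -> (nth 0 z j <= acap A j)%N &
     forall v, v \in vs -> `|exc A v (ratv z) - ((Y v)%:R - (X v)%:R) / 2| <= (odd (X v + Y v))%:R / 2].
Proof.
case/(int_flow_val Avs vsn) => sz H1 H2; split=> // v /H2; rewrite /F /= halfE natrD => /andP[h1 h2].
by rewrite ler_norml; apply/andP; split; lra.
Qed.
End Half.

(** * Routing inside one commodity *)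

Section Route.
Variables (A : seq arc) (vs T : seq nat) (s t d L Z n : nat).
Hypotheses (Avs : forall a, a \in A -> (a.1.1 \in vs) && (a.1.2 \in vs))
  (vsn : forall v, v \in vs -> (v <= n)%N) (st : s != t) (svs : s \in vs) (tvs : t \in vs)
  (TL : (size T <= L)%N) (dZ : (d <= Z)%N)
  (near : forall v, v \in vs -> `|exc A v (fun j => (acap A j)%:R) - d%:R * ((v == s)%:R - (v == t)%:R)| <= (v \in T)%:R).
Let m := size A.
Let V := 'I_n.+1.
Let tl (j : 'I_m) : V := inord (atail A j).
Let hd (j : 'I_m) : V := inord (ahead A j).
Let F v := if v == s then (0%N, (d - L + Z)%N, Z) else if v == t then (0%N, 0%N, Z) else (0%N, 0%N, 0%N).
Let zeros := [seq 0%N | _ <- A].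

(** The capacities themselves form a flow of value d from s to t with error at most 1 at the
    vertices of T. A set with s but without t therefore has outgoing capacity at least d - |T| >= d
    - L; all other cut conditions are trivial. *)
Lemma route_feasible : exists y, int_flow A vs F zeros y.
Proof.
pose cap (j : 'I_m) : int := acap A j.
have ex (v : V) : (excess tl hd cap v)%:~R = exc A v (fun j => (acap A j)%:R) :> rat.
  rewrite -(excE Avs vsn) /excess rmorph_sum; apply: eq_bigr => j _.
  by rewrite rmorphB !rmorphMn /= -!pmulrn.
have cge0 (X : {set V}) : 0 <= cutval tl hd (fun=> 0) cap X.
  by apply: sumr_ge0 => j _; rewrite mul0rn subr0 mulrn_wge0.
have cle (X : {set V}) : \sum_(v in X) excess tl hd cap v <= cutval tl hd (fun=> 0) cap X.
  by rewrite excess_set; apply: ler_sum => j _; rewrite lerD2l lerN2 mul0rn mulrn_wge0.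
have loE (v : V) : flo vs F v = (Posz (d - L)) *+ (val v == s) - (Posz Z) *+ (val v == t).
  rewrite /flo /F; case: ifP => [_|/negbT nv].
    case: (eqVneq (val v) s) => [->|_]; first by rewrite (negbTE st) /= subr0; lia.
    by case: eqVneq => _ /=; rewrite ?sub0r ?subr0.
  by case: eqVneq nv => [->|_]; rewrite ?svs //; case: eqVneq => [->|_]; rewrite ?tvs.
have hi0 (v : V) : 0 <= fhi vs F v.
  by rewrite /fhi /F; case: ifP => // _; case: eqP => _ /=; [|case: eqP => _ /=]; rewrite ?subr0.
have pick (X : {set V}) (w : nat) (c : int) (lt : (w < n.+1)%N) :
    \sum_(v in X) c *+ (val v == w) = c *+ (Ordinal lt \in X).
  case: (boolP (Ordinal lt \in X)) => wX; last first.
    rewrite big1 // => v vX; case: eqP => // e.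
    by move: vX; rewrite (_ : v = Ordinal lt) ?(negbTE wX) //; exact: val_inj.
  rewrite (bigD1 (Ordinal lt)) //= eqxx big1 ?addr0 // => v /andP[_].
  by rewrite -val_eqE /= => /negbTE ->.
have ls : (s < n.+1)%N by rewrite ltnS vsn.
have lt : (t < n.+1)%N by rewrite ltnS vsn.
have [||||y [y1 y2]] := @transshipment int V 'I_m tl hd (fun=> 0) cap (@flo vs F n) (@fhi vs F n).
- by [].
- move=> v; rewrite loE /fhi /F; case: ifP => [_|/negbT nv].
    case: (eqVneq (val v) s) => [->|_]; first by rewrite (negbTE st) /=; lia.
    by case: eqVneq => _ /=; lia.
  by case: eqVneq nv => [->|_]; rewrite ?svs //; case: eqVneq => [->|_]; rewrite ?tvs.
- move=> X; rewrite (eq_bigr _ (fun v _ => loE v)) sumrB !(pick _ _ _ ls) !(pick _ _ _ lt).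
  case: (boolP (Ordinal lt \in X)) => tX.
    by apply: le_trans (cge0 X); case: (_ \in X); lia.
  case: (boolP (Ordinal ls \in X)) => sX; last by rewrite subr0; exact: cge0.
  rewrite subr0 mulr1n; case: (leqP d L) => dL.
    by have -> : (d - L)%N = 0%N by [apply/eqP]; exact: cge0.
  apply: le_trans (cle X).
  have H : \sum_(v in X) (d%:Z *+ (val v == s) - (d%:Z *+ (val v == t)) - (val v \in T)%:Z) <= \sum_(v in X) excess tl hd cap v.
    apply: ler_sum => v _; rewrite -(ler_int rat) ex !rmorphB !rmorphMn /= -!pmulrn.
    case: (boolP (val v \in vs)) => vin.
      by have := near vin; rewrite ler_norml => /andP[h _]; move: h; rewrite mulrBr !mulr_natr; lra.
    rewrite (exc_notin Avs) //; have vns : (val v == s) = false by apply: contraNF vin => /eqP ->.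
    have vnt : (val v == t) = false by apply: contraNF vin => /eqP ->.
    by rewrite vns vnt !mulr0n subrr sub0r oppr_le0.
  apply: le_trans H; rewrite !sumrB !(pick _ _ _ ls) !(pick _ _ _ lt) sX (negbTE tX) mulr1n mulr0n subr0.
  have cT : \sum_(v in X) (val v \in T)%:Z <= (size T)%:Z.
    rewrite -(big_morph Posz PoszD (erefl _)) lez_nat -big_mkcondr /= sum1_card.
    apply: leq_trans (_ : #|[seq inord v | v <- T] : seq V| <= _)%N; last first.
      by apply: leq_trans (card_size _) _; rewrite size_map.
    apply/subset_leq_card/subsetP => v /andP[_ vT].
    by apply/mapP; exists (val v); rewrite ?inord_val.
  move: cT; set S := \sum_(v in X) _; move=> cT.
  by rewrite -subzn ?(ltnW dL) // lerD2l lerN2; apply: le_trans cT _; rewrite lez_nat.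
- move=> X; apply: le_trans (_ : 0 <= _); last by apply: sumr_ge0.
  by rewrite -oppr_ge0 -sumrN; apply: sumr_ge0 => j _; rewrite mul0rn sub0r opprK mulrn_wge0.
by apply: (int_flow_of_int Avs vsn y1).
Qed.

Lemma route_val y : int_flow A vs F zeros y ->
  [/\ size y = m, forall j, (j < m)%N -> (nth 0 y j <= acap A j)%N,
     forall v, v \in vs -> v != s -> v != t -> exc A v (ratv y) = 0 & (d - L)%:R <= exc A s (ratv y)].
Proof.
case/(int_flow_val Avs vsn) => sz H1 H2; split=> // [v vin ns nt|].
  by have := H2 _ vin; rewrite /F (negbTE ns) (negbTE nt) /= subr0 => h; apply/esym/eqP; rewrite eq_le.
by have := H2 _ svs; rewrite /F eqxx /= natrD addrK => /andP[].
Qed.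
End Route.

Local Close Scope ring_scope.

(** * Parity after fixing *)

Local Open Scope ring_scope.

Section EvenPart.
Variables (E : seq arc) (cv vs : seq nat) (q : terms) (N kp tau n : nat) (fx : seq bool).
Let m := size E.
Hypotheses (loopless : forall a, a \in E -> a.1.1 != a.1.2)
  (Evs : forall a, a \in E -> (a.1.1 \in vs) && (a.1.2 \in vs))
  (vsn : forall v, v \in vs -> (v <= n)%N)
  (covered : forall a, a \in E -> (a.1.1 \in cv) || (a.1.2 \in cv))
  (cv_terms : forall v, v \notin cv -> [/\ supply q v = 0%N, demand q v = 0%N,
     supply (swap2 q) v = 0%N & demand (swap2 q) v = 0%N])
  (sf : size fx = m)
  (Ho : forall j, nth false fx j -> exists2 v, incident (nth arc0 E j) v & odd_inner E cv v)
  (N3 : (2 * kp + 3 * tau < N)%N) (small : ((kp + 2 * tau) * (m + size vs) < 2 * N)%N).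
Let A := even_arcs E fx.
Let fxj j := nth false fx j.

Lemma size_even : size A = m.
Proof. by rewrite size_map size_zip sf minnn. Qed.

Lemma nth_even j : (j < m)%N -> nth arc0 A j = ((nth arc0 E j).1, (acap E j - fxj j)%N).
Proof.
move=> lt; rewrite (nth_map (arc0, false)) ?size_zip ?sf ?minnn // nth_zip ?sf //.
Qed.
Lemma atail_even j : (j < m)%N -> atail A j = atail E j.
Proof. by move=> lt; rewrite /atail nth_even. Qed.
Lemma ahead_even j : (j < m)%N -> ahead A j = ahead E j.
Proof. by move=> lt; rewrite /ahead nth_even. Qed.
Lemma acap_even j : (j < m)%N -> acap A j = (acap E j - fxj j)%N.
Proof. by move=> lt; rewrite /acap nth_even. Qed.

Lemma exc_even v x : exc A v x = exc E v x.
Proof. by rewrite /exc size_even; apply: eq_bigr => j _; rewrite atail_even // ahead_even. Qed.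

Lemma even_Avs a : a \in A -> (a.1.1 \in vs) && (a.1.2 \in vs).
Proof.
case/(nthP arc0) => j; rewrite size_even => lt <-; rewrite nth_even //=.
exact: Evs (mem_nth _ _).
Qed.
Lemma even_loopless a : a \in A -> a.1.1 != a.1.2.
Proof.
case/(nthP arc0) => j; rewrite size_even => lt <-; rewrite nth_even //=.
exact: loopless (mem_nth _ _).
Qed.

Section Feasible.
Variables (lm : nat -> rat) (lm0 : forall j, (j < m)%N -> 0 <= lm j)
  (lmfix : forall j, (j < m)%N -> (if fxj j then N else 0)%:R <= lm j + kp%:R + tau%:R).

(** With capacity 0 the two bounds on lambda add up to lambda <= tau, far below the N - kp - tau
    required at a fixed edge. *)
Lemma cap_fixed (p : nat -> rat) j : (j < m)%N -> lm j <= p j + tau%:R ->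
  p j + lm j <= (N * (acap E j + acap E j))%:R + tau%:R -> (fxj j <= acap E j)%N.
Proof.
move=> lt h1 h2; have := lmfix lt; case: (fxj j) => // h3.
rewrite lt0n; apply/eqP => c0; move: h2; rewrite c0 addn0 muln0.
have : (2 * kp + 3 * tau)%:R < N%:R :> rat by rewrite ltr_nat.
have : 0 <= tau%:R :> rat by exact: ler0n.
have : 0 <= kp%:R :> rat by exact: ler0n.
by rewrite natrD !natrM; move: h1 h3; lra.
Qed.

Definition half_bounds (q' : terms) v := (demand q' v + in_cap A v, supply q' v + out_cap A v,
  ((demand q' v + in_cap A v) + (supply q' v + out_cap A v) + 1)./2)%N.

(** With c' the capacity left after fixing, the fractional flow is (g + c') / 2, which is p / (2 N)
    - fx / 2. At a fixed edge lambda is almost a full unit and keeps it inside [0, c'] up to (kp + 2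
    tau) / (2 N); [small] makes the total error less than 1. *)
Lemma half_flow_exists q' (p : nat -> rat) :
  (forall j, (j < m)%N -> [/\ 0 <= p j, lm j <= p j + tau%:R &
    p j + lm j <= (N * (acap E j + acap E j))%:R + tau%:R]) ->
  (forall v, v \in vs -> `|exc E v p - N%:R * wdiv E q' v| <= tau%:R) ->
  exists z, int_flow A vs (half_bounds q') [seq 0%N | _ <- A] z.
Proof.
move=> Hp Hv; have N0 : 0 < N%:R :> rat by rewrite ltr0n; case: N N3.
pose eps : rat := (kp%:R + 2 * tau%:R) / (2 * N%:R).
have t0 : 0 <= tau%:R :> rat by exact: ler0n.
have k0 : 0 <= kp%:R :> rat by exact: ler0n.
have epsE : kp%:R + 2 * tau%:R = N%:R * (2 * eps).
  by rewrite /eps; field; rewrite gt_eqF.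
have e0 : 0 <= eps by apply: divr_ge0; [move: t0 k0; lra|move: N0; lra].
have cf j : (j < m)%N -> (fxj j <= acap E j)%N.
  by move=> lt; have [h1 h2 h3] := Hp j lt; exact: cap_fixed lt h2 h3.
pose y j := p j / N%:R / 2 - (fxj j)%:R / 2.
apply: (@half_feasible A vs (fun v => demand q' v + in_cap A v)%N (fun v => supply q' v + out_cap A v)%N n even_Avs vsn y eps e0).
- rewrite size_even => j lt; rewrite acap_even // natrB ?cf //.
  have [h1 h2 h3] := Hp j lt; have h4 := lmfix lt; have h5 := lm0 lt.
  pose P := p j / N%:R; pose L := lm j / N%:R; pose K := kp%:R / N%:R : rat; pose T := tau%:R / N%:R : rat.
  have eP : p j = N%:R * P by rewrite mulrC divfK // gt_eqF.
  have eL : lm j = N%:R * L by rewrite mulrC divfK // gt_eqF.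
  have eK : kp%:R = N%:R * K by rewrite mulrC divfK // gt_eqF.
  have eT : tau%:R = N%:R * T by rewrite mulrC divfK // gt_eqF.
  have eE : 2 * eps = K + 2 * T by apply: (mulfI (lt0r_neq0 N0)); rewrite -epsE eK eT; ring.
  have P0 : 0 <= P by rewrite /P divr_ge0 // ltW.
  have L0 : 0 <= L by rewrite /L divr_ge0 // ltW.
  have K0 : 0 <= K by rewrite /K divr_ge0 // ltW.
  have T0 : 0 <= T by rewrite /T divr_ge0 // ltW.
  have g2 : L <= P + T by move: h2; rewrite eP eL eT -mulrDr ler_pM2l.
  have g3 : P + L <= ((acap E j)%:R + (acap E j)%:R) + T.
    by move: h3; rewrite eP eL eT natrM natrD -!mulrDr ler_pM2l.
  have g4 : (fxj j)%:R <= L + K + T.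
    move: h4; rewrite eL eK eT; case: (fxj j); rewrite -!mulrDr; last by rewrite mulr0n => _; lra.
    by rewrite -[leLHS]mulr1 ler_pM2l.
  rewrite /y -/P; move: g4 g2 g3 eE; case: (fxj j) => /=; rewrite ?mulr1n ?mulr0n => g4 g2 g3 eE.
    by apply/andP; split; lra.
  by apply/andP; split; lra.
- move=> v vin; rewrite exc_even.
  have -> : exc E v y = exc E v p / N%:R / 2 - exc E v (fun j => (fxj j)%:R) / 2.
    rewrite /exc !mulr_suml -sumrB; apply: eq_bigr => j _; rewrite /y; ring.
  have eA : exc E v (fun j => (acap A j)%:R) = exc E v (fun j => (acap E j)%:R) - exc E v (fun j => (fxj j)%:R).
    rewrite /exc -sumrB; apply: eq_bigr => j _.
    by rewrite acap_even // natrB ?cf // mulrBr.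
  have := exc_cap A v; rewrite exc_even eA exc_cap => eA'.
  have hv := Hv v vin; pose X := exc E v p / N%:R; pose T := tau%:R / N%:R : rat.
  have eX : exc E v p = N%:R * X by rewrite mulrC divfK // gt_eqF.
  have eT : tau%:R = N%:R * T by rewrite mulrC divfK // gt_eqF.
  have hX : `|X - wdiv E q' v| <= T.
    by move: hv; rewrite eX eT -mulrBr normrM gtr0_norm // ler_pM2l.
  have Te : T <= eps.
    rewrite -(ler_pM2l N0) -eT; move: epsE; rewrite mulrCA; move: k0; set Ne := N%:R * eps; lra.
  rewrite -/X; move: hX; rewrite /wdiv !natrD !ler_norml => /andP[hX1 hX2].
  by apply/andP; split; lra.
rewrite size_even /eps mulrAC ltr_pdivrMr ?mul1r ?mulr_gt0 //.
by rewrite -!natrM -natrD -natrM ltr_nat.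
Qed.
End Feasible.

Definition free_vertices := undup [seq v <- vs | free_at E cv fx v].

Lemma incidentE j v : (j < m)%N -> (incident (nth arc0 E j) v : nat) = ((atail E j == v) + (ahead E j == v))%N.
Proof.
move=> lt; rewrite /incident -/(atail E j) -/(ahead E j).
have := loopless (mem_nth arc0 lt); rewrite -/(atail E j) -/(ahead E j).
by move=> ne; case: (eqVneq (atail E j) v) => [e|] //=; rewrite -e [ahead E j == _]eq_sym (negbTE ne).
Qed.

Definition fixed_degree v := (\sum_(j < m) (incident (nth arc0 E j) v && fxj j))%N.

Lemma cap_even_fixed v : (forall j, (j < m)%N -> (fxj j <= acap E j)%N) ->
  (out_cap A v + in_cap A v + fixed_degree v = out_cap E v + in_cap E v)%N.
Proof.
move=> cf; rewrite !out_capE !in_capE size_even -!big_split /=; apply: eq_bigr => j _.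
rewrite atail_even // ahead_even // acap_even // -!mulnDl -incidentE //.
have := cf j (ltn_ord j); by case: incident; case: (fxj j) => /= le; rewrite ?mul1n ?mul0n ?subn0 ?addn0 // subnK.
Qed.

(** Two fixed edges at v would have lambda of total at least 2 (N - kp - tau), and [N3] says that
    this exceeds N + tau. *)
Lemma fixed_degree_odd lm v : (forall j, (j < m)%N -> 0 <= lm j) ->
  (forall j, (j < m)%N -> (if fxj j then N else 0)%:R <= lm j + kp%:R + tau%:R) ->
  `|lamsum E lm v - N%:R| <= tau%:R -> odd_inner E cv v -> ~~ free_at E cv fx v -> fixed_degree v = 1%N.
Proof.
move=> lm0 lmfix lam oi; rewrite /free_at oi negbK => /hasP[[a [|]]] abin //= ia.
case/(nthP (arc0, false)): abin => j; rewrite size_zip sf minnn => lt.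
rewrite nth_zip ?sf // => -[aE fj].
rewrite /fixed_degree (bigD1 (Ordinal lt)) //= aE ia /fxj fj big1 // => i ne; apply/eqP; rewrite eqb0; apply/negP => /andP[ii fi].
move: lam; rewrite ler_norml /lamsum => /andP[_].
rewrite (bigD1 (Ordinal lt)) //= (bigD1 i) //= aE ia ii !mul1r.
set S := \sum_(k < _ | _) _; have S0 : 0 <= S by apply: sumr_ge0 => k _; rewrite mulr_ge0 ?ler0n ?lm0.
have h1 := lmfix j lt; have h2 := lmfix i (ltn_ord i); move: h1 h2; rewrite /fxj fj; have -> : nth false fx i = true := fi.
have : (2 * kp + 3 * tau)%:R < N%:R :> rat by rewrite ltr_nat.
by rewrite natrD !natrM; lra.
Qed.

(** An odd inner vertex that is not free loses exactly one unit and becomes even. An even inner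
    vertex loses none: a fixed edge has an odd end outside the cover, and it cannot have a second
    end outside. *)
Lemma parity q' lm v : (forall j, (j < m)%N -> (fxj j <= acap E j)%N) ->
  (forall j, (j < m)%N -> 0 <= lm j) ->
  (forall j, (j < m)%N -> (if fxj j then N else 0)%:R <= lm j + kp%:R + tau%:R) ->
  (odd_inner E cv v -> `|lamsum E lm v - N%:R| <= tau%:R) ->
  (v \notin cv -> supply q' v = 0%N /\ demand q' v = 0%N) -> v \in vs ->
  odd ((demand q' v + in_cap A v) + (supply q' v + out_cap A v)) -> v \in cv ++ free_vertices.
Proof.
move=> cf lm0 lmfix lam qv vin; rewrite mem_cat; case: (boolP (v \in cv)) => //= nv.
rewrite mem_undup mem_filter vin andbT; have [-> ->] := qv nv; rewrite !add0n => od.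
apply: contraT => nf; have := cap_even_fixed v cf; rewrite [(out_cap A v + _)%N]addnC => eq.
case: (boolP (odd_inner E cv v)) => oi.
  have := fixed_degree_odd lm0 lmfix (lam oi) oi nf => fd.
  have := oi; rewrite /odd_inner -eq fd => /andP[]; rewrite addn1 /=.
  by rewrite od.
have fd : fixed_degree v = 0%N.
  rewrite /fixed_degree big1 // => j _; apply/eqP; rewrite eqb0; apply/negP => /andP[ij fj].
  have [w iw ow] := Ho fj; have nw : w \notin cv by case/andP: ow; rewrite mem_natE.
  case: (eqVneq v w) => [e|ne]; first by rewrite e ow in oi.
  by have := not_shared covered (ltn_ord j) nv nw ne ij; rewrite iw.
by move: oi; rewrite /odd_inner -eq fd addn0 od mem_natE (negbTE nv).
Qed.
End EvenPart.

Local Close Scope ring_scope.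

(** * The two commodities *)

Local Open Scope ring_scope.

Section RouteArcs.
Variables (E : seq arc) (fw bw : seq nat).
Let m := size E.
Hypotheses (sw : size fw = m) (sb : size bw = m).
Let A := route_arcs E fw bw.

Lemma size_route : size A = (m + m)%N.
Proof. by rewrite size_cat !size_map !size_zip sw sb minnn. Qed.

Lemma nth_route_fw j : (j < m)%N -> nth arc0 A j = ((nth arc0 E j).1, nth 0%N fw j).
Proof.
move=> lt; rewrite nth_cat size_map size_zip sw minnn lt (nth_map (arc0, 0%N)) ?size_zip ?sw ?minnn //.
by rewrite nth_zip ?sw.
Qed.
Lemma nth_route_bw j : (j < m)%N -> nth arc0 A (m + j) = (ahead E j, atail E j, nth 0%N bw j).
Proof.
move=> lt; rewrite nth_cat size_map size_zip sw minnn ltnNge leq_addr addKn /=.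
by rewrite (nth_map (arc0, 0%N)) ?size_zip ?sb ?minnn // nth_zip ?sb.
Qed.

Lemma route_nthP (Q : arc -> Prop) :
  (forall j, (j < m)%N -> Q ((nth arc0 E j).1, nth 0%N fw j)) ->
  (forall j, (j < m)%N -> Q (ahead E j, atail E j, nth 0%N bw j)) ->
  forall j, (j < m + m)%N -> Q (nth arc0 A j).
Proof.
move=> h1 h2 j lt; case: (ltnP j m) => le; first by rewrite nth_route_fw //; exact: h1.
have lt' : (j - m < m)%N by rewrite ltn_subLR.
by rewrite -(subnKC le) nth_route_bw //; exact: h2.
Qed.

Lemma exc_route v x : exc A v x = exc E v (fun j => x j - x (m + j)%N).
Proof.
rewrite /exc size_route big_split_ord /= -big_split /=; apply: eq_bigr => j _.
by rewrite /atail /ahead nth_route_fw // nth_route_bw //= /atail /ahead; ring.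
Qed.

Lemma exc_route_cap v : exc A v (fun j => (acap A j)%:R) = exc E v (fun j => (nth 0%N fw j)%:R - (nth 0%N bw j)%:R).
Proof.
by rewrite exc_route; apply: eq_bigr => j _; rewrite /acap nth_route_fw // nth_route_bw.
Qed.
End RouteArcs.

Lemma nat_diff (a b : nat) : (a - b)%N%:R - (b - a)%N%:R = a%:R - b%:R :> rat.
Proof.
by case: (leqP a b) => h; [have /eqP -> : (a - b)%N == 0%N by [] | have /eqP -> : (b - a)%N == 0%N by exact: ltnW];
  rewrite natrB ?(ltnW h) //; ring.
Qed.

Lemma zip_take (T U : Type) (s1 : seq T) (s2 : seq U) : zip s1 s2 = zip s1 (take (size s1) s2).
Proof. by elim: s1 s2 => [|a s1 IH] [|b s2] //=; rewrite -IH. Qed.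

Section TwoFlow.
Variables (P : param) (l : seq unit) (B m : nat) (vs : seq nat) (n : nat).
Let M := pM P.
Let N := pN P.
(** Routing uses two opposite arcs per edge, so the parameters must serve twice as many arcs. *)
Let m2 := (m + m)%N.
Hypotheses (mM : (m2 <= M)%N) (M0 : (0 < M)%N)
  (HN : ((m2 + size vs) * M + 2 * M < N)%N) (Hsc : psc P = scales M l)
  (HR : (m2 * ((2 * M) * (m2 + size vs)) ^ 2 < size (pR P))%N)
  (HB : (N * B <= 2 * (M * 2 ^ size l))%N) (HB2 : (B < 2 ^ (size l).+1)%N)
  (vsn : forall v, v \in vs -> (v <= n)%N).

Lemma intflow_ok A (F : nat -> nat * nat * nat) : (size A <= m2)%N ->
  (forall a, a \in A -> a.1.1 != a.1.2) -> (forall a, a \in A -> (a.1.1 \in vs) && (a.1.2 \in vs)) ->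
  (forall j, (acap A j <= B)%N) ->
  (forall v, ((F v).1.1 + (F v).1.2 <= (F v).2 + (F v).2)%N) ->
  (forall v, ((F v).1.1 <= (F v).2 + B)%N /\ ((F v).1.2 <= (F v).2 + B)%N) ->
  (exists y, int_flow A vs F [seq 0%N | _ <- A] y) ->
  int_flow A vs F [seq 0%N | _ <- A] (intflow P A [seq (v, F v) | v <- vs]).
Proof.
move=> sA nl Avs capB Fok FB.
apply: (intflow_correct nl Avs vsn Fok (l := l)) => //.
- exact: leq_trans sA mM.
- by apply: leq_ltn_trans HN; rewrite leq_add2r leq_mul2r leq_add2r sA orbT.
- apply: leq_ltn_trans HR; rewrite leq_mul // leq_exp2r // leq_mul2l leq_add2r sA.
  by rewrite orbT.
- by move=> j; apply: leq_trans HB; rewrite leq_mul2l capB orbT.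
- move=> w /mapP[v _ ->] /=; have [h1 h2] := FB v.
  by split; apply: leq_trans (_ : N * ((F v).2 + B) <= _)%N; rewrite ?leq_mul2l ?h1 ?h2 ?orbT // mulnDr leq_add2l.
- by move=> j; apply: leq_ltn_trans HB2.
Qed.

Variables (E : seq arc) (T : seq nat) (L : nat).
Hypotheses (sE : size E = m) (loopless : forall a, a \in E -> a.1.1 != a.1.2)
  (Evs : forall a, a \in E -> (a.1.1 \in vs) && (a.1.2 \in vs)) (TL : (size T <= L)%N).

Lemma route_correct s t d fw bw : s != t -> s \in vs -> t \in vs -> size fw = m -> size bw = m ->
  (d <= B)%N -> (forall j, (j < m)%N -> (nth 0 fw j <= B)%N /\ (nth 0 bw j <= B)%N) ->
  (forall v, v \in vs -> `|exc E v (fun j => (nth 0%N fw j)%:R - (nth 0%N bw j)%:R) - d%:R * ((v == s)%:R - (v == t)%:R)| <= (v \in T)%:R) ->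
  let r := route P E vs s t d L fw bw in
  [/\ size r = m, forall j, (j < m)%N -> ((nth (0, 0) r j).1 <= nth 0 fw j)%N /\ ((nth (0, 0) r j).2 <= nth 0 bw j)%N,
    forall v, v \in vs -> v != s -> v != t -> exc E v (fun j => (nth (0, 0)%N r j).1%:R - (nth (0, 0)%N r j).2%:R) = 0 &
    (d - L)%:R <= exc E s (fun j => (nth (0, 0)%N r j).1%:R - (nth (0, 0)%N r j).2%:R)].
Proof.
move=> st svs tvs sw sb dB capB near r.
have sw' : size fw = size E by rewrite sE.
have sb' : size bw = size E by rewrite sE.
have dZ : (d <= sumn fw + sumn bw + d)%N by exact: leq_addl.
set Z := (sumn fw + sumn bw + d)%N in dZ.
pose F v := if v == s then (0%N, (d - L + Z)%N, Z) else if v == t then (0%N, 0%N, Z) else (0%N, 0%N, 0%N).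
set A := route_arcs E fw bw.
have Avs a : a \in A -> (a.1.1 \in vs) && (a.1.2 \in vs).
  case/(nthP arc0) => j; rewrite size_route // => lt <-; move: j lt.
  apply: (route_nthP sw' sb' (Q := fun a => (a.1.1 \in vs) && (a.1.2 \in vs))) => j lt /=.
    exact: Evs (mem_nth _ _).
  by rewrite andbC; exact: Evs (mem_nth _ _).
have nl a : a \in A -> a.1.1 != a.1.2.
  case/(nthP arc0) => j; rewrite size_route // => lt <-; move: j lt.
  apply: (route_nthP sw' sb' (Q := fun a => a.1.1 != a.1.2)) => j lt /=.
    exact: loopless (mem_nth _ _).
  by rewrite eq_sym; exact: loopless (mem_nth _ _).
have cB j : (acap A j <= B)%N.
  case: (ltnP j (size E + size E)) => lt; last by rewrite /acap nth_default ?size_route.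
  move: j lt; apply: (route_nthP sw' sb' (Q := fun a => (a.2 <= B)%N)) => j; rewrite sE => lt /=; by case: (capB j lt).
have near' v : v \in vs -> `|exc A v (fun j => (acap A j)%:R) - d%:R * ((v == s)%:R - (v == t)%:R)| <= (v \in T)%:R.
  by move=> vin; rewrite exc_route_cap //; exact: near.
have fe := route_feasible Avs vsn st svs tvs TL dZ near'.
have fl : int_flow A vs F [seq 0%N | _ <- A] (intflow P A [seq (v, F v) | v <- vs]).
  apply: intflow_ok => //.
  - by rewrite size_route // sE.
  - by move=> v; rewrite /F; case: ifP => _ /=; [|case: ifP => _ //=]; lia.
  - by move=> v; rewrite /F; case: ifP => _ /=; [|case: ifP => _ //=]; lia.
have [sy y1 y2 y3] := route_val Avs vsn svs fl.
move: sy y1 y2 y3 {fl}; set y := intflow _ _ _; rewrite size_route // => sy y1 y2 y3.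
have dE (U : Type) (s1 : seq U) (u : seq nat) : drop_size u s1 = drop (size s1) u.
  by rewrite /drop_size; elim: s1 u => [|a s1 IH] u /=; rewrite ?drop0 // IH -drop1 drop_drop addn1.
have rE : r = zip (take m y) (drop m y).
  rewrite /r /route -/Z -/A; have -> : route_vcons vs s t d L Z = [seq (v, F v) | v <- vs] by [].
  rewrite -/y dE sE; congr zip.
  by rewrite zip_take -/(unzip2 _) unzip2_zip ?sE // size_takel // sy sE leq_addr.
have st' : size (take m y) = m by rewrite size_takel // sy sE leq_addr.
have sd' : size (drop m y) = m by rewrite size_drop sy sE addKn.
have rN j : (j < m)%N -> nth (0, 0)%N r j = (nth 0%N y j, nth 0%N y (m + j)).
  by move=> lt; rewrite rE nth_zip ?st' ?sd' // nth_take // nth_drop.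
have ee v : exc E v (fun j => (nth (0, 0)%N r j).1%:R - (nth (0, 0)%N r j).2%:R) = exc A v (ratv y).
  rewrite exc_route //; apply: exc_ext => j; rewrite sE => lt; by rewrite rN.
split.
- by rewrite rE size_zip st' sd' minnn.
- move=> j lt; rewrite rN //=; have ltE : (j < size E)%N by rewrite sE.
  have e2 := nth_route_bw sw' sb' ltE; have e1 := nth_route_fw bw sw' ltE; rewrite sE in e2.
  have := y1 j; have := y1 (m + j)%N; rewrite sE ltn_add2l lt ltn_addr // /acap /A e1 e2 /=.
  by move=> /(_ isT) h2 /(_ isT) h1.
- by move=> v vin vs' vt'; rewrite ee y2.
- by rewrite ee.
Qed.
End TwoFlow.

Definition fl0 : nat * nat * nat * nat := (0, 0, 0, 0)%N.

Section TwoFlowCorrect.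
Variables (P : param) (l : seq unit) (B : nat) (E : seq arc) (cv vs : seq nat)
  (s1 t1 s2 t2 d1 d2 kp tau n L : nat) (fx : seq bool).
Let m := size E.
Let q : terms := (s1, t1, s2, t2, d1, d2).
Let M := pM P.
Let N := pN P.
Let m2 := (m + m)%N.
Hypotheses (mM : (m2 <= M)%N) (M0 : (0 < M)%N)
  (HN : ((m2 + size vs) * M + 2 * M < N)%N) (Hsc : psc P = scales M l)
  (HR : (m2 * ((2 * M) * (m2 + size vs)) ^ 2 < size (pR P))%N)
  (HB : (N * B <= 2 * (M * 2 ^ size l))%N) (HB2 : (B < 2 ^ (size l).+1)%N)
  (capB : forall j, (acap E j <= B)%N)
  (divB : forall v, [/\ demand q v + in_cap E v <= B, supply q v + out_cap E v <= B,
     demand (swap2 q) v + in_cap E v <= B & supply (swap2 q) v + out_cap E v <= B]%N)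
  (dB : (d1 <= B)%N /\ (d2 <= B)%N)
  (loopless : forall a, a \in E -> a.1.1 != a.1.2)
  (Evs : forall a, a \in E -> (a.1.1 \in vs) && (a.1.2 \in vs))
  (vsn : forall v, v \in vs -> (v <= n)%N)
  (covered : forall a, a \in E -> (a.1.1 \in cv) || (a.1.2 \in cv))
  (cv_terms : forall v, v \notin cv -> [/\ supply q v = 0%N, demand q v = 0%N,
     supply (swap2 q) v = 0%N & demand (swap2 q) v = 0%N])
  (tvs : [/\ s1 \in vs, t1 \in vs, s2 \in vs & t2 \in vs])
  (nst1 : s1 != t1) (nst2 : s2 != t2)
  (sf : size fx = m)
  (Ho : forall j, nth false fx j -> exists2 v, incident (nth arc0 E j) v & odd_inner E cv v)
  (N3 : (2 * kp + 3 * tau < N)%N) (small : ((kp + 2 * tau) * (m + size vs) < 2 * N)%N)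
  (feas : lpfeas E cv vs q N kp tau%:R fx)
  (TL : (size (cv ++ free_vertices E cv vs fx) <= L)%N).
Let A := even_arcs E fx.
Let T := cv ++ free_vertices E cv vs fx.

Let F q' v := half_bounds E fx q' v.

Lemma acap_even_le j : (acap A j <= acap E j)%N.
Proof.
case: (ltnP j m) => lt; first by rewrite acap_even // leq_subr.
by rewrite {1}/acap nth_default // size_even.
Qed.

Lemma div_even v : (out_cap A v <= out_cap E v)%N /\ (in_cap A v <= in_cap E v)%N.
Proof.
rewrite !out_capE !in_capE size_even //; split; apply: leq_sum => j _.
  by rewrite atail_even // leq_mul2l acap_even_le orbT.
by rewrite ahead_even // leq_mul2l acap_even_le orbT.
Qed.

(** The errors of one half for g and one half for h add up to an error of at most 1 in each
    commodity. *)
Definition half_spec q' z := [/\ size z = m, forall j, (j < m)%N -> (nth 0%N z j <= acap A j)%N &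
  forall v, v \in vs -> `|exc E v (ratv z) - ((supply q' v)%:R + (out_cap A v)%:R - ((demand q' v)%:R + (in_cap A v)%:R)) / 2|
    <= (v \in T)%:R / 2].

Lemma half_spec_intflow q' lm p :
  (forall j, (j < m)%N -> 0 <= lm j) ->
  (forall j, (j < m)%N -> (if nth false fx j then N else 0)%:R <= lm j + kp%:R + tau%:R) ->
  (forall v, v \in vs -> odd_inner E cv v -> `|lamsum E lm v - N%:R| <= tau%:R) ->
  (forall v, v \notin cv -> supply q' v = 0%N /\ demand q' v = 0%N) ->
  (forall v, demand q' v + in_cap E v <= B /\ supply q' v + out_cap E v <= B)%N ->
  (forall j, (j < m)%N -> [/\ 0 <= p j, lm j <= p j + tau%:R &
    p j + lm j <= (N * (acap E j + acap E j))%:R + tau%:R]) ->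
  (forall v, v \in vs -> `|exc E v p - N%:R * wdiv E q' v| <= tau%:R) ->
  half_spec q' (intflow P A (half_vcons q' A vs)).
Proof.
move=> lm0 lmfix lam qv qB Hp Hv.
have fe := half_flow_exists Evs vsn sf N3 small lm0 lmfix Hp Hv.
have cf j : (j < m)%N -> (nth false fx j <= acap E j)%N.
  by move=> lt; have [h1 h2 h3] := Hp j lt; exact: (cap_fixed N3 lmfix lt h2 h3).
have fl : int_flow A vs (F q') [seq 0%N | _ <- A] (intflow P A [seq (v, F q' v) | v <- vs]).
  apply: (@intflow_ok P l B m vs n) => //.
  - by rewrite size_even // leq_addr.
  - exact: even_loopless.
  - exact: even_Avs.
  - by move=> j; apply: leq_trans (acap_even_le j) (capB j).
  - move=> v; rewrite /F /half_bounds /=; set X := (X in (X <= _)%N).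
    by have := odd_double_half (X + 1); rewrite -addnn; case: odd; lia.
  - move=> v; have [h1 h2] := qB v; have [g1 g2] := div_even v; rewrite /F /half_bounds /=.
    by split; apply: leq_trans (leq_addl _ _); [apply: leq_trans h1|apply: leq_trans h2]; rewrite leq_add2l.
have -> : half_vcons q' A vs = [seq (v, F q' v) | v <- vs] by [].
have [sz z1 z2] := half_val (even_Avs Evs sf) vsn fl.
rewrite size_even // in sz z1; split=> // v vin.
have := z2 v vin; rewrite exc_even // !natrD => h; apply: le_trans h _.
have : (odd (demand q' v + in_cap A v + (supply q' v + out_cap A v)) <= (v \in T))%N.
  case: (boolP (odd _)) => // od; rewrite lt0b.
  exact: (parity loopless covered sf Ho N3 cf lm0 lmfix (lam v vin) (qv v) vin od).
by rewrite -(ler_nat rat); lra.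
Qed.

(** Capacities hold because 0 <= a, b <= c' implies |a + b - c'| + |a - b| <= c', and routing never
    increases a flow value. *)
Theorem two_flow_correct : let fl := two_flow P q E vs L A in
  [/\ size fl = m,
    forall j, (j < m)%N -> ((nth fl0 fl j).1.1.1 + (nth fl0 fl j).1.1.2 + ((nth fl0 fl j).1.2 + (nth fl0 fl j).2) <= acap E j)%N,
    (forall v, v \in vs -> v != s1 -> v != t1 -> exc E v (fun j => (nth fl0 fl j).1.1.1%:R - (nth fl0 fl j).1.1.2%:R) = 0) /\
    (d1 - L)%:R <= exc E s1 (fun j => (nth fl0 fl j).1.1.1%:R - (nth fl0 fl j).1.1.2%:R) &
    (forall v, v \in vs -> v != s2 -> v != t2 -> exc E v (fun j => (nth fl0 fl j).1.2%:R - (nth fl0 fl j).2%:R) = 0) /\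
    (d2 - L)%:R <= exc E s2 (fun j => (nth fl0 fl j).1.2%:R - (nth fl0 fl j).2%:R)].
Proof.
have [x [x0 [Hx1 Hx2 Hx3 Hx4]]] := feas.
have lm0 j : (j < m)%N -> 0 <= part3 m x j by move=> _; exact: x0.
have [vs1 vt1 vs2 vt2] := tvs.
have [||||g1 g2 g3] := @half_spec_intflow q (part3 m x) x lm0 Hx2 Hx4.
- by move=> v /cv_terms[].
- by move=> v; have [] := divB v.
- by move=> j lt; have [] := Hx1 j lt.
- by move=> v vin; have [] := Hx3 v vin.
have [||||h1 h2 h3] := @half_spec_intflow (swap2 q) (part3 m x) (part2 m x) lm0 Hx2 Hx4.
- by move=> v /cv_terms[].
- by move=> v; have [] := divB v.
- by move=> j lt; have [] := Hx1 j lt; split=> //; exact: x0.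
- by move=> v vin; have [] := Hx3 v vin.
rewrite /two_flow /q -/q; move: g1 g2 g3 h1 h2 h3.
set zg := intflow _ _ (half_vcons q _ _); set zh := intflow _ _ (half_vcons (swap2 q) _ _).
move=> g1 g2 g3 h1 h2 h3; set z := zip (zip zg zh) A.
have sz : size z = m by rewrite !size_zip g1 h1 size_even // !minnn.
have zN j : (j < m)%N -> nth (0%N, 0%N, arc0) z j = (nth 0%N zg j, nth 0%N zh j, nth arc0 A j).
  move=> lt; rewrite nth_zip; last by rewrite size_zip g1 h1 size_even // minnn.
  by rewrite nth_zip // g1 h1.
have zmN (f : nat * nat * arc -> nat) j : (j < m)%N -> nth 0%N [seq f p | p <- z] j = f (nth 0%N zg j, nth 0%N zh j, nth arc0 A j).
  by move=> lt; rewrite (nth_map (0%N, 0%N, arc0)) ?sz // zN.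
set fw1 := [seq (p.1.1 + p.1.2 - p.2.2)%N | p <- z]; set bw1 := [seq (p.2.2 - (p.1.1 + p.1.2))%N | p <- z].
set fw2 := [seq (p.1.1 - p.1.2)%N | p <- z]; set bw2 := [seq (p.1.2 - p.1.1)%N | p <- z].
have cA j : (acap A j <= B)%N by apply: leq_trans (acap_even_le j) (capB j).
have eA v : exc E v (fun j => (acap A j)%:R) = (out_cap A v)%:R - (in_cap A v)%:R.
  by rewrite -exc_cap exc_even.
have [|||||r1s r1c r1v r1d] := @route_correct P l B m vs n mM M0 HN Hsc HR HB HB2 vsn E T L erefl loopless Evs TL s1 t1 d1 fw1 bw1 nst1 vs1 vt1.
- by rewrite size_map.
- by rewrite size_map.
- by case: dB.
- move=> j lt; rewrite !zmN //=; have := g2 j lt; have := h2 j lt; have := cA j; rewrite /acap.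
  by clear; lia.
- move=> v vin; have -> : exc E v (fun j => (nth 0%N fw1 j)%:R - (nth 0%N bw1 j)%:R) =
      exc E v (ratv zg) + exc E v (ratv zh) - exc E v (fun j => (acap A j)%:R).
    rewrite /exc -big_split -sumrB; apply: eq_bigr => j _ /=; rewrite !zmN //= nat_diff natrD /ratv /acap; ring.
  rewrite eA; have := g3 v vin; have := h3 v vin; rewrite !ler_norml /q /=.
  rewrite ?natrD ?natrM; set X1 := exc _ _ _; set X2 := exc _ _ _.
  by move=> /andP[u1 u2] /andP[u3 u4]; apply/andP; split; lra.
have [|||||r2s r2c r2v r2d] := @route_correct P l B m vs n mM M0 HN Hsc HR HB HB2 vsn E T L erefl loopless Evs TL s2 t2 d2 fw2 bw2 nst2 vs2 vt2.
- by rewrite size_map.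
- by rewrite size_map.
- by case: dB.
- move=> j lt; rewrite !zmN //=; have := g2 j lt; have := h2 j lt; have := cA j; rewrite /acap.
  by clear; lia.
- move=> v vin; have -> : exc E v (fun j => (nth 0%N fw2 j)%:R - (nth 0%N bw2 j)%:R) =
      exc E v (ratv zg) - exc E v (ratv zh).
    rewrite /exc -sumrB; apply: eq_bigr => j _ /=; rewrite !zmN //= nat_diff /ratv; ring.
  have := g3 v vin; have := h3 v vin; rewrite !ler_norml /q /=.
  rewrite ?natrD ?natrM; set X1 := exc _ _ _; set X2 := exc _ _ _.
  by move=> /andP[u1 u2] /andP[u3 u4]; apply/andP; split; lra.
move: r1s r1c r1v r1d r2s r2c r2v r2d.
set r1 := route _ _ _ s1 _ _ _ _ _; set r2 := route _ _ _ s2 _ _ _ _ _.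
move=> r1s r1c r1v r1d r2s r2c r2v r2d; set fl := map _ _.
have flN j : (j < m)%N -> nth fl0 fl j = (nth (0, 0)%N r1 j, (nth (0, 0)%N r2 j).1, (nth (0, 0)%N r2 j).2).
  move=> lt; rewrite (nth_map ((0, 0), (0, 0))%N); last by rewrite size_zip r1s r2s minnn.
  by rewrite nth_zip // r1s r2s.
have e1 v : exc E v (fun j => (nth fl0 fl j).1.1.1%:R - (nth fl0 fl j).1.1.2%:R) =
   exc E v (fun j => (nth (0, 0)%N r1 j).1%:R - (nth (0, 0)%N r1 j).2%:R).
  by rewrite /exc; apply: eq_bigr => i _; rewrite flN.
have e2 v : exc E v (fun j => (nth fl0 fl j).1.2%:R - (nth fl0 fl j).2%:R) =
   exc E v (fun j => (nth (0, 0)%N r2 j).1%:R - (nth (0, 0)%N r2 j).2%:R).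
  by rewrite /exc; apply: eq_bigr => i _; rewrite flN.
split; first by rewrite size_map size_zip r1s r2s minnn.
- move=> j lt; rewrite flN //=; have [a1 a2] := r1c j lt; have [a3 a4] := r2c j lt.
  move: a1 a2 a3 a4; rewrite !zmN //=; have := g2 j lt; have := h2 j lt; have := acap_even_le j.
  by rewrite /acap; clear; lia.
- by split=> [v vin n1 n2|]; rewrite e1 //; exact: r1v.
- by split=> [v vin n1 n2|]; rewrite e2 //; exact: r2v.
Qed.
End TwoFlowCorrect.

Local Close Scope ring_scope.

(** * Instances and their flows *)

Local Open Scope ring_scope.

Section Instance.
Variables (I : inst).
Hypothesis wfI : wf_inst I.
Let E := i_edges I.
Let m := size E.
Let n := i_n I.

Definition joins (v w : nat) (e : nat * nat * nat) :=
  ((e.1.1 == v) && (e.1.2 == w)) || ((e.1.1 == w) && (e.1.2 == v)).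

Lemma edge_ends e : e \in E -> [/\ (e.1.1 < n)%N, (e.1.2 < n)%N & e.1.1 != e.1.2].
Proof. by case: wfI => /allP H _ _ _ /H /and3P. Qed.

Lemma joins_same v w e e' : joins v w e -> joins v w e' -> same_pair e e'.
Proof.
by rewrite /joins /same_pair => /orP[] /andP[/eqP -> /eqP ->] /orP[] /andP[/eqP -> /eqP ->]; rewrite !eqxx ?orbT.
Qed.

Lemma count_joins v w : count (joins v w) E = adjb I v w :> nat.
Proof.
rewrite /adjb -/E; case: wfI => _ + _ _; rewrite -/E; elim: E => //= e s IH /andP[/allP ne pw].
rewrite IH //; case: (boolP (joins v w e)) => je; last by move: je; rewrite /joins => /negbTE ->.
have -> : (has (fun e0 => (e0.1.1 == v) && (e0.1.2 == w) || (e0.1.1 == w) && (e0.1.2 == v)) s) = false.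
  by apply/negbTE/hasPn => e' /ne; apply: contra; exact: joins_same je.
by move: je; rewrite /joins => ->.
Qed.

Definition sgn (e : nat * nat * nat) (v : nat) : int := (e.1.1 == v)%:Z - (e.1.2 == v)%:Z.
Definition net (f : flowfun) (i : 'I_2) (e : nat * nat * nat) : int := (f i e.1.1 e.1.2)%:Z - (f i e.1.2 e.1.1)%:Z.

(** No pair of vertices is joined twice, by [count_joins], so the sum over neighbours is a sum over
    incident edges. *)
Lemma netout_edges f i v : netout I f i v = \sum_(e <- E) sgn e v * net f i e.
Proof.
pose a (x y : nat) : int := (f i x y)%:Z - (f i y x)%:Z.
have aN x y : a x y = - a y x by rewrite /a opprB.
have pick (x : nat) (g : nat -> int) : (x < n)%N -> \sum_(w < n) g w * (x == w)%:Z = g x.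
  move=> lt; rewrite (bigD1 (Ordinal lt)) //= eqxx mulr1 big1 ?addr0 // => w.
  by rewrite -val_eqE /= eq_sym => /negbTE ->; rewrite mulr0.
have -> : netout I f i v = \sum_(w < n) \sum_(e <- E) a v w * (joins v w e)%:Z.
  rewrite /netout big_mkcond /=; apply: eq_bigr => w _.
  rewrite -mulr_sumr -(big_morph Posz PoszD (erefl _)) -big_mkcond /= sum1_count count_joins.
  by case: adjb; rewrite ?mulr1 ?mulr0.
rewrite exchange_big /=; apply: eq_big_seq => e eE; have [l1 l2 ne] := edge_ends eE.
have jE w : (joins v w e)%:Z = (e.1.1 == v)%:Z * (e.1.2 == w)%:Z + (e.1.2 == v)%:Z * (e.1.1 == w)%:Z.
  rewrite /joins; case: (eqVneq e.1.1 v) => [e1|_] /=; last first.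
    by rewrite mul0r add0r andbC; case: (_ == v); case: (_ == w).
  rewrite -e1 [e.1.2 == e.1.1]eq_sym (negbTE ne) andbF orbF mul1r mul0r addr0 //.
rewrite (eq_bigr (fun w : 'I_n => (e.1.1 == v)%:Z * (a v w * (e.1.2 == w)%:Z) + (e.1.2 == v)%:Z * (a v w * (e.1.1 == w)%:Z))); last first.
  by move=> w _; rewrite jE; ring.
rewrite big_split -!mulr_sumr /= !pick // /sgn /net -/(a e.1.1 e.1.2) mulrBl.
case: (eqVneq e.1.1 v) => [e1|_]; case: (eqVneq e.1.2 v) => [e2|_]; rewrite ?mul1r ?mul0r ?addr0 ?add0r ?subr0 ?sub0r //.
- by move: ne; rewrite e1 e2 eqxx.
- by rewrite e1.
- by rewrite e2 aN.
Qed.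

Lemma netout_exc f i v : exc E v (fun j => (f i (atail E j) (ahead E j))%:R - (f i (ahead E j) (atail E j))%:R) = (netout I f i v)%:~R.
Proof.
rewrite netout_edges (big_nth arc0) big_mkord rmorph_sum /exc; apply: eq_bigr => j _.
by rewrite /sgn /net rmorphM !rmorphB /= -!pmulrn.
Qed.

Lemma adjb_sym v w : adjb I v w = adjb I w v.
Proof. by rewrite /adjb; apply: eq_has => e; rewrite orbC. Qed.

Lemma sum_netout f i : \sum_(v < n) netout I f i v = 0.
Proof.
set S := \sum_(v < n) _; suff : S = - S by move: S => S; lia.
rewrite {1}/S /netout (exchange_big_dep xpredT) //= /S -sumrN; apply: eq_bigr => v _.
rewrite /netout -sumrN; apply: eq_big => w; first by rewrite adjb_sym.
by move=> _; rewrite opprB.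
Qed.

(** * From a flow that meets the demands to a solution of the program *)

Section Meets.
Variable f : flowfun.
Hypothesis mf : meets_demands I f.

Lemma ends_lt i : (src I i < n)%N /\ (snk I i < n)%N.
Proof. by case: wfI => _ _ /and4P[? ? ? ?] _; rewrite /src /snk; case: ifP. Qed.

Lemma dem_gt0 i : (0 < dem I i)%N.
Proof. by case: wfI => _ _ _ []; rewrite /dem; case: ifP. Qed.

(** If source and sink coincide, conservation elsewhere and total net outflow 0 leave value 0,
    contrary to the positive demand. *)
Lemma src_neq_snk i : src I i != snk I i.
Proof.
apply/eqP => e; have [[_ cons] val] := mf; have [ls _] := ends_lt i.
have := sum_netout f i; rewrite (bigD1 (Ordinal ls)) //= val big1 ?addr0.
  by have := dem_gt0 i; lia.
move=> v; rewrite -val_eqE /= => ne; apply: cons => //.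
by rewrite -e.
Qed.

Lemma netout_val i v : (v < n)%N -> netout I f i v = (dem I i)%:Z * ((v == src I i)%:Z - (v == snk I i)%:Z).
Proof.
move=> lv; have [[_ cons] val] := mf; have ne := src_neq_snk i; have [ls lt] := ends_lt i.
case: (eqVneq v (src I i)) => [->|ns]; first by rewrite val (negbTE ne); lia.
case: (eqVneq v (snk I i)) => [e|nt]; last by rewrite cons //; lia.
suff h0 : (dem I i)%:Z + netout I f i v = 0 by rewrite sub0r mulrN1; apply/eqP; rewrite -addr_eq0 addrC h0.
rewrite -[RHS](sum_netout f i) (bigD1 (Ordinal ls)) //= (bigD1 (Ordinal lv)) //= val big1 ?addr0 //.
by move=> w; rewrite -!val_eqE /= => /andP[h1 h2]; apply: cons; rewrite -?e.
Qed.

Definition q_of : terms := (i_s1 I, i_t1 I, i_s2 I, i_t2 I, i_d1 I, i_d2 I).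

Variables (cv vs : seq nat) (N kp : nat).
Hypotheses (vsn : forall v, v \in vs -> (v < n)%N)
  (covered : forall a, a \in E -> (a.1.1 \in cv) || (a.1.2 \in cv))
  (cv_terms : forall v, v \notin cv -> [/\ v != i_s1 I, v != i_t1 I, v != i_s2 I & v != i_t2 I]).

Definition load e := (`|net f ord0 e| + `|net f ord_max e|)%N.

Lemma load_le e : e \in E -> (load e <= e.2)%N.
Proof.
move=> eE; have [[cap _] _] := mf; apply: leq_trans (cap e eE); rewrite !big_ord_recl big_ord0 addn0.
have -> : lift ord0 ord0 = ord_max :> 'I_2 by exact: val_inj.
have absB (a b : nat) : (`|a%:Z - b%:Z|%N <= a + b)%N by lia.
by apply: leq_add; exact: absB.
Qed.

Lemma sum_even_diff (s : seq (nat * nat * nat)) (a b : nat * nat * nat -> int) :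
  (forall e, e \in s -> exists k, a e = b e + 2 * k) ->
  exists k, \sum_(e <- s) a e = \sum_(e <- s) b e + 2 * k.
Proof.
elim: s => [|e s IH] H; first by exists 0; rewrite !big_nil.
have [k1 e1] := H e (mem_head _ _); have [|k2 e2] := IH.
  by move=> e' e's; apply: H; rewrite inE e's orbT.
by exists (k1 + k2); rewrite !big_cons e1 e2; ring.
Qed.

Lemma abs_parity (x : int) : (exists k, `|x|%N%:Z = x + 2 * k) /\ (exists k, `|x|%N%:Z = - x + 2 * k).
Proof.
case: (lerP 0 x) => h; split; [exists 0|exists x|exists (- x)|exists 0]; lia.
Qed.

(** On a full edge c = |f1| + |f2| has the parity of f1 + f2. If all edges at v were full, the
    degree of v would have the parity of the sum of its two net outflows, which are 0 outside the
    cover. *)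
Lemma slack_edge v : (v < n)%N -> odd_inner E cv v -> exists2 e, e \in E & incident e v && (load e < e.2)%N.
Proof.
move=> lv oi; apply/hasP; apply: contraT => /hasPn no; exfalso.
have nv : v \notin cv by move: oi; rewrite /odd_inner mem_natE => /andP[].
have [n1 n2 n3 n4] := cv_terms nv.
have z i : netout I f i v = 0.
  by rewrite netout_val // /src /snk; case: ifP => _; rewrite ?(negbTE n1) ?(negbTE n2) ?(negbTE n3) ?(negbTE n4) subrr mulr0.
have [k ek] : exists k, \sum_(e <- E) (e.2 * ((e.1.1 == v) + (e.1.2 == v)))%N%:Z =
    \sum_(e <- E) (sgn e v * net f ord0 e + sgn e v * net f ord_max e) + 2 * k.
  apply: sum_even_diff => e eE; have [_ _ ne] := edge_ends eE; have := no e eE; have := load_le eE.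
  rewrite /incident /sgn /load; have [[k1 a1] [k2 a2]] := abs_parity (net f ord0 e).
  have [[k3 a3] [k4 a4]] := abs_parity (net f ord_max e).
  case: (eqVneq e.1.1 v) => [e1|_] /=.
    have -> /= : (e.1.2 == v) = false by rewrite -e1 eq_sym; exact: negbTE.
    by move=> h1 h2; exists (k1 + k3); lia.
  case: (eqVneq e.1.2 v) => [e1|_] /= h1 h2; last by exists 0; lia.
  by exists (k2 + k4); lia.
move: ek; rewrite big_split /= -!netout_edges !z addr0 add0r.
rewrite -(big_morph Posz PoszD (erefl _)) => ek.
have : odd (out_cap E v + in_cap E v) by case/andP: oi.
have -> : (out_cap E v + in_cap E v = \sum_(e <- E) e.2 * ((e.1.1 == v) + (e.1.2 == v)))%N.
  rewrite /out_cap /in_cap !sumnE !big_map -big_split /=; apply: eq_bigr => e _.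
  by rewrite mulnDr; case: ifP => _; case: ifP => _; rewrite ?muln1 ?muln0.
by move: ek; set S := (\sum_(e <- E) _)%N; move: S => S; lia.
Qed.

Definition chosen v := find (fun e => incident e v && (load e < e.2)%N) E.
Definition lam j : bool :=
  has (fun v => odd_inner E cv v && (chosen v == j)) [:: atail E j; ahead E j].

Lemma lamP j : (j < m)%N -> lam j -> exists v, [/\ incident (nth arc0 E j) v, odd_inner E cv v, chosen v = j &
   (load (nth arc0 E j) < acap E j)%N].
Proof.
move=> lt /hasP[v vin /andP[oi /eqP ch]]; exists v; split=> //.
  by move: vin; rewrite !inE /incident /atail /ahead => /orP[]/eqP ->; rewrite eqxx ?orbT.
have := @nth_find _ arc0 (fun e => incident e v && (load e < e.2)%N) E.
by rewrite has_find -/(chosen v) ch => /(_ lt) /andP[].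
Qed.

Lemma chosenP v : (v < n)%N -> odd_inner E cv v -> [/\ (chosen v < m)%N, incident (nth arc0 E (chosen v)) v & lam (chosen v)].
Proof.
move=> lv oi; have [e eE he] := slack_edge lv oi.
have hs : has (fun e => incident e v && (load e < e.2)%N) E by apply/hasP; exists e.
have lt : (chosen v < m)%N by rewrite /chosen -has_find.
have /andP[ii _] := nth_find arc0 hs; split=> //; rewrite /lam /= orbF.
by move: ii; rewrite /incident -/(chosen v) -/(atail E _) -/(ahead E _) => /orP[]/eqP ->; rewrite oi eqxx ?orbT.
Qed.

(** A second marked edge at v would have been chosen by its other end, but that end lies in the
    cover. *)
Lemma lamsum_chosen v : (v < n)%N -> odd_inner E cv v -> lamsum E (fun j => N%:R * (lam j)%:R) v = N%:R.
Proof.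
move=> lv oi; have [lt ii la] := chosenP lv oi; have nv : v \notin cv by move: oi; rewrite /odd_inner mem_natE => /andP[].
rewrite /lamsum (bigD1 (Ordinal lt)) //= ii la !mulr1 mul1r big1 ?addr0 // => j ne.
case: (boolP (incident _ _)) => ij; last by rewrite mul0r.
case: (boolP (lam j)) => lj; last by rewrite mulr0 mulr0.
have [w [iw ow cw _]] := lamP (ltn_ord j) lj; have nw : w \notin cv by move: ow; rewrite /odd_inner mem_natE => /andP[].
case: (eqVneq v w) => [e|nvw].
  by move: ne; rewrite -val_eqE /= -cw e eqxx.
by have := not_shared covered (ltn_ord j) nv nw nvw ij; rewrite iw.
Qed.

(** The net flows define g and h: cancelling opposite flow on an edge keeps the excess and only
    frees capacity. *)
Lemma meets_lpfeas : lpfeas E cv vs q_of N kp 0 [seq false | _ <- E].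
Proof.
pose g j : rat := (net f ord0 (nth arc0 E j))%:~R + (net f ord_max (nth arc0 E j))%:~R.
pose h j : rat := (net f ord0 (nth arc0 E j))%:~R - (net f ord_max (nth arc0 E j))%:~R.
have N0 : 0 <= N%:R :> rat by exact: ler0n.
have cE i v : (v < n)%N -> exc E v (fun j => (net f i (nth arc0 E j))%:~R) = (dem I i)%:R * ((v == src I i)%:R - (v == snk I i)%:R).
  move=> lv; have := netout_exc f i v; rewrite netout_val // rmorphM rmorphB /= -!pmulrn => <-.
  by apply: eq_bigr => j _; rewrite /net rmorphB /= -!pmulrn.
have bnd j : (j < m)%N -> `|(net f ord0 (nth arc0 E j))%:~R| + `|(net f ord_max (nth arc0 E j))%:~R| + (lam j)%:R <= (acap E j)%:R :> rat.
  move=> lt; rewrite -!intr_norm -!abszE -!pmulrn -!natrD ler_nat.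
  case: (boolP (lam j)) => [/(lamP lt)[v [_ _ _]]|_]; first by rewrite addn1.
  by rewrite addn0; apply: load_le; rewrite mem_nth.
have [||x [x0 xs _]] := @lpsat_glue E cv vs q_of N kp 0 [seq false | _ <- E]
    (fun j => N%:R * (g j + (acap E j)%:R)) (fun j => N%:R * (h j + (acap E j)%:R)) (fun j => N%:R * (lam j)%:R); last by exists x.
- move=> j lt; have b := bnd j lt; have l0 : 0 <= (lam j)%:R :> rat by exact: ler0n.
  rewrite /g /h; move: b; set a1 : rat := (net f ord0 _)%:~R; set a2 : rat := (net f ord_max _)%:~R => b.
  have := ler_norm a1; have := ler_norm a2; have := ler_norm (- a1); have := ler_norm (- a2); rewrite !normrN => b1 b2 b3 b4.
  by split; apply: mulr_ge0 => //; move: b l0 b1 b2 b3 b4; lra.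
split=> [j lt|j lt|v vin|v vin ov].
- have b := bnd j lt; have l0 : 0 <= (lam j)%:R :> rat by exact: ler0n.
  rewrite /g /h; move: b; set a1 : rat := (net f ord0 _)%:~R; set a2 : rat := (net f ord_max _)%:~R => b.
  have := ler_norm a1; have := ler_norm a2; have := ler_norm (- a1); have := ler_norm (- a2); rewrite !normrN => b1 b2 b3 b4.
  rewrite !addr0 !natrM !natrD -!mulrDr; have l1 : (lam j)%:R <= 1 :> rat by case: (lam j).
  split; try (apply: ler_wpM2l => //; move: b l0 b1 b2 b3 b4; lra).
  by rewrite -[leRHS]mulr1 ler_wpM2l.
- by rewrite (nth_map arc0) // addr0 mulr0n addr_ge0 ?mulr_ge0.
- have lv := vsn vin.
  have gE : exc E v (fun j => N%:R * (g j + (acap E j)%:R)) = N%:R * wdiv E q_of v.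
    rewrite excZ !excD !cE // exc_cap /wdiv /supply /demand /src /snk /dem /=.
    by rewrite !natrD !natrM; ring.
  have hE : exc E v (fun j => N%:R * (h j + (acap E j)%:R)) = N%:R * wdiv E (swap2 q_of) v.
    rewrite excZ excD exc_cap; have -> : exc E v h = exc E v (fun j => (net f ord0 (nth arc0 E j))%:~R) - exc E v (fun j => (net f ord_max (nth arc0 E j))%:~R).
      by rewrite /exc -sumrB; apply: eq_bigr => j _; rewrite mulrBr.
    rewrite !cE // /wdiv /supply /demand /src /snk /dem /=.
    by rewrite !natrD !natrM; ring.
  by rewrite gE hE !subrr normr0.
- by rewrite lamsum_chosen ?subrr ?normr0 //; exact: vsn.
Qed.
End Meets.
End Instance.

Local Close Scope ring_scope.

(** * Correctness of the algorithm *)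

Lemma cover_stepE cv e : cover_step cv e = if (e.1.1 \in cv) || (e.1.2 \in cv) then cv else e.1.1 :: e.1.2 :: cv.
Proof. by rewrite /cover_step !mem_natE. Qed.

Lemma cover_sub s cv : {subset cv <= foldl cover_step cv s}.
Proof.
elim: s cv => [|e s IH] cv v vc //=; apply: IH; rewrite cover_stepE; case: ifP => //.
by rewrite !inE vc !orbT.
Qed.

Lemma coverP s cv e : e \in s -> (e.1.1 \in foldl cover_step cv s) || (e.1.2 \in foldl cover_step cv s).
Proof.
elim: s cv => //= e' s IH cv; rewrite inE => /orP[/eqP ->|]; last exact: IH.
suff : (e'.1.1 \in cover_step cv e') || (e'.1.2 \in cover_step cv e').
  by case/orP => /cover_sub ->; rewrite ?orbT.
by rewrite cover_stepE; case: ifP => [//|_]; rewrite !inE eqxx.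
Qed.

Section Cover.
Variables (I : inst) (wfI : wf_inst I).

(** A matching edge adds two entries to the list and at least one vertex of S not collected before;
    twice the number of collected vertices of S pays for the growth. *)
Lemma cover_size_step (S : {set 'I_(i_n I)}) s cv : is_cover S -> {subset s <= i_edges I} ->
  size (foldl cover_step cv s) + 2 * #|[set x in S | val x \in cv]| <= size cv + 2 * #|S|.
Proof.
move=> /allP cS; elim: s cv => [|e s IH] cv sub /=.
  by rewrite leq_add2l leq_mul2l subset_leq_card //; apply/subsetP => x; rewrite inE => /andP[].
have sub' : {subset s <= i_edges I} by move=> x xs; apply: sub; rewrite inE xs orbT.
have := IH (cover_step cv e) sub'; rewrite cover_stepE; case: ifP => // /negbT; rewrite negb_or => /andP[n1 n2].
have /existsP[x /andP[xS xe]] := cS e (sub e (mem_head _ _)).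
have : #|[set x in S | val x \in cv]| < #|[set x in S | val x \in e.1.1 :: e.1.2 :: cv]|.
  apply: proper_card; apply/properP; split.
    by apply/subsetP => y; rewrite !inE => /andP[-> ->]; rewrite !orbT.
  exists x; rewrite !inE xS /=; first by case/orP: xe => ->; rewrite ?orbT.
  by case/orP: xe => /eqP ->.
by move=> /=; lia.
Qed.

Lemma cover_size q : size (cover q (i_edges I)) <= 4 + 2 * vc I.
Proof.
have H (S : {set 'I_(i_n I)}) : is_cover S -> size (cover q (i_edges I)) <= 4 + 2 * #|S|.
  move=> cS; have := @cover_size_step S (i_edges I) (terminals q) cS (fun _ h => h).
  have -> : size (terminals q) = 4 by case: q => [[[[[? ?] ?] ?] ?] ?].
  by rewrite /cover; lia.
rewrite /vc; elim/big_ind: _ => [|a b ha hb|S cS]; last exact: H.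
(* The default value of the minimum is the number of vertices, the size of the cover by all
   vertices. *)
- have := H setT; rewrite cardsT card_ord; apply; apply/allP => e eE.
  have [lt _ _] := edge_ends wfI eE; apply/existsP; exists (Ordinal lt).
  by rewrite inE /= eqxx.
- by rewrite /minn; case: ifP.
Qed.
End Cover.

Section FlowOf.
Variables (I : inst) (wfI : wf_inst I).
Let E := i_edges I.
Let m := size E.
Local Notation at_ j := (nth arc0 E j).

Lemma find_edge j : j < m -> find (fun e => (e.1.1 == (at_ j).1.1) && (e.1.2 == (at_ j).1.2)) E = j.
Proof.
move=> lt; set p := fun e => _; have hj : p (at_ j) by rewrite /p !eqxx.
have le : find p E <= j by rewrite leqNgt; apply/negP => /(before_find arc0); rewrite hj.
move: le; rewrite leq_eqVlt => /orP[/eqP //|lt'].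
have hp : p (nth arc0 E (find p E)) by apply: nth_find; apply/(has_nthP arc0); exists j.
case: wfI => _ /(pairwiseP arc0)/(_ (find p E) j) + _ _.
rewrite !inE => /(_ (ltn_trans lt' lt) lt lt') /negP[].
by move: hp; rewrite /p /same_pair => ->.
Qed.

(** An edge stored in the opposite orientation would repeat the pair, so this search fails and
    [flow_of] reads the backward entry of edge j. *)
Lemma find_rev j : j < m -> find (fun e => (e.1.1 == (at_ j).1.2) && (e.1.2 == (at_ j).1.1)) E = m.
Proof.
move=> lt; apply: hasNfind; apply/hasPn => e eE; apply/negP => he.
have [_ _ ne] := edge_ends wfI (mem_nth arc0 lt).
case/(nthP arc0): eE => i lti ei.
have sp : same_pair e (at_ j) && same_pair (at_ j) e.
  by rewrite /same_pair; case/andP: he => /eqP -> /eqP ->; rewrite !eqxx !orbT.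
case: wfI => _ /(pairwiseP arc0) pw _ _.
case: (ltngtP i j) => ij.
- by have := pw i j; rewrite !inE => /(_ lti lt ij); rewrite ei; case/andP: sp => ->.
- by have := pw j i; rewrite !inE => /(_ lt lti ij); rewrite ei; case/andP: sp => _ ->.
by move: he; rewrite -ei ij => /andP[/eqP e1 _]; rewrite e1 eqxx in ne.
Qed.

Variable fl : seq (nat * nat * nat * nat).

Lemma flow_of_fw i j : j < m ->
  flow_of I fl i (at_ j).1.1 (at_ j).1.2 = if val i == 0 then (nth fl0 fl j).1.1.1 else (nth fl0 fl j).1.2.
Proof. by move=> lt; rewrite /flow_of find_edge // lt. Qed.

Lemma flow_of_bw i j : j < m ->
  flow_of I fl i (at_ j).1.2 (at_ j).1.1 = if val i == 0 then (nth fl0 fl j).1.1.2 else (nth fl0 fl j).2.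
Proof. by move=> lt; rewrite /flow_of find_rev // ltnn find_edge // lt. Qed.

Lemma netout_flow_of i v : ((netout I (flow_of I fl) i v)%:~R)%R =
  exc E v (fun j => if val i == 0 then ((nth fl0 fl j).1.1.1%:R - (nth fl0 fl j).1.1.2%:R)%R
                    else ((nth fl0 fl j).1.2%:R - (nth fl0 fl j).2%:R)%R).
Proof.
rewrite -(netout_exc wfI); apply: eq_bigr => j _.
by rewrite /atail /ahead flow_of_fw // flow_of_bw //; case: ifP.
Qed.
End FlowOf.

Lemma size_mulu a b : size (mulu a b) = size a * size b.
Proof. by elim: a => //= x a IH; rewrite /mulu /= size_cat -/(mulu a b) IH mulSn. Qed.

Lemma size_pw2 W : size (pw2 W) = size W ^ 2.
Proof. exact: size_mulu. Qed.

Lemma size_pw2x3 W : size (pw2 (pw2 (pw2 W))) = size W ^ 8.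
Proof. by rewrite !size_pw2 -!expnM. Qed.

Lemma size_pR W l : size (pR (mk_param W l)) = size W ^ 24.
Proof. by rewrite size_mulu [size (pw2 (pw2 (pw2 (pw2 W))))]size_pw2 !size_pw2x3 -expnM -expnD. Qed.

Lemma size_poly_base E : size (poly_base E) = 16 * (size E).+1.
Proof.
rewrite /poly_base -[(size E).+1]/(size ((0, 0, 0) :: E)); elim: (_ :: E) => //= a s IH.
by rewrite IH -add1n; lia.
Qed.

Section Numeric.
Variables (m : nat).
(** The factor 16 in w lets one further power of w absorb any constant up to 16 or any small
    multiple of m, so the inequalities below reduce to comparing exponents. [r] is the length of the
    vertex list. *)
Let k := m.+1.
Let w := 16 * k.
Let r := 4 + (m + m).

Lemma w16 : 16 <= w. Proof. by rewrite /w /k; lia. Qed.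
Lemma w_exp a b : a <= b -> w ^ a <= w ^ b.
Proof. by move=> h; rewrite leq_pexp2l //; have := w16; lia. Qed.
Lemma w_exp_mul c a b : c <= 16 -> a < b -> c * w ^ a <= w ^ b.
Proof.
move=> hc lt; apply: leq_trans (w_exp lt); rewrite expnS leq_mul2r (leq_trans hc w16) orbT //.
Qed.
Lemma w_gt0 a : 0 < w ^ a. Proof. by rewrite expn_gt0; have := w16; lia. Qed.
Lemma w_lt c a b : c < 16 -> a < b -> c * w ^ a < w ^ b.
Proof.
move=> hc lt; apply: leq_trans (w_exp_mul (leqnn _) lt).
by rewrite ltn_pmul2r ?w_gt0.
Qed.
Lemma m3w : m + (m + m) <= w. Proof. by rewrite /w /k; lia. Qed.
Lemma m2rw : 2 * (m + m + r) <= w. Proof. by rewrite /w /k /r; lia. Qed.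
Lemma mrw : 2 * (m + r + 1) <= w. Proof. by rewrite /w /k /r; lia. Qed.

Lemma num_HN : (m + m + r) * w + 2 * w < w ^ 8.
Proof.
apply: leq_ltn_trans (_ : w ^ 2 < _); last by have := @w_lt 1 2 8 isT isT; rewrite mul1n.
by rewrite -mulnDl expnS expn1 leq_mul2r /r /w /k; apply/orP; right; lia.
Qed.
Lemma num_HR14 : (m + m) * ((2 * w) * (m + m + r)) ^ 2 < w ^ 24.
Proof.
apply: leq_ltn_trans (_ : w ^ 5 < _); last by have := @w_lt 1 5 24 isT isT; rewrite mul1n.
rewrite (expnS w 4) leq_mul //; first by have := m3w; lia.
rewrite [w ^ 4](expnM w 2 2) leq_exp2r // -mulnA mulnCA expnS expn1 leq_mul2l m2rw orbT //.
Qed.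
Lemma num_HR9 : (m + (m + m)) * ((2 * w + w ^ 8 + w * m) * (m + r + 1)) ^ 2 < w ^ 24.
Proof.
apply: leq_ltn_trans (_ : w ^ 19 < _); last by have := @w_lt 1 19 24 isT isT; rewrite mul1n.
rewrite (expnS w 18) leq_mul ?m3w // [w ^ 18](expnM w 9 2) leq_exp2r //.
have h : 2 * w + w ^ 8 + w * m <= 2 * w ^ 8.
  have := w_exp (isT : 2 <= 8); have : w * (2 + m) <= w ^ 2.
    by rewrite expnS expn1 leq_mul2l /w /k; apply/orP; right; lia.
  by rewrite mulnDr [w * 2]mulnC; move: (w ^ 8) (w ^ 2) (2 * w) (w * m) => A C a b; clear; lia.
apply: leq_trans (leq_mul h (leqnn _)) _.
by rewrite mulnAC [w ^ 9]expnSr mulnC leq_mul2l mrw orbT.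
Qed.
Lemma kw2 : w * k <= w ^ 2.
Proof. by rewrite expnS expn1 leq_mul2l /w leq_pmull ?orbT. Qed.
Lemma num_kp : w * k + m * (m.+2 * (w * k)) <= w ^ 4.
Proof.
have -> : w * k + m * (m.+2 * (w * k)) = (w * k) * (k * k) by rewrite /k; ring.
rewrite [w ^ 4](expnD w 2 2) leq_mul ?kw2 // expnS expn1 leq_mul // /w leq_pmull //.
Qed.
Lemma num_N : w ^ 4 + w * k < w ^ 8.
Proof.
apply: leq_ltn_trans (_ : 2 * w ^ 4 < _); last exact: w_lt.
by rewrite mul2n -addnn leq_add2l; apply: leq_trans kw2 (w_exp _).
Qed.
Lemma num_N3 tau : tau <= w * k -> 2 * w ^ 4 + 3 * tau < w ^ 8.
Proof.
move=> ht; apply: leq_ltn_trans (_ : 5 * w ^ 4 < _); last exact: w_lt.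
have := leq_trans ht (leq_trans kw2 (w_exp (isT : 2 <= 4))); set A := w ^ 4; lia.
Qed.
Lemma num_small tau : tau <= w * k -> (w ^ 4 + 2 * tau) * (m + r) < 2 * w ^ 8.
Proof.
move=> ht; apply: leq_ltn_trans (_ : 3 * w ^ 5 < _).
  rewrite [w ^ 5]expnSr mulnA leq_mul //; last by have := mrw; lia.
  have := leq_trans ht (leq_trans kw2 (w_exp (isT : 2 <= 4))); set A := w ^ 4; lia.
by apply: leq_trans (@w_lt 3 5 8 isT isT) _; rewrite leq_pmull.
Qed.
Lemma num_HB L : w ^ 8 * (w * 2 ^ L) <= 2 * (w * 2 ^ (w ^ 8 + L)).
Proof.
rewrite expnD; have h := ltnW (ltn_expl (w ^ 8) (isT : 1 < 2)); move: h.
set A := w ^ 8 => h; apply: leq_trans (leq_pmull _ (isT : 0 < 2)).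
by rewrite mulnCA leq_mul2l leq_mul2r h !orbT.
Qed.
Lemma num_HB2 L : w * 2 ^ L < 2 ^ (w ^ 8 + L).+1.
Proof.
rewrite expnS expnD; have h := ltn_expl (w ^ 8) (isT : 1 < 2).
have h2 : w <= w ^ 8 by have := w_exp (isT : 1 <= 8); rewrite expn1.
apply: leq_trans (leq_pmull _ (isT : 0 < 2)); rewrite ltn_pmul2r ?expn_gt0 //.
exact: leq_ltn_trans h2 h.
Qed.
End Numeric.

Section Solve.
Variables (I : inst) (wfI : wf_inst I) (l : seq unit).
Let E := i_edges I.
Let m := size E.
Let q := q_of I.
Let W := poly_base E.
Let w := 16 * m.+1.
Let P := mk_param W l.
Let cv := cover q E.
Let vs := vertices q E.
Let kp := size (pw2 (pw2 W)).
Hypotheses (capl : forall e, e \in E -> e.2 <= 2 ^ size l)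
  (dl : i_d1 I <= 2 ^ size l /\ i_d2 I <= 2 ^ size l).

Lemma pME : pM P = w. Proof. exact: size_poly_base. Qed.
Lemma kpE : kp = w ^ 4.
Proof. by rewrite /kp !size_pw2 size_poly_base -expnM. Qed.
Lemma pNE : pN P = w ^ 8.
Proof. by rewrite -[pN P]/(size (pw2 (pw2 (pw2 W)))) size_pw2x3 size_poly_base. Qed.
Lemma pRE : size (pR P) = w ^ 24.
Proof. by rewrite size_pR size_poly_base. Qed.
Lemma pscE : psc P = scales (pM P) (pw2 (pw2 (pw2 W)) ++ l). Proof. by []. Qed.
Lemma size_lE : size (pw2 (pw2 (pw2 W)) ++ l) = w ^ 8 + size l.
Proof. by rewrite size_cat size_pw2x3 size_poly_base. Qed.

Lemma size_vs : size vs = 4 + (m + m).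
Proof.
rewrite /vs /vertices size_cat /= size_flatten /shape -map_comp; congr (_ + _).
by rewrite /m; elim: E => //= a s IH; rewrite IH; lia.
Qed.

Lemma vs_edge a : a \in E -> (a.1.1 \in vs) && (a.1.2 \in vs).
Proof.
move=> aE; rewrite !mem_cat; apply/andP; split; apply/orP; right; apply/flatten_mapP; exists a => //;
by rewrite !inE eqxx ?orbT.
Qed.

Lemma vs_lt v : v \in vs -> v < i_n I.
Proof.
rewrite mem_cat => /orP[|/flatten_mapP[e eE]].
  by case: wfI => _ _ /and4P[? ? ? ?] _; rewrite /= !inE => /or4P[] /eqP ->.
by have [? ? _] := edge_ends wfI eE; rewrite !inE => /orP[] /eqP ->.
Qed.

Lemma not_cv_terms v : v \notin cv -> [/\ v != i_s1 I, v != i_t1 I, v != i_s2 I & v != i_t2 I].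
Proof.
move=> nv; have H x : x \in terminals q -> v != x.
  by move=> /(@cover_sub E) h; apply: contraNneq nv => ->.
by split; apply: H; rewrite /= !inE eqxx ?orbT.
Qed.

Lemma not_cv_supply v : v \notin cv -> [/\ supply q v = 0, demand q v = 0, supply (swap2 q) v = 0 & demand (swap2 q) v = 0].
Proof.
by move=> /not_cv_terms[/negbTE n1 /negbTE n2 /negbTE n3 /negbTE n4]; rewrite /= n1 n2 n3 n4.
Qed.

Lemma cap_bound j : acap E j <= 2 ^ size l.
Proof.
case: (ltnP j m) => lt; last by rewrite /acap nth_default.
by apply: capl; rewrite mem_nth.
Qed.

Lemma in_out_bound v : in_cap E v + out_cap E v <= (m + m) * 2 ^ size l.
Proof.
rewrite in_capE out_capE -big_split /=.
apply: leq_trans (_ : \sum_(j < m) (2 * 2 ^ size l) <= _); last by rewrite sum_nat_const card_ord -/m addnn -muln2 mulnA.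
apply: leq_sum => j _; rewrite mul2n -addnn; apply: leq_add.
  by case: (_ == v); rewrite ?mul1n ?mul0n // cap_bound.
by case: (_ == v); rewrite ?mul1n ?mul0n // cap_bound.
Qed.

Lemma supply_bound v : [/\ supply q v <= 2 * 2 ^ size l, demand q v <= 2 * 2 ^ size l,
  supply (swap2 q) v <= 2 * 2 ^ size l & demand (swap2 q) v <= 2 * 2 ^ size l].
Proof.
case: dl => h1 h2; rewrite /= mul2n -addnn; split; apply: leq_add;
by case: (_ == _); rewrite ?mul1n ?mul0n.
Qed.

Let l' := pw2 (pw2 (pw2 W)) ++ l.
Let n := i_n I.

Lemma loopless_E a : a \in E -> a.1.1 != a.1.2.
Proof. by case/(edge_ends wfI). Qed.
Lemma vs_le v : v \in vs -> v <= n. Proof. by move/vs_lt/ltnW. Qed.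
Lemma covered_E a : a \in E -> (a.1.1 \in cv) || (a.1.2 \in cv).
Proof. exact: coverP. Qed.

Lemma div_bound v : [/\ demand q v + in_cap E v <= w * 2 ^ size l, supply q v + out_cap E v <= w * 2 ^ size l,
     demand (swap2 q) v + in_cap E v <= w * 2 ^ size l & supply (swap2 q) v + out_cap E v <= w * 2 ^ size l].
Proof.
have h : 2 * 2 ^ size l + (m + m) * 2 ^ size l <= w * 2 ^ size l.
  by rewrite -mulnDl leq_mul2r /w; apply/orP; right; lia.
have [h1 h2 h3 h4] := supply_bound v; have h5 := in_out_bound v.
have h6 : in_cap E v <= (m + m) * 2 ^ size l by apply: leq_trans h5; rewrite leq_addr.
have h7 : out_cap E v <= (m + m) * 2 ^ size l by apply: leq_trans h5; rewrite leq_addl.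
by split; apply: leq_trans h; apply: leq_add.
Qed.

Lemma big_bound v : pN P * (in_cap E v + out_cap E v + supply q v + demand q v + supply (swap2 q) v + demand (swap2 q) v + 1)
     <= 2 * (pM P * 2 ^ size l').
Proof.
rewrite pNE pME size_lE; apply: leq_trans (num_HB m (size l)); rewrite leq_mul2l; apply/orP; right.
have [h1 h2 h3 h4] := supply_bound v; have h5 := in_out_bound v; have h0 : 1 <= 2 ^ size l by rewrite expn_gt0.
apply: leq_trans (leq_add (leq_add (leq_add (leq_add (leq_add h5 h1) h2) h3) h4) h0) _.
rewrite -[X in _ + X <= _]mul1n -!mulnDl leq_mul2r /w; apply/orP; right; lia.
Qed.

Lemma HR9 : (m + (m + m)) * ((2 * pM P + pN P + pM P * m) * (m + size vs + 1)) ^ 2 < size (pR P).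
Proof. by rewrite pME pNE pRE size_vs; exact: num_HR9. Qed.
Lemma kp_ge_ok : pM P * m.+1 + m * (m.+2 * (pM P * m.+1)) <= kp.
Proof. by rewrite pME kpE; exact: num_kp. Qed.
Lemma N_ge_ok : kp + pM P * m.+1 < pN P.
Proof. by rewrite pME pNE kpE; exact: num_N. Qed.
Lemma kp_pos : 0 < kp. Proof. by rewrite kpE w_gt0. Qed.
Lemma mM_ok : m + (m + m) <= pM P. Proof. by rewrite pME m3w. Qed.
Lemma M_pos : 0 < pM P. Proof. by rewrite pME. Qed.

Let f0 := [seq false | _ <- E].
Let D : lpdata := (E, cv, vs, q, kp).

Lemma nfix_f0 : nfix f0 = 0.
Proof. by rewrite /f0; elim: E. Qed.

Lemma meets_lp_ok f : meets_demands I f -> lp_ok P D f0.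
Proof.
move=> mf; apply: (lp_ok_complete loopless_E vs_edge vs_le mM_ok M_pos pscE HR9 big_bound); first exact: size_map.
rewrite nfix_f0 muln0; exact: (meets_lpfeas wfI mf (pN P) kp vs_lt covered_E not_cv_terms).
Qed.

Lemma solveE : solve l q E = if (i_s1 I == i_t1 I) || (i_s2 I == i_t2 I) || ~~ lp_ok P D f0 then None
  else Some (two_flow P q E vs (3 * size cv) (even_arcs E (fix_edges P D))).
Proof. by []. Qed.

Lemma free_size fx : (forall U, uniq U -> {subset U <= vs} -> (forall v, v \in U -> free_at E cv fx v) -> size U <= size cv + size cv) ->
  size (cv ++ free_vertices E cv vs fx) <= 3 * size cv.
Proof.
move=> st; rewrite size_cat; have -> : 3 * size cv = size cv + (size cv + size cv) by lia.
rewrite leq_add2l; apply: st; rewrite ?undup_uniq // => v; rewrite mem_undup mem_filter; first by case/andP.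
by case/andP.
Qed.

Lemma solve_correct : match solve l q E with
  | None => ~ (exists f : flowfun, meets_demands I f)
  | Some fl => size fl = size (i_edges I) /\ int_2flow I (flow_of I fl) /\
      forall i : 'I_2, (Posz (dem I i) - Posz (18 * (vc I ^ 3 + 1))%N <= netout I (flow_of I fl) i (src I i))%R
  end.
Proof.
rewrite solveE; case: ifP => [no [f mf]|/negbT].
  have s1 : i_s1 I != i_t1 I := src_neq_snk wfI mf ord0.
  have s2 : i_s2 I != i_t2 I := src_neq_snk wfI mf ord_max.
  by move: no; rewrite (negbTE s1) (negbTE s2) (meets_lp_ok mf).
rewrite !negb_or negbK => /andP[/andP[st1 st2] ok].
have inv0 : inv E cv vs q kp P f0.
  split; first exact: size_map.
    by apply: (lp_ok_sound loopless_E) => //; exact: size_map.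
  by move=> j; case: (ltnP j m) => lt; [rewrite (nth_map arc0)|rewrite nth_default ?size_map].
have [[sf feas Ho] st] := fix_edges_spec loopless_E vs_edge vs_le covered_E not_cv_supply kp_ge_ok N_ge_ok kp_pos mM_ok M_pos pscE HR9 big_bound inv0.
set fx := fix_edges P D in sf feas Ho st *.
have tl : pM P * nfix fx + pM P <= w * m.+1.
  by rewrite pME addnC -mulnS leq_mul2l ltnS; apply/orP; right; rewrite -[X in _ <= X]sf; exact: nfix_le.
have [cs c1 c2] : [/\ (m + m <= pM P)%N, (((m + m) + size vs) * pM P + 2 * pM P < pN P)%N &
   ((m + m) * ((2 * pM P) * ((m + m) + size vs)) ^ 2 < size (pR P))%N].
  split; first by apply: leq_trans mM_ok; rewrite leq_addl.
    by rewrite pME pNE size_vs; exact: num_HN.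
  by rewrite pME pRE size_vs; exact: num_HR14.
have c3 : (pN P * (w * 2 ^ size l) <= 2 * (pM P * 2 ^ size l'))%N by rewrite pNE pME size_lE; exact: num_HB.
have c4 : (w * 2 ^ size l < 2 ^ (size l').+1)%N by rewrite size_lE; exact: num_HB2.
have le1 x : (x <= 2 ^ size l -> x <= w * 2 ^ size l)%N by move=> h; apply: leq_trans h _; rewrite leq_pmull.
have c5 : (2 * kp + 3 * (pM P * nfix fx + pM P) < pN P)%N by rewrite pNE kpE; apply: num_N3.
have c6 : ((kp + 2 * (pM P * nfix fx + pM P)) * (m + size vs) < 2 * pN P)%N by rewrite pNE kpE size_vs; apply: num_small.
have tv : [/\ i_s1 I \in vs, i_t1 I \in vs, i_s2 I \in vs & i_t2 I \in vs].
  by rewrite /vs /vertices /= !inE !eqxx !orbT.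
have [sz cap [k1 v1] [k2 v2]] := @two_flow_correct P l' (w * 2 ^ size l) E cv vs _ _ _ _ _ _ kp _ n (3 * size cv) fx cs M_pos c1 pscE c2 c3 c4
   (fun j => le1 _ (cap_bound j)) div_bound (conj (le1 _ dl.1) (le1 _ dl.2)) loopless_E vs_edge vs_le covered_E not_cv_supply
   tv st1 st2 sf Ho c5 c6 feas (free_size st).
set fl := two_flow _ _ _ _ _ _ in sz cap k1 v1 k2 v2 *.
have main (i : 'I_2) : (forall v, v \in vs -> v != src I i -> v != snk I i -> netout I (flow_of I fl) i v = 0%R) /\
    ((dem I i - 3 * size cv)%N%:Z <= netout I (flow_of I fl) i (src I i))%R.
  split=> [v vin|].
    rewrite /src /snk => ns nt; apply: (@intr_inj rat); rewrite netout_flow_of //.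
    by move: ns nt; case: (val i == 0) => ns nt; [exact: k1|exact: k2].
  rewrite -(ler_int rat) netout_flow_of // /src /dem -pmulrn.
  by case: (val i == 0); [exact: v1|exact: v2].
split=> //; split.
  split=> [e eE|i v lv ns nt].
    case/(nthP arc0): eE => j lt <-; rewrite !big_ord_recl big_ord0 addn0 !flow_of_fw // !flow_of_bw //=.
    exact: cap.
  case: (boolP (v \in vs)) => vin; first by have [h _] := main i; exact: h.
  apply: (@intr_inj rat); rewrite -(netout_exc wfI) (exc_notin vs_edge) //.
move=> i; have [_ h] := main i; apply: le_trans h.
(* The loss is 3 |cv| <= 12 + 6 vc; since vc <= vc^3, it is covered by 18 (vc^3 + 1). *)
have cs' := cover_size wfI q; rewrite -/cv in cs'.
have vc3 : (vc I <= vc I ^ 3)%N by case: (vc I) => // k; rewrite -[X in (X <= _)%N]expn1 leq_pexp2l.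
by move: cs' vc3; move: (vc I ^ 3)%N (vc I) (size cv) (dem I i) => a b c d; clear; lia.
Qed.
End Solve.

(** * Turing machines simulate stack machines *)

Inductive stk := SA | SB | SC | SD | SF.
Definition T5 (T : Type) := (T * T * T * T * T)%type.

Definition get5 T (x : T5 T) (k : stk) : T :=
  let: (a, b, c, d, e) := x in
  match k with SA => a | SB => b | SC => c | SD => d | SF => e end.

Definition set5 T (x : T5 T) (k : stk) (y : T) : T5 T :=
  let: (a, b, c, d, e) := x in
  match k with
  | SA => (y, b, c, d, e) | SB => (a, y, c, d, e) | SC => (a, b, y, d, e)
  | SD => (a, b, c, y, e) | SF => (a, b, c, d, y)
  end.

Definition stacks := T5 (seq bool).

Inductive instr :=
  IPush of stk & bool | IPop of stk & nat & nat & nat | IJmp of nat.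

Definition instr_stk i := match i with IPush k _ => k | IPop k _ _ _ => k | IJmp _ => SA end.
Definition targets_le n i :=
  match i with
  | IPush _ _ => true
  | IPop _ j0 j1 j2 => [&& j0 <= n, j1 <= n & j2 <= n]
  | IJmp j => j <= n
  end.

Definition sm_next (code : seq instr) (c : nat * stacks) : nat * stacks :=
  match nth (IJmp c.1) code c.1 with
  | IPush k b => (c.1.+1, set5 c.2 k (b :: get5 c.2 k))
  | IPop k j0 j1 j2 =>
      match get5 c.2 k with
      | [::] => (j0, c.2)
      | b :: s => (if b then j2 else j1, set5 c.2 k s)
      end
  | IJmp j => (j, c.2)
  end.

Section Simulation.
Variable code : seq instr.
Let n := size code.
Hypothesis wf_code : all (targets_le n) code.

(** [None] is the mark of the origin, [Some] a column of the five tracks. Neither is a bit, so a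
    printed output ends at the first cell that still holds a column. *)
Definition cellA := option (T5 (option bool)).
Definition cell := option (bool + cellA).
Definition none5 : T5 (option bool) := (None, None, None, None, None).
Definition rd (s : cell) : T5 (option bool) :=
  match s with Some (inr (Some tr)) => tr | _ => none5 end.
Definition mark : cell := Some (inr None).
Definition ismark (s : cell) := if s is Some (inr None) then true else false.
Definition mk tr : cell := Some (inr (Some tr)).

Definition phase := ('I_11 * option bool)%type.
Definition tg k (lt : k < 11) : 'I_11 := Ordinal lt.
Notation "% k" := (@tg k isT) (at level 5, k at level 0).
Definition ctl := ('I_n.+1 * phase)%type.

(* Phases: 0-2 turn the input bits into track 0 of a five-track tape whose
   origin -1 is marked; 3 returns to the mark, 4 fetches an instruction,
   5 shifts a track right, 6-7 shift a track left, 8-9 print track 0. *)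
Definition delta (q : ctl) (s : cell) : ctl * cell * move :=
  let: (pc, (tag, c)) := q in
  let i := nth (IJmp 0) code pc in
  let k := instr_stk i in
  match val tag with
  | 0 => ((pc, (%1, None)), s, MoveL)
  | 1 => ((pc, (%2, None)), mark, MoveR)
  | 2 => match s with
         | Some (inl b) => ((pc, (%2, None)), mk (set5 none5 SA (Some b)), MoveR)
         | _ => ((pc, (%3, None)), s, MoveL)
         end
  | 3 => if ismark s then ((pc, (%4, None)), s, Stay) else ((pc, (%3, None)), s, MoveL)
  | 4 => if val pc == n then ((pc, (%8, None)), s, MoveR) else
         match i with
         | IPush _ b => ((pc, (%5, Some b)), s, MoveR)
         | IPop _ _ _ _ => ((pc, (%6, None)), s, MoveR)
         | IJmp j => ((inord j, (%4, None)), s, Stay)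
         end
  | 5 => let old := get5 (rd s) k in
         let s' := mk (set5 (rd s) k c) in
         if old is Some _ then ((pc, (%5, old)), s', MoveR)
         else ((inord pc.+1, (%3, None)), s', MoveL)
  | 6 => if get5 (rd s) k is Some _ then ((pc, (%6, None)), s, MoveR)
         else ((pc, (%7, None)), s, MoveL)
  | 7 => if ismark s then
           let j := match i, c with
                    | IPop _ j0 _ _, None => j0
                    | IPop _ _ j1 _, Some false => j1
                    | IPop _ _ _ j2, Some true => j2
                    | _, _ => 0 end in
           ((inord j, (%4, None)), s, Stay)
         else ((pc, (%7, get5 (rd s) k)), mk (set5 (rd s) k c), MoveL)
  | 8 => if get5 (rd s) SA is Some b then ((pc, (%8, None)), Some (inl b), MoveR)
         else ((pc, (%9, None)), s, MoveL)
  | 9 => if ismark s then ((pc, (%10, None)), s, MoveR) else ((pc, (%9, None)), s, MoveL)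
  | _ => (q, s, Stay)
  end.

Definition machine : TM :=
  @MkTM cellA ctl (ord0, (%0, None)) (fun q => q.2.1 == %10) delta.

Local Notation cfg := (config machine).
Local Notation stp := (@step machine).

Definition tapeP := (int -> cell) -> Prop.
(** Time, state and head position are exact and only the tape is described by a predicate, so
    consecutive segments compose by adding their times. *)
Definition hoare (t : nat) (q : ctl) (h : int) (P : tapeP) (q' : ctl) (h' : int) (P' : tapeP) :=
  forall c : cfg, c_state c = q -> c_head c = h -> P (c_tape c) ->
  let c' := iter t stp c in
  [/\ c_state c' = q', c_head c' = h' & P' (c_tape c')].

Lemma hoare_trans t1 t2 q1 h1 P1 q2 h2 P2 q3 h3 P3 :
  hoare t1 q1 h1 P1 q2 h2 P2 -> hoare t2 q2 h2 P2 q3 h3 P3 ->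
  hoare (t2 + t1) q1 h1 P1 q3 h3 P3.
Proof.
move=> H1 H2 c e1 e2 e3 /=; rewrite iterD.
by have [f1 f2 f3] := H1 c e1 e2 e3; exact: H2.
Qed.

Lemma hoare_step q h (P : tapeP) q' mv (P' : tapeP) :
  q.2.1 != %10 ->
  (forall T, P T -> exists s', delta q (T h) = (q', s', mv) /\
      P' (fun j => if j == h then s' else T j)) ->
  hoare 1 q h P q' (h + move_int mv)%R P'.
Proof.
move=> nh H [cs ch ct] /= -> -> /H[s' [e HP]].
by rewrite /step /= (negbTE nh) e.
Qed.

Definition trep (tr : nat -> T5 (option bool)) : tapeP := fun T =>
  T (-1)%R = mark /\ forall j : nat,
    [/\ rd (T (Posz j)) = tr j, ~~ ismark (T (Posz j)) & ~~ @is_bit machine (T (Posz j))].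

Lemma trep_ext tr tr' T : tr =1 tr' -> trep tr T -> trep tr' T.
Proof. by move=> e [m H]; split=> // j; have [] := H j; rewrite e. Qed.

Lemma trep_mk tr T (j : nat) x :
  trep tr T -> trep (fun i => if i == j then x else tr i)
                    (fun i => if i == Posz j then mk x else T i).
Proof.
move=> [m H]; split=> [//|i]; rewrite eqz_nat; case: eqP => _ //; exact: H.
Qed.

Lemma trep_id tr T (h : int) : trep tr T -> trep tr (fun i => if i == h then T h else T i).
Proof.
move=> [m H]; split=> [|j]; first by case: eqP => [<-|].
by case: eqP => [<-|_]; exact: H.
Qed.

Lemma hoare_ret tr pc (j : nat) tag :
  (tag == %3) || (tag == %9) ->
  hoare j.+1 (pc, (tag, None)) (Posz j) (trep tr) (pc, (tag, None)) (-1)%R (trep tr).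
Proof.
move=> tg39; elim: j => [|j IH].
  rewrite -[(-1)%R]add0r; apply: (@hoare_step _ _ _ _ MoveL) => [|T HT].
    by case/orP: tg39 => /eqP ->.
  exists (T 0%R); split; last exact: trep_id.
  by case: HT => _ /(_ 0)[_ /negbTE m _]; case/orP: tg39 => /eqP -> /=; rewrite m.
rewrite -addn1; apply: hoare_trans IH.
rewrite (_ : Posz j = Posz j.+1 + move_int MoveL)%R; last by rewrite /=; lia.
apply: hoare_step => [|T HT]; first by case/orP: tg39 => /eqP ->.
exists (T (Posz j.+1)); split; last exact: trep_id.
by case: HT => _ /(_ j.+1)[_ /negbTE m _]; case/orP: tg39 => /eqP -> /=; rewrite m.
Qed.

Lemma hoare_ret3 tr pc (j : nat) :
  hoare j.+2 (pc, (%3, None)) (Posz j) (trep tr) (pc, (%4, None)) (-1)%R (trep tr).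
Proof.
rewrite -[j.+2]add1n; apply: hoare_trans (@hoare_ret tr pc j %3 isT) _.
rewrite -[X in hoare _ _ _ _ _ X](addr0 (-1)%R).
apply: (@hoare_step _ _ _ _ Stay) => // T HT.
exists (T (-1)%R); split; last exact: trep_id.
by case: HT => m _; rewrite /= m.
Qed.

Definition trk (st : stacks) (j : nat) : T5 (option bool) :=
  let: (a, b, c, d, e) := st in (onth a j, onth b j, onth c j, onth d j, onth e j).

Lemma get5_trk st j k : get5 (trk st j) k = onth (get5 st k) j.
Proof. by case: st => [[[[? ?] ?] ?] ?]; case: k. Qed.

Lemma get5_set5 T (x : T5 T) k y : get5 (set5 x k y) k = y.
Proof. by case: x => [[[[? ?] ?] ?] ?]; case: k. Qed.

Lemma set5_set5 T (x : T5 T) k y z : set5 (set5 x k y) k z = set5 x k z.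
Proof. by case: x => [[[[? ?] ?] ?] ?]; case: k. Qed.

Lemma set5_get5 T (x : T5 T) k : set5 x k (get5 x k) = x.
Proof. by case: x => [[[[? ?] ?] ?] ?]; case: k. Qed.

Lemma trk_set5 st k s j : trk (set5 st k s) j = set5 (trk st j) k (onth s j).
Proof. by case: st => [[[[? ?] ?] ?] ?]; case: k. Qed.

Lemma onth_lt (T : Type) (x0 : T) s i : i < size s -> onth s i = Some (nth x0 s i).
Proof. by move=> lt; rewrite onthE (nth_map x0). Qed.

Definition stk_of (pc : 'I_n.+1) := instr_stk (nth (IJmp 0) code pc).

(** The state carries the symbol b displaced from the previous cell; p is the part of the track
    already rewritten. *)
Lemma hoare_push_loop st (pc : 'I_n.+1) k (b : bool) s (j : nat) p :
  k = stk_of pc -> size p = j ->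
  hoare (size s).+1 (pc, (%5, Some b)) (Posz j)
    (trep (trk (set5 st k (p ++ s))))
    (inord pc.+1, (%3, None)) (Posz (j + size s) - 1)%R
    (trep (trk (set5 st k (p ++ b :: s)))).
Proof.
move=> ek; elim: s b j p => [|x s IH] b j p ep.
  rewrite addn0; apply: (@hoare_step _ _ _ _ MoveL) => // T HT.
  case: (HT) => _ /(_ j)[e _ _].
  exists (mk (set5 (rd (T (Posz j))) k (Some b))); split.
    rewrite /= -/(stk_of pc) -ek e get5_trk get5_set5.
    by rewrite cats0 onth_default ?ep.
  apply: trep_ext (trep_mk _ _ HT) => i; case: eqP => [->|ne].
    by rewrite e !trk_set5 set5_set5 -ep onth_cat ltnn subnn.
  rewrite !trk_set5 cats0 onth_cat ep; congr set5.
  case: ltnP => // le; rewrite !onth_default // ?ep //=; lia.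
rewrite -[(size (x :: s)).+1]addn1.
apply: (@hoare_trans _ _ _ _ _ (pc, (%5, Some x)) (Posz j.+1) (trep (trk (set5 st k (rcons p b ++ s))))); last first.
  rewrite -cat_rcons -cat_rcons; have := IH x j.+1 (rcons p b).
  rewrite size_rcons ep /= addSnnS => /(_ erefl).
  by rewrite -!cat_rcons.
rewrite (_ : Posz j.+1 = Posz j + move_int MoveR)%R; last by rewrite /=; lia.
apply: hoare_step => // T HT.
case: (HT) => _ /(_ j)[e _ _].
exists (mk (set5 (rd (T (Posz j))) k (Some b))); split.
  rewrite /= -/(stk_of pc) -ek e get5_trk get5_set5.
  by rewrite onth_cat ep ltnn subnn.
apply: trep_ext (trep_mk _ _ HT) => i; case: eqP => [->|ne].
  by rewrite e !trk_set5 set5_set5 -cats1 -catA onth_cat ep ltnn subnn.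
rewrite !trk_set5 -cats1 -catA !onth_cat ep; congr set5.
case: ltnP => // le; have -> : i - j = (i - j.+1).+1 by lia.
by rewrite /= subn1.
Qed.

Lemma hoare_push st (pc : 'I_n.+1) k b :
  nth (IJmp 0) code pc = IPush k b -> pc < n ->
  exists2 t, t <= 2 * size (get5 st k) + 4 &
  hoare t (pc, (%4, None)) (-1)%R (trep (trk st))
    (inord pc.+1, (%4, None)) (-1)%R (trep (trk (set5 st k (b :: get5 st k)))).
Proof.
move=> ei lt; pose s := get5 st k; set st' := set5 st k _.
have ek : k = stk_of pc by rewrite /stk_of ei.
have H1 : hoare 1 (pc, (%4, None)) (-1)%R (trep (trk st)) (pc, (%5, Some b)) 0%R (trep (trk st)).
  rewrite -[X in hoare _ _ _ _ _ X](addNr 1%R).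
  apply: (@hoare_step _ _ _ _ MoveR) => // T HT; exists (T (-1)%R).
  split; last exact: trep_id.
  by rewrite /= ltn_eqF // ei.
have := @hoare_push_loop st pc k b s 0 [::] ek erefl.
rewrite !cat0s set5_get5 => /(hoare_trans H1) {}H1.
case: (posnP (size s)) => [s0|sp].
  exists (1 + ((size s).+1 + 1)); first by rewrite s0.
  apply: hoare_trans H1 _; rewrite s0 add0n sub0r.
  rewrite -[X in hoare _ _ _ _ _ X](addr0 (-1)%R).
  apply: (@hoare_step _ _ _ _ Stay) => // T HT.
  exists (T (-1)%R); split; last exact: trep_id.
  by case: HT => m _; rewrite /= m.
exists ((size s).-1.+2 + ((size s).+1 + 1)); first by rewrite -/s; lia.
apply: hoare_trans H1 _.
have -> : (Posz (0 + size s) - 1 = Posz (size s).-1)%R by lia.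
exact: hoare_ret3.
Qed.

(** The track in the middle of a left shift that proceeds from right to left: the cells from m on
    already hold the symbol of their right neighbour. *)
Definition physcol (L : seq bool) m i := if i < m then onth L i else onth L i.+1.

Lemma hoare_popR st (pc : 'I_n.+1) k p s :
  k = stk_of pc -> get5 st k = p ++ s ->
  hoare (size s).+1 (pc, (%6, None)) (Posz (size p)) (trep (trk st))
    (pc, (%7, None)) (Posz (size p + size s) - 1)%R (trep (trk st)).
Proof.
move=> ek; elim: s p => [|x s IH] p eL.
  rewrite addn0; apply: (@hoare_step _ _ _ _ MoveL) => // T HT.
  case: (HT) => _ /(_ (size p))[e _ _].
  exists (T (Posz (size p))); split; last exact: trep_id.
  by rewrite /= -/(stk_of pc) -ek e get5_trk eL cats0 onth_default.
rewrite -[(size (x :: s)).+1]addn1.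
apply: (@hoare_trans _ _ _ _ _ (pc, (%6, None)) (Posz (size p).+1) (trep (trk st))); last first.
  have := IH (rcons p x); rewrite size_rcons cat_rcons eL => /(_ erefl).
  by rewrite addSnnS.
rewrite (_ : Posz (size p).+1 = Posz (size p) + move_int MoveR)%R; last by rewrite /=; lia.
apply: hoare_step => // T HT; case: (HT) => _ /(_ (size p))[e _ _].
exists (T (Posz (size p))); split; last exact: trep_id.
by rewrite /= -/(stk_of pc) -ek e get5_trk eL onth_cat ltnn subnn.
Qed.

Definition pop_target i (c : option bool) :=
  match i, c with
  | IPop _ j0 _ _, None => j0
  | IPop _ _ j1 _, Some false => j1
  | IPop _ _ _ j2, Some true => j2
  | _, _ => 0
  end.

Lemma hoare_popL st (pc : 'I_n.+1) k L m :
  k = stk_of pc ->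
  hoare m.+1 (pc, (%7, onth L m)) (Posz m - 1)%R
    (trep (fun i => set5 (trk st i) k (physcol L m i)))
    (inord (pop_target (nth (IJmp 0) code pc) (onth L 0)), (%4, None)) (-1)%R
    (trep (fun i => set5 (trk st i) k (physcol L 0 i))).
Proof.
move=> ek; elim: m => [|m IH].
  rewrite sub0r -[X in hoare _ _ _ _ _ X](addr0 (-1)%R).
  apply: (@hoare_step _ _ _ _ Stay) => // T HT; exists (T (-1)%R).
  by split; [case: HT => mk _; rewrite /= mk | exact: trep_id].
rewrite -addn1; apply: hoare_trans IH.
have -> : (Posz m.+1 - 1 = Posz m)%R by lia.
apply: (@hoare_step _ _ _ _ MoveL) => // T HT.
case: (HT) => _ /(_ m)[e /negbTE nm _].
exists (mk (set5 (rd (T (Posz m))) k (onth L m.+1))); split.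
  by rewrite /= nm -/(stk_of pc) -ek e get5_set5 /physcol ltnSn.
apply: trep_ext (trep_mk _ _ HT) => i; case: eqP => [->|ne].
  by rewrite e set5_set5 /physcol ltnn.
by congr set5; rewrite /physcol; case: ltnP => ?; case: ltnP => ? //; lia.
Qed.

Lemma hoare_pop st (pc : 'I_n.+1) k j0 j1 j2 :
  nth (IJmp 0) code pc = IPop k j0 j1 j2 -> pc < n ->
  exists2 t, t <= 2 * size (get5 st k) + 4 &
  hoare t (pc, (%4, None)) (-1)%R (trep (trk st))
    (inord (sm_next code (nat_of_ord pc, st)).1, (%4, None)) (-1)%R (trep (trk (sm_next code (nat_of_ord pc, st)).2)).
Proof.
move=> ei lt; pose s := get5 st k.
have ek : k = stk_of pc by rewrite /stk_of ei.
have H1 : hoare 1 (pc, (%4, None)) (-1)%R (trep (trk st)) (pc, (%6, None)) 0%R (trep (trk st)).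
  rewrite -[X in hoare _ _ _ _ _ X](addNr 1%R).
  apply: (@hoare_step _ _ _ _ MoveR) => // T HT; exists (T (-1)%R).
  split; last exact: trep_id.
  by rewrite /= ltn_eqF // ei.
exists ((size s).+1 + ((size s).+1 + 1)); first by rewrite -/s; lia.
have H2 := @hoare_popR st pc k [::] s ek erefl.
apply: hoare_trans (hoare_trans H1 H2) _.
have H3 := @hoare_popL st pc k s (size s) ek.
have -> : 0 + size s = size s by [].
move=> c e1 e2 e3.
have : trep (fun i => set5 (trk st i) k (physcol s (size s) i)) (c_tape c).
  apply: trep_ext e3 => i; rewrite -[LHS](set5_get5 _ k) get5_trk -/s /physcol.
  by congr set5; case: ltnP => // le; rewrite !onth_default //; lia.
case/(H3 c _ e2); first by rewrite onth_default.
rewrite /sm_next /= (set_nth_default (IJmp 0)) // ei -/s /= => -> -> H; split=> //.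
  by congr (inord _, _); case: (s) => [|[] ?].
apply: trep_ext H => i; rewrite /physcol /=.
rewrite /s; case es: (get5 st k) => [|x s']; last by rewrite trk_set5.
by rewrite -[RHS](set5_get5 _ k) get5_trk es !onth_default.
Qed.

Lemma hoare_jmp st (pc : 'I_n.+1) j :
  nth (IJmp 0) code pc = IJmp j -> pc < n ->
  hoare 1 (pc, (%4, None)) (-1)%R (trep (trk st)) (inord j, (%4, None)) (-1)%R (trep (trk st)).
Proof.
move=> ei lt; rewrite -[X in hoare _ _ _ _ _ X](addr0 (-1)%R).
apply: (@hoare_step _ _ _ _ Stay) => // T HT; exists (T (-1)%R).
split; last exact: trep_id.
by rewrite /= ltn_eqF // ei.
Qed.

Definition sz5 (st : stacks) :=
  let: (a, b, c, d, e) := st in size a + size b + size c + size d + size e.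

Lemma sz5_get5 st k : size (get5 st k) <= sz5 st.
Proof. by case: st => [[[[a b] c] d] e]; case: k => /=; lia. Qed.

Lemma sz5_next c : sz5 (sm_next code c).2 <= (sz5 c.2).+1.
Proof.
case: c => pc [[[[a b] c] d] e]; rewrite /sm_next /=.
case: nth => [k x|k j0 j1 j2|j] /=; last by lia.
  by case: k => /=; lia.
by case: k => /=; [case: a|case: b|case: c|case: d|case: e] => //= *; lia.
Qed.

Lemma hoare_next st (pc : nat) : pc < n ->
  exists2 t, t <= 2 * sz5 st + 4 &
  hoare t (inord pc, (%4, None)) (-1)%R (trep (trk st))
    (inord (sm_next code (pc, st)).1, (%4, None)) (-1)%R (trep (trk (sm_next code (pc, st)).2)).
Proof.
move=> lt; set pc' := inord pc; have e : nat_of_ord pc' = pc by rewrite inordK // ltnS ltnW.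
have lt' : pc' < n by rewrite e.
case ei: (nth (IJmp 0) code pc') => [k b|k j0 j1 j2|j].
- have [t tle H] := @hoare_push st pc' k b ei lt'; exists t.
    by have := sz5_get5 st k; lia.
  move: ei H; rewrite /sm_next e => ei; rewrite (set_nth_default (IJmp 0)) //.
  by rewrite ei.
- have [t tle] := @hoare_pop st pc' k j0 j1 j2 ei lt'; rewrite e => H; exists t => //.
  by have := sz5_get5 st k; lia.
exists 1; first by lia.
have := @hoare_jmp st _ _ ei lt'; move: ei; rewrite /sm_next e => ei.
by rewrite (set_nth_default (IJmp 0)) // ei.
Qed.

Lemma sm_next_le c : c.1 <= n -> (sm_next code c).1 <= n.
Proof.
rewrite /sm_next; case: (ltnP c.1 n) => [lt _|ge le]; last first.
  by rewrite nth_default.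
have /(all_nthP (IJmp c.1)) /(_ _ lt) := wf_code.
case: nth => [k b|k j0 j1 j2|j] //= /and3P[? ? ?].
by case: (get5 c.2 k) => // -[].
Qed.

(** The stacks grow by at most one symbol per instruction, so each of the first t instructions costs
    at most 2 (|st| + t) + 4 machine steps. *)
Lemma hoare_steps t st : exists2 T, T <= t * (2 * (sz5 st + t) + 4) &
  let c := iter t (sm_next code) (0, st) in
  hoare T (inord 0, (%4, None)) (-1)%R (trep (trk st))
          (inord c.1, (%4, None)) (-1)%R (trep (trk c.2)) /\
  (c.1 <= n /\ sz5 c.2 <= sz5 st + t).
Proof.
elim: t => [|t [T le [H [Hle Hsz]]]].
  exists 0 => //; split; last by rewrite /= addn0.
  by move=> c.
rewrite iterS; set c := iter t _ _ in H Hle Hsz *.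
have szn := sz5_next c.
have [lt|ge] := ltnP c.1 n; last first.
  exists T; first by apply: leq_trans le _; nia.
  have -> : sm_next code c = c.
    by rewrite /sm_next nth_default //; case: (c).
  by split=> //; split=> //; lia.
have [t' le' H'] := @hoare_next c.2 c.1 lt.
exists (t' + T); first by nia.
rewrite /=; split; last by split; [exact: sm_next_le | lia].
apply: hoare_trans H _; move: H'.
by case: (c).
Qed.

Definition stin (x : seq bool) : stacks := (x, [::], [::], [::], [::]).

Lemma hoare_init x : 
  hoare (2 * size x + 4) (ord0, (%0, None)) 0%R
    (fun T => forall j, T j = c_tape (@init machine x) j)
    (inord 0, (%4, None)) (-1)%R (trep (trk (stin x))).
Proof.
have -> : inord 0 = ord0 :> 'I_n.+1 by apply: val_inj; rewrite /= inordK.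
pose P k : tapeP := fun T => T (-1)%R = mark /\ forall j : nat,
  T (Posz j) = if j < size x then
    (if j < k then mk (set5 none5 SA (Some (nth false x j))) else Some (inl (nth false x j)))
    else None.
have H1 : hoare 1 (ord0, (%0, None)) 0%R
    (fun T => forall j, T j = c_tape (@init machine x) j) (ord0, (%1, None)) (-1)%R
    (fun T => forall j, T j = c_tape (@init machine x) j).
  rewrite -[X in hoare _ _ _ _ _ X](add0r (-1)%R).
  apply: (@hoare_step _ _ _ _ MoveL) => // T HT; exists (T 0%R); split=> // j.
  by case: eqP => [->|_].
have H2 : hoare 1 (ord0, (%1, None)) (-1)%R
    (fun T => forall j, T j = c_tape (@init machine x) j) (ord0, (%2, None)) 0%R (P 0).
  rewrite -[X in hoare _ _ _ _ _ X](addNr 1%R).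
  apply: (@hoare_step _ _ _ _ MoveR) => // T HT; exists mark; split=> //; split=> // j.
  by rewrite /= HT.
have H3 k : k <= size x -> hoare k (ord0, (%2, None)) 0%R (P 0) (ord0, (%2, None)) (Posz k) (P k).
  elim: k => [|k IH] le; first by move=> c.
  rewrite -add1n; apply: hoare_trans (IH (ltnW le)) _.
  rewrite (_ : Posz (1 + k) = Posz k + move_int MoveR)%R; last by rewrite /=; lia.
  apply: hoare_step => // T [mT HT].
  exists (mk (set5 none5 SA (Some (nth false x k)))); split.
    by rewrite /= HT le ltnn.
  split=> // j; rewrite eqz_nat HT; case: eqP => [->|ne].
    by rewrite le add1n ltnSn.
  case: ltnP => // _; rewrite add1n ltnS.
  by case: ltnP => ?; case: ltnP => ? //; lia.
have H4 : hoare 1 (ord0, (%2, None)) (Posz (size x)) (P (size x)) (ord0, (%3, None)) (Posz (size x) - 1)%R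
   (trep (trk (stin x))).
  apply: (@hoare_step _ _ _ _ MoveL) => // T [mT HT].
  exists (T (Posz (size x))); split; first by rewrite /= HT ltnn.
  apply: trep_id; split=> // j; rewrite HT.
  case: ltnP => [lt|ge] //=; last by rewrite !onth_default.
  by rewrite (onth_lt false) ?onth0n.
have H := hoare_trans (hoare_trans (hoare_trans H1 H2) (H3 _ (leqnn _))) H4.
have E : (size x == 0) || (0 < size x) by case: (size x).
case/orP: E => [/eqP s0|sp].
  have H5 : hoare 1 (ord0, (%3, None)) (Posz (size x) - 1)%R (trep (trk (stin x)))
       (ord0, (%4, None)) (-1)%R (trep (trk (stin x))).
    rewrite s0 sub0r -[X in hoare _ _ _ _ _ X](addr0 (-1)%R).
    apply: (@hoare_step _ _ _ _ Stay) => // T HT; exists (T (-1)%R).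
    by split; [case: HT => m _; rewrite /= m | exact: trep_id].
  by have := hoare_trans H H5; rewrite s0.
move: H; rewrite (_ : (Posz (size x) - 1)%R = Posz (size x).-1); last by lia.
move=> H; have := hoare_trans H (@hoare_ret3 (trk (stin x)) ord0 (size x).-1).
by congr hoare; lia.
Qed.

Lemma hoare_out y rest (st := set5 rest SA y) : exists2 t, t <= 2 * size y + 4 &
  hoare t (inord n, (%4, None)) (-1)%R (trep (trk st)) (inord n, (%10, None)) 0%R
   (fun T => (forall j, j < size y -> T (Posz j) = Some (inl (nth false y j))) /\
             ~~ @is_bit machine (T (Posz (size y)))).
Proof.
pose P k : tapeP := fun T => T (-1)%R = mark /\ forall j : nat,
  if j < k then T (Posz j) = Some (inl (nth false y j))
  else [/\ rd (T (Posz j)) = trk st j, ~~ ismark (T (Posz j)) & ~~ @is_bit machine (T (Posz j))].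
have H1 : hoare 1 (inord n, (%4, None)) (-1)%R (trep (trk st)) (inord n, (%8, None)) 0%R (P 0).
  rewrite -[X in hoare _ _ _ _ _ X](addNr 1%R).
  apply: (@hoare_step _ _ _ _ MoveR) => // T HT; exists (T (-1)%R).
  split; last by have [? ?] := trep_id (-1)%R HT.
  by rewrite /= inordK // eqxx.
have H2 k : k <= size y -> hoare k (inord n, (%8, None)) 0%R (P 0) (inord n, (%8, None)) (Posz k) (P k).
  elim: k => [|k IH] le; first by move=> c.
  rewrite -add1n; apply: hoare_trans (IH (ltnW le)) _.
  rewrite (_ : Posz (1 + k) = Posz k + move_int MoveR)%R; last by rewrite /=; lia.
  apply: hoare_step => // T [mT HT].
  exists (Some (inl (nth false y k))); split.
    have := HT k; rewrite ltnn => -[e _ _].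
    by rewrite /delta /= e get5_trk get5_set5 (onth_lt false).
  split=> // j; rewrite eqz_nat; case: eqP => [->|ne]; first by rewrite add1n ltnSn.
  have -> : (j < 1 + k) = (j < k) by lia.
  exact: HT.
have H3 : hoare 1 (inord n, (%8, None)) (Posz (size y)) (P (size y)) (inord n, (%9, None)) (Posz (size y) - 1)%R (P (size y)).
  apply: (@hoare_step _ _ _ _ MoveL) => // T [mT HT].
  exists (T (Posz (size y))); split.
    have := HT (size y); rewrite ltnn => -[e _ _].
    by rewrite /delta /= e get5_trk get5_set5 onth_default.
  by split=> [|j]; case: eqP => [e|_] //; rewrite -?e //; apply: HT.
have H4 k : k <= size y -> hoare k (inord n, (%9, None)) (Posz k - 1)%R (P (size y)) (inord n, (%9, None)) (-1)%R (P (size y)).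
  elim: k => [|k IH] le; first by move=> c.
  rewrite -addn1; apply: hoare_trans (IH (ltnW le)).
  rewrite (_ : Posz (k + 1) - 1 = Posz k)%R; last by lia.
  apply: (@hoare_step _ _ _ _ MoveL) => // T [mT HT].
  exists (T (Posz k)); split; last by split=> [|j]; case: eqP => [e|_] //; rewrite -?e //; apply: HT.
  by have := HT k; rewrite le /= => ->.
have H5 : hoare 1 (inord n, (%9, None)) (-1)%R (P (size y)) (inord n, (%10, None)) 0%R (P (size y)).
  rewrite -[X in hoare _ _ _ _ _ X](addNr 1%R).
  apply: (@hoare_step _ _ _ _ MoveR) => // T [mT HT]; exists (T (-1)%R).
  by split=> [|]; [rewrite /= mT | split=> [|j]; case: eqP => [e|_] //; rewrite -?e //; apply: HT].
have H := hoare_trans (hoare_trans (hoare_trans (hoare_trans H1 (H2 _ (leqnn _))) H3) (H4 _ (leqnn _))) H5.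
exists (1 + (size y + (1 + (size y + 1)))); first by lia.
move=> c e1 e2 e3; have [f1 f2 [_ f3]] := H c e1 e2 e3; split=> //; split.
  by move=> j lt; have := f3 j; rewrite lt.
by have := f3 (size y); rewrite ltnn => -[].
Qed.

Theorem machine_halts x t rest y :
  iter t (sm_next code) (0, stin x) = (n, set5 rest SA y) ->
  exists2 T, T <= 2 * size x + 8 + t * (2 * (size x + t) + 4) + 2 * (size x + t) &
  halts_with machine x T y.
Proof.
move=> e; have [T le] := hoare_steps t (stin x); rewrite e /= => -[H [_ sz]].
have [t' le' H'] := hoare_out y rest.
have HT := hoare_trans (hoare_trans (@hoare_init x) H) H'.
set T' := (t' + _) in HT; exists T'.
  have szx : sz5 (stin x) = size x by rewrite /=; lia.
  have := sz5_get5 (set5 rest SA y) SA; rewrite get5_set5 => ?.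
  by rewrite szx in le sz; rewrite /T'; lia.
have [f1 f2 [f3 f4]] := HT (@init machine x) erefl erefl (fun=> erefl).
rewrite /halts_with /reads_output f1 f2; split=> //.
Qed.
End Simulation.

(** * Structured stack programs *)

Inductive prog :=
| Push of stk & bool
| Skip
| Seq of prog & prog
| Case of stk & prog & prog & prog  (* pop; branch on empty, false, true *)
| While of stk & prog.              (* pop; loop as long as the symbol is true *)

(** The last argument is the exact number of instructions executed by the compiled code, including
    the jump after each branch and each loop body. *)
Inductive ev : prog -> stacks -> stacks -> nat -> Prop :=
| ev_push k b st : ev (Push k b) st (set5 st k (b :: get5 st k)) 1
| ev_skip st : ev Skip st st 0
| ev_seq p q st1 st2 st3 t1 t2 :
    ev p st1 st2 t1 -> ev q st2 st3 t2 -> ev (Seq p q) st1 st3 (t1 + t2)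
| ev_case0 k p0 p1 p2 st st' t : get5 st k = [::] ->
    ev p0 st st' t -> ev (Case k p0 p1 p2) st st' t.+2
| ev_case1 k p0 p1 p2 st st' s t : get5 st k = false :: s ->
    ev p1 (set5 st k s) st' t -> ev (Case k p0 p1 p2) st st' t.+2
| ev_case2 k p0 p1 p2 st st' s t : get5 st k = true :: s ->
    ev p2 (set5 st k s) st' t -> ev (Case k p0 p1 p2) st st' t.+2
| ev_while0 k p st : get5 st k = [::] -> ev (While k p) st st 1
| ev_while1 k p st s : get5 st k = false :: s -> ev (While k p) st (set5 st k s) 1
| ev_while2 k p st s st1 st2 t1 t2 : get5 st k = true :: s ->
    ev p (set5 st k s) st1 t1 -> ev (While k p) st1 st2 t2 ->
    ev (While k p) st st2 (1 + t1 + 1 + t2).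

Fixpoint plen p :=
  match p with
  | Push _ _ => 1 | Skip => 0 | Seq p q => plen p + plen q
  | Case _ p0 p1 p2 => 1 + (plen p0 + 1) + (plen p1 + 1) + (plen p2 + 1)
  | While _ p => 1 + plen p + 1
  end.

Fixpoint compile p (o : nat) : seq instr :=
  match p with
  | Push k b => [:: IPush k b]
  | Skip => [::]
  | Seq p q => compile p o ++ compile q (o + plen p)
  | Case k p0 p1 p2 =>
      let o0 := o + 1 in
      let o1 := o0 + (plen p0 + 1) in
      let o2 := o1 + (plen p1 + 1) in
      let e := o2 + (plen p2 + 1) in
      [:: IPop k o0 o1 o2] ++ (compile p0 o0 ++ [:: IJmp e]) ++ (compile p1 o1 ++ [:: IJmp e])
        ++ (compile p2 o2 ++ [:: IJmp e])
  | While k p =>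
      let e := o + (1 + plen p + 1) in
      [:: IPop k e e (o + 1)] ++ (compile p (o + 1) ++ [:: IJmp o])
  end.

Lemma size_comp p o : size (compile p o) = plen p.
Proof.
by elim: p o => //= [p IHp q IHq|k p0 IH0 p1 IH1 p2 IH2|k p IH] o;
   rewrite ?size_cat /= ?size_cat /= ?IHp ?IHq ?IH0 ?IH1 ?IH2 ?IH; lia.
Qed.

Lemma targets_leW m n i : m <= n -> targets_le m i -> targets_le n i.
Proof. by move=> le; case: i => //= [k a b c /and3P[? ? ?]|j ?]; [apply/and3P; split|]; lia. Qed.

Lemma comp_wf p o : all (targets_le (o + plen p)) (compile p o).
Proof.
have W m n s : m <= n -> all (targets_le m) s -> all (targets_le n) s.
  by move=> le; apply: sub_all => i; exact: targets_leW.
elim: p o => //= [p IHp q IHq|k p0 IH0 p1 IH1 p2 IH2|k p IH] o.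
- rewrite all_cat (W _ _ _ _ (IHp o)) ?(W _ _ _ _ (IHq (o + plen p))) //; lia.
- rewrite !all_cat /= (W _ _ _ _ (IH0 _)) ?(W _ _ _ _ (IH1 _)) ?(W _ _ _ _ (IH2 _)) /=; lia.
- rewrite !all_cat /= (W _ _ _ _ (IH _)) /=; lia.
Qed.

Definition code_at (code : seq instr) o s := exists c1 c2, code = c1 ++ s ++ c2 /\ size c1 = o.

Lemma code_at_cat code o s1 s2 :
  code_at code o (s1 ++ s2) -> code_at code o s1 /\ code_at code (o + size s1) s2.
Proof.
case=> c1 [c2 [-> <-]]; split; first by exists c1, (s2 ++ c2); rewrite -!catA.
by exists (c1 ++ s1), c2; rewrite -!catA size_cat.
Qed.

Lemma code_at1 code o i x : code_at code o [:: i] -> nth x code o = i.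
Proof. by case=> c1 [c2 [-> <-]]; rewrite nth_cat ltnn subnn. Qed.

Lemma ev_iter p st st' t : ev p st st' t ->
  forall code o, code_at code o (compile p o) ->
  iter t (sm_next code) (o, st) = (o + plen p, st').
Proof.
elim=> {p st st' t}.
- move=> k b st code o /= H.
  by rewrite /sm_next /= (code_at1 _ H) addn1.
- by move=> st code o _; rewrite addn0.
- move=> p q st1 st2 st3 t1 t2 _ IH1 _ IH2 code o /= /code_at_cat[H1].
  rewrite size_comp => H2.
  by rewrite addnC iterD IH1 // IH2 // addnA.
- move=> k p0 p1 p2 st st' t e _ IH code o /= H.
  have [H0] := @code_at_cat _ _ [:: _] _ H.
  case/code_at_cat => /code_at_cat[/IH {}IH HJ] _.
  rewrite -!iterS iterS iterSr (_ : sm_next code (o, st) = (o + 1, st)); last first.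
    by rewrite /sm_next /= (code_at1 _ H0) e.
  rewrite IH.
  by rewrite /sm_next /= -[X in nth _ _ (_ + X)](size_comp p0 (o + 1)) (code_at1 _ HJ) /=; congr (_, _); lia.
- move=> k p0 p1 p2 st st' s t e _ IH code o /= H.
  have [H0] := @code_at_cat _ _ [:: _] _ H.
  case/code_at_cat => _ /code_at_cat[+ _]; rewrite size_cat size_comp /=.
  case/code_at_cat => /IH {}IH HJ.
  rewrite -!iterS iterS iterSr (_ : sm_next code (o, st) = (o + 1 + (plen p0 + 1), set5 st k s)); last first.
    by rewrite /sm_next /= (code_at1 _ H0) e.
  rewrite IH.
  by rewrite /sm_next /= -[X in nth _ _ (_ + X)](size_comp p1 (o + 1 + (plen p0 + 1))) (code_at1 _ HJ) /=; congr (_, _); lia.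
- move=> k p0 p1 p2 st st' s t e _ IH code o /= H.
  have [H0] := @code_at_cat _ _ [:: _] _ H.
  case/code_at_cat => _ /code_at_cat[_]; rewrite !size_cat !size_comp /=.
  case/code_at_cat => /IH {}IH HJ.
  rewrite -!iterS iterS iterSr (_ : sm_next code (o, st) = (o + 1 + (plen p0 + 1) + (plen p1 + 1), set5 st k s)); last first.
    by rewrite /sm_next /= (code_at1 _ H0) e.
  rewrite IH.
  by rewrite /sm_next /= -[X in nth _ _ (_ + X)](size_comp p2 (o + 1 + (plen p0 + 1) + (plen p1 + 1))) (code_at1 _ HJ) /=; congr (_, _); lia.
- move=> k p st e code o /= H.
  have [H0 _] := @code_at_cat _ _ [:: _] _ H.
  by rewrite /sm_next /= (code_at1 _ H0) e.
- move=> k p st s e code o /= H.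
  have [H0 _] := @code_at_cat _ _ [:: _] _ H.
  by rewrite /sm_next /= (code_at1 _ H0) e.
- move=> k p st s st1 st2 t1 t2 e _ IH1 _ IH2 code o H.
  have {}IH2 := IH2 _ _ H.
  have [H0 H1] := @code_at_cat _ _ [:: _] _ H.
  have [/IH1 {}IH1] := code_at_cat H1; rewrite size_comp => HJ.
  have -> : 1 + t1 + 1 + t2 = t2 + t1.+2 by lia.
  rewrite iterD iterS iterSr (_ : sm_next code (o, st) = (o + 1, set5 st k s)); last first.
    by rewrite /sm_next /= (code_at1 _ H0) e.
  rewrite IH1.
  rewrite (_ : sm_next code (o + 1 + plen p, st1) = (o, st1)) ?IH2 //.
  by rewrite /sm_next /= (code_at1 _ HJ).
Qed.

(** * Binary trees on the stacks *)

Inductive tree := Lf | Nd of tree & tree.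
(** A prefix code: a value on top of a stack needs no delimiter, and a program can consume exactly
    one value. *)
Fixpoint ser t := match t with Lf => [:: false] | Nd a b => true :: ser a ++ ser b end.

Definition evb p st st' b := exists2 t, t <= b & ev p st st' t.

Lemma evb_seq p q st1 st2 st3 b1 b2 :
  evb p st1 st2 b1 -> evb q st2 st3 b2 -> evb (Seq p q) st1 st3 (b1 + b2).
Proof.
move=> [t1 le1 e1] [t2 le2 e2]; exists (t1 + t2); first exact: leq_add.
exact: ev_seq e1 e2.
Qed.

Lemma evb_leq p st st' b b' : b <= b' -> evb p st st' b -> evb p st st' b'.
Proof. by move=> le [t lt e]; exists t => //; exact: leq_trans le. Qed.

Lemma evb_push k b st : evb (Push k b) st (set5 st k (b :: get5 st k)) 1.
Proof. by exists 1 => //; constructor. Qed.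

Lemma evb_skip st : evb Skip st st 0.
Proof. by exists 0 => //; constructor. Qed.

Lemma evb_case0 k p0 p1 p2 st st' b : get5 st k = [::] ->
  evb p0 st st' b -> evb (Case k p0 p1 p2) st st' b.+2.
Proof. by move=> e [t le h]; exists t.+2 => //; exact: ev_case0. Qed.

Lemma evb_case1 k p0 p1 p2 st st' s b : get5 st k = false :: s ->
  evb p1 (set5 st k s) st' b -> evb (Case k p0 p1 p2) st st' b.+2.
Proof. by move=> e [t le h]; exists t.+2 => //; exact: ev_case1 h. Qed.

Lemma evb_case2 k p0 p1 p2 st st' s b : get5 st k = true :: s ->
  evb p2 (set5 st k s) st' b -> evb (Case k p0 p1 p2) st st' b.+2.
Proof. by move=> e [t le h]; exists t.+2 => //; exact: ev_case2 h. Qed.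

Lemma evb_while0 k p st : get5 st k = [::] -> evb (While k p) st st 1.
Proof. by move=> e; exists 1 => //; exact: ev_while0. Qed.

Lemma evb_while2 k p st s st1 st2 b1 b2 : get5 st k = true :: s ->
  evb p (set5 st k s) st1 b1 -> evb (While k p) st1 st2 b2 ->
  evb (While k p) st st2 (b1 + b2 + 2).
Proof.
move=> e [t1 le1 e1] [t2 le2 e2]; exists (1 + t1 + 1 + t2); first by lia.
exact: ev_while2 e1 e2.
Qed.

Definition put (j : nat) b : prog :=
  match j with 0 => Skip | 1 => Push SB b | _ => Push SD b end.
Definition putB j s (B : seq bool) := if j is 1 then catrev s B else B.
Definition putD j s (D : seq bool) := if j is j'.+2 then catrev s D else D.

Lemma evb_put j b A B C D F :
  evb (put j b) (A, B, C, D, F) (A, putB j [:: b] B, C, putD j [:: b] D, F) 1.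
Proof.
case: j => [|[|j]] /=; first exact: evb_leq (evb_skip _).
  exact: evb_push.
exact: evb_push.
Qed.

(* Stack SC counts, in unary, the subtrees that remain to be read. *)
Definition move_loop j := While SC (Case SA Skip (put j false)
  (Seq (put j true) (Seq (Push SC true) (Push SC true)))).
Definition move_tree j := Seq (Push SC true) (move_loop j).

(** Stated for an arbitrary continuation of the loop, so that it can be applied to both subtrees in
    turn: a leaf uses up one counter symbol, and a node replaces its symbol by two. *)
Lemma evb_move_loop j t A B C D st' b :
  evb (move_loop j) (A, putB j (ser t) B, C, putD j (ser t) D, [::]) st' b ->
  evb (move_loop j) (ser t ++ A, B, true :: C, D, [::]) st' (b + 7 * size (ser t)).
Proof.
elim: t A B C D b => [|t1 IH1 t2 IH2] A B C D b /= H.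
  eapply evb_leq; last first.
    eapply evb_while2; first by []; last exact: H.
    eapply evb_case1; first by []; exact: evb_put.
  by lia.
have e3 : putB j (true :: ser t1 ++ ser t2) B =
   putB j (ser t2) (putB j (ser t1) (putB j [:: true] B)).
  by case: j {IH1 IH2 H} => [|[|j]] //=; rewrite /catrev -/catrev !catrevE rev_cat !catA.
have e4 : putD j (true :: ser t1 ++ ser t2) D =
   putD j (ser t2) (putD j (ser t1) (putD j [:: true] D)).
  by case: j {IH1 IH2 H e3} => [|[|j]] //=; rewrite /catrev -/catrev !catrevE rev_cat !catA.
rewrite e3 e4 in H; move/IH2/IH1: H => H.
rewrite -catA; eapply evb_leq; last first.
  eapply evb_while2; first by []; last exact: H.
  eapply evb_case2; first by []; eapply evb_seq; first exact: evb_put.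
  eapply evb_seq; first exact: evb_push.
  exact: evb_push.
by rewrite /= size_cat; lia.
Qed.

Lemma evb_move j t A B D :
  evb (move_tree j) (ser t ++ A, B, [::], D, [::])
      (A, putB j (ser t) B, [::], putD j (ser t) D, [::]) (7 * size (ser t) + 2).
Proof.
eapply evb_leq; last first.
  eapply evb_seq; first exact: evb_push.
  apply: evb_move_loop; exact: evb_while0.
by lia.
Qed.

(** The loop is controlled by a flag on [SF], because the popped symbol itself may be false. *)
Definition pour_loop k (p : bool -> prog) := While SF (Case k Skip
  (Seq (p false) (Push SF true)) (Seq (p true) (Push SF true))).
Definition pour k (p : bool -> prog) := Seq (Push SF true) (pour_loop k p).

Lemma evb_pourBA A B C D : evb (pour SB (Push SA)) (A, B, C, D, [::])
  (catrev B A, [::], C, D, [::]) (6 * size B + 6).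
Proof.
suff H : evb (pour_loop SB (Push SA)) (A, B, C, D, [:: true])
    (catrev B A, [::], C, D, [::]) (6 * size B + 5).
  by apply: (evb_leq _ (evb_seq (evb_push SF true (A, B, C, D, [::])) H)); lia.
elim: B A => [|b B IH] A.
  eapply evb_leq; last first.
    eapply evb_while2; first by []; last exact: evb_while0.
    by eapply evb_case0; first by []; exact: evb_skip.
  by [].
eapply evb_leq; last first.
  eapply evb_while2; first by []; last exact: (IH (b :: A)).
  case: b; [eapply evb_case2; first by [] | eapply evb_case1; first by []];
  by eapply evb_seq; exact: evb_push.
by rewrite /=; lia.
Qed.

Lemma evb_pourDA A B C D : evb (pour SD (Push SA)) (A, B, C, D, [::])
  (catrev D A, B, C, [::], [::]) (6 * size D + 6).
Proof.
suff H : evb (pour_loop SD (Push SA)) (A, B, C, D, [:: true])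
    (catrev D A, B, C, [::], [::]) (6 * size D + 5).
  by apply: (evb_leq _ (evb_seq (evb_push SF true (A, B, C, D, [::])) H)); lia.
elim: D A => [|b D IH] A.
  eapply evb_leq; last first.
    eapply evb_while2; first by []; last exact: evb_while0.
    by eapply evb_case0; first by []; exact: evb_skip.
  by [].
eapply evb_leq; last first.
  eapply evb_while2; first by []; last exact: (IH (b :: A)).
  case: b; [eapply evb_case2; first by [] | eapply evb_case1; first by []];
  by eapply evb_seq; exact: evb_push.
by rewrite /=; lia.
Qed.

Lemma evb_pourDB A B C D : evb (pour SD (Push SB)) (A, B, C, D, [::])
  (A, catrev D B, C, [::], [::]) (6 * size D + 6).
Proof.
suff H : evb (pour_loop SD (Push SB)) (A, B, C, D, [:: true])
    (A, catrev D B, C, [::], [::]) (6 * size D + 5).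
  by apply: (evb_leq _ (evb_seq (evb_push SF true (A, B, C, D, [::])) H)); lia.
elim: D B => [|b D IH] B.
  eapply evb_leq; last first.
    eapply evb_while2; first by []; last exact: evb_while0.
    by eapply evb_case0; first by []; exact: evb_skip.
  by [].
eapply evb_leq; last first.
  eapply evb_while2; first by []; last exact: (IH (b :: B)).
  case: b; [eapply evb_case2; first by [] | eapply evb_case1; first by []];
  by eapply evb_seq; exact: evb_push.
by rewrite /=; lia.
Qed.

Definition pushAD b := Seq (Push SA b) (Push SD b).

Lemma evb_pourBAD A B C D : evb (pour SB pushAD) (A, B, C, D, [::])
  (catrev B A, [::], C, catrev B D, [::]) (7 * size B + 6).
Proof.
suff H : evb (pour_loop SB pushAD) (A, B, C, D, [:: true])
    (catrev B A, [::], C, catrev B D, [::]) (7 * size B + 5).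
  by apply: (evb_leq _ (evb_seq (evb_push SF true (A, B, C, D, [::])) H)); lia.
elim: B A D => [|b B IH] A D.
  eapply evb_leq; last first.
    eapply evb_while2; first by []; last exact: evb_while0.
    by eapply evb_case0; first by []; exact: evb_skip.
  by [].
eapply evb_leq; last first.
  eapply evb_while2; first by []; last exact: (IH (b :: A) (b :: D)).
  case: b; [eapply evb_case2; first by [] | eapply evb_case1; first by []];
  by eapply evb_seq; [eapply evb_seq|]; exact: evb_push.
by rewrite /=; lia.
Qed.

Definition st0 A : stacks := (A, [::], [::], [::], [::]).
Definition run p A A' b := evb p (st0 A) (st0 A') b.

Definition drop_tree := move_tree 0.
Definition dup_tree := Seq (move_tree 1) (Seq (pour SB pushAD) (Seq (pour SD (Push SB)) (pour SB (Push SA)))).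
Definition swap_tree := Seq (move_tree 1) (Seq (move_tree 2) (Seq (pour SB (Push SA)) (pour SD (Push SA)))).

Lemma run_drop t A : run drop_tree (ser t ++ A) A (7 * size (ser t) + 2).
Proof. exact: evb_move. Qed.

Lemma run_dup t A : run dup_tree (ser t ++ A) (ser t ++ ser t ++ A) (26 * size (ser t) + 20).
Proof.
eapply evb_leq; last first.
  eapply evb_seq; first exact: (@evb_move 1).
  eapply evb_seq; first exact: evb_pourBAD.
  eapply evb_seq; first exact: evb_pourDB.
  rewrite /st0; set s := ser t.
  have -> : s ++ s ++ A = catrev (catrev (catrev (catrev s [::]) [::]) [::]) (catrev (catrev s [::]) A).
    by rewrite !catrevE !cats0 !revK.
  exact: evb_pourBA.
by rewrite /= !catrevE !cats0 !size_rev; lia.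
Qed.

Lemma run_swap t u A : run swap_tree (ser t ++ ser u ++ A) (ser u ++ ser t ++ A)
  (13 * size (ser t) + 13 * size (ser u) + 20).
Proof.
eapply evb_leq; last first.
  eapply evb_seq; first exact: (@evb_move 1).
  eapply evb_seq; first exact: (@evb_move 2).
  eapply evb_seq; first exact: evb_pourBA.
  rewrite /st0.
  have -> : ser u ++ ser t ++ A = catrev (catrev (ser u) [::]) (catrev (catrev (ser t) [::]) A).
    by rewrite !catrevE !cats0 !revK.
  exact: evb_pourDA.
by rewrite /= !catrevE !cats0 !size_rev; lia.
Qed.

Fixpoint push_all (s : seq bool) := if s is b :: s' then Seq (push_all s') (Push SA b) else Skip.

Lemma run_push_all s A : run (push_all s) A (s ++ A) (size s).
Proof.
elim: s => [|b s IH] /=; first exact: evb_skip.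
rewrite -addn1; exact: evb_seq IH (evb_push _ _ _).
Qed.

Lemma run_push b A : run (Push SA b) A (b :: A) 1.
Proof. exact: evb_push. Qed.

Lemma ev_size p st st' t : ev p st st' t -> sz5 st' <= sz5 st + t.
Proof.
have set_le st1 k b s : get5 st1 k = b :: s -> sz5 (set5 st1 k s) <= sz5 st1.
  by case: st1 => [[[[A B] C] D] F]; case: k => /= ->; rewrite /=; lia.
elim=> {p st st' t} //=; try by move=> *; lia.
- by move=> k b [[[[A B] C] D] F]; case: k => /=; lia.
- by move=> k p0 p1 p2 st st' s t /set_le *; lia.
- by move=> k p0 p1 p2 st st' s t /set_le *; lia.
- by move=> k p st s /set_le *; lia.
- by move=> k p st s st1 st2 t1 t2 /set_le *; lia.
Qed.

Class Enc (A : Type) := enc : A -> tree.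
Definition es {A} {_ : Enc A} (a : A) := size (ser (enc a)).

Instance Enc_unit : Enc unit := fun _ => Lf.
Instance Enc_bool : Enc bool := fun b => if b then Nd Lf Lf else Lf.
Instance Enc_prod A B (_ : Enc A) (_ : Enc B) : Enc (A * B) := fun x => Nd (enc x.1) (enc x.2).
(** A nonempty list is encoded like the pair of its head and its tail, so consing and splitting a
    list cost no more than pairing. *)
Fixpoint enc_seq A (_ : Enc A) (s : seq A) := if s is x :: s' then Nd (enc x) (enc_seq _ s') else Lf.
Instance Enc_seq A (eA : Enc A) : Enc (seq A) := enc_seq eA.
Instance Enc_nat : Enc nat := fun n => enc (nat_bits n).

Section PolyBounds.
Context {A : Type} {eA : Enc A}.

Definition pbound (b : A -> nat) := exists c k, forall a, b a <= c * es a ^ k.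

Lemma es_gt0 (a : A) : 0 < es a.
Proof. by rewrite /es; case: (enc a). Qed.

Lemma pb_le b b' : (forall a, b a <= b' a) -> pbound b' -> pbound b.
Proof. by move=> le [c [k H]]; exists c, k => a; exact: leq_trans (H a). Qed.

Lemma pb_const n : pbound (fun=> n).
Proof. by exists n, 0 => a; rewrite expn0 muln1. Qed.

Lemma pb_es : pbound es.
Proof. by exists 1, 1 => a; rewrite mul1n. Qed.

Lemma pb_add b b' : pbound b -> pbound b' -> pbound (fun a => b a + b' a).
Proof.
move=> [c [k H]] [c' [k' H']]; exists (c + c'), (k + k') => a.
rewrite mulnDl leq_add //.
  apply: leq_trans (H a) _; rewrite leq_mul2l leq_pexp2l ?es_gt0 ?leq_addr ?orbT //.
apply: leq_trans (H' a) _; rewrite leq_mul2l leq_pexp2l ?es_gt0 ?leq_addl ?orbT //.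
Qed.

Lemma pb_mul b b' : pbound b -> pbound b' -> pbound (fun a => b a * b' a).
Proof.
move=> [c [k H]] [c' [k' H']]; exists (c * c'), (k + k') => a.
by rewrite expnD mulnACA leq_mul.
Qed.

Lemma pb_exp b n : pbound b -> pbound (fun a => b a ^ n).
Proof.
move=> [c [k H]]; exists (c ^ n), (k * n) => a.
by rewrite expnM -expnMn; case: n => // n; rewrite leq_exp2r.
Qed.
End PolyBounds.

(** * Polynomial-time functions *)

(** The program must work above any remaining stack content [r]; composition and pairing depend on
    this. *)
Definition ptime {A B} {eA : Enc A} {eB : Enc B} (f : A -> B) := exists p b,
  pbound b /\ forall a r, run p (ser (enc a) ++ r) (ser (enc (f a)) ++ r) (b a).

(** One instruction adds at most one symbol, so the output is no longer than the input plus the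
    time. *)
Lemma ptime_size {A B} {eA : Enc A} {eB : Enc B} (f : A -> B) :
  ptime f -> pbound (fun a => es (f a)).
Proof.
move=> [p [b [Hb H]]]; apply: (@pb_le _ _ _ (fun a => es a + b a)) => [a|]; last first.
  exact: pb_add (pb_es) Hb.
have [t le e] := H a [::]; have := ev_size e.
by rewrite !cats0 /es /=; lia.
Qed.

Lemma pb_comp {A B} {eA : Enc A} {eB : Enc B} (f : A -> B) b :
  pbound (fun a => es (f a)) -> pbound b -> pbound (fun a => b (f a)).
Proof.
move=> Hf [c [k H]]; apply: (pb_le (b' := fun a => c * es (f a) ^ k)) => [a //|].
exact: pb_mul (pb_const _) (pb_exp _ Hf).
Qed.

Lemma pt_comp {A B C} {eA : Enc A} {eB : Enc B} {eC : Enc C} (g : B -> C) (f : A -> B) :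
  ptime g -> ptime f -> ptime (fun a => g (f a)).
Proof.
move=> [q [b' [Hb' H']]] Hf; have Hs := ptime_size Hf.
move: Hf => [p [b [Hb H]]].
exists (Seq p q), (fun a => b a + b' (f a)); split.
  by apply: pb_add => //; exact: pb_comp.
by move=> a r; exact: evb_seq (H a r) (H' _ _).
Qed.

Lemma pt_id {A} {eA : Enc A} : ptime (fun a : A => a).
Proof. by exists Skip, (fun=> 0); split; [exact: pb_const | move=> a r; exact: evb_skip]. Qed.

Lemma pt_ext {A B} {eA : Enc A} {eB : Enc B} (f g : A -> B) : f =1 g -> ptime f -> ptime g.
Proof. by move=> e [p [b [Hb H]]]; exists p, b; split=> // a r; rewrite -e. Qed.

(* A change of type that does not change the encoding costs nothing. *)
Lemma pt_enc {A B B'} {eA : Enc A} {eB : Enc B} {eB' : Enc B'} (f : A -> B) (g : A -> B') :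
  (forall a, enc (f a) = enc (g a)) -> ptime f -> ptime g.
Proof. by move=> e [p [b [Hb H]]]; exists p, b; split=> // a r; rewrite -e. Qed.

Lemma pt_pair {A B C} {eA : Enc A} {eB : Enc B} {eC : Enc C} (f : A -> B) (g : A -> C) :
  ptime f -> ptime g -> ptime (fun a => (f a, g a)).
Proof.
move=> Hf Hg; have Hfs := ptime_size Hf; have Hgs := ptime_size Hg.
move: Hf Hg => [p [b [Hb H]]] [q [b' [Hb' H']]].
exists (Seq dup_tree (Seq p (Seq swap_tree (Seq q (Seq swap_tree (Push SA true)))))).
exists (fun a => (26 * es a + 20) + (b a + ((13 * es (f a) + 13 * es a + 20) +
         (b' a + ((13 * es (g a) + 13 * es (f a) + 20) + 1))))); split.
  by do ?[apply: pb_add | apply: pb_mul | exact: pb_const | exact: pb_es | assumption].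
move=> a r; apply: evb_seq (run_dup _ _) _; apply: evb_seq (H _ _) _.
apply: evb_seq (run_swap _ _ _) _; apply: evb_seq (H' _ _) _.
apply: evb_seq (run_swap _ _ _) _.
rewrite /= -catA; exact: run_push.
Qed.

Lemma pt_const {A B} {eA : Enc A} {eB : Enc B} (b : B) : ptime (fun a : A => b).
Proof.
exists (Seq drop_tree (push_all (ser (enc b)))), (fun a => (7 * es a + 2) + es b); split.
  by do ?[apply: pb_add | apply: pb_mul | exact: pb_const | exact: pb_es | assumption].
move=> a r; apply: evb_seq (run_drop _ _) _; exact: run_push_all.
Qed.

Lemma pt_fst1 {A B} {eA : Enc A} {eB : Enc B} : ptime (@fst A B).
Proof.
exists (Case SA Skip Skip (Seq swap_tree drop_tree)), (fun x => (26 * es x + 20 + (7 * es x + 2)).+2); split.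
  apply: (pb_le (b' := fun x => 33 * es x + 24)) => [x|]; first by lia.
  by do ?[apply: pb_add | apply: pb_mul | exact: pb_const | exact: pb_es | assumption].
move=> [a b] r /=; eapply evb_leq; last first.
  eapply evb_case2; first by [].
  rewrite -catA; apply: evb_seq (run_swap _ _ _) _; exact: run_drop.
by rewrite /es /= size_cat; lia.
Qed.

Lemma pt_snd1 {A B} {eA : Enc A} {eB : Enc B} : ptime (@snd A B).
Proof.
exists (Case SA Skip Skip drop_tree), (fun x => (7 * es x + 2).+2); split.
  apply: (pb_le (b' := fun x => 33 * es x + 24)) => [x|]; first by lia.
  by do ?[apply: pb_add | apply: pb_mul | exact: pb_const | exact: pb_es | assumption].
move=> [a b] r /=; eapply evb_leq; last first.
  eapply evb_case2; first by [].
  rewrite -catA; exact: run_drop.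
by rewrite /es /= size_cat; lia.
Qed.

Lemma es_cons {X} {eX : Enc X} (x : X) s : es (x :: s) = (es x + es s).+1.
Proof. by rewrite /es /= size_cat. Qed.

Lemma es_pair {A B} {eA : Enc A} {eB : Enc B} (a : A) (b : B) : es (a, b) = (es a + es b).+1.
Proof. by rewrite /es /= size_cat. Qed.

Lemma es_cat {X} {eX : Enc X} (s1 s2 : seq X) : es s1 + es s2 = (es (s1 ++ s2)).+1.
Proof. by elim: s1 => [|x s1 IH]; rewrite ?cat_cons ?es_cons //=; lia. Qed.

Lemma size_le_es {X} {eX : Enc X} (s : seq X) : size s < es s.
Proof. by elim: s => [|x s IH] //=; rewrite es_cons; lia. Qed.

Section Lists.
Context {A X : Type} {eA : Enc A} {eX : Enc X}.

Lemma pt_head1 (x0 : X) : ptime (head x0).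
Proof.
exists (Case SA Skip (push_all (ser (enc x0))) (Seq swap_tree drop_tree)).
exists (fun x => (es x0 + (26 * es x + 20 + (7 * es x + 2))).+2); split.
  apply: (pb_le (b' := fun x => es x0 + 33 * es x + 24)) => [x|]; first by lia.
  by do ?[apply: pb_add | apply: pb_mul | exact: pb_const | exact: pb_es | assumption].
move=> [|x s] r /=; (eapply evb_leq; last first).
- eapply evb_case1; first by []. exact: run_push_all.
- by rewrite /es /=; lia.
- eapply evb_case2; first by [].
  rewrite -catA; apply: evb_seq (run_swap _ _ _) _; exact: run_drop.
by rewrite /es /= size_cat; lia.
Qed.

Lemma pt_behead1 : ptime (@behead X).
Proof.
exists (Case SA Skip (Push SA false) drop_tree), (fun x => (7 * es x + 2).+2); split.
  apply: (pb_le (b' := fun x => 33 * es x + 24)) => [x|]; first by lia.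
  by do ?[apply: pb_add | apply: pb_mul | exact: pb_const | exact: pb_es | assumption].
move=> [|x s] r /=; (eapply evb_leq; last first).
- eapply evb_case1; first by []. exact: run_push.
- by rewrite /es /=; lia.
- eapply evb_case2; first by []. rewrite -catA; exact: run_drop.
by rewrite /es /= size_cat; lia.
Qed.

Lemma pt_nilp1 : ptime (@nilp X).
Proof.
exists (Case SA Skip (push_all (ser (enc true))) (Seq drop_tree (Seq drop_tree (Push SA false)))).
exists (fun x => (14 * es x + 9).+2); split.
  apply: (pb_le (b' := fun x => 33 * es x + 24)) => [x|]; first by lia.
  by do ?[apply: pb_add | apply: pb_mul | exact: pb_const | exact: pb_es | assumption].
move=> [|x s] r /=; (eapply evb_leq; last first).
- eapply evb_case1; first by []. exact: (run_push_all (ser (enc true))).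
- by rewrite /es /=; lia.
- eapply evb_case2; first by []. rewrite -catA; apply: evb_seq (run_drop _ _) _.
  apply: evb_seq (run_drop _ _) _; exact: run_push.
by rewrite /es /= size_cat; lia.
Qed.

Lemma pt_if (b : A -> bool) (f g : A -> X) : ptime b -> ptime f -> ptime g ->
  ptime (fun a => if b a then f a else g a).
Proof.
move=> [p [bp [Hp H]]] [q [bq [Hq H']]] [q' [bq' [Hq' H'']]].
exists (Seq dup_tree (Seq p (Case SA Skip q' (Case SA Skip (Case SA Skip q Skip) Skip)))).
exists (fun a => 26 * es a + 20 + (bp a + (bq a + bq' a).+4.+2)); split.
  apply: (pb_le (b' := fun a => 26 * es a + 20 + (bp a + (bq a + bq' a + 6)))) => [x|]; first by lia.
  by do ?[apply: pb_add | apply: pb_mul | exact: pb_const | exact: pb_es | assumption].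
move=> a r; apply: evb_seq (run_dup _ _) _; apply: evb_seq (H _ _) _.
case: (b a) => /=; (eapply evb_leq; last first).
- eapply evb_case2; first by []. eapply evb_case1; first by [].
  eapply evb_case1; first by []. exact: H'.
- lia.
- eapply evb_case1; first by []. exact: H''.
lia.
Qed.

Lemma pt_cons (f : A -> X) (g : A -> seq X) : ptime f -> ptime g -> ptime (fun a => f a :: g a).
Proof. by move=> Hf Hg; exact: (pt_enc (f := fun a => (f a, g a))) (pt_pair Hf Hg). Qed.
End Lists.

Lemma pt_fst {A B C} {eA : Enc A} {eB : Enc B} {eC : Enc C} (f : A -> B * C) :
  ptime f -> ptime (fun a => (f a).1).
Proof. exact: pt_comp pt_fst1. Qed.
Lemma pt_snd {A B C} {eA : Enc A} {eB : Enc B} {eC : Enc C} (f : A -> B * C) :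
  ptime f -> ptime (fun a => (f a).2).
Proof. exact: pt_comp pt_snd1. Qed.
Lemma pt_head {A X} {eA : Enc A} {eX : Enc X} x0 (f : A -> seq X) :
  ptime f -> ptime (fun a => head x0 (f a)).
Proof. exact: pt_comp (pt_head1 x0). Qed.
Lemma pt_behead {A X} {eA : Enc A} {eX : Enc X} (f : A -> seq X) :
  ptime f -> ptime (fun a => behead (f a)).
Proof. exact: pt_comp pt_behead1. Qed.
Lemma pt_nilp {A X} {eA : Enc A} {eX : Enc X} (f : A -> seq X) :
  ptime f -> ptime (fun a => nilp (f a)).
Proof. exact: pt_comp pt_nilp1. Qed.

Section Foldl.
Context {C A X : Type} {eC : Enc C} {eA : Enc A} {eX : Enc X}.
Variables (f : C -> A -> X -> A) (l : C -> seq X) (init : C -> A).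

Definition fold_body (q : (C * A) * (X * seq X)) : seq X * (C * A) :=
  (q.2.2, (q.1.1, f q.1.1 q.1.2 q.2.1)).

(** Iterating a polynomial-time step may let the accumulator grow exponentially, so a polynomial
    bound on all intermediate accumulators is demanded. *)
Lemma pt_foldl :
  ptime (fun p : C * A * X => f p.1.1 p.1.2 p.2) -> ptime l -> ptime init ->
  (exists2 b, pbound b & forall c l1 l2, l c = l1 ++ l2 ->
     es (foldl (f c) (init c) l1) <= b c) ->
  ptime (fun c => foldl (f c) (init c) (l c)).
Proof.
move=> Hf Hl Hi [b Hb Hle].
have : ptime fold_body.
  apply: pt_pair; first by apply: pt_snd; apply: pt_snd; exact: pt_id.
  apply: pt_pair; first by apply: pt_fst; apply: pt_fst; exact: pt_id.
  apply: (pt_comp (g := fun p : C * A * X => f p.1.1 p.1.2 p.2)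
          (f := fun q : (C * A) * (X * seq X) => (q.1, q.2.1))) => //.
  apply: pt_pair; first by apply: pt_fst; exact: pt_id.
  by apply: pt_fst; apply: pt_snd; exact: pt_id.
case=> p [bp [[cp [kp Hbp]] Hp]].
have Hls := ptime_size Hl.
have : ptime (fun c => (l c, (c, init c))).
  by apply: pt_pair => //; apply: pt_pair => //; exact: pt_id.
case=> q [bq [Hbq Hq]].
have [ps [bs [[cs [ks Hbs]] Hs]]] := @pt_snd1 C A _ _.
(* The two pushed tags turn the stack into the encoding of ((c, acc), (x, rest)). The tag of the
   resulting pair is popped, which leaves the remaining list on top of (c, acc). *)
pose body := Seq (Push SA true) (Seq swap_tree (Seq (Push SA true) (Seq p
   (Seq (Case SA Skip Skip Skip) (Push SF true))))).
pose loop := While SF (Case SA Skip Skip body).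
pose (Sz := fun c : C => 3 + es c + b c + es (l c)).
have HS : pbound Sz.
  by do ?[apply: pb_add | apply: pb_mul | exact: pb_const | exact: pb_es | assumption].
pose (B := fun c : C => cp * Sz c ^ kp + 13 * Sz c + 40).
have HB : pbound B.
  by do ?[apply: pb_add | apply: pb_mul | apply: pb_exp | exact: pb_const | exact: pb_es | assumption].
exists (Seq q (Seq (Case SA Skip Skip Skip) (Seq (Push SF true) (Seq loop ps)))).
exists (fun c : C => bq c + (2 + (1 + ((es (l c) * B c + 10) + cs * Sz c ^ ks)))); split.
  by do ?[apply: pb_add | apply: pb_mul | apply: pb_exp | exact: pb_const | exact: pb_es | assumption].
move=> c r; apply: evb_seq (Hq _ _) _ => /=.
eapply evb_seq; first by eapply evb_case2; [by []|exact: evb_skip].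
eapply evb_seq; first exact: evb_push.
have Ha : es (c, foldl (f c) (init c) (l c)) <= Sz c.
  have := Hle c (l c) [::]; rewrite cats0 => /(_ erefl).
  by rewrite /Sz /es /= size_cat; lia.
apply: evb_seq; last first.
  apply: evb_leq (Hs (c, foldl (f c) (init c) (l c)) r).
  apply: leq_trans (Hbs _) _; rewrite leq_mul2l; apply/orP; right.
  by case: (ks) => // k; rewrite leq_exp2r.
set F := foldl _ _ _.
enough (H : forall l1 l2, l c = l1 ++ l2 ->
  evb loop ((ser (enc l2) ++ ser (enc (c, foldl (f c) (init c) l1))) ++ r, [::], [::], [::], [:: true])
    (st0 (ser (enc (c, F)) ++ r)) (size l2 * B c + 10)).
  have := H [::] (l c) erefl; apply: evb_leq; rewrite leq_add2r leq_mul2r; apply/orP; right.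
  exact: ltnW (size_le_es _).
move=> l1 l2; elim: l2 l1 => [|x l2 IH] l1 el.
  eapply evb_leq; last first.
    eapply evb_while2; first by [].
      by eapply evb_case1; [by []|exact: evb_skip].
    move: el; rewrite cats0 /F => ->.
    by exact: evb_while0.
  by rewrite /=; lia.
have {}IH := IH (rcons l1 x); rewrite cat_rcons foldl_rcons in IH; have {}IH := IH el.
eapply evb_leq; last first.
  eapply evb_while2; [by [] | | exact: IH].
  eapply evb_case2; first by [].
  have -> : set5 (set5 ((ser (enc (x :: l2)) ++ ser (enc (c, foldl (f c) (init c) l1))) ++ r,
     [::], [::], [::], [:: true]) SF [::]) SA
    (((ser (enc x) ++ ser (enc l2)) ++ ser (enc (c, foldl (f c) (init c) l1))) ++ r) =
    st0 ((ser (enc x) ++ ser (enc l2)) ++ (ser (enc (c, foldl (f c) (init c) l1)) ++ r)).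
    by rewrite /= -!catA.
  apply: evb_seq (run_push _ _) _.
  apply: evb_seq (run_swap (enc (x, l2)) _ _) _.
  apply: evb_seq (run_push _ _) _.
  have Hp' : run p (true :: ser (enc (c, foldl (f c) (init c) l1)) ++ ser (enc (x, l2)) ++ r)
      (ser (enc (fold_body ((c, foldl (f c) (init c) l1), (x, l2)))) ++ r)
      (bp ((c, foldl (f c) (init c) l1), (x, l2))).
    rewrite catA; exact: (Hp ((c, foldl (f c) (init c) l1), (x, l2)) r).
  apply: evb_seq Hp' _.
  eapply evb_seq; first by eapply evb_case2; [by []|exact: evb_skip].
  exact: evb_push.
have le0 := Hle c l1 (x :: l2) el.
have e1 : es (c, foldl (f c) (init c) l1, (x, l2)) <= Sz c.
  move: le0; rewrite /Sz el !es_pair; have := @es_cat X eX l1 (x :: l2); rewrite es_cons; lia.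
have e2 : bp (c, foldl (f c) (init c) l1, (x, l2)) <= cp * Sz c ^ kp.
  apply: leq_trans (Hbp _) _; rewrite leq_mul2l; apply/orP; right.
  by case: (kp) => // k; rewrite leq_exp2r.
move: e1 e2; rewrite !es_pair /B; set u := _ * Sz c ^ kp.
rewrite -/(es (x, l2)) -/(es (c, foldl (f c) (init c) l1)) !es_pair [size (x :: l2)]/= mulSn.
set w := size l2 * _; lia.
Qed.
End Foldl.

Lemma evb_pourAB A B C D : evb (pour SA (Push SB)) (A, B, C, D, [::])
  ([::], catrev A B, C, D, [::]) (6 * size A + 6).
Proof.
suff H : evb (pour_loop SA (Push SB)) (A, B, C, D, [:: true])
    ([::], catrev A B, C, D, [::]) (6 * size A + 5).
  by apply: (evb_leq _ (evb_seq (evb_push SF true (A, B, C, D, [::])) H)); lia.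
elim: A B => [|b A IH] B.
  eapply evb_leq; last first.
    eapply evb_while2; [by [] | | by exact: evb_while0].
    by eapply evb_case0; [by []|exact: evb_skip].
  by [].
eapply evb_leq; last first.
  eapply evb_while2; [by [] | | exact: (IH (b :: B))].
  case: b; [eapply evb_case2; first by [] | eapply evb_case1; first by []];
  by eapply evb_seq; exact: evb_push.
by rewrite /=; lia.
Qed.

Definition push_bit b := Seq (push_all (ser (@enc bool _ b))) (Push SA true).

Lemma evb_push_all s A B C D F : evb (push_all s) (A, B, C, D, F) (s ++ A, B, C, D, F) (size s).
Proof.
elim: s => [|b s IH] /=; first exact: evb_skip.
rewrite -addn1; exact: evb_seq IH (evb_push _ _ _).
Qed.

Lemma evb_pour_bits A B : evb (pour SB push_bit) (A, B, [::], [::], [::])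
  (flatten [seq true :: ser (@enc bool _ b) | b <- rev B] ++ A, [::], [::], [::], [::]) (10 * size B + 6).
Proof.
enough (H : evb (pour_loop SB push_bit) (A, B, [::], [::], [:: true])
  (flatten [seq true :: ser (@enc bool _ b) | b <- rev B] ++ A, [::], [::], [::], [::]) (10 * size B + 5)).
  eapply evb_leq; last first.
    eapply evb_seq; [exact: evb_push | exact: H].
  by lia.
elim: B A => [|b B IH] A.
  eapply evb_leq; last first.
    eapply evb_while2; [by [] | | by exact: evb_while0].
    by eapply evb_case0; [by []|exact: evb_skip].
  by [].
rewrite rev_cons map_rcons flatten_rcons -catA.
eapply evb_leq; last first.
  eapply evb_while2; [by [] | | exact: IH].
  assert (H : evb (push_bit b) (A, B, [::], [::], [::])
     ((true :: ser (@enc bool _ b)) ++ A, B, [::], [::], [::]) 4).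
    rewrite cat_cons; eapply evb_leq; last first.
      eapply evb_seq; [exact: evb_push_all|exact (evb_push SA true (ser (@enc bool _ b) ++ A, B, [::], [::], [::]))].
    by case: b.
  case: b H => H; [eapply evb_case2; first by [] | eapply evb_case1; first by []];
  by eapply evb_seq; [exact: H|exact: evb_push].
by rewrite /=; lia.
Qed.

Lemma ser_bits (x : seq bool) : ser (enc x) = flatten [seq true :: ser (@enc bool _ b) | b <- x] ++ [:: false].
Proof. by elim: x => //= b x ->; rewrite catA. Qed.

Definition read_input := Seq (pour SA (Push SB)) (Seq (Push SA false) (pour SB push_bit)).

Lemma run_read_input x : run read_input x (ser (enc x)) (16 * size x + 13).
Proof.
rewrite ser_bits -[X in map _ X]revK -[rev x]cats0 -catrevE.
eapply evb_leq; last first.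
  eapply evb_seq; first exact: evb_pourAB.
  eapply evb_seq; first exact: evb_push.
  exact: evb_pour_bits.
by rewrite /= catrevE cats0 size_rev; lia.
Qed.

Definition pop1 := Case SA Skip Skip Skip.
Definition write_loop := While SF (Case SA Skip Skip
  (Seq (Case SA Skip (Push SB false) (Seq pop1 (Seq pop1 (Push SB true)))) (Push SF true))).
Definition write_output := Seq (Push SF true) (Seq write_loop (pour SB (Push SA))).

Lemma run_write_output y : run write_output (ser (enc y)) y (30 * size y + 20).
Proof.
assert (H : forall B, evb write_loop (ser (enc y), B, [::], [::], [:: true])
    ([::], catrev y B, [::], [::], [::]) (20 * size y + 10)).
  elim: y => [|b y IH] B.
    eapply evb_leq; last first.
      eapply evb_while2; [by [] | | by exact: evb_while0].
      by eapply evb_case1; [by []|exact: evb_skip].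
    by [].
  eapply evb_leq; last first.
    eapply evb_while2; [by [] | | exact: (IH (b :: B))].
    eapply evb_case2; first by [].
    assert (H : evb (Case SA Skip (Push SB false) (Seq pop1 (Seq pop1 (Push SB true))))
       (ser (@enc bool _ b) ++ ser (enc y), B, [::], [::], [::])
       (ser (enc y), b :: B, [::], [::], [::]) 10).
      case: b.
        eexists; last first.
          eapply ev_case2; first by []. eapply ev_seq; first by eapply ev_case1; [by []|constructor].
          eapply ev_seq; first by eapply ev_case1; [by []|constructor].
          exact: ev_push.
        by [].
      eexists; last first.
        eapply ev_case1; first by []. exact: ev_push.
      by [].
    eapply evb_seq; first exact: H.
    exact: evb_push.
  by rewrite /=; lia.
have e : y = catrev (catrev y [::]) [::] by rewrite !catrevE !cats0 revK.
eapply evb_leq; last first.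
  eapply evb_seq; first exact: evb_push.
  eapply evb_seq; first exact: H.
  rewrite {2}e; exact: evb_pourBA.
by rewrite catrevE cats0 size_rev; lia.
Qed.

Lemma es_bits (x : seq bool) : es x <= 4 * size x + 1.
Proof. by elim: x => // b x IH; rewrite es_cons /=; case: b; rewrite /es /= in IH *; lia. Qed.

Lemma pbound_size (b : seq bool -> nat) : pbound b -> exists a k, forall x, b x <= a * size x ^ k + a.
Proof.
move=> [c [k H]]; exists (c * 5 ^ k), k => x.
apply: leq_trans (H x) _; rewrite -mulnA -mulnDr leq_mul2l; apply/orP; right.
case: (posnP k) => [->|kp]; first by rewrite !expn0.
case: (posnP (size x)) => [s0|sp].
  by case: (x) s0 => // _; rewrite /es /= exp1n addn_gt0 expn_gt0 orbT.
apply: leq_trans (leq_addr _ _); rewrite -expnMn leq_exp2r //.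
by have := es_bits x; lia.
Qed.

Theorem ptime_TM (f : seq bool -> seq bool) : ptime f -> exists (M : TM) a k, forall x,
  exists2 T, T <= a * size x ^ k + a & halts_with M x T (f x).
Proof.
move=> Hf; have Hs := ptime_size Hf; move: Hf => [p [b [Hb H]]].
pose q := Seq read_input (Seq p write_output).
pose code := compile q 0.
pose (t := fun x : seq bool => (16 * es x + 13) + (b x + (30 * es (f x) + 20))).
pose (B := fun x : seq bool => 2 * es x + 8 + t x * (2 * (es x + t x) + 4) + 2 * (es x + t x)).
have Ht : pbound t.
  by do ?[apply: pb_add | apply: pb_mul | exact: pb_const | exact: pb_es | assumption].
have /pbound_size[a [k HB]] : pbound B.
  by do ?[apply: pb_add | apply: pb_mul | exact: pb_const | exact: pb_es | assumption].
exists (machine code), a, k => x.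
assert (E : evb q (st0 x) (st0 (f x)) (t x)).
  rewrite /q /t; apply: evb_seq.
    apply: evb_leq (run_read_input x); have := @size_le_es bool Enc_bool x; lia.
  have := H x [::]; rewrite !cats0 => Hp; apply: evb_seq Hp _.
  apply: evb_leq (run_write_output _); have := @size_le_es bool Enc_bool (f x); lia.
case: E => t' le' e.
have wf : all (targets_le (size code)) code.
  by have := comp_wf q 0; rewrite size_comp.
have Hc : code_at code 0 (compile q 0) by exists [::], [::]; rewrite cats0.
have := ev_iter e Hc; rewrite add0n -(size_comp q 0) -/code => Hi.
have [T le HT] := machine_halts wf (rest := st0 [::]) (y := f x) Hi.
exists T => //; apply: leq_trans le _; apply: leq_trans (HB x).
have := @size_le_es bool Enc_bool x; rewrite /B; move: le'; nia.
Qed.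

Ltac pb := do ?[apply: pb_add | apply: pb_mul | apply: pb_exp | exact: pb_const | exact: pb_es | assumption].

Ltac pt_ext := fail.
Ltac pt_step :=
  lazymatch goal with
  | |- ptime (fun x => x) => exact: pt_id
  | |- ptime (@fst _ _) => exact: pt_fst1
  | |- ptime (@snd _ _) => exact: pt_snd1
  | |- ptime (fun x => fst (@?f x)) => apply: pt_fst
  | |- ptime (fun x => snd (@?f x)) => apply: pt_snd
  | |- ptime (fun x => (@?f x, @?g x)) => apply: pt_pair
  | |- ptime (fun x => @?f x :: @?g x) => apply: pt_cons
  | |- ptime (fun x => head ?d (@?f x)) => apply: pt_head
  | |- ptime (fun x => behead (@?f x)) => apply: pt_behead
  | |- ptime (fun x => nilp (@?f x)) => apply: pt_nilp
  | _ => first [pt_ext | simple apply pt_const | simple apply pt_if]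
  end.
Ltac pt := repeat (cbv beta; first [assumption | pt_step]); try solve [rewrite //=].

Lemma pt_neg {A} {eA : Enc A} (b : A -> bool) : ptime b -> ptime (fun a => ~~ b a).
Proof.
by move=> Hb; apply: (pt_ext (f := fun a => if b a then false else true)); [move=> a; case: (b a)|pt].
Qed.

Lemma pt_and {A} {eA : Enc A} (b c : A -> bool) : ptime b -> ptime c -> ptime (fun a => b a && c a).
Proof. by move=> Hb Hc; apply: (pt_ext (f := fun a => if b a then c a else false)) => //; pt. Qed.

Lemma pt_or {A} {eA : Enc A} (b c : A -> bool) : ptime b -> ptime c -> ptime (fun a => b a || c a).
Proof. by move=> Hb Hc; apply: (pt_ext (f := fun a => if b a then true else c a)) => //; pt. Qed.

Lemma pt_xor {A} {eA : Enc A} (b c : A -> bool) : ptime b -> ptime c -> ptime (fun a => b a (+) c a).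
Proof.
move=> Hb Hc; apply: (pt_ext (f := fun a => if b a then if c a then false else true else c a)).
  by move=> a; case: (b a); case: (c a).
by pt.
Qed.

Section FoldlAcc.
Context {C A X : Type} {eC : Enc C} {eA : Enc A} {eX : Enc X}.
Variables (f : C -> A -> X -> A) (l : C -> seq X) (init : C -> A).

(** A step that lengthens the accumulator by an amount independent of the accumulator keeps the
    total length polynomial. *)
Lemma pt_foldl_acc (G : C * X -> nat) :
  ptime (fun p : C * A * X => f p.1.1 p.1.2 p.2) -> ptime l -> ptime init ->
  pbound G -> (forall c a x, es (f c a x) <= es a + G (c, x)) ->
  ptime (fun c => foldl (f c) (init c) (l c)).
Proof.
move=> Hf Hl Hi [k0 [k1 HG]] Hfx; apply: pt_foldl => //.
have Hls := ptime_size Hl; have His := ptime_size Hi.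
exists (fun c => es (init c) + es (l c) * (k0 * (es c + es (l c) + 1) ^ k1)); first by pb.
move=> c l1 l2 el.
enough (H : es (foldl (f c) (init c) l1) <= es (init c) + size l1 * (k0 * (es c + es (l c) + 1) ^ k1)).
  apply: leq_trans H _; rewrite leq_add2l leq_mul2r; apply/orP; right.
  by have := @size_le_es X eX (l c); rewrite el size_cat; lia.
elim/last_ind: l1 l2 el => [|l1 x IH] l2 el; first by rewrite /= addn0.
rewrite foldl_rcons; apply: leq_trans (Hfx _ _ _) _.
rewrite cat_rcons in el; have {}IH := IH _ el.
rewrite size_rcons mulSn; have : G (c, x) <= k0 * (es c + es (l c) + 1) ^ k1.
  apply: leq_trans (HG _) _; rewrite leq_mul2l; apply/orP; right.
  case: (k1) => // k; rewrite leq_exp2r // es_pair el.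
  by have := @es_cat X eX l1 (x :: l2); rewrite es_cons; lia.
lia.
Qed.
End FoldlAcc.

Section ListOps.
Context {A X : Type} {eA : Enc A} {eX : Enc X}.

Lemma pt_catrev (f g : A -> seq X) : ptime f -> ptime g -> ptime (fun a => catrev (f a) (g a)).
Proof.
move=> Hf Hg; apply: (pt_ext (f := fun a => foldl (fun acc x => x :: acc) (g a) (f a))).
  by move=> a; elim: (f a) (g a) => //= x s IH acc; exact: IH.
apply: (pt_foldl_acc (f := fun _ acc x => x :: acc) (G := es)) => //; first by pt.
  exact: pb_es.
by move=> c a x; rewrite es_cons es_pair; lia.
Qed.

Lemma pt_rev (f : A -> seq X) : ptime f -> ptime (fun a => rev (f a)).
Proof. by move=> Hf; apply: pt_catrev => //; exact: pt_const. Qed.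

End ListOps.

Section Map.
Context {A X Y : Type} {eA : Enc A} {eX : Enc X} {eY : Enc Y}.

Lemma pt_map (f : A -> X -> Y) (l : A -> seq X) :
  ptime (fun p : A * X => f p.1 p.2) -> ptime l -> ptime (fun a => [seq f a x | x <- l a]).
Proof.
move=> Hf Hl; apply: (pt_ext (f := fun a => rev (foldl (fun acc x => f a x :: acc) [::] (l a)))).
  move=> a; rewrite /rev; suff -> acc : foldl (fun acc x => f a x :: acc) acc (l a) = catrev [seq f a x | x <- l a] acc.
    by rewrite -[RHS]revK.
  by elim: (l a) acc => //= x s IH acc; rewrite IH.
apply: pt_rev.
apply: (pt_foldl_acc (f := fun c acc x => f c x :: acc) (G := fun p => es (f p.1 p.2) + 1)) => //.
- apply: pt_cons; last by pt.
  by apply: (pt_comp (g := fun p : A * X => f p.1 p.2) (f := fun p : A * seq Y * X => (p.1.1, p.2))); pt.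
- by pt.
- by apply: pb_add; [exact: (ptime_size Hf)|exact: pb_const].
by move=> c a x /=; rewrite es_cons; lia.
Qed.
End Map.

Section ListOps2.
Context {A X Y : Type} {eA : Enc A} {eX : Enc X} {eY : Enc Y}.

Lemma pt_cat (f g : A -> seq X) : ptime f -> ptime g -> ptime (fun a => f a ++ g a).
Proof.
move=> Hf Hg; apply: (pt_ext (f := fun a => catrev (rev (f a)) (g a))).
  by move=> a; rewrite catrevE revK.
by apply: pt_catrev => //; exact: pt_rev.
Qed.

Lemma pt_filter (f : A -> X -> bool) (l : A -> seq X) :
  ptime (fun p : A * X => f p.1 p.2) -> ptime l -> ptime (fun a => [seq x <- l a | f a x]).
Proof.
move=> Hf Hl; apply: (pt_ext (f := fun a => rev (foldl (fun acc x => if f a x then x :: acc else acc) [::] (l a)))).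
  move=> a; rewrite /rev; suff -> acc : foldl (fun acc x => if f a x then x :: acc else acc) acc (l a)
     = catrev [seq x <- l a | f a x] acc by rewrite -[RHS]revK.
  by elim: (l a) acc => //= x s IH acc; rewrite IH; case: (f a x).
apply: pt_rev.
apply: (pt_foldl_acc (f := fun c acc x => if f c x then x :: acc else acc) (G := es)) => //.
- apply: pt_if; [|by pt|by pt].
  by apply: (pt_comp (g := fun p : A * X => f p.1 p.2) (f := fun p : A * seq X * X => (p.1.1, p.2))); pt.
- by pt.
- exact: pb_es.
by move=> c a x /=; case: (f c x); rewrite ?es_cons es_pair; lia.
Qed.

Lemma pt_all (f : A -> X -> bool) (l : A -> seq X) :
  ptime (fun p : A * X => f p.1 p.2) -> ptime l -> ptime (fun a => all (f a) (l a)).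
Proof.
move=> Hf Hl; apply: (pt_ext (f := fun a => nilp [seq x <- l a | ~~ f a x])).
  by move=> a; rewrite /nilp size_filter eqn0Ngt -has_count -all_predC; apply: eq_all => x /=; rewrite negbK.
by apply: pt_nilp; apply: (pt_filter (f := fun a x => ~~ f a x)) => //; exact: pt_neg.
Qed.

Lemma pt_has (f : A -> X -> bool) (l : A -> seq X) :
  ptime (fun p : A * X => f p.1 p.2) -> ptime l -> ptime (fun a => has (f a) (l a)).
Proof.
move=> Hf Hl; apply: (pt_ext (f := fun a => ~~ all (fun x => ~~ f a x) (l a))).
  by move=> a; rewrite -has_predC; apply: eq_has => x /=; rewrite negbK.
apply: pt_neg; apply: (pt_all (f := fun a x => ~~ f a x)) => //; exact: pt_neg.
Qed.

Lemma pt_zip (y0 : Y) (f : A -> seq X) (g : A -> seq Y) :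
  ptime f -> ptime g -> ptime (fun a => zip (f a) (g a)).
Proof.
move=> Hf Hg.
pose (st := fun (p : seq (X * Y) * seq Y) (x : X) =>
  if nilp p.2 then p else ((x, head y0 p.2) :: p.1, behead p.2)).
apply: (pt_ext (f := fun a => rev (foldl st ([::], g a) (f a)).1)).
  move=> a; rewrite /rev; suff -> acc s : (foldl st (acc, s) (f a)).1 = catrev (zip (f a) s) acc.
    by rewrite -[RHS]revK.
  elim: (f a) acc s => [|x l IH] acc [|y s] //=.
    by elim: l {IH} => //= z l ->.
  exact: IH.
apply: pt_rev.
apply: pt_fst; apply: (pt_foldl_acc (f := fun _ => st) (G := fun p => 2 * es p + 10)) => //.
- by rewrite /st; pt.
- by pt.
- by pb.
move=> c [a s] x; rewrite /st /=; case: s => [|y s] /=; rewrite ?es_pair ?es_cons ?es_pair; lia.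
Qed.

Lemma pt_flatten (l : A -> seq (seq X)) : ptime l -> ptime (fun a => flatten (l a)).
Proof.
move=> Hl; apply: (pt_ext (f := fun a => rev (foldl (fun acc s => catrev s acc) [::] (l a)))).
  move=> a; rewrite /rev; suff -> acc : foldl (fun acc s => catrev s acc) acc (l a) = catrev (flatten (l a)) acc.
    by rewrite -[RHS]revK.
  by elim: (l a) acc => //= x s IH acc; rewrite IH !catrevE rev_cat -catA.
apply: pt_rev.
apply: (pt_foldl_acc (f := fun _ acc s => catrev s acc) (G := es)) => //.
- by apply: pt_catrev; pt.
- by pt.
- exact: pb_es.
move=> c a x; rewrite es_pair; enough (es (catrev x a) <= es x + es a) by lia.
by elim: x a => [|y x IH] a /=; [lia|have := IH (y :: a); rewrite !es_cons; lia].
Qed.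
End ListOps2.

(** * Arithmetic in binary *)

Lemma nat_bits_aux_fuel f1 f2 n : n <= f1 -> n <= f2 -> nat_bits_aux f1 n = nat_bits_aux f2 n.
Proof.
elim: f1 f2 n => [|f1 IH] [|f2] [|n] //= l1 l2; congr (_ :: _).
by apply: IH; have := odd_double_half n.+1; rewrite -muln2 /=; lia.
Qed.

Lemma nat_bits_rec (b : bool) n : nat_bits (b + n.*2) = if b || (0 < n) then b :: nat_bits n else [::].
Proof.
rewrite /nat_bits; case e: (b + n.*2) => [|k]; first by case: b e => //=; case: n.
have -> : b || (0 < n) by case: b e => //=; case: n.
change (odd k.+1 :: nat_bits_aux k (k.+1)./2 = b :: nat_bits_aux n n).
rewrite -e oddD odd_double oddb addbF; congr (_ :: _).
have -> : (b + n.*2)./2 = n by rewrite half_bit_double.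
by apply: nat_bits_aux_fuel => //; move: e; lia.
Qed.

Definition bval (s : seq bool) : nat := foldr (fun (b : bool) n => b + n.*2) 0 s.

Lemma bval_nat_bits n : bval (nat_bits n) = n.
Proof.
have [m le] := ubnP n; elim: m n le => // m IH n le.
case: (posnP n) => [->//|np].
rewrite -[in nat_bits n](odd_double_half n) nat_bits_rec.
have -> : odd n || (0 < n./2) by case: n np le => [|[|n]] //=; rewrite orbT.
by rewrite /= IH ?odd_double_half //; lia.
Qed.

Lemma bval_cat s t : bval (s ++ t) = bval s + 2 ^ size s * bval t.
Proof. by elim: s => [|b s IH] /=; rewrite ?mul1n // IH expnS; lia. Qed.

Lemma bval_lt s : bval s < 2 ^ size s.
Proof. by elim: s => //= b s IH; rewrite expnS; case: b; lia. Qed.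

(** Digits arrive most significant first and leading zeros are dropped, since only canonical digit
    lists encode numbers. *)
Definition norm_step (out : seq bool) (b : bool) := if b || ~~ nilp out then b :: out else out.
Definition norm_rev (s : seq bool) := foldl norm_step [::] s.

Lemma norm_revE s : norm_rev s = nat_bits (bval (rev s)).
Proof.
rewrite /norm_rev; elim/last_ind: s => // s b IH.
rewrite foldl_rcons IH rev_rcons /= nat_bits_rec /norm_step.
have -> : nilp (nat_bits (bval (rev s))) = (bval (rev s) == 0).
  by apply/nilP/eqP => [e|->//]; rewrite -(bval_nat_bits (bval (rev s))) e.
by rewrite -lt0n; case: b => //=; case: (posnP (bval (rev s))) => // ->.
Qed.

Lemma size_nat_bits n L : n < 2 ^ L -> size (nat_bits n) <= L.
Proof.
elim: L n => [|L IH] n; first by case: n.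
case: (posnP n) => [->//|np] lt.
rewrite -(odd_double_half n) nat_bits_rec; case: ifP => // _ /=.
by rewrite ltnS IH // -(ltn_pmul2l (isT : 0 < 2)) -expnS mul2n; apply: leq_ltn_trans lt; lia.
Qed.

Lemma es_nat_le n L : n < 2 ^ L -> es n <= 4 * L + 1.
Proof.
move=> /size_nat_bits H; rewrite -[es n]/(es (nat_bits n)).
by apply: leq_trans (es_bits _) _; lia.
Qed.

Lemma ltn_2es n : n < 2 ^ es n.
Proof.
rewrite -{1}(bval_nat_bits n); apply: leq_trans (bval_lt _) _.
by rewrite leq_exp2l // ltnW // (size_le_es (nat_bits n)).
Qed.

Lemma size_nat_bits_es n : size (nat_bits n) <= es n.
Proof. by rewrite ltnW // (size_le_es (nat_bits n)). Qed.

Lemma pt_bits {A} {eA : Enc A} (f : A -> nat) : ptime f -> ptime (fun a => nat_bits (f a)).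
Proof. exact: (pt_enc (f := f)). Qed.

Lemma pt_norm_rev {A} {eA : Enc A} (f : A -> seq bool) : ptime f -> ptime (fun a => norm_rev (f a)).
Proof.
move=> Hf; apply: (pt_foldl_acc (f := fun _ => norm_step) (G := fun=> 4)) => //.
- rewrite /norm_step; apply: pt_if; [apply: pt_or; [by pt | apply: pt_neg; by pt]|by pt|by pt].
- by pt.
- by pb.
move=> c a x; rewrite /norm_step; case: (_ || _); rewrite ?es_cons; last by lia.
by case: x; rewrite /es /=; lia.
Qed.

Lemma pt_bval_rev {A} {eA : Enc A} (f : A -> seq bool) : ptime f -> ptime (fun a => bval (rev (f a))).
Proof.
move=> Hf; apply: (pt_enc (f := fun a => norm_rev (f a))); last exact: pt_norm_rev.
by move=> a; rewrite norm_revE.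
Qed.

Lemma bval_pad s t : bval (s ++ [seq false | _ <- (t : seq bool)]) = bval s.
Proof.
rewrite bval_cat; suff -> : bval [seq false | _ <- t] = 0 by rewrite muln0 addn0.
by elim: t => //= _ t ->.
Qed.

(* Ripple-carry arithmetic; the accumulator lists the digits computed so far,
   most significant first. *)
Definition add_step (p : bool * seq bool) (xy : bool * bool) : bool * seq bool :=
  (if p.1 then xy.1 || xy.2 else xy.1 && xy.2, (p.1 (+) (xy.1 (+) xy.2)) :: p.2).
Definition sub_step (p : bool * seq bool) (xy : bool * bool) : bool * seq bool :=
  (if p.1 then ~~ xy.1 || xy.2 else ~~ xy.1 && xy.2, (p.1 (+) (xy.1 (+) xy.2)) :: p.2).

(** Both lists are padded to the sum of their lengths, which is long enough for the sum, so no carry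
    remains at the end. *)
Definition pad2 (s t : seq bool) := zip (s ++ [seq false | _ <- t]) (t ++ [seq false | _ <- s]).

Lemma add_stepsE ps : let r := foldl add_step (false, [::]) ps in
  size r.2 = size ps /\
  bval (unzip1 ps) + bval (unzip2 ps) = bval (rev r.2) + r.1 * 2 ^ size ps.
Proof.
elim/last_ind: ps => [|ps [x y] [IHs IH]] //=; rewrite foldl_rcons.
split; first by rewrite /= size_rcons IHs.
rewrite /unzip1 /unzip2 !map_rcons -!cats1 !bval_cat !size_map /= rev_cons -cats1 bval_cat size_rev IHs /=.
move: IH; rewrite /unzip1 /unzip2 size_cat /= addn1 expnS.
set u := bval _; set v := bval _; set w := bval _.
by case: x; case: y; case: (foldl _ _ _).1 => /=; lia.
Qed.

Lemma sub_stepsE ps : let r := foldl sub_step (false, [::]) ps in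
  size r.2 = size ps /\
  bval (unzip1 ps) + r.1 * 2 ^ size ps = bval (rev r.2) + bval (unzip2 ps).
Proof.
elim/last_ind: ps => [|ps [x y] [IHs IH]] //=; rewrite foldl_rcons.
split; first by rewrite /= size_rcons IHs.
rewrite /unzip1 /unzip2 !map_rcons -!cats1 !bval_cat !size_map /= rev_cons -cats1 bval_cat size_rev IHs /=.
move: IH; rewrite /unzip1 /unzip2 size_cat /= addn1 expnS.
set u := bval _; set v := bval _; set w := bval _.
by case: x; case: y; case: (foldl _ _ _).1 => /=; lia.
Qed.

Lemma pad2E s t : [/\ size (pad2 s t) = size s + size t,
  bval (unzip1 (pad2 s t)) = bval s & bval (unzip2 (pad2 s t)) = bval t].
Proof.
have es : size (s ++ [seq false | _ <- t]) = size (t ++ [seq false | _ <- s]).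
  by rewrite !size_cat !size_map addnC.
by split; rewrite /pad2 ?unzip1_zip ?unzip2_zip ?bval_pad ?size_zip -?es ?minnn ?size_cat ?size_map.
Qed.

Lemma addbE m n : let r := foldl add_step (false, [::]) (pad2 (nat_bits m) (nat_bits n)) in
  m + n = bval (rev r.2).
Proof.
set ps := pad2 _ _ => r; have [e1 e2 e3] := pad2E (nat_bits m) (nat_bits n).
have [sz] := add_stepsE ps; rewrite -/r e2 e3 !bval_nat_bits.
case: r.1 => /=; last by rewrite mul0n addn0.
have := bval_lt (nat_bits m); have := bval_lt (nat_bits n); rewrite !bval_nat_bits.
rewrite e1 expnD; set a := 2 ^ size (nat_bits m); set b := 2 ^ _ => ltb lta H.
have : 0 < a /\ 0 < b by rewrite !expn_gt0.
nia.
Qed.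

(** The final borrow decides the comparison, and without it the digits are those of the
    difference. *)
Lemma subbE m n : let r := foldl sub_step (false, [::]) (pad2 (nat_bits m) (nat_bits n)) in
  r.1 = (m < n) /\ (n <= m -> m - n = bval (rev r.2)).
Proof.
set ps := pad2 _ _ => r; have [e1 e2 e3] := pad2E (nat_bits m) (nat_bits n).
have [sz] := sub_stepsE ps; rewrite -/r e2 e3 !bval_nat_bits.
have := bval_lt (rev r.2); rewrite size_rev sz.
by case: r.1 => /= lt H; split; lia.
Qed.

Section Arith.
Context {A : Type} {eA : Enc A}.
Variables (f g : A -> nat).
Hypotheses (Hf : ptime f) (Hg : ptime g).

Lemma pt_pad2 (h k : A -> seq bool) : ptime h -> ptime k -> ptime (fun a => pad2 (h a) (k a)).
Proof.
move=> Hh Hk; apply: (pt_zip false); apply: pt_cat => //;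
by apply: (pt_map (f := fun _ _ => false)) => //; pt.
Qed.

Lemma pt_addn : ptime (fun a => f a + g a).
Proof.
apply: (pt_ext (f := fun a => bval (rev (foldl add_step (false, [::]) (pad2 (nat_bits (f a)) (nat_bits (g a)))).2))).
  by move=> a; rewrite -addbE.
apply: pt_bval_rev; apply: pt_snd.
apply: (pt_foldl_acc (f := fun _ => add_step) (G := fun=> 10)).
- by rewrite /add_step; pt; [apply: pt_or|apply: pt_and|apply: pt_xor; last apply: pt_xor]; pt.
- by apply: pt_pad2; apply: pt_bits.
- by pt.
- by pb.
move=> c [b s] [x y]; rewrite /add_step !es_pair es_cons /=.
by case: b; case: x; case: y; rewrite /es /=; lia.
Qed.

Let subr a := foldl sub_step (false, [::]) (pad2 (nat_bits (f a)) (nat_bits (g a))).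

Lemma pt_subr : ptime subr.
Proof.
apply: (pt_foldl_acc (f := fun _ => sub_step) (G := fun=> 10)).
- rewrite /sub_step; pt; [apply: pt_or|apply: pt_and|apply: pt_xor; last apply: pt_xor]; pt;
  by apply: pt_neg; pt.
- by apply: pt_pad2; apply: pt_bits.
- by pt.
- by pb.
move=> c [b s] [x y]; rewrite /sub_step !es_pair es_cons /=.
by case: b; case: x; case: y; rewrite /es /=; lia.
Qed.

Lemma pt_ltn : ptime (fun a => f a < g a).
Proof.
apply: (pt_ext (f := fun a => (subr a).1)); first by move=> a; case: (subbE (f a) (g a)).
by apply: pt_fst; exact: pt_subr.
Qed.

Lemma pt_subn : ptime (fun a => f a - g a).
Proof.
apply: (pt_ext (f := fun a => if (subr a).1 then 0 else bval (rev (subr a).2))).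
  move=> a; have [-> H] := subbE (f a) (g a); case: ltnP; first by lia.
  by move/H.
by apply: pt_if; [apply: pt_fst; exact: pt_subr|exact: pt_const|apply: pt_bval_rev; apply: pt_snd; exact: pt_subr].
Qed.

Lemma pt_half : ptime (fun a => (f a)./2).
Proof.
apply: (pt_enc (f := fun a => behead (nat_bits (f a)))); last by apply: pt_behead; exact: pt_bits.
move=> a; change (enc (behead (nat_bits (f a))) = enc (nat_bits (f a)./2)); congr enc.
rewrite -{1}(odd_double_half (f a)) nat_bits_rec; case: ifP => //.
by case: (odd _) => //=; case: (_./2).
Qed.

Lemma pt_odd : ptime (fun a => odd (f a)).
Proof.
apply: (pt_ext (f := fun a => head false (nat_bits (f a)))); last by apply: pt_head; exact: pt_bits.
move=> a; rewrite -{1}(odd_double_half (f a)) nat_bits_rec; case: ifP => //.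
by case: (odd _).
Qed.
End Arith.

Section Arith2.
Context {A : Type} {eA : Enc A}.
Variables (f g : A -> nat).
Hypotheses (Hf : ptime f) (Hg : ptime g).

Lemma pt_leq : ptime (fun a => f a <= g a).
Proof.
apply: (pt_ext (f := fun a => ~~ (g a < f a))); first by move=> a; rewrite -leqNgt.
by apply: pt_neg; exact: pt_ltn.
Qed.

Lemma pt_eqn : ptime (fun a => f a == g a).
Proof.
apply: (pt_ext (f := fun a => (f a <= g a) && (g a <= f a))).
  by move=> a; rewrite eqn_leq.
apply: pt_and; first exact: pt_leq.
apply: (pt_ext (f := fun a => ~~ (f a < g a))); first by move=> a; rewrite -leqNgt.
by apply: pt_neg; exact: pt_ltn.
Qed.

Lemma pt_muln : ptime (fun a => f a * g a).
Proof.
(* Horner's rule on the digits of the second factor, most significant first. *)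
pose (st := fun (c : nat) (acc : nat) (b : bool) => if b then acc + acc + c else acc + acc).
have stE c s : foldl (st c) 0 s = c * bval (rev s).
  elim/last_ind: s => [|s b IH]; first by rewrite muln0.
  by rewrite foldl_rcons IH rev_rcons /= /st; case: b; nia.
apply: (pt_ext (f := fun a => foldl (st (f a)) 0 (rev (nat_bits (g a))))).
  by move=> a; rewrite stE revK bval_nat_bits.
apply: (pt_foldl (f := fun a => st (f a))).
- rewrite /st; have H1 : ptime (fun p : A * nat * bool => p.1.2) by pt.
  have H2 : ptime (fun p : A * nat * bool => f p.1.1) by apply: (pt_comp (g := f)) => //; pt.
  apply: pt_if; first by pt.
    by apply: pt_addn => //; apply: pt_addn.
  by apply: pt_addn.
- by apply: pt_rev; exact: pt_bits.
- by pt.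
exists (fun a => 4 * (es (f a) + es (g a)) + 1).
  have := ptime_size Hf; have := ptime_size Hg => ? ?; by pb.
move=> c l1 l2 el; rewrite stE; apply: es_nat_le; rewrite expnD.
have le1 : size l1 <= es (g c).
  by apply: leq_trans (size_nat_bits_es _); rewrite -(size_rev (nat_bits _)) el size_cat leq_addr.
have := bval_lt (rev l1); rewrite size_rev => lt1.
have le2 : 2 ^ size l1 <= 2 ^ es (g c) by rewrite leq_exp2l.
have := ltn_2es (f c); nia.
Qed.

Lemma pt_nat_of_bool (b : A -> bool) : ptime b -> ptime (fun a => nat_of_bool (b a)).
Proof.
move=> Hb; apply: (pt_ext (f := fun a => if b a then 1 else 0)); first by move=> a; case: (b a).
by pt.
Qed.
End Arith2.

Section SizeOps.
Context {A X : Type} {eA : Enc A} {eX : Enc X}.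

Lemma pt_size (l : A -> seq X) : ptime l -> ptime (fun a => size (l a)).
Proof.
move=> Hl; pose (st := fun (n : nat) (x : X) => n + 1).
have stE s : foldl st 0 s = size s.
  by elim/last_ind: s => // s x IH; rewrite foldl_rcons IH size_rcons /st addn1.
apply: (pt_ext (f := fun a => foldl st 0 (l a))); first by move=> a; exact: stE.
apply: (pt_foldl (f := fun _ => st)) => //.
- by apply: pt_addn; pt.
- by pt.
exists (fun a => 4 * es (l a) + 1); first by have := ptime_size Hl => ?; pb.
move=> c l1 l2 el; rewrite stE; apply: es_nat_le.
have le : size l1 < es (l c) by apply: leq_trans (size_le_es _); rewrite el size_cat ltnS leq_addr.
by apply: ltn_trans le _; exact: ltn_expl.
Qed.

Lemma pt_sumn (l : A -> seq nat) : ptime l -> ptime (fun a => sumn (l a)).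
Proof.
move=> Hl; apply: (pt_ext (f := fun a => foldl addn 0 (l a))).
  move=> a; rewrite sumnE; suff -> n : foldl addn n (l a) = n + \sum_(i <- l a) i by [].
  by elim: (l a) n => [|x s IH] n /=; rewrite ?big_nil ?big_cons ?addn0 // IH addnA.
apply: (pt_foldl (f := fun _ => addn)) => //.
- by apply: pt_addn; pt.
- by pt.
exists (fun a => 4 * es (l a) + 1); first by have := ptime_size Hl => ?; pb.
move=> c l1 l2 el; apply: es_nat_le.
(* A partial sum is smaller than 2 to the power of the encoded length of its terms. *)
apply: (@leq_trans (2 ^ es l1)); last first.
  by rewrite leq_exp2l // el; have := @es_cat nat Enc_nat l1 l2; have := @es_gt0 _ (Enc_seq Enc_nat) l2; lia.
elim/last_ind: {l2 el} l1 => [|s x IH]; first by [].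
rewrite foldl_rcons -cats1; have := @es_cat nat Enc_nat s [:: x]; rewrite es_cons => e.
have -> : es (s ++ [:: x]) = (es s + es x).+1 by have e0 : @es _ (Enc_seq Enc_nat) [::] = 1 by []; rewrite e0 in e; lia.
rewrite expnS expnD; have := ltn_2es x; have : 1 < 2 ^ es s by rewrite -{1}(expn0 2) ltn_exp2l // es_gt0.
nia.
Qed.

Lemma pt_iota (l : A -> seq X) : ptime l -> ptime (fun a => iota 0 (size (l a))).
Proof.
move=> Hl; pose (st := fun (p : nat * seq nat) (x : X) => (p.1 + 1, p.1 :: p.2)).
have stE s : foldl st (0, [::]) s = (size s, rev (iota 0 (size s))).
  elim/last_ind: s => // s x IH.
  have e : iota 0 (size s).+1 = rcons (iota 0 (size s)) (size s) by rewrite -addn1 iotaD cats1.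
  by rewrite foldl_rcons IH size_rcons e rev_rcons /st addn1.
apply: (pt_ext (f := fun a => rev (foldl st (0, [::]) (l a)).2)).
  by move=> a; rewrite stE /= revK.
apply: pt_rev; apply: pt_snd; apply: (pt_foldl (f := fun _ => st)) => //.
- by rewrite /st; pt; apply: pt_addn; pt.
- by pt.
exists (fun a => (4 * es (l a) + 1) + (es (l a) * (4 * es (l a) + 2) + 1) + 1); first by have := ptime_size Hl => ?; pb.
move=> c l1 l2 el; rewrite stE es_pair.
have le : size l1 <= es (l c) by apply: leq_trans (ltnW (size_le_es _)); rewrite el size_cat leq_addr.
have le1 : es (size l1) <= 4 * es (l c) + 1.
  by apply: es_nat_le; apply: leq_ltn_trans le _; exact: ltn_expl.
enough (le2 : @es _ (Enc_seq Enc_nat) (rev (iota 0 (size l1))) <= es (l c) * (4 * es (l c) + 2) + 1) by lia.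
apply: (@leq_trans (size l1 * (4 * es (l c) + 2) + 1)); last by rewrite leq_add2r leq_mul2r le orbT.
have : all (fun n => n < es (l c)) (rev (iota 0 (size l1))).
  by rewrite all_rev; apply/allP => n; rewrite mem_iota => /andP[_ lt]; apply: leq_trans lt _.
rewrite -[in X in _ -> _ <= X](size_iota 0 (size l1)) -[in X in _ -> _ <= X]size_rev.
elim: (rev _) => //= n s IH /andP[lt /IH {}IH]; rewrite es_cons.
have : es n <= 4 * es (l c) + 1 by apply: es_nat_le; apply: ltn_trans lt _; exact: ltn_expl.
by rewrite mulSn; lia.
Qed.
End SizeOps.

(** * Running time of the algorithm *)

#[global] Instance Enc_arc : Enc arc := Enc_prod (Enc_prod Enc_nat Enc_nat) Enc_nat.
#[global] Instance Enc_vcon : Enc vcon := Enc_prod Enc_nat Enc_arc.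
#[global] Instance Enc_row : Enc row := Enc_prod (Enc_seq (Enc_prod Enc_bool Enc_bool)) (Enc_prod Enc_nat Enc_nat).
#[global] Instance Enc_param : Enc param :=
  Enc_prod (Enc_prod (Enc_prod Enc_nat Enc_nat) (Enc_seq Enc_unit)) (Enc_seq (Enc_prod Enc_nat Enc_nat)).
#[global] Instance Enc_terms : Enc terms := Enc_prod (Enc_prod (Enc_prod (Enc_prod (Enc_prod Enc_nat Enc_nat) Enc_nat) Enc_nat) Enc_nat) Enc_nat.
#[global] Instance Enc_lpdata : Enc lpdata :=
  Enc_prod (Enc_prod (Enc_prod (Enc_prod (Enc_seq Enc_arc) (Enc_seq Enc_nat)) (Enc_seq Enc_nat)) Enc_terms) Enc_nat.

Lemma pt_succ {A} {eA : Enc A} (f : A -> nat) : ptime f -> ptime (fun a => (f a).+1).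
Proof.
move=> Hf; apply: (pt_ext (f := fun a => f a + 1)); first by move=> a; rewrite addn1.
by apply: pt_addn => //; exact: pt_const.
Qed.

Lemma pt_indices {A X} {eA : Enc A} {eX : Enc X} (f : A -> seq X) : ptime f -> ptime (fun a => indices (f a)).
Proof. exact: pt_iota. Qed.

Ltac pt_more := fail.
Ltac pt_ext ::=
  lazymatch goal with
  | |- ptime (fun a => negb (@?f a)) => apply: pt_neg
  | |- ptime (fun a => andb (@?f a) (@?g a)) => apply: pt_and
  | |- ptime (fun a => orb (@?f a) (@?g a)) => apply: pt_or
  | |- ptime (fun a => leq (S (@?f a)) (@?g a)) => apply: (pt_ltn (f := f) (g := g))
  | |- ptime (fun a => leq (@?f a) (@?g a)) => apply: pt_leq
  | |- ptime (fun a => @eq_op _ (@?f a) (@?g a)) => apply: (pt_eqn (f := f) (g := g))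
  | |- ptime (fun a => addn (@?f a) (@?g a)) => apply: pt_addn
  | |- ptime (fun a => subn (@?f a) (@?g a)) => apply: pt_subn
  | |- ptime (fun a => muln (@?f a) (@?g a)) => apply: pt_muln
  | |- ptime (fun a => S (@?f a)) => apply: (pt_succ (f := f))
  | |- ptime (fun a => half (@?f a)) => apply: pt_half
  | |- ptime (fun a => odd (@?f a)) => apply: pt_odd
  | |- ptime (fun a => nat_of_bool (@?f a)) => apply: pt_nat_of_bool
  | |- ptime (fun a => size (@?f a)) => apply: pt_size
  | |- ptime (fun a => sumn (@?f a)) => apply: pt_sumn
  | |- ptime (fun a => indices (@?f a)) => apply: pt_indices
  | |- ptime (fun a => map (@?f a) (@?g a)) => apply: (pt_map (f := f) (l := g))
  | |- ptime (fun a => filter (@?f a) (@?g a)) => apply: (pt_filter (f := f) (l := g))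
  | |- ptime (fun a => all (@?f a) (@?g a)) => apply: (pt_all (f := f) (l := g))
  | |- ptime (fun a => has (@?f a) (@?g a)) => apply: (pt_has (f := f) (l := g))
  | |- ptime (fun a => flatten (@?f a)) => apply: pt_flatten
  | |- ptime (fun a => cat (@?f a) (@?g a)) => apply: pt_cat
  | |- ptime (fun a => rev (@?f a)) => apply: pt_rev
  | |- ptime (fun a => zip (@?f a) (@?g a)) =>
      refine (@pt_zip _ _ _ _ _ _ _ f g _ _); [solve [repeat constructor] | | ]
  | _ => first [
      match goal with H : ptime ?h |- ptime (fun a => ?h (@?g a)) => apply: (pt_comp (g := h) (f := g) H) end
    | pt_more]
  end.

(** * Accumulators whose entries grow additively *)

Section Grow.

Definition grows (X : Type) (f : seq nat -> X -> seq nat) (D : nat) (a : X) :=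
  forall B x, all (fun v => v <= B) x -> all (fun v => v <= B + D) (f x a) /\ size (f x a) <= size x.

Lemma foldl_grows (X : eqType) (f : seq nat -> X -> seq nat) (D B : nat) (l : seq X) x :
  (forall a, a \in l -> grows f D a) -> all (fun v => v <= B) x ->
  all (fun v => v <= B + size l * D) (foldl f x l) /\ size (foldl f x l) <= size x.
Proof.
elim: l B x => [|a l IH] B x H Hx /=; first by rewrite addn0.
have [h1 h2] := H a (mem_head _ _) _ _ Hx.
have [|h3 h4] := IH _ _ _ h1; first by move=> b bl; apply: H; rewrite inE bl orbT.
by rewrite mulSn addnA; split=> //; exact: leq_trans h4 h2.
Qed.

Lemma es_bounded (x : seq nat) B K : all (fun v => v <= B) x -> B < 2 ^ K -> es x <= size x * (4 * K + 2) + 1.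
Proof.
move=> Hx lt; elim: x Hx => //= v x IH /andP[hv /IH h]; rewrite es_cons.
assert (hv' : es v <= 4 * K + 1); first by apply: es_nat_le; exact: leq_ltn_trans hv lt.
by rewrite mulSn; lia.
Qed.

Lemma mem_le_es {X : eqType} {eX : Enc X} (x : X) s : x \in s -> es x <= es s.
Proof.
elim: s => //= y s IH; rewrite inE es_cons => /orP[/eqP ->|/IH h]; first by lia.
lia.
Qed.

Lemma all_le_es (x : seq nat) : all (fun v => v <= 2 ^ es x) x.
Proof.
apply/allP => v vx; apply: leq_trans (ltnW (ltn_2es v)) _.
by rewrite leq_exp2l //; exact: mem_le_es.
Qed.

Lemma size_2es {X : Type} {eX : Enc X} (s : seq X) : size s <= 2 ^ es s.
Proof. by apply: leq_trans (ltnW (size_le_es s)) _; apply: ltnW; exact: ltn_expl. Qed.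

Lemma scale_le (sc : seq (nat * nat)) sm : sm \in sc -> sm.1 <= 2 ^ es sc.
Proof.
move=> smin; apply: leq_trans (ltnW (ltn_2es _)) _; rewrite leq_exp2l //.
apply: leq_trans (@mem_le_es _ (Enc_prod Enc_nat Enc_nat) sm sc smin).
by case: sm {smin} => u v; rewrite es_pair /=; lia.
Qed.

(** After k steps the entries are at most their initial bound plus k 2^g. Their values may be
    exponential, but their binary length stays polynomial, which is why the algorithm is restricted
    to additions. *)
Lemma pt_foldl_grows {C : Type} {X : eqType} {eC : Enc C} {eX : Enc X}
  (f : C -> seq nat -> X -> seq nat) (l : C -> seq X) (init : C -> seq nat) (g : C -> nat) :
  ptime (fun p : C * seq nat * X => f p.1.1 p.1.2 p.2) -> ptime l -> ptime init -> pbound g ->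
  (forall c a, a \in l c -> grows (f c) (2 ^ g c) a) ->
  ptime (fun c => foldl (f c) (init c) (l c)).
Proof.
move=> Hf Hl Hi Hg H; apply: pt_foldl => //.
have Hls := ptime_size Hl; have His := ptime_size Hi.
pose (K := fun c => es (init c) + es (l c) + g c + 2).
exists (fun c => es (init c) * (4 * K c + 2) + 1); first by rewrite /K; pb.
move=> c l1 l2 el.
have [||h1 h2] := @foldl_grows X (f c) (2 ^ g c) (2 ^ es (init c)) l1 (init c).
- by move=> a al; apply: H; rewrite el mem_cat al.
- exact: all_le_es.
apply: leq_trans (es_bounded (K := K c) h1 _) _; last first.
  by rewrite leq_add2r leq_mul2r (leq_trans h2) ?orbT // ltnW // size_le_es.
assert (hl : size l1 <= 2 ^ es (l c)).
  by apply: leq_trans (size_2es (l c)); rewrite el size_cat leq_addr.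
rewrite /K expnD -[2 ^ 2]/4.
assert (hA : 2 ^ es (init c) <= 2 ^ (es (init c) + es (l c) + g c)); first by rewrite leq_exp2l // -addnA leq_addr //.
assert (hB : size l1 * 2 ^ g c <= 2 ^ (es (init c) + es (l c) + g c)).
  rewrite [X in _ <= X]expnD leq_mul2r; apply/orP; right; apply: leq_trans hl _.
  by rewrite leq_exp2l // leq_addl.
assert (h0 : 0 < 2 ^ (es (init c) + es (l c) + g c)); first by rewrite expn_gt0 //.
by move: hA hB h0; move: (2 ^ (_ + _ + _)) (2 ^ es (init c)) (size l1 * _) => u v w'; clear; lia.
Qed.
End Grow.

Lemma move_along_grows s cs B x : all (fun v => v <= B) x ->
  all (fun v => v <= B + s) (move_along s x cs) /\ size (move_along s x cs) <= size x.
Proof.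
move=> Hx; rewrite /move_along size_map size_zip geq_minr; split=> //.
elim: cs x Hx => [|c cs IH] [|v x] //= /andP[hv hx]; rewrite IH // andbT.
by case: c => [[] []] /=; lia.
Qed.

Lemma relax_step_grows rows sm B x : all (fun v => v <= B) x ->
  all (fun v => v <= B + sm.1) (relax_step rows sm x) /\ size (relax_step rows sm x) <= size x.
Proof.
move=> Hx; rewrite /relax_step; case: ifP => _; last exact: move_along_grows.
by split=> //; apply: sub_all Hx => v hv; exact: leq_trans hv (leq_addr _ _).
Qed.

Section Relax.
Context {A : Type} {eA : Enc A}.
Variables (rows : A -> seq row) (R : A -> seq unit) (x : A -> seq nat).
Hypotheses (Hrows : ptime rows) (HR : ptime R) (Hx : ptime x).

Lemma pt_relax_phase (sm : A -> nat * nat) : ptime sm ->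
  ptime (fun a => relax_phase (rows a) (R a) (x a) (sm a)).
Proof.
move=> Hsm; have Hs := ptime_size Hsm.
apply: (pt_foldl_grows (f := fun a x (_ : unit) => relax_step (rows a) (sm a) x) (g := fun a => es (sm a))) => //.
  by rewrite /relax_step /move_along /violated /pos_val /neg_val; pt.
move=> c a _ B y Hy; have [h1 h2] := relax_step_grows (rows c) (sm c) Hy; split=> //.
apply: sub_all h1 => v hv; apply: leq_trans hv _; rewrite leq_add2l ltnW //.
by apply: leq_trans (ltn_2es _) _; rewrite leq_exp2l //; case: (sm c) => u v' /=; rewrite es_pair; lia.
Qed.
End Relax.

Section Decide.
Context {A : Type} {eA : Enc A}.
Variables (P : A -> param) (rows : A -> seq row) (x : A -> seq nat).
Hypotheses (HP : ptime P) (Hrows : ptime rows) (Hx : ptime x).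

Lemma pt_relax : ptime (fun a => relax (rows a) (psc (P a)) (pR (P a)) (x a)).
Proof.
have Hsc : ptime (fun a => psc (P a)) by rewrite /psc; pt.
have HR : ptime (fun a => pR (P a)) by rewrite /pR; pt.
have Hs := ptime_size Hsc; have HsR := ptime_size HR.
apply: (pt_foldl_grows (f := fun a => relax_phase (rows a) (pR (P a))) (g := fun a => es (pR (P a)) + es (psc (P a)))) => //.
- by apply: pt_relax_phase; rewrite /pR; pt.
- by pb.
move=> c sm smin B y Hy.
have [|h1 h2] := @foldl_grows _ (fun x (_ : unit) => relax_step (rows c) sm x) sm.1 B (pR (P c)) y _ Hy.
  by move=> a _ B' y' Hy'; exact: relax_step_grows.
split=> //; apply: sub_all h1 => v hv; apply: leq_trans hv _; rewrite leq_add2l expnD leq_mul //.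
  exact: size_2es.
exact: scale_le.
Qed.

End Decide.

Ltac pt_more ::=
  lazymatch goal with
  | |- ptime (fun a => relax (@?rows a) (psc (@?P a)) (pR _) (@?x a)) => apply: (pt_relax (P := P) (rows := rows) (x := x))
  end.

Lemma pt_decide {A : Type} {eA : Enc A} (P : A -> param) (rows : A -> seq row) (x : A -> seq nat) :
  ptime P -> ptime rows -> ptime x -> ptime (fun a => decide (P a) (rows a) (x a)).
Proof. by move=> HP Hrows Hx; rewrite /decide /violated /pos_val /neg_val /pM; pt. Qed.

Ltac pt_more ::=
  lazymatch goal with
  | |- ptime (fun a => decide (@?P a) (@?rows a) (@?x a)) => apply: (pt_decide (P := P) (rows := rows) (x := x))
  end.

Section IntFlow.
Context {A : Type} {eA : Enc A}.
Variables (P : A -> param) (arcs : A -> seq arc) (vcs : A -> seq vcon).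
Hypotheses (HP : ptime P) (Harcs : ptime arcs) (Hvcs : ptime vcs).

Lemma pt_flow_ok (lo : A -> seq nat) : ptime lo -> ptime (fun a => flow_ok (P a) (arcs a) (vcs a) (lo a)).
Proof.
move=> Hlo; rewrite /flow_ok /flow_rows /arc_rows /vcon_rows /onehot /div_row /pN; pt.
Qed.
End IntFlow.

Section IntFlow2.
Context {A : Type} {eA : Enc A}.
Variables (P : A -> param) (arcs : A -> seq arc) (vcs : A -> seq vcon).
Hypotheses (HP : ptime P) (Harcs : ptime arcs) (Hvcs : ptime vcs).

Lemma raise_grows j s B lo : all (fun v => v <= B) lo ->
  all (fun v => v <= B + s) (raise_at j s lo) /\ size (raise_at j s lo) <= size lo.
Proof.
move=> H; rewrite /raise_at size_map size_zip geq_minr; split=> //.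
apply/allP => v /mapP[[i x]] /= ix ->.
have xlo : x \in lo.
  have : x \in unzip2 (zip (indices lo) lo) by apply/mapP; exists (i, x).
  by rewrite unzip2_zip // size_iota.
by have := allP H x xlo; case: ifP => _ h; [rewrite leq_add2r|apply: leq_trans h _; rewrite leq_addr].
Qed.

Lemma raise_step_grows Pa arcsa vcsa j sm B lo : all (fun v => v <= B) lo ->
  all (fun v => v <= B + sm.1) (raise_step Pa arcsa vcsa j lo sm) /\ size (raise_step Pa arcsa vcsa j lo sm) <= size lo.
Proof.
move=> H; rewrite /raise_step; case: ifP => _; first exact: raise_grows.
by split=> //; apply: sub_all H => v hv; exact: leq_trans hv (leq_addr _ _).
Qed.

Lemma pt_raise_digits (lo : A -> seq nat) (j : A -> nat) : ptime lo -> ptime j ->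
  ptime (fun a => foldl (raise_step (P a) (arcs a) (vcs a) (j a)) (lo a) (psc (P a))).
Proof.
move=> Hlo Hj; have Hsc : ptime (fun a => psc (P a)) by rewrite /psc; pt.
have Hs := ptime_size Hsc.
apply: (pt_foldl_grows (f := fun a => raise_step (P a) (arcs a) (vcs a) (j a)) (g := fun a => es (psc (P a)))) => //.
  rewrite /raise_step /raise_at; apply: pt_if; [apply: pt_flow_ok|..]; pt.
move=> c sm smin B y Hy; have [h1 h2] := raise_step_grows (P c) (arcs c) (vcs c) (j c) sm Hy; split=> //.
apply: sub_all h1 => v hv; apply: leq_trans hv _; rewrite leq_add2l.
exact: scale_le.
Qed.
End IntFlow2.

Lemma pt_intflow {A : Type} {eA : Enc A} (P : A -> param) (arcs : A -> seq arc) (vcs : A -> seq vcon) :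
  ptime P -> ptime arcs -> ptime vcs -> ptime (fun a => intflow (P a) (arcs a) (vcs a)).
Proof.
move=> HP Harcs Hvcs; have Hsc : ptime (fun a => psc (P a)) by rewrite /psc; pt.
have Hs := ptime_size Hsc.
apply: (pt_foldl_grows (f := fun a lo j => foldl (raise_step (P a) (arcs a) (vcs a) j) lo (psc (P a)))
   (l := fun a => indices (arcs a)) (init := fun a => [seq 0 | _ <- arcs a]) (g := fun a => es (psc (P a)) + es (psc (P a)))).
- by apply: pt_raise_digits; pt.
- by pt.
- by pt.
- by pb.
move=> c j _ B y Hy.
have [|h1 h2] := @foldl_grows _ (raise_step (P c) (arcs c) (vcs c) j) (2 ^ es (psc (P c))) B (psc (P c)) y _ Hy.
  move=> sm smin B' y' Hy'; have [h1 h2] := raise_step_grows (P c) (arcs c) (vcs c) j sm Hy'; split=> //.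
  by apply: sub_all h1 => v hv; apply: leq_trans hv _; rewrite leq_add2l; exact: scale_le.
split=> //; apply: sub_all h1 => v hv; apply: leq_trans hv _; rewrite leq_add2l expnD leq_mul //.
exact: size_2es.
Qed.

Lemma es_le_all {X : eqType} {eX : Enc X} (s : seq X) K : (forall x, x \in s -> es x <= K) -> es s <= size s * K.+1 + 1.
Proof.
elim: s => //= x s IH H; rewrite es_cons mulSn.
have h1 := H x (mem_head _ _); enough (h2 : es s <= size s * K.+1 + 1) by lia.
by apply: IH => y ys; apply: H; rewrite inE ys orbT.
Qed.

Section Misc.
Context {A : Type} {eA : Enc A}.

(** Each doubling adds one digit, and the number of doublings is given in unary. *)
Lemma pt_scales (M : A -> nat) (l : A -> seq unit) : ptime M -> ptime l -> ptime (fun a => scales (M a) (l a)).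
Proof.
move=> HM Hl; have HMs := ptime_size HM; have Hls := ptime_size Hl.
apply: (pt_foldl (f := fun _ => dbl_head) (init := fun a => [:: (1, M a)])) => //.
- by rewrite /dbl_head; pt.
- by pt.
pose (K := fun a => 8 * es (l a) + 4 * es (M a) + 8).
exists (fun a => (es (l a) + 1) * (K a + 1) + 1); first by rewrite /K; pb.
move=> c l1 l2 el; rewrite -/(scales (M c) l1) scalesE.
assert (le : size l1 <= es (l c)).
  by apply: leq_trans (ltnW (size_le_es (l c))); rewrite el size_cat leq_addr.
apply: leq_trans (@es_le_all _ (Enc_prod Enc_nat Enc_nat) _ (K c) _) _.
  move=> x /mapP[j]; rewrite mem_rev mem_iota => /andP[_ hj'] ->; have hj : j <= size l1 := hj'; rewrite es_pair.
  assert (h1 : es (2 ^ j) <= 4 * j.+1 + 1); first by apply: es_nat_le; rewrite ltn_exp2l.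
  assert (h2 : es (M c * 2 ^ j) <= 4 * (es (M c) + j) + 1).
    by apply: es_nat_le; rewrite expnD ltn_pmul2r ?expn_gt0 // ltn_2es.
  assert (h3 := leq_trans hj le).
  by apply: leq_ltn_trans (leq_add h1 h2) _; rewrite /K; lia.
by rewrite size_map size_rev size_iota !addn1 ltnS leq_mul2r ltnS le orbT.
Qed.

Lemma pt_drop_size {T U : Type} {eT : Enc T} {eU : Enc U} (r : A -> seq T) (E : A -> seq U) :
  ptime r -> ptime E -> ptime (fun a => drop_size (r a) (E a)).
Proof.
move=> Hr HE; apply: (pt_foldl_acc (f := fun _ r (_ : U) => behead r) (G := fun=> 0)) => //.
- by pt.
- by pb.
by move=> _ [|x s] _ /=; rewrite ?es_cons; lia.
Qed.

Lemma pt_foldl_cover (c : A -> seq nat) (E : A -> seq arc) : ptime c -> ptime E ->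
  ptime (fun a => foldl cover_step (c a) (E a)).
Proof.
move=> Hc HE; apply: (pt_foldl_acc (f := fun _ => cover_step) (G := es)) => //.
- by rewrite /cover_step /mem_nat; pt.
- by pb.
move=> d cv [[u v] w]; rewrite /cover_step /=; case: ifP => _; first by lia.
by rewrite !es_cons !es_pair; lia.
Qed.

Lemma pt_supply (q : A -> terms) (v : A -> nat) : ptime q -> ptime v -> ptime (fun a => supply (q a) (v a)).
Proof.
move=> Hq Hv; apply: (pt_ext (f := fun a => (v a == (q a).1.1.1.1.1) * (q a).1.2 + (v a == (q a).1.1.1.2) * (q a).2)).
  by move=> a; case: (q a) => [[[[[? ?] ?] ?] ?] ?].
by pt.
Qed.
Lemma pt_demand (q : A -> terms) (v : A -> nat) : ptime q -> ptime v -> ptime (fun a => demand (q a) (v a)).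
Proof.
move=> Hq Hv; apply: (pt_ext (f := fun a => (v a == (q a).1.1.1.1.2) * (q a).1.2 + (v a == (q a).1.1.2) * (q a).2)).
  by move=> a; case: (q a) => [[[[[? ?] ?] ?] ?] ?].
by pt.
Qed.
Lemma pt_swap2 (q : A -> terms) : ptime q -> ptime (fun a => swap2 (q a)).
Proof.
move=> Hq; apply: (pt_ext (f := fun a => ((q a).1.1.1.1, (q a).1.1.2, (q a).1.1.1.2, (q a).1.2, (q a).2))).
  by move=> a; case: (q a) => [[[[[? ?] ?] ?] ?] ?].
by pt.
Qed.
Lemma pt_terminals (q : A -> terms) : ptime q -> ptime (fun a => terminals (q a)).
Proof.
move=> Hq; apply: (pt_ext (f := fun a => [:: (q a).1.1.1.1.1; (q a).1.1.1.1.2; (q a).1.1.1.2; (q a).1.1.2])).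
  by move=> a; case: (q a) => [[[[[? ?] ?] ?] ?] ?].
by pt.
Qed.
End Misc.

Ltac pt_more ::=
  lazymatch goal with
  | |- ptime (fun a => decide (@?P a) (@?rows a) (@?x a)) => apply: (pt_decide (P := P) (rows := rows) (x := x))
  | |- ptime (fun a => supply (@?f a) (@?g a)) => apply: (pt_supply (q := f) (v := g))
  | |- ptime (fun a => demand (@?f a) (@?g a)) => apply: (pt_demand (q := f) (v := g))
  | |- ptime (fun a => swap2 (@?f a)) => apply: (pt_swap2 (q := f))
  end.

Section LP.
Context {A : Type} {eA : Enc A}.
Variables (P : A -> param) (E : A -> seq arc) (cv vs : A -> seq nat) (q : A -> terms) (kp : A -> nat).
Hypotheses (HP : ptime P) (HE : ptime E) (Hcv : ptime cv) (Hvs : ptime vs) (Hq : ptime q) (Hkp : ptime kp).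

Lemma pt_lp_ok (fx : A -> seq bool) : ptime fx -> ptime (fun a => lp_ok (P a) (E a, cv a, vs a, q a, kp a) (fx a)).
Proof.
move=> Hfx; rewrite /lp_ok /lp_rows /edge_rows /cons_rows /odd_rows /odd_inner /mem_nat /onehot /div_row /nones /out_cap /in_cap
  /nfix /pM /pN /incident; cbv zeta; pt.
Qed.
End LP.

Section Fix.
Context {A : Type} {eA : Enc A}.

Lemma pt_lp_ok_data (P : A -> param) (D : A -> lpdata) (fx : A -> seq bool) :
  ptime P -> ptime D -> ptime fx -> ptime (fun a => lp_ok (P a) (D a) (fx a)).
Proof.
move=> HP HD Hfx; apply: (pt_ext (f := fun a => lp_ok (P a) ((D a).1.1.1.1, (D a).1.1.1.2, (D a).1.1.2, (D a).1.2, (D a).2) (fx a))).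
  by move=> a; case: (D a) => [[[[? ?] ?] ?] ?].
by apply: pt_lp_ok; pt.
Qed.

Lemma pt_set_fix (fx : A -> seq bool) (j : A -> nat) : ptime fx -> ptime j -> ptime (fun a => set_fix (fx a) (j a)).
Proof. by move=> Hfx Hj; rewrite /set_fix; pt. Qed.
End Fix.

Lemma pt_fixable {A : Type} {eA : Enc A} (P : A -> param) (D : A -> lpdata) (fx : A -> seq bool) :
  ptime P -> ptime D -> ptime fx -> ptime (fun a => fixable (P a) (D a) (fx a)).
Proof.
move=> HP HD Hfx.
apply: (pt_ext (f := fun a => [seq p <- zip (indices (D a).1.1.1.1) (D a).1.1.1.1 |
   (free_at (D a).1.1.1.1 (D a).1.1.1.2 (fx a) p.2.1.1 || free_at (D a).1.1.1.1 (D a).1.1.1.2 (fx a) p.2.1.2) &&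
   lp_ok (P a) (D a) (set_fix (fx a) p.1)])).
  by move=> a; case: (D a) => [[[[? ?] ?] ?] ?].
rewrite /free_at /odd_inner /mem_nat /out_cap /in_cap /incident.
apply: (pt_filter (f := fun a p => _ && _)); last by pt.
apply: pt_and; first by pt.
by apply: pt_lp_ok_data; [pt|pt|apply: pt_set_fix; pt].
Qed.

Lemma es_bools (s : seq bool) : es s <= 4 * size s + 1.
Proof.
elim: s => //= b s IH; rewrite es_cons mulnS.
assert (h : @es bool _ b <= 3); first by case: b.
lia.
Qed.

(** The accumulator is a list of booleans whose length never changes, hence of linear size. *)
Lemma pt_fix_edges {A : Type} {eA : Enc A} (P : A -> param) (D : A -> lpdata) :
  ptime P -> ptime D -> ptime (fun a => fix_edges (P a) (D a)).
Proof.
move=> HP HD.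
apply: (pt_ext (f := fun a => foldl (fix_step (P a) (D a)) [seq false | _ <- (D a).1.1.1.1] (D a).1.1.1.1)).
  by move=> a; case: (D a) => [[[[? ?] ?] ?] ?].
have HE : ptime (fun a => (D a).1.1.1.1) by pt.
have Hs := ptime_size HE.
apply: (pt_foldl (f := fun a => fix_step (P a) (D a)) (init := fun a => [seq false | _ <- (D a).1.1.1.1])) => //.
- rewrite /fix_step; apply: pt_if; [apply: pt_nilp; apply: pt_fixable; pt|by pt|].
  apply: pt_set_fix; first by pt.
  by apply: pt_fst; apply: pt_head; apply: pt_fixable; pt.
- by pt.
exists (fun a => 4 * es (D a).1.1.1.1 + 1); first by pb.
move=> c l1 l2 _; apply: leq_trans (es_bools _) _; rewrite leq_add2r leq_mul2l /=.
apply: leq_trans (ltnW (size_le_es (D c).1.1.1.1)).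
rewrite -[X in _ <= X](size_map (fun=> false)).
elim: l1 [seq _ | _ <- _] => //= x l1 IH fx; apply: leq_trans (IH _) _.
rewrite /fix_step; case: ifP => // _.
by rewrite size_map size_zip size_iota minnn.
Qed.

Ltac pt_more ::=
  lazymatch goal with
  | |- ptime (fun a => intflow (@?P a) (@?rows a) (@?x a)) => apply: (pt_intflow (P := P) (arcs := rows) (vcs := x))
  | |- ptime (fun a => scales (@?f a) (@?g a)) => apply: (pt_scales (M := f) (l := g))
  | |- ptime (fun a => drop_size (@?f a) (@?g a)) => apply: (pt_drop_size (r := f) (E := g))
  | |- ptime (fun a => foldl cover_step (@?f a) (@?g a)) => apply: (pt_foldl_cover (c := f) (E := g))
  | |- ptime (fun a => supply (@?f a) (@?g a)) => apply: (pt_supply (q := f) (v := g))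
  | |- ptime (fun a => demand (@?f a) (@?g a)) => apply: (pt_demand (q := f) (v := g))
  | |- ptime (fun a => swap2 (@?f a)) => apply: (pt_swap2 (q := f))
  | |- ptime (fun a => terminals (@?f a)) => apply: (pt_terminals (q := f))
  | |- ptime (fun a => nat_bits (@?f a)) => apply: (pt_bits (f := f))
  end.

Section Two.
Context {A : Type} {eA : Enc A}.

Lemma pt_route (P : A -> param) (E : A -> seq arc) (vs : A -> seq nat) (s t d L : A -> nat) (fw bw : A -> seq nat) :
  ptime P -> ptime E -> ptime vs -> ptime s -> ptime t -> ptime d -> ptime L -> ptime fw -> ptime bw ->
  ptime (fun a => route (P a) (E a) (vs a) (s a) (t a) (d a) (L a) (fw a) (bw a)).
Proof.
move=> HP HE Hvs Hs Ht Hd HL Hfw Hbw; rewrite /route; cbv zeta.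
by rewrite /route_arcs /route_vcons; pt.
Qed.

Lemma pt_half_flow (P : A -> param) (q : A -> terms) (arcs : A -> seq arc) (vs : A -> seq nat) :
  ptime P -> ptime q -> ptime arcs -> ptime vs -> ptime (fun a => intflow (P a) (arcs a) (half_vcons (q a) (arcs a) (vs a))).
Proof. by move=> HP Hq Ha Hvs; rewrite /half_vcons /in_cap /out_cap; pt. Qed.

Lemma pt_two_flow (P : A -> param) (q : A -> terms) (E : A -> seq arc) (vs : A -> seq nat) (L : A -> nat) (arcs : A -> seq arc) :
  ptime P -> ptime q -> ptime E -> ptime vs -> ptime L -> ptime arcs ->
  ptime (fun a => two_flow (P a) (q a) (E a) (vs a) (L a) (arcs a)).
Proof.
move=> HP Hq HE Hvs HL Ha.
pose (z := fun a => zip (zip (intflow (P a) (arcs a) (half_vcons (q a) (arcs a) (vs a)))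
   (intflow (P a) (arcs a) (half_vcons (swap2 (q a)) (arcs a) (vs a)))) (arcs a)).
have Hz : ptime z.
  have H1 := pt_half_flow HP Hq Ha Hvs; have H2 := pt_half_flow HP (pt_swap2 Hq) Ha Hvs.
  exact: (pt_zip (0, 0, 0) (pt_zip 0 H1 H2) Ha).
apply: (pt_ext (f := fun a =>
  [seq (p.1, p.2.1, p.2.2) | p <- zip
    (route (P a) (E a) (vs a) (q a).1.1.1.1.1 (q a).1.1.1.1.2 (q a).1.2 (L a)
       [seq p.1.1 + p.1.2 - p.2.2 | p <- z a] [seq p.2.2 - (p.1.1 + p.1.2) | p <- z a])
    (route (P a) (E a) (vs a) (q a).1.1.1.2 (q a).1.1.2 (q a).2 (L a)
       [seq p.1.1 - p.1.2 | p <- z a] [seq p.1.2 - p.1.1 | p <- z a])])).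
  by move=> a; rewrite /z /two_flow; case: (q a) => [[[[[? ?] ?] ?] ?] ?].
apply: (pt_map (f := fun _ (p : (nat * nat) * (nat * nat)) => (p.1, p.2.1, p.2.2))); first by pt.
by apply: (pt_zip (0, 0)); apply: pt_route; pt.
Qed.

Lemma pt_mk_param (W l : A -> seq unit) : ptime W -> ptime l -> ptime (fun a => mk_param (W a) (l a)).
Proof. by move=> HW Hl; rewrite /mk_param /pw2 /mulu; pt. Qed.

Lemma pt_poly_base (E : A -> seq arc) : ptime E -> ptime (fun a => poly_base (E a)).
Proof. by move=> HE; rewrite /poly_base; pt. Qed.
End Two.

(** * Parsing the input *)

(** The state holds the first bit of an unfinished pair of bits, the digits of the current number
    and the finished numbers, the latter two in reverse order. *)
Definition parse_step (st : seq bool * (seq bool * seq nat)) (b : bool) :=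
  if nilp st.1 then ([:: b], st.2)
  else if head false st.1 then ([::], (b :: st.2.1, st.2.2))
  else ([::], ([::], bval (rev st.2.1) :: st.2.2)).
Definition parse (x : seq bool) : seq nat := rev (foldl parse_step ([::], ([::], [::])) x).2.2.

Lemma parse_bits s cur nums :
  foldl parse_step ([::], (cur, nums)) (flatten [seq [:: true; b] | b <- s]) = ([::], (catrev s cur, nums)).
Proof. by elim: s cur => //= b s IH cur; rewrite /parse_step /=; exact: IH. Qed.

Lemma parse_nat n nums x : foldl parse_step ([::], ([::], nums)) (enc_nat n ++ x) = foldl parse_step ([::], ([::], n :: nums)) x.
Proof.
rewrite /enc_nat -catA foldl_cat parse_bits /= /parse_step /=.
by rewrite -/(rev (nat_bits n)) revK bval_nat_bits.
Qed.

Lemma parse_enc s : parse (enc_nats s) = size s :: s.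
Proof.
rewrite /parse /enc_nats parse_nat; suff -> nums : foldl parse_step ([::], ([::], nums)) (flatten (map enc_nat s)) = ([::], ([::], catrev s nums)).
  by rewrite /= catrevE rev_cat revK.
by elim: s nums => //= n s IH nums; rewrite parse_nat IH.
Qed.

Definition triple_step (st : seq nat * seq arc) (v : nat) : seq nat * seq arc :=
  if nilp (behead st.1) then (v :: st.1, st.2)
  else ([::], (head 0 (behead st.1), head 0 st.1, v) :: st.2).
Definition triples (s : seq nat) : seq arc := rev (foldl triple_step ([::], [::]) s).2.

Lemma triplesK (E : seq arc) : triples (flatten [seq [:: e.1.1; e.1.2; e.2] | e <- E]) = E.
Proof.
rewrite /triples; suff -> acc : foldl triple_step ([::], acc) (flatten [seq [:: e.1.1; e.1.2; e.2] | e <- E]) = ([::], catrev E acc).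
  by rewrite /= -[RHS]revK.
by elim: E acc => //= [[[u v] w] E IH] acc; rewrite /triple_step /=; exact: IH.
Qed.

Section Parse.
Context {A : Type} {eA : Enc A}.

Lemma pt_parse (x : A -> seq bool) : ptime x -> ptime (fun a => parse (x a)).
Proof.
move=> Hx; have Hs := ptime_size Hx; apply: pt_rev; do 2 apply: pt_snd.
apply: (pt_foldl (f := fun _ => parse_step) (init := fun _ => ([::], ([::], [::])))) => //.
- rewrite /parse_step; do ![apply: pt_if|apply: pt_pair|apply: pt_cons|apply: pt_bval_rev]; pt.
- by pt.
exists (fun a => 4 * es (x a) + 20); first by pb.
move=> c l1 l2 el; pose st := foldl parse_step ([::], ([::], [::])) l1.
(* A potential argument: each input bit contributes 4, and the digits of the unfinished number are
   charged in advance for its encoding. *)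
assert (H : size st.1 <= 1 /\ 4 * size st.2.1 + es st.2.2 <= 4 * size l1 + 1).
  rewrite /st; elim/last_ind: l1 {el st} => // l1 b IH; rewrite foldl_rcons size_rcons.
  move: IH; case: (foldl _ _ l1) => p [cur nums] /= [h1 h2]; rewrite /parse_step /=.
  case: ifP => _ /=; first by split=> //; lia.
  case: ifP => _ /=; first by split=> //; lia.
  split=> //; rewrite es_cons muln0 add0n.
  assert (h3 : es (bval (rev cur)) <= 4 * size cur + 1).
    by apply: es_nat_le; rewrite -(size_rev cur); exact: bval_lt.
  lia.
have le : size l1 < es (x c) by apply: leq_trans (size_le_es _); rewrite el size_cat ltnS leq_addr.
rewrite -/st; move: H; case: st => p [cur nums] /= [h1 h2]; rewrite !es_pair.
have h3 := es_bools p; have h4 := es_bools cur.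
by move: h1 h2 h3 h4 le; clear; lia.
Qed.

Lemma pt_triples (s : A -> seq nat) : ptime s -> ptime (fun a => triples (s a)).
Proof.
move=> Hs; apply: pt_rev; apply: pt_snd.
apply: (pt_foldl_acc (f := fun _ => triple_step) (init := fun _ => ([::], [::])) (G := fun p => es p + 10)) => //.
- by rewrite /triple_step; pt.
- by pt.
- by pb.
move=> c [p acc] v; rewrite /triple_step /=; case: p => [|u [|u' p]] /=; rewrite !es_pair ?es_cons ?es_pair; try lia.
by have := es_gt0 p; change (es (Nil nat)) with 1; lia.
Qed.

Lemma pt_enc_nat (n : A -> nat) : ptime n -> ptime (fun a => enc_nat (n a)).
Proof. by move=> Hn; rewrite /enc_nat; pt. Qed.
End Parse.

Lemma pt_enc_nats {A : Type} {eA : Enc A} (s : A -> seq nat) : ptime s -> ptime (fun a => enc_nats (s a)).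
Proof.
move=> Hs; rewrite /enc_nats; apply: pt_cat; first by apply: pt_enc_nat; pt.
apply: pt_flatten; apply: (pt_map (f := fun _ n => enc_nat n)) => //; apply: pt_enc_nat; pt.
Qed.

(** The output is encoded inside each branch, so that no tree encoding of an option type has to be
    provided. *)
Definition solution (l : seq unit) (q : terms) (E : seq arc) : seq bool :=
  let P := mk_param (poly_base E) l in
  let D := (E, cover q E, vertices q E, q, size (pw2 (pw2 (poly_base E)))) in
  if (q.1.1.1.1.1 == q.1.1.1.1.2) || (q.1.1.1.2 == q.1.1.2) || ~~ lp_ok P D [seq false | _ <- E] then [:: false]
  else true :: enc_nats (flatten [seq [:: x.1.1.1; x.1.1.2; x.1.2; x.2] |
    x <- two_flow P q E (vertices q E) (3 * size (cover q E)) (even_arcs E (fix_edges P D))]).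

Lemma solutionE l q E : solution l q E = enc_out (solve l q E).
Proof. by rewrite /solution /solve; case: q => [[[[[s1 t1] s2] t2] d1] d2]; case: ifP. Qed.

Lemma pt_pw2 {A : Type} {eA : Enc A} (W : A -> seq unit) : ptime W -> ptime (fun a => pw2 (W a)).
Proof. by move=> HW; rewrite /pw2 /mulu; pt. Qed.

Lemma pt_solution {A : Type} {eA : Enc A} (l : A -> seq unit) (q : A -> terms) (E : A -> seq arc) :
  ptime l -> ptime q -> ptime E -> ptime (fun a => solution (l a) (q a) (E a)).
Proof.
move=> Hl Hq HE; rewrite /solution; cbv zeta.
have HW := pt_poly_base HE; have HP := pt_mk_param HW Hl.
have Hcv : ptime (fun a => cover (q a) (E a)) by rewrite /cover; pt.
have Hvs : ptime (fun a => vertices (q a) (E a)) by rewrite /vertices; pt.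
have Hk := pt_size (pt_pw2 (pt_pw2 HW)).
have HD := pt_pair (pt_pair (pt_pair (pt_pair HE Hcv) Hvs) Hq) Hk.
have H0 : ptime (fun a => [seq false | _ <- E a]) by pt.
have Hok := pt_lp_ok_data HP HD H0.
have Hfx := pt_fix_edges HP HD.
apply: pt_if; first by pt.
  by pt.
apply: pt_cons; first by pt.
apply: pt_enc_nats; apply: pt_flatten.
apply: (pt_map (f := fun _ (x : nat * nat * nat * nat) => [:: x.1.1.1; x.1.1.2; x.1.2; x.2])); first by pt.
apply: pt_two_flow => //; first by pt.
by rewrite /even_arcs; pt.
Qed.

(* The input lists the length, the number of vertices, the six parameters and
   the edges. *)
Definition alg (x : seq bool) : seq bool :=
  let s := behead (behead (parse x)) in
  let r := behead (behead (behead (behead s))) in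
  solution [seq tt | _ <- x]
    (head 0 s, head 0 (behead s), head 0 (behead (behead s)), head 0 (behead (behead (behead s))), head 0 r, head 0 (behead r))
    (triples (behead (behead r))).

Lemma pt_alg : ptime alg.
Proof.
have Hp : ptime parse by apply: pt_parse; pt.
rewrite /alg; cbv zeta; apply: pt_solution; [|by pt|].
  by apply: (pt_map (f := fun _ _ => tt) (l := fun x => x)); pt.
by apply: pt_triples; pt.
Qed.

Lemma size_enc_nats n s : n \in s -> size (nat_bits n) <= size (enc_nats s).
Proof.
move=> ns; rewrite /enc_nats size_cat; apply: leq_trans (leq_addl _ _).
elim: s ns => //= m s IH; rewrite inE size_cat => /orP[/eqP <-|/IH h]; last by apply: leq_trans h (leq_addl _ _).
apply: leq_trans (leq_addr _ _); rewrite /enc_nat size_cat; apply: leq_trans (leq_addr _ _).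
by elim: (nat_bits n) => //= b t h; lia.
Qed.

Lemma alg_correct I : alg (enc_inst I) = enc_out (solve [seq tt | _ <- enc_inst I] (q_of I) (i_edges I)).
Proof. by rewrite -solutionE /alg /enc_inst parse_enc /= triplesK. Qed.

Theorem theorem12 :
  exists (M : TM) (a k C : nat),
    forall I : inst, wf_inst I ->
      exists (T : nat) (y : seq bool),
        T <= a * (size (enc_inst I)) ^ k + a /\
        halts_with M (enc_inst I) T y /\
        exists r : flow_out, y = enc_out r /\
          match r with
          | None => ~ (exists f : flowfun, meets_demands I f)
          | Some fl =>
              size fl = size (i_edges I) /\
              int_2flow I (flow_of I fl) /\
              forall i : 'I_2,
                (Posz (dem I i) - Posz (C * (vc I ^ 3 + 1))%N <= netout I (flow_of I fl) i (src I i))%R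
          end.
Proof.
have [M [a [k H]]] := ptime_TM pt_alg; exists M, a, k, 18 => I wfI.
have [T hT hM] := H (enc_inst I); exists T, (alg (enc_inst I)); split=> //; split=> //.
(* A number of the instance has at most as many binary digits as the input has bits, so the input
   length in unary is a valid choice of [l]. *)
have bnd n : n \in [:: i_n I; i_s1 I; i_t1 I; i_s2 I; i_t2 I; i_d1 I; i_d2 I] ++
    flatten [seq [:: e.1.1; e.1.2; e.2] | e <- i_edges I] -> n <= 2 ^ size [seq tt | _ <- enc_inst I].
  move=> nin; rewrite size_map -(bval_nat_bits n) ltnW //; apply: leq_trans (bval_lt _) _.
  by rewrite leq_exp2l //; exact: size_enc_nats.
exists (solve [seq tt | _ <- enc_inst I] (q_of I) (i_edges I)); split; first exact: alg_correct.
apply: solve_correct => // [e eE|].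
  apply: bnd; rewrite mem_cat; apply/orP; right; apply/flatten_mapP; exists e => //.
  by rewrite !inE eqxx !orbT.
by split; apply: bnd; rewrite mem_cat !inE eqxx !orbT.
Qed.
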